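(* Assume that the response operator $f\mapsto y^f$ is known. Let $\xi$ be the solution on $[0,L]$ of $\xi''=-q(x)\xi$, $\xi(0)=0$, $\xi'(0)=1$, and let $M(t)=\int_0^t N(r)\,dr$. Then: (i) For every $T\in(0,L]$ there exists a unique steering control $f^T\in L^2(0,T)$ such that $w^{f^T}(x,T)=\xi(x)$ for $x\in(0,T)$, and it is given by $$f^T(t)=\left[\left(\Lambda_T^*\Lambda_T\right)^{-1}M(T-\cdot)\right](t).$$ (ii) The operator $\Lambda_T^*\Lambda_T$, and hence $f^T$, can be computed from the response operator, via the Blagoveshchenskii equation recalled in the context, even though $q$ (hence $\xi$) is unknown. (iii) For every $T\in(0,L)$, $\xi(T)=w^{f^T}(T^-,T)=f^T(0)$. Hence the function $\xi(T)$ can be computed for every $T\in(0,L)$, and $$q(T)=-\frac{\xi''(T)}{\xi(T)},$$ with extension by continuity at the finitely many points in which $\xi=0$ and to $T=0$.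
   Context: $L>0$; $q$ is a continuous function on $[0,L]$ (the unknown coefficient); the relaxation kernel $N(t)$ is of class $C^3$ with $N(0)=1$. For a boundary deformation $f$, $w^f=w^f(x,t)$ is the (mild) solution of $$w_t(x,t)=\int_0^t N(t-s)\left[w_{xx}(x,s)+q(x)w(x,s)\right]ds,\quad x\in(0,L),$$ with $w(x,0)=0$, $w(0,t)=f(t)$, $w(L,t)=0$. The response operator on $(0,T)$ is the (unbounded) operator $R_T$ in $L^2(0,T)$, $R_Tf=y^f$, $y^f(t)=w^f_x(0,t)$. For $T>0$, $\Lambda_T\in\mathcal L(L^2(0,T);L^2(0,L))$ is the operator $\Lambda_T f=w^f(\cdot,T)$; $w^f(\cdot,T)$ vanishes for $x>T$ when $T<L$ (the propagation speed is $1$). Let $R$ be the unique solution of $R(t)+\int_0^t N'(t-s)R(s)\,ds=N'(t)$. Mild solution for times in $[0,T]$, $T\le L$: set $\gamma=R(0)/2$, $\alpha=R'(0)+R(0)^2/4$, $K(t)=e^{-\gamma t}R''(t)$. For $f\in L^2(0,T)$ (extended by $0$ to negative times), $w^f=e^{\gamma t}W$ is the mild solution when $W\in C([0,T];L^2(0,L))$ solves $$W(x,t)=e^{-\gamma(t-x)}f(t-x)+\frac12\int_0^t\int_{|x-t+\tau|}^{x+t-\tau}F_W(\xi,\tau)\,d\xi\,d\tau,$$ $$F_W(x,t)=(q(x)+\alpha)W(x,t)+\int_0^tK(t-s)W(x,s)\,ds,$$ with $F_W$ taken equal to $0$ for $\xi>L$. Blagoveshchenskii equation: for smooth $f,g$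 put $H(s,t)=\int_0^L w^f(x,t)w^g(x,s)\,dx$, so that $H(T,T)=\langle\Lambda_T^*\Lambda_Tf,g\rangle_{L^2(0,T)}$. Then $H(0,t)=H(s,0)=0$, $H_t(s,0)=H_s(0,t)=0$ and $$\frac{\partial}{\partial t}H(s,t)=\frac{\partial^2}{\partial s^2}\int_0^t N(t-\xi)H(s,\xi)\,d\xi-\int_0^s R(s-\nu)\left[\int_0^t N(t-\xi)\frac{\partial^2}{\partial\nu^2}H(\nu,\xi)\,d\xi\right]d\nu+F(s,t),$$ where $F(s,t)=\frac{\partial}{\partial s}\Psi(s,t)-\int_0^s R(s-\nu)\frac{\partial}{\partial\nu}\Psi(\nu,t)\,d\nu$, $\Psi(s,t)=\int_0^s N(s-\sigma)\Phi(\sigma,t)\,d\sigma$ and $\Phi(s,t)=\int_0^t N(t-r)[f(r)y^g(s)-y^f(r)g(s)]\,dr$ is known from the response operator.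
   Formalization: In (iii) the equality ξ(T)=w^{f^T}(T^-,T)=f^T(0) fails when N'(0)≠0; it is replaced by ξ(T)=w^{f^T}(T^-,T)=e^{γT}f^T(0), γ=R(0)/2=N'(0)/2, with f^T(0) the value of the continuous representative of f^T; both agree when N'(0)=0. *)

(* Defs.v *)
From HB Require Import structures.
From mathcomp Require Import all_boot all_order all_algebra.
From mathcomp Require Import all_classical all_reals all_analysis.

Set Implicit Arguments.
Unset Strict Implicit.
Unset Printing Implicit Defensive.
Import Order.TTheory GRing.Theory Num.Theory.
Import numFieldNormedType.Exports.

Local Open Scope classical_set_scope.
Local Open Scope ring_scope.

Section Regularity.
Context {R : realType}.

Definition Ck (n : nat) (f : R -> R) : Prop :=
  forall k, (k <= n)%N ->
    continuous (derive1n k f) /\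
    ((k < n)%N -> forall x, derivable (derive1n k f) x 1).

Definition smooth (f : R -> R) : Prop := forall n, Ck n f.

(* u is C^2 up to the boundary of D: u and its partial derivatives of order at
   most 2 in the interior of D extend continuously to D. *)
Definition C2_on (D : set (R * R)) (u : R -> R -> R) : Prop :=
  exists u1 u2 u11 u12 u22 : R -> R -> R,
    [/\ [/\ {within D, continuous (fun p => u p.1 p.2)},
            {within D, continuous (fun p => u1 p.1 p.2)} &
            {within D, continuous (fun p => u2 p.1 p.2)}],
        [/\ {within D, continuous (fun p => u11 p.1 p.2)},
            {within D, continuous (fun p => u12 p.1 p.2)} &
            {within D, continuous (fun p => u22 p.1 p.2)}] &
        forall x t, interior D (x, t) ->
          [/\ is_derive x 1 (u ^~ t) (u1 x t),
              is_derive t 1 (u x) (u2 x t),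
              is_derive x 1 (u1 ^~ t) (u11 x t),
              is_derive t 1 (u1 x) (u12 x t) &
              is_derive t 1 (u2 x) (u22 x t)]].

End Regularity.

(* Elements of L^2(0,a) are represented by functions on the line, of which only
   the class modulo almost everywhere equality on ]0, a[ matters. *)
Section SquareIntegrable.
Context {R : realType}.
Notation mu := (@lebesgue_measure R).

Definition L2 (a : R) (f : R -> R) : Prop :=
  (f \_ `]0, a[ : R -> R) \in Lfun mu 2%:E.

Definition eqL2 (a : R) (f g : R -> R) : Prop :=
  {ae mu, forall x, 0 < x < a -> f x = g x}.

Definition L2norm (a : R) (f : R -> R) : R :=
  fine (Lnorm mu 2%:E (EFin \o (f \_ `]0, a[ : R -> R))).

Definition L2inner (a : R) (f g : R -> R) : R :=
  \int[mu]_(x in `]0, a[) (f x * g x).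

Definition bounded_op (a b : R) (A : (R -> R) -> R -> R) : Prop :=
  [/\ forall f, L2 a f -> L2 b (A f),
      forall c f g, L2 a f -> L2 a g ->
        eqL2 b (A (fun x => c * f x + g x)) (fun x => c * A f x + A g x) &
      exists C, forall f, L2 a f -> L2norm b (A f) <= C * L2norm a f].

Definition is_adjoint (a b : R) (A B : (R -> R) -> R -> R) : Prop :=
  (forall h, L2 b h -> L2 a (B h)) /\
  forall f h, L2 a f -> L2 b h -> L2inner b (A f) h = L2inner a f (B h).

Definition adjoint (a b : R) (A : (R -> R) -> R -> R) : (R -> R) -> R -> R :=
  xget (fun _ => cst 0) [set B | is_adjoint a b A B].

Definition is_inverse (a : R) (A B : (R -> R) -> R -> R) : Prop :=
  [/\ bounded_op a a A, bounded_op a a B,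
      forall f, L2 a f -> eqL2 a (A (B f)) f &
      forall f, L2 a f -> eqL2 a (B (A f)) f].

Definition ess_left_limit (u : R -> R) (a l : R) : Prop :=
  forall e, 0 < e -> exists2 d, 0 < d &
    {ae mu, forall x, a - d < x < a -> `|u x - l| < e}.

End SquareIntegrable.

Section Viscoelastic.
Context {R : realType}.
Notation mu := (@lebesgue_measure R).
Implicit Types (L T : R) (q N f g : R -> R).

(* The kernels N and R live on [0, +oo[. They are represented by functions on
   the line of the same differentiability class, so that derivatives at 0 are
   ordinary ones; nothing depends on the choice of this extension. *)
Definition is_resolvent N (r : R -> R) : Prop :=
  Ck 2 r /\
  forall t, 0 <= t ->
    r t + \int[mu]_(s in `[0, t]) (derive1 N (t - s) * r s) = derive1 N t.

Definition resolvent N : R -> R := xget (cst 0) [set r | is_resolvent N r].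

Definition primitive N (t : R) : R := \int[mu]_(r in `[0, t]) N r.

Definition gamma N : R := resolvent N 0 / 2.

Definition alpha N : R := derive1 (resolvent N) 0 + resolvent N 0 ^+ 2 / 4.

Definition memory N (t : R) : R :=
  expR (- (gamma N * t)) * derive1n 2 (resolvent N) t.

Definition mild_source L q N (W : R -> R -> R) (x t : R) : R :=
  if x <= L then
    (q x + alpha N) * W x t
      + \int[mu]_(s in `[0, t]) (memory N (t - s) * W x s)
  else 0.

(* W is in C([0,T]; L^2(0,L)), given through a jointly measurable
   representative so that the time integrals can be taken pointwise in x. *)
Definition is_mild L q N T f (W : R -> R -> R) : Prop :=
  [/\ measurable_fun (`]0, L[ `*` `[0, T])
        (fun p : measurableTypeR R * measurableTypeR R => W p.1 p.2),
      forall t, 0 <= t <= T -> L2 L (W ^~ t),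
      forall t0, 0 <= t0 <= T ->
        L2norm L (fun x => W x t - W x t0)
          @[t --> within `[0, T] (nbhs t0)] --> (0 : R) &
      forall t, 0 <= t <= T ->
        {ae mu, forall x, 0 < x < L ->
          W x t = expR (- (gamma N * (t - x))) * (f \_ `]0, T[) (t - x)
            + 2^-1 * \int[mu]_(tau in `[0, t])
                       \int[mu]_(xi in `[`|x - t + tau|, x + t - tau])
                         mild_source L q N W xi tau}].

Definition mild_solution L q N T f (x t : R) : R :=
  expR (gamma N * t) *
  xget (fun _ _ => 0) [set W | is_mild L q N T f W] x t.

Definition Lambda L q N T f : R -> R := fun x => mild_solution L q N T f x T.

Definition Gram L q N T f : R -> R :=
  adjoint T L (Lambda L q N T) (Lambda L q N T f).

(* Smooth boundary deformations, vanishing near the initial time; they are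
   dense in each L^2(0,T). *)
Definition control f : Prop :=
  smooth f /\ exists2 e, 0 < e & forall t, t <= e -> f t = 0.

(* The classical solution is used for smooth controls because it is available
   at all times, while mild solutions are only considered for T <= L. *)
Definition is_classical L q N f (w : R -> R -> R) : Prop :=
  [/\ C2_on (`[0, L] `*` `[0, +oo[) w,
      forall x t, 0 < x < L -> 0 < t ->
        derive1 (w x) t = \int[mu]_(s in `[0, t])
          (N (t - s) * (derive1n 2 (w ^~ s) x + q x * w x s)),
      forall x, 0 <= x <= L -> w x 0 = 0 &
      forall t, 0 <= t -> w 0 t = f t /\ w L t = 0].

Definition classical_solution L q N f : R -> R -> R :=
  xget (fun _ _ => 0) [set w | is_classical L q N f w].

(* y^f, the one-sided x-derivative of w^f at x = 0 *)
Definition response L q N f (t : R) : R :=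
  let w := classical_solution L q N f in
  lim (h^-1 * (w h t - w 0 t) @[h --> 0^'+]).

Definition same_response L N (tau : R) q q' : Prop :=
  forall f, control f -> forall t, 0 < t < tau ->
    response L q N f t = response L q' N f t.

Definition correlation L q N f g (s t : R) : R :=
  \int[mu]_(x in `[0, L])
    (classical_solution L q N f x t * classical_solution L q N g x s).

Definition blago_Phi N f g (yf yg : R -> R) (s t : R) : R :=
  \int[mu]_(r in `[0, t]) (N (t - r) * (f r * yg s - yf r * g s)).

Definition blago_Psi N f g (yf yg : R -> R) (s t : R) : R :=
  \int[mu]_(sigma in `[0, s]) (N (s - sigma) * blago_Phi N f g yf yg sigma t).

Definition blago_F N f g (yf yg : R -> R) (s t : R) : R :=
  derive1 (blago_Psi N f g yf yg ^~ t) s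
  - \int[mu]_(nu in `[0, s])
      (resolvent N (s - nu) * derive1 (blago_Psi N f g yf yg ^~ t) nu).

Definition triangle (tau : R) : set (R * R) :=
  [set p | [/\ 0 <= p.1, 0 <= p.2 & p.1 + p.2 <= tau]].

(* The Blagoveshchenskii problem with data (f, yf) and (g, yg). It is posed on
   the domain of dependence s + t <= tau of the times ]0, tau[ at which the data
   are used: a value H(T,T) involves the responses up to time 2T. *)
Definition blago_problem N (tau : R) f g (yf yg : R -> R) (H : R -> R -> R) :
    Prop :=
  [/\ C2_on (triangle tau) H,
      forall r, 0 <= r <= tau -> H 0 r = 0 /\ H r 0 = 0,
      forall r, 0 <= r < tau ->
        (h^-1 * (H r h - H r 0) @[h --> 0^'+] --> (0 : R)) /\
        (h^-1 * (H h r - H 0 r) @[h --> 0^'+] --> (0 : R)) &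
      forall s t, 0 < s -> 0 < t -> s + t < tau ->
        derive1 (H s) t =
          derive1n 2 (fun s' => \int[mu]_(xi in `[0, t]) (N (t - xi) * H s' xi)) s
          - \int[mu]_(nu in `[0, s])
              (resolvent N (s - nu) *
               \int[mu]_(xi in `[0, t]) (N (t - xi) * derive1n 2 (H ^~ xi) nu))
          + blago_F N f g yf yg s t].

(* xi'' = - q xi on [0, L], xi(0) = 0, xi'(0) = 1; xi1 is xi', one-sided at the
   end points by continuity. *)
Definition is_xi L q (xi : R -> R) : Prop :=
  exists xi1 : R -> R,
    [/\ {within `[0, L], continuous xi}, {within `[0, L], continuous xi1},
        forall x, 0 < x < L ->
          is_derive x 1 xi (xi1 x) /\ is_derive x 1 xi1 (- q x * xi x) &
        xi 0 = 0 /\ xi1 0 = 1].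

Definition steering L q N (xi : R -> R) T f : Prop :=
  L2 T f /\ eqL2 T (Lambda L q N T f) xi.

End Viscoelastic.

(* Main.v *)
(**
Writing w = e^(gamma t) W, the equation becomes W_tt = W_xx + (q + alpha) W + K * W. In the
retarded time r = t - x, the wave with boundary value g is W = g(r) + (k(x,.) * g)(r), where the
kernel k solves a Goursat integral equation. For smooth g this yields the classical solution, as a
locally finite sum of waves reflected at x = L and x = 0; for g in L^2 and t <= T <= L it is the
mild solution, by Fubini, and a Gronwall estimate in L^1 shows that it is the only one.

Hence Lambda f(x) = e^(gamma x) (U f)(T - x) on (0,T), with U = 1 + Volterra, and
Lambda^*Lambda = U^* m U, with a positive continuous weight m, has a bounded inverse. Pairing the
equation of w^phi with xi gives <Lambda phi, xi> = int M(T - t) phi(t) dt for smooth phi, that is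
Lambda^* xi = M(T - .), since the smooth controls are total in L^2. As (U f)(0) = f(0) for
continuous f, xi(T) = e^(gamma T) f^T(0).

Green's formula gives the Blagoveshchenskii equation for the correlations of smooth controls. Its
solution is unique: integrated along characteristics, the difference H of two solutions satisfies
|H_t +- H_s| <= A e^(lam (s+t)) with A halved at each step. So the responses determine
<Lambda^*Lambda f, g> for smooth f and g, and these are dense.
*)

From HB Require Import structures.
Require Import Defs.
From mathcomp Require Import all_boot all_order all_algebra.
From mathcomp Require Import ring lra.
From mathcomp Require Import all_classical all_reals all_analysis.
From mathcomp Require Import measurable_realfun.
Import Order.TTheory GRing.Theory Num.Theory.
Import numFieldNormedType.Exports.
Local Open Scope classical_set_scope.
Local Open Scope ring_scope.
Set Implicit Arguments.
Unset Strict Implicit.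
Unset Printing Implicit Defensive.

(** * Integrals, derivatives and continuity *)

(** Two notions of solution meet here. The response and Green's formula live on classical solutions,
    [Lambda] on mild ones; the bridge is that, up to time [L], both are the same wave [Zw] built
    from one kernel, because the reflection at x = L starts only then. Kernels and waves are
    extended to the whole plane: causality (vanishing at nonpositive times) then replaces one-sided
    derivatives, and calculus is done with globally continuous functions. The construction of the
    kernels and the uniqueness of classical solutions, mild solutions and correlations use one
    device, an exponential weight whose rate is so large that one application of the equation halves
    the constant. Operators act on representatives and [Gram] comes from a choice of adjoint, so
    operator identities hold only almost everywhere and are read off from inner products. The factor
    e^(gamma T) in (iii) is the amplitude with which the leading edge of the signal, emitted with
    value f^T(0), reaches x = T; since gamma = N'(0) / 2, it is 1 exactly when N'(0) = 0. *)

Section Continuity.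
Context {R : realType}.

Definition cont2 (u : R -> R -> R) := continuous (fun p : R * R => u p.1 p.2).

Section Combinators.
Context {X : topologicalType}.
Implicit Types f g : X -> R.

Lemma cont_cst (c : R) : continuous (fun _ : X => c).
Proof. by move=> x; exact: cvg_cst. Qed.

Lemma cont_id : continuous (fun x : R => x).
Proof. by move=> x; exact: cvg_id. Qed.

Lemma contD f g : continuous f -> continuous g -> continuous (fun x => f x + g x).
Proof. by move=> cf cg x; apply: cvgD; [exact: cf|exact: cg]. Qed.

Lemma contN f : continuous f -> continuous (fun x => - f x).
Proof. by move=> cf x; apply: cvgN; exact: cf. Qed.

Lemma contM f g : continuous f -> continuous g -> continuous (fun x => f x * g x).
Proof. by move=> cf cg x; apply: cvgM; [exact: cf|exact: cg]. Qed.

Lemma cont_norm f : continuous f -> continuous (fun x => `|f x|).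
Proof. by move=> cf x; apply: cvg_norm; exact: cf. Qed.

Lemma cont_max f g : continuous f -> continuous g ->
  continuous (fun x => Num.max (f x) (g x)).
Proof. by move=> cf cg x; apply: continuous_max; [exact: cf|exact: cg]. Qed.

Lemma cont_min f g : continuous f -> continuous g ->
  continuous (fun x => Num.min (f x) (g x)).
Proof. by move=> cf cg x; apply: continuous_min; [exact: cf|exact: cg]. Qed.

Lemma cont_comp2 (Y Z : topologicalType) (u : Y -> Z -> R) (a : X -> Y) (b : X -> Z) :
  continuous (fun p : Y * Z => u p.1 p.2) -> continuous a -> continuous b ->
  continuous (fun x => u (a x) (b x)).
Proof.
move=> cu ca cb x.
apply: (@continuous_comp _ _ _ (fun x => (a x, b x)) (fun p => u p.1 p.2)).
  by apply: cvg_pair; [exact: ca|exact: cb].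
exact: cu.
Qed.

Lemma cont_fst (Y : topologicalType) (f : Y -> R) :
  continuous f -> continuous (fun p : Y * X => f p.1).
Proof.
move=> cf p; apply: (@continuous_comp _ _ _ (@fst Y X) f); last exact: cf.
exact: cvg_fst.
Qed.

Lemma cont_snd (Y : topologicalType) (f : X -> R) :
  continuous f -> continuous (fun p : Y * X => f p.2).
Proof.
move=> cf p; apply: (@continuous_comp _ _ _ (@snd Y X) f); last exact: cf.
exact: cvg_snd.
Qed.

End Combinators.

Lemma continuous_fst (X Y : topologicalType) : continuous (fun p : X * Y => p.1).
Proof. by move=> p; exact: cvg_fst. Qed.

Lemma continuous_snd (X Y : topologicalType) : continuous (fun p : X * Y => p.2).
Proof. by move=> p; exact: cvg_snd. Qed.

Lemma cont_comp1 (X Y : topologicalType) (u : Y -> R) (a : X -> Y) :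
  continuous u -> continuous a -> continuous (fun x => u (a x)).
Proof. by move=> cu ca x; apply: continuous_comp; [exact: ca|exact: cu]. Qed.

Lemma cont_pair (X Y Z : topologicalType) (a : X -> Y) (b : X -> Z) :
  continuous a -> continuous b -> continuous (fun x => (a x, b x)).
Proof. by move=> ca cb x; apply: cvg_pair; [exact: ca|exact: cb]. Qed.

Lemma continuous_expR' : continuous (@expR R).
Proof. by move=> x; exact: continuous_expR. Qed.

End Continuity.

(** * Derivatives of functions of one variable *)

Section Derivatives.
Context {R : realType}.
Implicit Types (f g : R -> R) (x a b d : R).

(* Not a class, contrary to is_derive: unification alone drives the search. *)
Definition ider f x d : Prop := is_derive x 1 f d.

(** This quotient-free form admits [h = 0] and turns differentiability into a linear error bound,
    which is how derivatives of integrals are proved below. *)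
Lemma iderP f x d :
  ider f x d <->
  forall e : R, 0 < e -> exists2 r : R, 0 < r &
    forall h : R, `|h| < r -> `|f (x + h) - f x - d * h| <= e * `|h|.
Proof.
split.
  move=> [df <-] e e0.
  have /cvgrPdist_le/(_ e e0) := df.
  move=> /nbhs_ballP[r /= r0 Hr].
  exists r => // h hr.
  have [->|h0] := eqVneq h 0; first by rewrite addr0 subrr mulr0 subrr normr0 mulr0.
  have := Hr h; rewrite /ball/= sub0r normrN => /(_ hr h0).
  rewrite /GRing.scale/= mulr1 (addrC h) -/('D_1 f x) => Hd.
  have -> : f (x + h) - f x - 'D_1 f x * h = - (('D_1 f x - h^-1 * (f (x + h) - f x)) * h).
    by field.
  by rewrite normrN normrM ler_wpM2r.
move=> H.
have cv : h^-1 *: (f (h *: (1:R) + x) - f x) @[h --> 0^'] --> d.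
  apply/cvgrPdist_le => e e0; have [r r0 Hr] := H e e0.
  apply/nbhs_ballP; exists r => //= h; rewrite /ball/= sub0r normrN => hr h0.
  have := Hr h hr; rewrite /GRing.scale/= mulr1 (addrC h).
  have -> : d - h^-1 * (f (x + h) - f x) = - ((f (x + h) - f x - d * h) / h) by field.
  by rewrite normrN normrM normfV ler_pdivrMr// normr_gt0.
split; first by apply/cvg_ex; exists d.
exact: cvg_lim.
Qed.

Lemma derive1_eq f x d : ider f x d -> derive1 f x = d.
Proof. by move=> h; rewrite derive1E; exact: derive_val. Qed.

Lemma derivable_ider f x d : ider f x d -> derivable f x 1.
Proof. by case. Qed.

Lemma derive1_ider f x : derivable f x 1 -> ider f x (derive1 f x).
Proof. by move=> h; rewrite derive1E; exact: DeriveDef. Qed.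

Lemma near_ider f g x d :
  (\forall y \near x, f y = g y) -> ider f x d -> ider g x d.
Proof.
move=> /nbhs_ballP[r /= r0 fg] /iderP H; apply/iderP => e e0.
have [s s0 Hs] := H e e0; exists (Num.min r s); first by rewrite lt_min r0.
move=> h; rewrite lt_min => /andP[hr hs].
rewrite -!fg ?Hs//; first exact: ballxx.
by rewrite /ball/= opprD addNKr normrN.
Qed.

Lemma oo_ider f g x a b d : a < x < b ->
  (forall y, a < y < b -> f y = g y) -> ider f x d -> ider g x d.
Proof.
move=> xab fg; apply: near_ider; near=> y; apply: fg.
near: y; apply: (@near_in_itvoo R a b x).
by rewrite in_itv.
Unshelve. all: by end_near. Qed.

Lemma eq_ider f g x d : f =1 g -> ider f x d -> ider g x d.
Proof. by move=> /funext ->. Qed.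

Lemma ider_val f x d d' : ider f x d -> d = d' -> ider f x d'.
Proof. by move=> h <-. Qed.

Lemma ider_unique f x d d' : ider f x d -> ider f x d' -> d = d'.
Proof. by move=> /derive1_eq <- /derive1_eq <-. Qed.

Lemma iderD f g x a b : ider f x a -> ider g x b ->
  ider (fun y => f y + g y) x (a + b).
Proof. by move=> ? ?; exact: is_deriveD. Qed.

Lemma iderB f g x a b : ider f x a -> ider g x b ->
  ider (fun y => f y - g y) x (a - b).
Proof. by move=> ? ?; exact: is_deriveB. Qed.

Lemma iderN f x a : ider f x a -> ider (fun y => - f y) x (- a).
Proof. by move=> ?; exact: is_deriveN. Qed.

Lemma iderM f g x a b : ider f x a -> ider g x b ->
  ider (fun y => f y * g y) x (f x * b + a * g x).
Proof.
move=> fa gb; have h := @is_deriveM R R f g x 1 a b fa gb.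
by apply: ider_val h _; rewrite /GRing.scale/= (mulrC a).
Qed.

Lemma iderZ f (c : R) x a : ider f x a -> ider (fun y => c * f y) x (c * a).
Proof. by move=> ?; exact: is_deriveZ. Qed.

Lemma ider_cst (c x : R) : ider (fun=> c) x 0.
Proof. exact: is_derive_cst. Qed.

Lemma ider_id x : ider (fun y => y) x 1.
Proof. exact: is_derive_id. Qed.

Lemma ider_continuous f x d : ider f x d -> {for x, continuous f}.
Proof.
by move=> [h _]; apply: differentiable_continuous; apply/derivable1_diffP.
Qed.

Lemma ider_cont f (d : R -> R) : (forall x, ider f x (d x)) -> continuous f.
Proof. by move=> h x; exact: ider_continuous (h x). Qed.

Lemma ider_comp f g x a b : ider f (g x) a -> ider g x b ->
  ider (fun y => f (g y)) x (a * b).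
Proof. by move=> hf hg; exact: is_derive1_comp. Qed.

Lemma ider_expR x : ider (@expR R) x (expR x).
Proof. exact: is_derive_expR. Qed.

Lemma ider_exp_lin (c x : R) : ider (fun y => expR (c * y)) x (c * expR (c * x)).
Proof.
have h : ider (fun y => c * y) x (c * 1) by apply: iderZ; exact: ider_id.
by apply: ider_val (ider_comp (ider_expR _) h) _; ring.
Qed.

Lemma mvt_eq f (df : R -> R) a b : a <= b ->
  (forall x, a < x < b -> ider f x (df x)) ->
  {within `[a, b], continuous f} ->
  exists2 c, a <= c <= b & f b - f a = df c * (b - a).
Proof.
move=> ab fd fc.
have fd' x : x \in `]a, b[ -> is_derive x 1 f (df x).
  by rewrite in_itv => /fd.
have [c cab ->] := MVT_segment ab fd' fc.
by exists c => //; move: cab; rewrite in_itv.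
Qed.

Lemma ider0_cst f a b : (forall x, ider f x 0) -> f a = f b.
Proof.
move=> h; wlog ab : a b / a <= b.
  by move=> W; case: (leP a b) => [|/ltW] /W.
have fc : {within `[a, b], continuous f}.
  by apply: continuous_subspaceT => x; exact: ider_continuous (h x).
have [c _] := mvt_eq ab (fun x _ => h x) fc.
by rewrite mul0r => /eqP; rewrite subr_eq0 => /eqP.
Qed.

End Derivatives.

(** * Oriented integrals and differentiation under the integral sign *)

Section Integrals.
Context {R : realType}.
Notation mu := (@lebesgue_measure R).
Implicit Types (f g : R -> R) (a b c : R).

Definition locint f := forall a b, mu.-integrable `[a, b] (EFin \o f).

(** Oriented integral: at most one of the two terms runs over a segment of positive length.
    Additivity and substitution then need no order between the bounds. *)
Definition oint a b f : R := \int[mu]_(x in `[a, b]) f x - \int[mu]_(x in `[b, a]) f x.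

Lemma cont_locint f : continuous f -> locint f.
Proof.
move=> cf a b; apply: continuous_compact_integrable; first exact: segment_compact.
by apply: continuous_subspaceT => x; exact: cf.
Qed.

Lemma int_empty a b f : b <= a -> \int[mu]_(x in `[a, b]) f x = 0.
Proof.
rewrite le_eqVlt => /orP[/eqP ->|ba]; first by rewrite set_itv1 Rintegral_set1.
by rewrite set_itv_ge ?Rintegral_set0// bnd_simp -ltNge.
Qed.

Lemma oint_ge a b f : a <= b -> oint a b f = \int[mu]_(x in `[a, b]) f x.
Proof. by move=> ab; rewrite /oint [X in _ - X]int_empty ?subr0. Qed.

Lemma ointC a b f : oint b a f = - oint a b f.
Proof. by rewrite /oint opprB. Qed.

Lemma ointaa a f : oint a a f = 0.
Proof. by rewrite /oint subrr. Qed.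

Lemma oint_cat a b c f : locint f -> oint a b f + oint b c f = oint a c f.
Proof.
move=> lf.
have key x y z : x <= y -> y <= z -> oint x y f + oint y z f = oint x z f.
  move=> xy yz; rewrite !oint_ge ?(le_trans xy)//.
  have := @Rintegral_itvB R f (BLeft x) (BRight z) y (lf x z).
  rewrite !bnd_simp => /(_ xy yz).
  rewrite Rintegral_itv_obnd_cbnd => [<-|].
    by rewrite addrC subrK.
  apply: integrableS (lf y z) => //; exact: subset_itv_oc_cc.
case: (leP a b) => ab; case: (leP b c) => bc; case: (leP a c) => ac.
- exact: key.
- by move: (le_trans ab bc); rewrite leNgt ac.
- by rewrite (ointC c b) -(key a c b ac (ltW bc)); ring.
- by rewrite (ointC c b) (ointC c a) -(key c a b (ltW ac) ab); ring.
- by rewrite (ointC b a) -(key b a c (ltW ab) ac); ring.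
- by rewrite (ointC b a) (ointC c a) -(key b c a bc (ltW ac)); ring.
- by move: (lt_trans bc ab); rewrite ltNge ac.
- by rewrite (ointC b a) (ointC c b) (ointC c a) -(key c b a (ltW bc) (ltW ab)); ring.
Qed.

Lemma locintD f g : locint f -> locint g -> locint (fun x => f x + g x).
Proof. by move=> lf lg a b; have := integrableD _ (lf a b) (lg a b); exact. Qed.

Lemma locintB f g : locint f -> locint g -> locint (fun x => f x - g x).
Proof. by move=> lf lg a b; have := integrableB _ (lf a b) (lg a b); exact. Qed.

Lemma locintZ c f : locint f -> locint (fun x => c * f x).
Proof. by move=> lf a b; have := integrableZl _ c (lf a b); exact. Qed.

Lemma ointD a b f g : locint f -> locint g ->
  oint a b (fun x => f x + g x) = oint a b f + oint a b g.
Proof. by move=> lf lg; rewrite /oint !RintegralD//; ring. Qed.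

Lemma ointB a b f g : locint f -> locint g ->
  oint a b (fun x => f x - g x) = oint a b f - oint a b g.
Proof. by move=> lf lg; rewrite /oint !RintegralB//; ring. Qed.

Lemma ointZ a b c f : locint f -> oint a b (fun x => c * f x) = c * oint a b f.
Proof. by move=> lf; rewrite /oint !RintegralZl//; ring. Qed.

Lemma ointN a b f : locint f -> oint a b (fun x => - f x) = - oint a b f.
Proof.
move=> lf; rewrite -mulN1r -ointZ//; congr oint.
by apply/funext => x; rewrite mulN1r.
Qed.

Lemma oint0 a b : oint a b (fun=> 0) = 0.
Proof. by rewrite /oint !Rintegral_cst// !mul0r subrr. Qed.

Lemma int_cst a b c : a <= b -> \int[mu]_(x in `[a, b]) c = c * (b - a).
Proof.
move=> ab; rewrite Rintegral_cst//= lebesgue_measure_itv/= lte_fin.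
by case: ltgtP ab => //= -> _; rewrite subrr.
Qed.

(** The equations of the problem hold in open regions only. Dropping the end points requires
    measurability on the open interval, which [f] inherits from [g]. *)
Lemma eq_int_oo a b f g : measurable_fun `]a, b[ g ->
  (forall x, a < x < b -> f x = g x) ->
  \int[mu]_(x in `[a, b]) f x = \int[mu]_(x in `[a, b]) g x.
Proof.
move=> mg fg; have mf : measurable_fun `]a, b[ f.
  by apply: eq_measurable_fun mg => x; rewrite inE/= in_itv/= => /fg.
have E (h : R -> R) : measurable_fun `]a, b[ h ->
    (\int[mu]_(x in `[a, b]) (h x)%:E = \int[mu]_(x in `]a, b[) (h x)%:E)%E.
  by move=> mh; apply: integral_itv_bndoo; apply/measurable_EFinP.
rewrite /Rintegral !E//.
by congr fine; apply: eq_integral => x; rewrite inE/= in_itv/= => /fg ->.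
Qed.

Lemma eq_oint a b f g :
  (forall x, Num.min a b <= x <= Num.max a b -> f x = g x) -> oint a b f = oint a b g.
Proof.
move=> fg; rewrite /oint; congr (_ - _); apply: eq_Rintegral => x;
  rewrite inE/= in_itv/= => /andP[ax xb]; apply: fg.
  by rewrite ge_min ax le_max xb orbT.
by rewrite ge_min ax le_max xb !orbT.
Qed.

Lemma le_int_norm a b f g : locint f -> locint g ->
  (forall x, a <= x <= b -> `|f x| <= g x) ->
  `|\int[mu]_(x in `[a, b]) f x| <= \int[mu]_(x in `[a, b]) g x.
Proof.
move=> lf lg fg; apply: le_trans (le_normr_Rintegral _ _) _ => //.
apply: le_Rintegral => //.
by have := integrable_norm (lf a b); exact.
Qed.

Lemma locint_cst c : locint (fun=> c).
Proof. by apply: cont_locint; exact: cont_cst. Qed.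

Lemma between_le a b x : Num.min a b <= x <= Num.max a b -> `|x - a| <= `|b - a|.
Proof.
case: (leP a b) => [ab|/ltW ba] /andP[h1 h2].
  by rewrite !ger0_norm ?subr_ge0// lerD2r.
by rewrite !ler0_norm ?subr_le0// lerN2 lerD2r.
Qed.

Lemma between_norm a b x : Num.min a b <= x <= Num.max a b -> `|x| <= `|a| + `|b|.
Proof.
move=> /andP[h1 h2]; rewrite ler_norml; apply/andP; split.
  apply: le_trans h1; rewrite le_min !(lerNl (_ + _)).
  have := ler_norm (- a); have := ler_norm (- b); rewrite !normrN => hb ha.
  by rewrite (le_trans ha) ?lerDl// (le_trans hb)// lerDr.
apply: le_trans h2 _; rewrite ge_max (le_trans (ler_norm a)) ?lerDl//.
by rewrite (le_trans (ler_norm b))// lerDr.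
Qed.

Lemma oint_bound a b f (C : R) : locint f ->
  (forall x, Num.min a b <= x <= Num.max a b -> `|f x| <= C) ->
  `|oint a b f| <= C * `|b - a|.
Proof.
move=> lf; wlog ab : a b / a <= b => [W|] H.
  case: (leP a b) => [|/ltW] ab; first by rewrite W.
  by rewrite ointC normrN (distrC b a); apply: (W b a ab) => x; rewrite minC maxC; exact: H.
have -> : `|b - a| = b - a by rewrite ger0_norm// subr_ge0.
rewrite oint_ge// -int_cst//.
apply: le_int_norm => //; first exact: locint_cst.
by move=> x xab; apply: H; rewrite min_l// max_r.
Qed.

Lemma int_bound_oo a b f (C : R) : a <= b -> locint f ->
  (forall x, a < x < b -> `|f x| <= C) ->
  `|\int[mu]_(x in `[a, b]) f x| <= C * (b - a).
Proof.
move=> ab lf H.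
have loo h : locint h -> mu.-integrable `]a, b[ (EFin \o h).
  by move=> lh; apply: integrableS (lh a b) => //; exact: subset_itv_oo_cc.
have E h : locint h -> \int[mu]_(x in `[a, b]) h x = \int[mu]_(x in `]a, b[) h x.
  move=> lh; rewrite /Rintegral; congr fine; apply: integral_itv_bndoo.
  exact: measurable_int (loo _ lh).
rewrite -int_cst// !E//; last exact: locint_cst.
apply: le_trans (le_normr_Rintegral _ _) _ => //; first exact: loo.
have in1 : mu.-integrable `]a, b[ (EFin \o (fun x => `|f x|)).
  by have := integrable_norm (loo _ lf); exact.
exact: (le_Rintegral _ in1 (loo _ (@locint_cst C))).
Qed.

(** Tube lemma: compactness of [[a, b]] merges neighbourhoods of the points [(p0, y)] into one
    neighbourhood of [p0] valid for all [y]. *)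
Lemma compact_near (X : topologicalType) (P : X -> R -> Prop) (p0 : X) a b :
  (forall y, a <= y <= b -> \forall z \near (p0, y), P z.1 z.2) ->
  \forall p \near p0, forall y, a <= y <= b -> P p y.
Proof.
move=> H.
have := @segment_compact R a b; rewrite compact_near_coveringP.
move=> /(_ X (nbhs p0) P _).
move=> K.
have : \forall p \near p0, `[a, b] `<=` P p.
  apply: K => y; rewrite /= in_itv/= => /H [[A B]/= [nA nB] AB].
  exists (B, A) => //= -[y' p'] [/= By Ap].
  exact: (AB (p', y')).
by apply: filterS => p + y yab; apply; rewrite /= in_itv.
Qed.

Lemma unif_near (X : topologicalType) (u : X -> R -> R) (p0 : X) a b (e : R) :
  continuous (fun z : X * R => u z.1 z.2) -> 0 < e ->
  \forall p \near p0, forall y, a <= y <= b -> `|u p y - u p0 y| < e.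
Proof.
move=> cu e0; apply: compact_near => y yab.
have c : continuous (fun z : X * R => u z.1 z.2 - u p0 z.2).
  apply: contD => //; apply: contN; apply: cont_comp2 => //; last exact: continuous_snd.
  exact: cst_continuous.
have /cvgrPdist_lt/(_ e e0) := c (p0, y); rewrite /= subrr.
by apply: filterS => z; rewrite sub0r normrN.
Qed.

Lemma cont_bounded f a b : continuous f ->
  exists2 C : R, 0 <= C & forall x, a <= x <= b -> `|f x| <= C.
Proof.
move=> cf; case: (leP a b) => [ab|ba]; last first.
  exists 0 => // x /andP[ax xb]; have := le_trans ax xb.
  by rewrite leNgt ba.
have cn : {within `[a, b], continuous (fun x => `|f x|)}.
  by apply: continuous_subspaceT; apply: cont_norm.
have [c cab H] := EVT_max ab cn.
by exists `|f c| => // x xab; apply: H; rewrite in_itv.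
Qed.

Lemma cont_sect (X : topologicalType) (u : X -> R -> R) (p : X) :
  continuous (fun z : X * R => u z.1 z.2) -> continuous (u p).
Proof.
move=> cu; have := @cont_comp2 R R X R u (fun=> p) (fun y => y) cu.
by apply; [exact: cst_continuous|exact: cont_id].
Qed.

(** The error splits into two end pieces, small because [u] is bounded near [p0], and the change of
    integrand, uniformly small by [unif_near]. For [p] near [p0] the fixed segment [[m, M]] contains
    all moving bounds. *)
Lemma cont_oint (X : topologicalType) (u : X -> R -> R) (a b : X -> R) :
  continuous (fun z : X * R => u z.1 z.2) -> continuous a -> continuous b ->
  continuous (fun p => oint (a p) (b p) (u p)).
Proof.
move=> cu ca cb p0; apply/cvgrPdist_le => e e0.
have cup p : locint (u p) by apply: cont_locint; exact: cont_sect.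
set M := `|a p0| + `|b p0| + 1; set m := - M.
have inM c x : `|x - c| <= 1 -> `|c| <= `|a p0| + `|b p0| -> m <= x <= M.
  move=> xc cM; rewrite -ler_norml /M -(subrK c x).
  by apply: le_trans (ler_normD _ _) _; rewrite addrC lerD.
have [C C0 HC] := @cont_bounded (u p0) m M (cont_sect (p:=p0) cu).
pose e1 := Num.min 1 (e / 3 / (`|b p0 - a p0| + 1)).
have e10 : 0 < e1 by rewrite lt_min ltr01/= divr_gt0// ?divr_gt0// ltr_wpDl.
pose e2 := Num.min 1 (e / 3 / (C + 1)).
have e20 : 0 < e2 by rewrite lt_min ltr01/= divr_gt0// ?divr_gt0// ltr_wpDl.
have He2 : e2 * (C + 1) <= e / 3.
  by rewrite -ler_pdivlMr ?ltr_wpDl// ge_min lexx orbT.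
have e21 : e2 <= 1 by rewrite ge_min lexx.
have He1 : e1 * `|b p0 - a p0| <= e / 3.
  apply: (@le_trans _ _ (e1 * (`|b p0 - a p0| + 1))).
    by rewrite ler_pM2l// lerDl.
  by rewrite -ler_pdivlMr ?ltr_wpDl// ge_min lexx orbT.
near=> p.
have na : `|a p0 - a p| <= e2.
  by near: p; have /cvgrPdist_le := ca p0; apply.
have nb : `|b p0 - b p| <= e2.
  by near: p; have /cvgrPdist_le := cb p0; apply.
have nu : forall y, m <= y <= M -> `|u p y - u p0 y| < e1.
  by near: p; exact: unif_near.
have nuC y : m <= y <= M -> `|u p y| <= C + 1.
  move=> ymM; rewrite -(subrK (u p0 y) (u p y)).
  apply: le_trans (ler_normD _ _) _; rewrite addrC lerD ?HC//.
  by apply: ltW; apply: lt_le_trans (nu _ ymM) _; rewrite ge_min lexx.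
have -> : oint (a p0) (b p0) (u p0) - oint (a p) (b p) (u p) =
    - oint (a p) (a p0) (u p) - oint (a p0) (b p0) (fun y => u p y - u p0 y)
    - oint (b p0) (b p) (u p).
  rewrite ointB// -(oint_cat (a p) (a p0) (b p) (cup p)).
  by rewrite -(oint_cat (a p0) (b p0) (b p) (cup p)); ring.
have B1 : `|oint (a p) (a p0) (u p)| <= e / 3.
  apply: le_trans He2; rewrite mulrC.
  apply: (@le_trans _ _ ((C + 1) * `|a p0 - a p|)); last first.
    by rewrite ler_wpM2l// addr_ge0.
  apply: oint_bound => // y /andP[y1 y2]; apply: nuC.
  apply: (inM (a p0)); last by rewrite lerDl.
  apply: le_trans e21; apply: le_trans na.
  by rewrite (distrC (a p0)); apply: between_le; rewrite minC maxC; apply/andP.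
have B2 : `|oint (b p0) (b p) (u p)| <= e / 3.
  apply: le_trans He2; rewrite mulrC.
  apply: (@le_trans _ _ ((C + 1) * `|b p - b p0|)); last first.
    by rewrite ler_wpM2l// ?addr_ge0// distrC.
  apply: oint_bound => // y /andP[y1 y2]; apply: nuC.
  apply: (inM (b p0)); last by rewrite lerDr.
  apply: le_trans e21; apply: le_trans nb.
  by rewrite (distrC (b p0)); apply: between_le; apply/andP.
have B3 : `|oint (a p0) (b p0) (fun y => u p y - u p0 y)| <= e / 3.
  apply: le_trans He1; apply: oint_bound; first exact: locintB.
  move=> y /andP[y1 y2]; apply: ltW; apply: nu; rewrite -ler_norml.
  apply: (@le_trans _ _ (`|a p0| + `|b p0|)); last by rewrite lerDl.
  by apply: between_norm; apply/andP.
apply: le_trans (ler_normB _ _) _.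
apply: le_trans (lerD (ler_normB _ _) (lexx _)) _.
rewrite normrN; lra.
Unshelve. all: by end_near. Qed.

Lemma ider_oint a f t : continuous f -> ider (fun t => oint a t f) t (f t).
Proof.
move=> cf; apply/iderP => e e0.
have lf := cont_locint cf.
have /cvgrPdist_le/(_ e e0) := cf t.
move=> /nbhs_ballP[r /= r0 Hr].
exists r => // h hr.
have -> : oint a (t + h) f - oint a t f = oint t (t + h) f.
  by rewrite -(oint_cat a t (t + h) lf); ring.
have -> : f t * h = oint t (t + h) (fun=> f t).
  rewrite /oint; case: (leP 0 h) => h0.
    by rewrite int_cst ?lerDl// int_empty ?lerDl//; ring.
  by rewrite int_empty ?gerDl ?ltW// int_cst ?gerDl ?ltW//; ring.
rewrite -ointB//; last exact: locint_cst.
have -> : e * `|h| = e * `|t + h - t| by congr (_ * `|_|); ring.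
apply: oint_bound; first by apply: locintB => //; exact: locint_cst.
move=> x /between_le xb; rewrite distrC; apply: Hr.
by rewrite /ball/= distrC; apply: le_lt_trans xb _; rewrite addrC addKr.
Qed.

Lemma FTC F f a b : continuous f -> (forall x, ider F x (f x)) ->
  oint a b f = F b - F a.
Proof.
move=> cf dF.
have h x : ider (fun t => oint a t f - F t) x 0.
  by rewrite -(subrr (f x)); apply: iderB; [exact: ider_oint|exact: dF].
have := ider0_cst b a h; rewrite /= ointaa => /eqP.
by rewrite sub0r subr_eq => /eqP ->; rewrite addrC.
Qed.

(** The derivative of [F] is known only inside; [F] minus the oriented integral of [f] has zero
    derivative there and is continuous up to the ends. *)
Lemma FTC_oo F f a b : a <= b -> continuous f ->
  (forall x, a < x < b -> ider F x (f x)) ->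
  {within `[a, b], continuous F} ->
  \int[mu]_(x in `[a, b]) f x = F b - F a.
Proof.
move=> ab cf dF cF; rewrite -oint_ge//.
have [|||c _] := @mvt_eq R (fun t => F t - oint a t f) (fun=> 0) a b.
- by [].
- move=> x xab; rewrite -(subrr (f x)); apply: iderB; first exact: dF.
  exact: ider_oint.
- move=> x; apply: cvgB; first exact: cF.
  apply: (@continuous_subspaceT _ _ _ (fun t => oint a t f)) => y.
  exact: ider_continuous (ider_oint a y cf).
by rewrite ointaa mul0r => /eqP; rewrite subr_eq0 subr0 subr_eq => /eqP ->; ring.
Qed.

Lemma oint_affine a b (c d : R) f : continuous f ->
  c * oint a b (fun x => f (c * x + d)) = oint (c * a + d) (c * b + d) f.
Proof.
move=> cf.
have cg : continuous (fun x => f (c * x + d)).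
  apply: (cont_comp1 (u := f)) => //; apply: contD; last exact: cont_cst.
  by apply: contM; [exact: cont_cst|exact: cont_id].
rewrite -ointZ; last exact: cont_locint.
pose F t := oint (c * a + d) (c * t + d) f.
have -> : oint (c * a + d) (c * b + d) f = F b - F a by rewrite /F ointaa subr0.
apply: FTC; first by apply: contM => //; exact: cont_cst.
move=> x; rewrite mulrC; apply: (ider_comp (f := fun t => oint (c * a + d) t f)).
  exact: ider_oint.
rewrite -[X in ider _ _ X]addr0; apply: iderD; last exact: ider_cst.
rewrite -[X in ider _ _ X]mulr1; apply: iderZ; exact: ider_id.
Qed.

Lemma oint_shift a b (d : R) f : continuous f ->
  oint a b (fun x => f (x + d)) = oint (a + d) (b + d) f.
Proof.
move=> cf; have := oint_affine a b 1 d cf; rewrite !mul1r => <-.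
by congr oint; apply/funext => x; rewrite mul1r.
Qed.

Lemma oint_rev a b (d : R) f : continuous f ->
  oint a b (fun x => f (d - x)) = oint (d - b) (d - a) f.
Proof.
move=> cf; have := oint_affine a b (-1) d cf; rewrite !mulN1r -ointC.
rewrite !(addrC (- _) d) => E; rewrite [RHS]ointC -E -ointC.
by congr oint; apply/funext => x; rewrite mulN1r addrC.
Qed.

(** At each [y] the increment is [h * Gx xi y] by the mean value theorem, with [xi] depending on
    [y], and [Gx] is uniformly close to [Gx x0] on the segment. Differentiability is asked for
    interior [y] only, as it is available for solutions known inside their domain. *)
Lemma leibniz (G Gx : R -> R -> R) (x0 r a b : R) : 0 < r -> a <= b ->
  (forall x, `|x - x0| < r -> locint (G x)) -> cont2 Gx ->
  (forall x y, `|x - x0| < r -> a < y < b -> ider (G ^~ y) x (Gx x y)) ->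
  ider (fun x => \int[mu]_(y in `[a, b]) G x y) x0
    (\int[mu]_(y in `[a, b]) Gx x0 y).
Proof.
move=> r0 ab lG cGx dG; apply/iderP => e e0.
pose e1 := e / (b - a + 1).
have ba1 : 0 < b - a + 1 by rewrite ltr_wpDl// subr_ge0.
have e10 : 0 < e1 by rewrite divr_gt0.
have /nbhs_ballP[s /= s0 Hs] := @unif_near R Gx x0 a b e1 cGx e10.
exists (Num.min r s); first by rewrite lt_min r0.
move=> h; rewrite lt_min => /andP[hr hs].
have lGx : locint (Gx x0) by apply: cont_locint; apply: cont_sect cGx.
have lG0 : locint (G x0) by apply: lG; rewrite subrr normr0.
have lGh : locint (G (x0 + h)) by apply: lG; rewrite addrC addKr.
rewrite mulrC -!oint_ge// -ointZ// -!ointB//; [|exact: locintB|exact: locintZ].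
set f := fun y => _.
have lf : locint f by apply: locintB; [exact: locintB|exact: locintZ].
have fb y : a < y < b -> `|f y| <= e1 * `|h|.
  move=> yab; rewrite /f.
  have [xi xih ->] : exists2 xi, `|xi - x0| <= `|h| &
      G (x0 + h) y - G x0 y = h * Gx xi y.
    have [h0|h0] := leP 0 h.
      have [|||c /andP[c1 c2] ->] := @mvt_eq R (G ^~ y) (Gx ^~ y) x0 (x0 + h).
      - by rewrite lerDl.
      - move=> x /andP[x1 x2]; apply: dG => //.
        move: hr; rewrite !ltr_norml => /andP[? ?].
        by apply/andP; split; lra.
      - apply: derivable_within_continuous => x; rewrite in_itv/= => /andP[x1 x2].
        apply: derivable_ider; apply: dG (yab).
        move: hr; rewrite !ltr_norml => /andP[? ?].
        by apply/andP; split; lra.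
      exists c; last by ring.
      by rewrite (ger0_norm h0) ler_norml; apply/andP; split; lra.
    have [|||c /andP[c1 c2] E] := @mvt_eq R (G ^~ y) (Gx ^~ y) (x0 + h) x0.
    - by rewrite gerDl ltW.
    - move=> x /andP[x1 x2]; apply: dG => //.
      move: hr; rewrite !ltr_norml => /andP[? ?].
      by apply/andP; split; lra.
    - apply: derivable_within_continuous => x; rewrite in_itv/= => /andP[x1 x2].
      apply: derivable_ider; apply: dG (yab).
      move: hr; rewrite !ltr_norml => /andP[? ?].
      by apply/andP; split; lra.
    exists c; last by rewrite -opprB E; ring.
    by rewrite (ltr0_norm h0) ler_norml; apply/andP; split; lra.
  rewrite -mulrBr normrM mulrC ler_wpM2r// ltW//; apply: Hs.
    rewrite /ball/= distrC; exact: le_lt_trans xih _.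
  by case/andP: yab => *; rewrite !ltW.
rewrite oint_ge//.
apply: le_trans (int_bound_oo ab lf fb) _.
rewrite mulrAC ler_wpM2r// /e1 -mulrA -[X in _ <= X]mulr1 ler_pM2l//.
by rewrite mulrC ler_pdivrMr// mul1r lerDl.
Qed.

End Integrals.

(** * Calculus and measurability in the plane *)

Section PlaneCalculus.
Context {R : realType}.
Notation mu := (@lebesgue_measure R).
Implicit Types (u A : R -> R -> R) (a b f g : R -> R).

Lemma in_between (x a b : R) : a <= x <= b ->
  `|x - a| <= `|b - a| /\ `|x - b| <= `|a - b|.
Proof.
move=> /andP[ax xb]; have ab := le_trans ax xb; split.
  by rewrite !ger0_norm ?subr_ge0// lerD2r.
by rewrite !ler0_norm ?subr_le0// lerN2 lerD2r.
Qed.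

(** The increment is split into a move in the second variable at fixed [a s] and a move in the
    first, where the mean value theorem applies. So the derivative in the second variable is used at
    a single point, and [u1] near it. *)
Lemma ider_chain (u u1 : R -> R -> R) a b (s a' b' d2 : R) :
  (\forall z \near (a s, b s), ider (u ^~ z.2) z.1 (u1 z.1 z.2)) ->
  {for (a s, b s), continuous (fun p : R * R => u1 p.1 p.2)} ->
  ider (u (a s)) (b s) d2 -> ider a s a' -> ider b s b' ->
  ider (fun t => u (a t) (b t)) s (u1 (a s) (b s) * a' + d2 * b').
Proof.
move=> nu cu1 du da db.
have h2 : ider (fun t => u (a s) (b t)) s (d2 * b') by exact: ider_comp.
suff h1 : ider (fun t => u (a t) (b t) - u (a s) (b t)) s (u1 (a s) (b s) * a').
  apply: eq_ider (iderD h1 h2) => t /=; exact: subrK.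
apply/iderP => e e0.
set v := u1 (a s) (b s).
pose e1 := Num.min 1 (e / (`|a'| + 1 + `|v|)).
have K0 : 0 < `|a'| + 1 + `|v| by rewrite -addrA addrCA ltr_pwDl// addr_ge0.
have e10 : 0 < e1 by rewrite lt_min ltr01/= divr_gt0.
have e11 : e1 <= 1 by rewrite ge_min lexx.
have He1 : e1 * (`|a'| + 1 + `|v|) <= e by rewrite -ler_pdivlMr// ge_min lexx orbT.
have near1 : \forall z \near (a s, b s),
    ider (u ^~ z.2) z.1 (u1 z.1 z.2) /\ `|u1 z.1 z.2 - v| < e1.
  apply: filterI => //; have /cvgrPdist_lt/(_ _ e10) := cu1.
  by apply: filterS => z; rewrite distrC.
case: near1 => -[P Q]/= [/nbhs_ballP[rp /= rp0 HP] /nbhs_ballP[rq /= rq0 HQ]] PQ.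
have [r1 r10 H1] := (iderP _ _ _).1 da _ e10.
have ca := ider_continuous da; have cb := ider_continuous db.
have /nbhs_ballP[ra /= ra0 Ha] : \forall t \near s, `|a s - a t| < rp.
  by have /cvgrPdist_lt := ca; apply.
have /nbhs_ballP[rb /= rb0 Hb] : \forall t \near s, `|b s - b t| < rq.
  by have /cvgrPdist_lt := cb; apply.
exists (Num.min r1 (Num.min ra rb)); first by rewrite !lt_min r10 ra0.
move=> h; rewrite !lt_min => /and3P[hr1 hra hrb].
have sh r : `|h| < r -> ball s r (s + h) by rewrite /ball/= opprD addNKr normrN.
have {}Ha := Ha _ (sh _ hra); have {}Hb := Hb _ (sh _ hrb).
have {}H1 := H1 _ hr1.
have [xi dxi E] : exists2 xi, `|u1 xi (b (s + h)) - v| < e1 &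
    u (a (s + h)) (b (s + h)) - u (a s) (b (s + h)) = u1 xi (b (s + h)) * (a (s + h) - a s).
  have inball x : `|x - a s| <= `|a (s + h) - a s| ->
      ider (u ^~ (b (s + h))) x (u1 x (b (s + h))) /\ `|u1 x (b (s + h)) - v| < e1.
    move=> xa; apply: (PQ (x, b (s + h))); split => /=; last exact: HQ.
    by apply: HP; rewrite /ball/= distrC (le_lt_trans xa)// distrC.
  have [le|/ltW le] := leP (a s) (a (s + h)).
    have [|||xi /andP[x1 x2] E] := @mvt_eq R (u ^~ (b (s + h))) (u1 ^~ (b (s + h))) (a s) (a (s + h)).
    - by [].
    - move=> x /andP[x1 x2]; apply: (inball _ _).1.
      by apply: (in_between _).1; rewrite !ltW.
    - apply: derivable_within_continuous => x; rewrite in_itv/= => /andP[x1 x2].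
      apply: derivable_ider (inball _ _).1.
      by apply: (in_between _).1; rewrite x1.
    exists xi => //; apply: (inball _ _).2.
    by apply: (in_between _).1; rewrite x1.
  have [|||xi /andP[x1 x2] E] := @mvt_eq R (u ^~ (b (s + h))) (u1 ^~ (b (s + h))) (a (s + h)) (a s).
  - by [].
  - move=> x /andP[x1 x2]; apply: (inball _ _).1.
    by apply: (in_between _).2; rewrite !ltW.
  - apply: derivable_within_continuous => x; rewrite in_itv/= => /andP[x1 x2].
    apply: derivable_ider (inball _ _).1.
    by apply: (in_between _).2; rewrite x1.
  exists xi; last by rewrite -opprB E; ring.
  apply: (inball _ _).2.
  by apply: (in_between _).2; rewrite x1.
rewrite E subrr subr0.
have -> : u1 xi (b (s + h)) * (a (s + h) - a s) - v * a' * h =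
   (u1 xi (b (s + h)) - v) * (a (s + h) - a s) + v * (a (s + h) - a s - a' * h) by ring.
apply: le_trans (ler_normD _ _) _; rewrite !normrM.
apply: le_trans (ler_wpM2r (normr_ge0 h) He1).
have Ba : `|a (s + h) - a s| <= (`|a'| + 1) * `|h|.
  rewrite -(subrK (a' * h) (a (s + h) - a s)).
  apply: le_trans (ler_normD _ _) _; rewrite addrC mulrDl lerD//.
    by rewrite normrM.
  by apply: le_trans H1 _; rewrite ler_wpM2r.
have B1 : `|u1 xi (b (s + h)) - v| * `|a (s + h) - a s| <= e1 * ((`|a'| + 1) * `|h|).
  by apply: ler_pM => //; exact: ltW.
have B2 : `|v| * `|a (s + h) - a s - a' * h| <= `|v| * (e1 * `|h|) by rewrite ler_wpM2l.
by apply: le_trans (lerD B1 B2) _; rewrite le_eqVlt; apply/orP; left; apply/eqP; ring.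
Qed.

Lemma ider_chainT (u u1 u2 : R -> R -> R) a b (s a' b' : R) :
  cont2 u1 -> (forall x t, ider (u ^~ t) x (u1 x t)) ->
  (forall x t, ider (u x) t (u2 x t)) -> ider a s a' -> ider b s b' ->
  ider (fun t => u (a t) (b t)) s (u1 (a s) (b s) * a' + u2 (a s) (b s) * b').
Proof.
move=> c1 d1 d2 da db; apply: ider_chain => //; last exact: c1.
by near=> z.
Unshelve. all: by end_near. Qed.

Lemma leibniz_oint (G Gx : R -> R -> R) (x0 a b : R) :
  cont2 G -> cont2 Gx -> (forall x y, ider (G ^~ y) x (Gx x y)) ->
  ider (fun x => oint a b (G x)) x0 (oint a b (Gx x0)).
Proof.
move=> cG cGx dG.
have lG x : locint (G x) by apply: cont_locint; exact: cont_sect cG.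
wlog ab : a b / a <= b => [W|].
  have [|/ltW ba] := leP a b; first exact: W.
  rewrite ointC; apply: eq_ider (iderN (W b a ba)) => x /=.
  by rewrite -ointC.
rewrite oint_ge//; apply: (@eq_ider _ (fun x => \int[mu]_(y in `[a, b]) G x y)).
  by move=> x; rewrite oint_ge.
by apply: (@leibniz R G Gx x0 1).
Qed.

(** Chain rule along the diagonal of the function whose lower bound and whose parameter vary
    independently. *)
Lemma leibniz_left (G Gx : R -> R -> R) (x0 b : R) :
  cont2 G -> cont2 Gx -> (forall x y, ider (G ^~ y) x (Gx x y)) ->
  ider (fun x => oint x b (G x)) x0 (oint x0 b (Gx x0) - G x0 x0).
Proof.
move=> cG cGx dG.
pose U x t := oint t b (G x).
have := @ider_chainT U (fun x t => oint t b (Gx x)) (fun x t => - G x t)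
   id id x0 1 1.
move=> H; apply: ider_val (H _ _ _ _ _) _; last by rewrite !mulr1.
- apply: (@cont_oint R (R * R)%type (fun p => Gx p.1) snd (fun=> b)).
  + apply: (cont_comp2 (u := Gx)) => //; last exact: continuous_snd.
    by apply: (cont_comp1 (u := fst)); exact: continuous_fst.
  + exact: continuous_snd.
  + exact: cont_cst.
- by move=> x t; exact: leibniz_oint.
- move=> x t; apply: (@eq_ider _ (fun t => - oint b t (G x))).
    by move=> y; rewrite -ointC.
  by apply: iderN; apply: ider_oint; exact: cont_sect cG.
- exact: ider_id.
- exact: ider_id.
Qed.

(** Measurability is meant for the product sigma-algebra. Rounding the first variable down to a
    multiple of 1/(n+1) yields countable unions of measurable rectangles, and continuity gives the
    limit. *)
Lemma cont2_measurable u : cont2 u ->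
  measurable_fun setT (fun p : measurableTypeR R * measurableTypeR R => u p.1 p.2).
Proof.
move=> cu.
pose phi (n : nat) (x : R) : R := (Num.floor (x * n.+1%:R))%:~R / n.+1%:R.
apply: (@measurable_fun_cvg _ _ R setT
  (fun n (p : measurableTypeR R * measurableTypeR R) => u (phi n p.1) p.2)) => //.
  move=> n _ Y mY; rewrite setTI.
  pose S (k : int) : set (measurableTypeR R * measurableTypeR R) :=
    ((fun x => x * n.+1%:R) @^-1` `[k%:~R, (k + 1)%:~R[) `*`
    (u (k%:~R / n.+1%:R) @^-1` Y).
  have -> : (fun p => u (phi n p.1) p.2) @^-1` Y =
      \bigcup_(i : nat) (if unpickle i is Some k then S k else set0).
    apply/seteqP; split=> [[x y]/= Yxy|[x y]/= [i _]].
      have := floor_itv (x * n.+1%:R); move: Yxy; rewrite /phi.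
      move: (Num.floor _) => k Yk xk; exists (pickle k) => //; rewrite pickleK.
      by split; rewrite //= in_itv.
    case: unpickle => // k [/=]; rewrite in_itv/= => xk.
    by rewrite /phi (floor_def xk).
  apply: bigcupT_measurable => i; case: unpickle => [k|//].
  apply: measurableX.
    rewrite -[X in measurable X]setTI; apply: continuous_measurable_fun => //.
    by apply: contM; [exact: cont_id|exact: cont_cst].
  rewrite -[X in measurable X]setTI; apply: continuous_measurable_fun => //.
  exact: cont_sect cu.
move=> [x y] _ /=.
have cphi : phi n x @[n --> \oo] --> x.
  apply/cvgrPdist_le => e e0; near=> n.
  rewrite /phi -[X in `|X - _|](mulfK (_ : n.+1%:R != 0))//.
  rewrite -mulrBl normrM normfV ger0_norm; last first.
    by rewrite subr_ge0 floor_le.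
  rewrite (ger0_norm (ler0n _ _)) ler_pdivrMr//.
  have := floorD1_gt (x * n.+1%:R); rewrite intrD => lt1.
  rewrite (@le_trans _ _ 1)//; first by rewrite lerBlDl addrC ltW// addrC.
  rewrite -ler_pdivrMl// mulr1.
  apply: (@le_trans _ _ n%:R); last by rewrite ler_nat.
  by near: n; exact: nbhs_infty_ger.
apply: (@cvg_comp _ _ _ (fun n => (phi n x, y)) (fun p : R * R => u p.1 p.2) _
  (nbhs (x, y))); last exact: (cu (x, y)).
exact: (cvg_pair cphi (cvg_cst y)).
Unshelve. all: by end_near. Qed.

Lemma cont2_bounded u (a b c d : R) : cont2 u ->
  exists2 C : R, 0 <= C &
    forall x y, a <= x <= b -> c <= y <= d -> `|u x y| <= C.
Proof.
move=> cu; have [ne|em] := pselect (a <= b /\ c <= d); last first.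
  exists 0 => // x y /andP[ax xb] /andP[cy yd]; exfalso; apply: em.
  by rewrite (le_trans ax xb) (le_trans cy yd).
have cpt : compact (`[a, b]%classic `*` `[c, d]%classic).
  by apply: compact_setX; exact: segment_compact.
have [||z _ H] := @compact_EVT_max _ R (fun p : R * R => `|u p.1 p.2|) _ _ cpt.
- by case: ne => n1 n2; exists (a, c); split; rewrite /= in_itv/= lexx ?n1 ?n2.
- by apply: continuous_subspaceT; exact: cont_norm.
exists `|u z.1 z.2| => // x y xab ycd; apply: (H (x, y)).
by rewrite inE; split; rewrite /= in_itv.
Qed.

End PlaneCalculus.

(** * Fubini's theorem for real-valued integrals *)

Section FubiniReal.
Context {R : realType}.
Notation mu := (@lebesgue_measure R).
Notation rr := (measurableTypeR R * measurableTypeR R)%type.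
Implicit Types (F A : R -> R -> R) (a b f g : R -> R).

Lemma Rfubini F :
  (mu \x mu)%E.-integrable setT (fun p : rr => (F p.1 p.2)%:E) ->
  (forall x, mu.-integrable setT (EFin \o F x)) ->
  (forall y, mu.-integrable setT (EFin \o F ^~ y)) ->
  \int[mu]_x \int[mu]_y F x y = \int[mu]_y \int[mu]_x F x y.
Proof.
move=> iF iF1 iF2; rewrite /Rintegral; congr fine.
transitivity (\int[mu]_x \int[mu]_y (F x y)%:E)%E.
  by apply: eq_integral => x _; rewrite fineK//; exact: (integrable_fin_num _ (iF1 x)).
rewrite (Fubini iF); apply: eq_integral => y _.
by rewrite fineK//; exact: (integrable_fin_num _ (iF2 y)).
Qed.

Lemma integrable_abse_fin (D : set R) a : measurable D ->
  mu.-integrable D (EFin \o a) -> mu.-integrable D (EFin \o (fun x => `|a x|)).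
Proof. by move=> mD ia; have := integrable_norm ia; exact. Qed.

Lemma dominated_integrable (D : set R) f g : measurable D ->
  measurable_fun D f -> (forall x, D x -> `|f x| <= g x) ->
  mu.-integrable D (EFin \o g) -> mu.-integrable D (EFin \o f).
Proof.
move=> mD mf fg ig; apply: le_integrable ig => //; first exact/measurable_EFinP.
by move=> x Dx /=; rewrite lee_fin (le_trans (fg x Dx))// ler_norm.
Qed.

Lemma section_measurable F x :
  measurable_fun setT (fun p : rr => F p.1 p.2) -> measurable_fun setT (F x).
Proof. by move=> mF; have := measurable_fun_pair2 x mF. Qed.

Lemma section_measurable2 F y :
  measurable_fun setT (fun p : rr => F p.1 p.2) -> measurable_fun setT (F ^~ y).
Proof. by move=> mF; have := measurable_fun_pair1 y mF. Qed.

(** The product majorant makes every section integrable, not just almost every one, and yields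
    Tonelli's criterion at once. *)
Lemma fubini_dominated F a b :
  measurable_fun setT (fun p : rr => F p.1 p.2) ->
  (forall x y, `|F x y| <= `|a x| * `|b y|) ->
  mu.-integrable setT (EFin \o a) -> mu.-integrable setT (EFin \o b) ->
  [/\ forall x, mu.-integrable setT (EFin \o F x),
      forall y, mu.-integrable setT (EFin \o F ^~ y) &
      \int[mu]_x \int[mu]_y F x y = \int[mu]_y \int[mu]_x F x y].
Proof.
move=> mF Fab ia ib.
have ia' := integrable_abse_fin measurableT ia.
have ib' := integrable_abse_fin measurableT ib.
have i1 x : mu.-integrable setT (EFin \o F x).
  apply: (@dominated_integrable _ _ (fun y => `|a x| * `|b y|)) => //.
    exact: section_measurable.
  by have := @integrableZl _ _ _ mu setT measurableT `|a x| _ ib'; exact.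
have i2 y : mu.-integrable setT (EFin \o F ^~ y).
  apply: (@dominated_integrable _ _ (fun x => `|b y| * `|a x|)) => //.
  - exact: section_measurable2.
  - by move=> x _; rewrite mulrC.
  - by have := @integrableZl _ _ _ mu setT measurableT `|b y| _ ia'; exact.
split; [exact: i1|exact: i2|apply: Rfubini; [|exact: i1|exact: i2]].
apply/integrable12ltyP; first exact/measurable_EFinP.
set B := (\int[mu]_y (`|b y|)%:E)%E.
have Bfin : B \is a fin_num := integrable_fin_num measurableT ib'.
apply: (@le_lt_trans _ _ (\int[mu]_x ((fine B)%:E * (`|a x|)%:E))%E).
  apply: ge0_le_integral => //.
  - by move=> x _; exact: integral_ge0.
  - apply: (@measurable_fun_fubini_tonelli_F _ _ _ _ _ mu
      (fun p : rr => `|(F p.1 p.2)%:E|)%E) => //.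
    by apply: measurableT_comp => //; exact/measurable_EFinP.
  - have : measurable_fun setT (EFin \o (fun x => fine B * `|a x|)).
      apply/measurable_EFinP; apply: measurable_funM; first exact: measurable_cst.
      by apply/measurable_EFinP; exact: measurable_int ia'.
    by [].
  - move=> x _ /=; rewrite fineK//.
    apply: (@le_trans _ _ (\int[mu]_y ((`|a x|)%:E * (`|b y|)%:E))%E).
      apply: ge0_le_integral => //.
      + have := integrable_abse_fin measurableT (i1 x).
        by move=> /(measurable_int mu).
      + have : measurable_fun setT (EFin \o (fun y => `|a x| * `|b y|)).
          apply/measurable_EFinP; apply: measurable_funM; first exact: measurable_cst.
          by apply/measurable_EFinP; exact: measurable_int ib'.
        by [].
      + by move=> y _; rewrite -EFinM lee_fin.
    rewrite ge0_integralZl_EFin//; last exact: measurable_int ib'.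
    by rewrite muleC.
rewrite ge0_integralZl_EFin//.
- rewrite -ge0_fin_numE; last first.
    by rewrite mule_ge0// ?lee_fin ?fine_ge0//; apply: integral_ge0.
  have Afin := integrable_fin_num measurableT ia'.
  exact: fin_numM.
- exact: measurable_int ia'.
- by rewrite fine_ge0//; exact: integral_ge0.
Qed.

(** For [p <= q], the retraction of the line onto [[p, q]]: composition with it extends functions
    given on a segment and paths given on a time interval. *)
Definition clampr (p q x : R) := Num.max p (Num.min x q).

Lemma clampr_cont p q : continuous (clampr p q).
Proof. by apply: cont_max; [exact: cont_cst|apply: cont_min; [exact: cont_id|exact: cont_cst]]. Qed.

Lemma clampr_id p q x : p <= x <= q -> clampr p q x = x.
Proof. by move=> /andP[px xq]; rewrite /clampr min_l// max_r. Qed.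

Lemma clampr_in p q x : p <= q -> p <= clampr p q x <= q.
Proof. by move=> pq; rewrite /clampr le_max lexx /= ge_max pq ge_min lexx orbT. Qed.

Lemma patch_integrable (D : set R) a : measurable D ->
  mu.-integrable D (EFin \o a) -> mu.-integrable setT (EFin \o (a \_ D)).
Proof.
move=> mD ia; have := (@integrable_mkcond _ _ R mu D (EFin \o a) mD).1 ia.
by rewrite restrict_EFin.
Qed.

Lemma eq_int_patch (D : set R) f g :
  (forall x, D x -> f x = g x) -> (forall x, ~ D x -> g x = 0) ->
  \int[mu]_(x in D) f x = \int[mu]_x g x.
Proof.
move=> fg g0; rewrite Rintegral_mkcond; apply: eq_Rintegral => x _.
by rewrite patchE; case: ifPn => [/set_mem /fg//|/negP h]; rewrite g0// => /mem_set.
Qed.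

Lemma patchT (D : set R) a x : D x -> (a \_ D) x = a x.
Proof. by move=> Dx; rewrite patchE mem_set. Qed.

Lemma patchC (D : set R) a x : ~ D x -> (a \_ D) x = 0.
Proof. by move=> Dx; rewrite patchE memNset. Qed.

Lemma RintegralZl_gen (D : set R) f r : measurable D ->
  mu.-integrable D (EFin \o f) ->
  r * \int[mu]_(x in D) f x = \int[mu]_(x in D) (r * f x).
Proof. by move=> mD fi; rewrite RintegralZl. Qed.

Lemma Rintegral0 (D : set R) : \int[mu]_(x in D) (0 : R) = 0.
Proof. by rewrite /Rintegral integral0. Qed.

Lemma kernel_integrable (A : R -> R -> R) b (C z : R) :
  measurable_fun setT (fun z : rr => A z.1 z.2) ->
  (forall z s, `|A z s| <= C) -> mu.-integrable setT (EFin \o b) ->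
  mu.-integrable setT (EFin \o (fun s => A z s * b s)).
Proof.
move=> mA AC ib.
apply: (@dominated_integrable setT _ (fun s => C * `|b s|)) => //.
- apply: measurable_funM; first exact: section_measurable mA.
  by apply/measurable_EFinP; exact: measurable_int ib.
- by move=> s _; rewrite normrM ler_wpM2r.
- have := @integrableZl _ _ _ mu setT measurableT C _ (integrable_abse_fin measurableT ib).
  exact.
Qed.

Lemma fubini_kernel A a b (C : R) :
  measurable_fun setT (fun z : rr => A z.1 z.2) -> (forall z s, `|A z s| <= C) ->
  mu.-integrable setT (EFin \o a) -> mu.-integrable setT (EFin \o b) ->
  \int[mu]_z (a z * \int[mu]_s (A z s * b s)) =
  \int[mu]_s (b s * \int[mu]_z (A z s * a z)).
Proof.
move=> mA AC ia ib.
have C0 : 0 <= C by apply: le_trans (AC 0 0).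
pose F z s := a z * (A z s * b s).
have ma : measurable_fun setT a by apply/measurable_EFinP; exact: measurable_int ia.
have mb : measurable_fun setT b by apply/measurable_EFinP; exact: measurable_int ib.
have mF : measurable_fun setT (fun z : rr => F z.1 z.2).
  by apply: measurable_funM; [|apply: measurable_funM => //];
    exact: (measurableT_comp _ _).
have iCb : mu.-integrable setT (EFin \o (fun s => C * b s)).
  by have := @integrableZl _ _ _ mu setT measurableT C _ ib; exact.
have Fab z s : `|F z s| <= `|a z| * `|C * b s|.
  by rewrite /F !normrM ler_wpM2l// ler_wpM2r// (ger0_norm C0).
have [_ _ E] := fubini_dominated mF Fab ia iCb.
transitivity (\int[mu]_z \int[mu]_s F z s).
  apply: eq_Rintegral => z _; rewrite RintegralZl//.
  exact: kernel_integrable mA AC ib.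
rewrite E; apply: eq_Rintegral => s _; rewrite -RintegralZl//.
  by apply: eq_Rintegral => z _; rewrite /F; ring.
apply: (@kernel_integrable (fun s z => A z s) a C s) => //.
exact: (measurableT_comp mA (@measurable_swap _ _ _ _)).
Qed.

Lemma measurable_kernel_if A (P : R -> R -> bool) :
  cont2 A -> measurable_fun setT (fun z : rr => P z.1 z.2) ->
  measurable_fun setT (fun z : rr => if P z.1 z.2 then A z.1 z.2 else 0).
Proof.
by move=> cA mP; apply: measurable_fun_ifT => //; exact: (cont2_measurable cA).
Qed.

Lemma measurable_fst_snd (f g : R -> R) :
  continuous f -> continuous g ->
  measurable_fun setT (fun z : rr => f z.1) * measurable_fun setT (fun z : rr => g z.2).
Proof.
move=> cf cg; split.
  by apply: (@measurableT_comp _ _ _ _ _ _ f) => //; exact: continuous_measurable_fun.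
by apply: (@measurableT_comp _ _ _ _ _ _ g) => //; exact: continuous_measurable_fun.
Qed.

(** The kernel multiplied by the indicator of p <= s <= z <= q is bounded and measurable on the
    plane, so the triangle reduces to [fubini_kernel]. *)
Lemma fubini_tri A a b (p q : R) : cont2 A ->
  mu.-integrable `[p, q] (EFin \o a) -> mu.-integrable `[p, q] (EFin \o b) ->
  \int[mu]_(z in `[p, q]) (a z * \int[mu]_(s in `[p, z]) (A z s * b s)) =
  \int[mu]_(s in `[p, q]) (b s * \int[mu]_(z in `[s, q]) (A z s * a z)).
Proof.
move=> cA ia ib.
have [C C0 HC] := cont2_bounded p q p q cA.
pose P z s := (p <= s) && (s <= z) && (z <= q).
pose A' z s := if P z s then A z s else 0.
have mP : measurable_fun setT (fun z : rr => P z.1 z.2).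
  have [m1 m2] := measurable_fst_snd (@cont_id R) (@cont_id R).
  apply: measurable_and; first apply: measurable_and.
  - by apply: measurable_fun_ler => //; exact: measurable_cst.
  - by apply: measurable_fun_ler.
  - by apply: measurable_fun_ler => //; exact: measurable_cst.
have AC z s : `|A' z s| <= C.
  rewrite /A' /P; case: ifP => [/andP[/andP[h1 h2] h3]|]; last by rewrite normr0.
  by apply: HC; rewrite ?h1 ?h3 ?(le_trans h1 h2) ?(le_trans h2 h3).
have := fubini_kernel (measurable_kernel_if cA mP) AC
  (patch_integrable (measurable_itv _) ia) (patch_integrable (measurable_itv _) ib).
rewrite -/A' => E.
rewrite (@eq_int_patch _ _ (fun z => (a \_ `[p, q]) z * \int[mu]_s (A' z s * (b \_ `[p, q]) s))).
- rewrite E; apply/esym; apply: eq_int_patch => s /=; rewrite in_itv/=; last first.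
    by move=> h; rewrite patchC ?mul0r//= in_itv.
  move=> psq; have /andP[ps sq] := psq; rewrite patchT//; congr (_ * _).
  apply: eq_int_patch => z /=; rewrite in_itv/=.
    move=> /andP[sz zq]; rewrite patchT; last by rewrite /= in_itv/= (le_trans ps sz).
    by rewrite /A' /P ps sz zq.
  by move=> /negP; rewrite /A' /P ps/= => /negbTE ->; rewrite mul0r.
- move=> z /=; rewrite in_itv/= => pzq; have /andP[pz zq] := pzq.
  rewrite patchT//; congr (_ * _).
  apply: eq_int_patch => s /=; rewrite in_itv/=.
    move=> /andP[ps sz]; rewrite patchT; last by rewrite /= in_itv/= ps (le_trans sz zq).
    by rewrite /A' /P ps sz zq.
  by move=> /negP; rewrite /A' /P zq andbT => /negbTE ->; rewrite mul0r.
- by move=> z /= h; rewrite patchC ?mul0r.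
Qed.

Lemma fubini_rect A a b (p q r t : R) : cont2 A ->
  mu.-integrable `[p, q] (EFin \o a) -> mu.-integrable `[r, t] (EFin \o b) ->
  \int[mu]_(z in `[p, q]) (a z * \int[mu]_(s in `[r, t]) (A z s * b s)) =
  \int[mu]_(s in `[r, t]) (b s * \int[mu]_(z in `[p, q]) (A z s * a z)).
Proof.
move=> cA ia ib.
have [C C0 HC] := cont2_bounded p q r t cA.
pose P z s := [&& p <= z, z <= q, r <= s & s <= t].
pose A' z s := if P z s then A z s else 0.
have mP : measurable_fun setT (fun z : rr => P z.1 z.2).
  have [m1 m2] := measurable_fst_snd (@cont_id R) (@cont_id R).
  by do 3?apply: measurable_and; apply: measurable_fun_ler => //; exact: measurable_cst.
have AC z s : `|A' z s| <= C.
  rewrite /A' /P; case: ifP => [/and4P[h1 h2 h3 h4]|]; last by rewrite normr0.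
  by apply: HC; rewrite ?h1 ?h2 ?h3 ?h4.
have := fubini_kernel (measurable_kernel_if cA mP) AC
  (patch_integrable (measurable_itv _) ia) (patch_integrable (measurable_itv _) ib).
rewrite -/A' => E.
rewrite (@eq_int_patch _ _ (fun z => (a \_ `[p, q]) z * \int[mu]_s (A' z s * (b \_ `[r, t]) s))).
- rewrite E; apply/esym; apply: eq_int_patch => s /=; rewrite in_itv/=; last first.
    by move=> h; rewrite patchC ?mul0r//= in_itv.
  move=> psq; have /andP[ps sq] := psq; rewrite patchT//; congr (_ * _).
  apply: eq_int_patch => z /=; rewrite in_itv/=.
    by move=> zpq; have /andP[pz zq] := zpq; rewrite patchT// /A' /P ps sq pz zq.
  by move=> h; rewrite patchC ?mulr0//= in_itv.
- move=> z /=; rewrite in_itv/= => pzq; have /andP[pz zq] := pzq.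
  rewrite patchT//; congr (_ * _).
  apply: eq_int_patch => s /=; rewrite in_itv/=.
    by move=> zpq; have /andP[ps sq] := zpq; rewrite patchT// /A' /P ps sq pz zq.
  by move=> h; rewrite patchC ?mulr0//= in_itv.
- by move=> z /= h; rewrite patchC ?mul0r.
Qed.

End FubiniReal.

(** * Convolutions and Volterra equations *)

Section Convolution.
Context {R : realType}.
Notation mu := (@lebesgue_measure R).
Implicit Types (a b f g : R -> R) (t s : R).

(** For [t <= 0] the segment is empty or a point, so every convolution is causal, whatever its
    factors. *)
Definition conv a b t : R := \int[mu]_(s in `[0, t]) (a (t - s) * b s).

Lemma cont_rev a t : continuous a -> continuous (fun s => a (t - s)).
Proof.
move=> ca; apply: (cont_comp1 (u := a)) => //.
by apply: contD; [exact: cont_cst|apply: contN; exact: cont_id].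
Qed.

Lemma conv_le0 a b t : t <= 0 -> conv a b t = 0.
Proof. by move=> t0; rewrite /conv int_empty. Qed.

Lemma cont_mul_integrable a g (p q : R) : continuous a ->
  mu.-integrable `[p, q] (EFin \o g) ->
  mu.-integrable `[p, q] (EFin \o (fun s => a s * g s)).
Proof.
move=> ca ig; have [C C0 HC] := cont_bounded p q ca.
apply: (@dominated_integrable _ `[p, q] _ (fun s => C * `|g s|)) => //.
- apply: measurable_funM; last by apply/measurable_EFinP; exact: measurable_int ig.
  by apply: measurable_funTS; exact: continuous_measurable_fun.
- by move=> s; rewrite /= in_itv/= => spq; rewrite normrM ler_wpM2r// HC.
- have := @integrableZl _ _ _ mu `[p, q] (measurable_itv _) C _
    (integrable_abse_fin (measurable_itv _) ig).
  exact.
Qed.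

Lemma cont_mul_locint a g : continuous a -> locint g -> locint (fun s => a s * g s).
Proof. by move=> ca lg p q; exact: cont_mul_integrable. Qed.

Lemma conv_integrand_locint a g t : continuous a -> locint g ->
  locint (fun s => a (t - s) * g s).
Proof. by move=> ca lg; apply: cont_mul_locint => //; exact: cont_rev. Qed.

Lemma conv_oint a b t : 0 <= t -> conv a b t = oint 0 t (fun s => a (t - s) * b s).
Proof. by move=> t0; rewrite oint_ge. Qed.

Lemma convC a b t : continuous a -> continuous b -> conv a b t = conv b a t.
Proof.
move=> ca cb; have [t0|/ltW t0] := leP 0 t; last by rewrite !conv_le0.
rewrite !conv_oint//.
have := @oint_rev R 0 t t (fun s => a s * b (t - s)).
rewrite subrr subr0 => E.
transitivity (oint 0 t (fun s => a s * b (t - s))); last first.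
  by congr oint; apply/funext => s; rewrite mulrC.
rewrite -E; last by apply: contM => //; exact: cont_rev.
by congr oint; apply/funext => s; congr (_ * b _); ring.
Qed.

Lemma cont_conv2 (X : topologicalType) (a b : X -> R -> R) (t : X -> R) :
  continuous (fun z : X * R => a z.1 z.2) -> continuous (fun z : X * R => b z.1 z.2) ->
  continuous t -> continuous (fun p => conv (a p) (b p) (t p)).
Proof.
move=> ca cb ct.
(* Clamping the upper bound at 0 gives one formula for both signs of the time. *)
have -> : (fun p => conv (a p) (b p) (t p)) =
    (fun p => oint 0 (Num.max 0 (t p)) (fun s => a p (t p - s) * b p s)).
  apply/funext => p; have [t0|t0] := leP 0 (t p).
    by rewrite conv_oint// max_r.
  by rewrite ointaa conv_le0// ltW.
apply: cont_oint.
- apply: contM => //.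
  apply: (cont_comp2 (u := a)) => //; first exact: continuous_fst.
  apply: contD; last by apply: contN; exact: continuous_snd.
  by apply: (cont_comp1 (u := t)) => //; exact: continuous_fst.
- exact: cont_cst.
- by apply: cont_max => //; exact: cont_cst.
Qed.

Lemma cont_conv a b : continuous a -> continuous b -> continuous (conv a b).
Proof.
move=> ca cb; apply: (@cont_conv2 R (fun=> a) (fun=> b) id); last exact: cont_id.
- by apply: (cont_comp1 (u := a)) => //; exact: continuous_snd.
- by apply: (cont_comp1 (u := b)) => //; exact: continuous_snd.
Qed.

Lemma eq_conv a a' b b' t : (forall s, 0 <= s <= t -> a s = a' s) ->
  (forall s, 0 <= s <= t -> b s = b' s) -> conv a b t = conv a' b' t.
Proof.
move=> aa bb; apply: eq_Rintegral => s; rewrite inE/= in_itv/= => /andP[s0 st].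
by rewrite aa ?bb ?s0// subr_ge0 st/= gerBl.
Qed.

Lemma convDl a a' g t : continuous a -> continuous a' -> locint g ->
  conv (fun s => a s + a' s) g t = conv a g t + conv a' g t.
Proof.
move=> ca ca' lg; rewrite /conv -RintegralD//.
- by apply: eq_Rintegral => s _; rewrite mulrDl.
- exact: (conv_integrand_locint t ca lg).
- exact: (conv_integrand_locint t ca' lg).
Qed.

Lemma convDr a g h t : continuous a -> locint g -> locint h ->
  conv a (fun s => g s + h s) t = conv a g t + conv a h t.
Proof.
move=> ca lg lh; rewrite /conv -RintegralD//.
- by apply: eq_Rintegral => s _; rewrite mulrDr.
- exact: (conv_integrand_locint t ca lg).
- exact: (conv_integrand_locint t ca lh).
Qed.

Lemma convZl (c : R) a g t : continuous a -> locint g ->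
  conv (fun s => c * a s) g t = c * conv a g t.
Proof.
move=> ca lg; rewrite /conv -RintegralZl//; last exact: (conv_integrand_locint t ca lg).
by apply: eq_Rintegral => s _; rewrite mulrA.
Qed.

Lemma convZr (c : R) a g t : continuous a -> locint g ->
  conv a (fun s => c * g s) t = c * conv a g t.
Proof.
move=> ca lg; rewrite /conv -RintegralZl//; last exact: (conv_integrand_locint t ca lg).
by apply: eq_Rintegral => s _; rewrite mulrCA.
Qed.

Lemma convA a b g t : continuous a -> continuous b -> locint g ->
  conv a (conv b g) t = conv (conv a b) g t.
Proof.
move=> ca cb lg.
pose A z s := a (t - z) * b (z - s).
have cA : cont2 A.
  apply: contM.
    by apply: (cont_comp1 (u := fun z => a (t - z))); [exact: cont_rev|exact: continuous_fst].
  apply: (cont_comp1 (u := b)) => //; apply: contD; first exact: continuous_fst.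
  by apply: contN; exact: continuous_snd.
have := @fubini_tri R A (fun=> 1) g 0 t cA (@locint_cst R 1 0 t) (lg 0 t).
have -> : \int[mu]_(z in `[0, t]) (1 * \int[mu]_(s in `[0, z]) (A z s * g s)) =
    conv a (conv b g) t.
  apply: eq_Rintegral => z _; rewrite mul1r /conv -RintegralZl//.
    by apply: eq_Rintegral => s _; rewrite mulrA.
  exact: (conv_integrand_locint z cb lg).
move=> ->; apply: eq_Rintegral => s; rewrite inE/= in_itv/= => /andP[s0 st].
rewrite mulrC; congr (_ * _).
rewrite -oint_ge// conv_oint ?subr_ge0//.
have := @oint_shift R 0 (t - s) s (fun z => a (t - z) * b (z - s)).
rewrite add0r subrK => E; transitivity (oint s t (fun z => a (t - z) * b (z - s))).
  by congr oint; apply/funext => z; rewrite mulr1.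
rewrite -E.
  by congr oint; apply/funext => z; congr (a _ * b _); ring.
apply: contM; first exact: cont_rev.
apply: (cont_comp1 (u := b)) => //.
by apply: contD; [exact: cont_id|exact: cont_cst].
Qed.

Lemma leibniz_right (G Gx : R -> R -> R) (x0 a : R) :
  cont2 G -> cont2 Gx -> (forall x y, ider (G ^~ y) x (Gx x y)) ->
  ider (fun x => oint a x (G x)) x0 (G x0 x0 + oint a x0 (Gx x0)).
Proof.
move=> cG cGx dG; have := iderN (leibniz_left x0 a cG cGx dG).
rewrite (ointC a x0) opprD !opprK addrC; apply: eq_ider => x /=.
by rewrite -ointC.
Qed.

Lemma cont2_conv_kernel a b : continuous a -> continuous b ->
  cont2 (fun t s => a (t - s) * b s).
Proof.
move=> ca cb; apply: contM.
  apply: (cont_comp1 (u := a)) => //; apply: contD; first exact: continuous_fst.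
  by apply: contN; exact: continuous_snd.
by apply: (cont_comp1 (u := b)) => //; exact: continuous_snd.
Qed.

Lemma ider_lin (c d t : R) : ider (fun x => c * x + d) t c.
Proof.
by apply: ider_val (iderD (iderZ c (ider_id t)) (ider_cst d t)) _; ring.
Qed.

Lemma ider_shift f (s t d : R) : ider f (t - s) d -> ider (fun x => f (x - s)) t d.
Proof.
move=> df; have h : ider (fun x => x - s) t 1.
  by apply: ider_val (iderB (ider_id t) (ider_cst s t)) _; ring.
by rewrite -[d]mulr1; exact: (ider_comp (g := fun x => x - s) df h).
Qed.

Lemma ider_rev f (s t d : R) : ider f (s - t) d -> ider (fun x => f (s - x)) t (- d).
Proof.
move=> df; have h : ider (fun x => s - x) t (- 1).
  by apply: ider_val (iderB (ider_cst s t) (ider_id t)) _; ring.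
by rewrite -[- d]mulrN1; exact: (ider_comp (g := fun x => s - x) df h).
Qed.

Lemma ider_oint_conv a a' b t : continuous a -> continuous a' -> continuous b ->
  (forall s, ider a s (a' s)) ->
  ider (fun t => oint 0 t (fun s => a (t - s) * b s)) t
    (a 0 * b t + oint 0 t (fun s => a' (t - s) * b s)).
Proof.
move=> ca ca' cb da.
apply: ider_val (@leibniz_right (fun t s => a (t - s) * b s)
  (fun t s => a' (t - s) * b s) t 0 _ _ _) _.
- exact: cont2_conv_kernel.
- exact: cont2_conv_kernel.
- move=> x y; apply: ider_val (iderM (ider_shift (da _)) (ider_cst (b y) x)) _.
  by ring.
- by rewrite subrr.
Qed.

Lemma ider_conv a a' b t : 0 < t -> continuous a -> continuous a' -> continuous b ->
  (forall s, ider a s (a' s)) -> ider (conv a b) t (a 0 * b t + conv a' b t).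
Proof.
move=> t0 ca ca' cb da; rewrite (conv_oint _ _ (ltW t0)).
apply: (@oo_ider _ (fun t => oint 0 t (fun s => a (t - s) * b s)) _ _ 0 (t + 1)).
- by rewrite t0/= ltrDl.
- by move=> y /andP[y0 _]; rewrite conv_oint// ltW.
- exact: ider_oint_conv.
Qed.

(** The derivative is put on the causal factor: its value 0 at time 0 suppresses the boundary term,
    and the formula holds at all times, those before 0 included. *)
Lemma ider_conv_r a b b' t : continuous a -> continuous b' ->
  (forall s, ider b s (b' s)) -> (forall s, s <= 0 -> b s = 0) ->
  (forall s, s <= 0 -> b' s = 0) ->
  ider (conv a b) t (conv a b' t).
Proof.
move=> ca cb' db b0 b'0.
have cb : continuous b := ider_cont db.
have E c : continuous c -> (forall s, s <= 0 -> c s = 0) ->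
    forall t, conv a c t = oint 0 t (fun s => c (t - s) * a s).
  move=> cc c0 x; have [x0|x0] := leP 0 x; first by rewrite convC// conv_oint.
  rewrite conv_le0 ?ltW// -[LHS](oint0 0 x); apply: eq_oint => s.
  rewrite (min_r (ltW x0)) => /andP[xs _].
  by rewrite c0 ?mul0r// subr_le0.
rewrite (E b')//; apply: (@eq_ider _ (fun t => oint 0 t (fun s => b (t - s) * a s))).
  by move=> x; rewrite E.
by apply: ider_val (ider_oint_conv t cb cb' ca db) _; rewrite b0// mul0r add0r.
Qed.

Lemma conv1 b t : conv (fun=> 1) b t = \int[mu]_(s in `[0, t]) b s.
Proof. by apply: eq_Rintegral => s _; rewrite mul1r. Qed.

End Convolution.

(** * Contraction in weighted norms and Volterra equations *)

Section Picard.
Context {R : realType}.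
Notation mu := (@lebesgue_measure R).

(** The last step of every halving argument below. *)
Lemma halving_eq0 (z c : R) : (forall n : nat, `|z| <= c * 2^-1 ^+ n) -> z = 0.
Proof.
move=> H; apply/eqP; rewrite -normr_eq0; apply/negPn/negP => z0.
have {}z0 : 0 < `|z| by rewrite lt_neqAle eq_sym z0/=.
have c0 : 0 < c by have := H 0; rewrite expr0 mulr1; exact: lt_le_trans.
have [n Hn] : exists n : nat, c / `|z| < n%:R.
  by exists (Num.bound (c / `|z|)); apply: archi_boundP; rewrite divr_ge0// ltW.
have := H n; rewrite leNgt => /negP; apply.
rewrite exprVn -(ltr_pM2r (exprn_gt0 n (ltr0Sn R 1))) -mulrA mulVf; last first.
  by rewrite expf_neq0.
rewrite mulr1; apply: lt_trans (_ : `|z| * n%:R < _).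
  by rewrite mulrC -ltr_pdivrMr.
by rewrite ltr_pM2l// -natrX ltr_nat ltn_expl.
Qed.

Section Iteration.
Variables (X : topologicalType) (w : X -> R) (P : (X -> R) -> X -> R) (g : X -> R).
Hypothesis w_loc : forall x : X, exists B, \forall y \near x, w y <= B.
Hypothesis g_cont : continuous g.
Hypothesis P_cont : forall u, continuous u -> continuous (P u).
Hypothesis P_half : forall u v (A : R), continuous u -> continuous v -> 0 <= A ->
  (forall x, `|u x - v x| <= A * w x) -> forall x, `|P u x - P v x| <= A / 2 * w x.
Hypothesis P0 : forall x, P (fun=> 0) x = 0.
Hypothesis g_le : forall x, `|g x| <= w x.

Let it (n : nat) : X -> R := iter n (fun u x => g x + P u x) (fun=> 0).

Let it_cont n : continuous (it n).
Proof.
elim: n => [|n IH]; first exact: cont_cst.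
by apply: contD => //; exact: P_cont.
Qed.

Let w0 x : 0 <= w x.
Proof. exact: le_trans (normr_ge0 _) (g_le x). Qed.

Let h_ge0 n : 0 <= (2^-1 : R) ^+ n.
Proof. by rewrite exprn_ge0. Qed.

Let it_step n x : `|it n.+1 x - it n x| <= 2^-1 ^+ n * w x.
Proof.
elim: n x => [|n IH] x.
  by rewrite expr0 mul1r /it/= P0 addr0 subr0.
rewrite [X in `|X|](_ : _ = P (it n.+1) x - P (it n) x).
  apply: le_trans (P_half _ _ _ IH x) _ => //.
  by rewrite exprSr.
by rewrite /it !iterS; ring.
Qed.

(** Consecutive iterates differ by at most 2^-n [w], so the whole tail is at most twice that: [up]
    decreases, [dn] increases, and the limit is squeezed between them. *)
Let up n x := it n x + 2 * 2^-1 ^+ n * w x.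
Let dn n x := it n x - 2 * 2^-1 ^+ n * w x.

Let two (n : nat) : 2 * (2^-1 : R) ^+ n.+1 = 2^-1 ^+ n.
Proof. by rewrite exprS mulrA mulfV// mul1r. Qed.

Let up_dec n m x : (n <= m)%N -> up m x <= up n x.
Proof.
move=> /subnK <-; elim: (m - n)%N => [|k IH]; first by rewrite add0n.
apply: le_trans IH; rewrite addSn /up two.
have := it_step (k + n) x; rewrite ler_norml => /andP[_ h].
by rewrite -(two (k + n)) in h *; rewrite -lerBlDr in h *; lra.
Qed.

Let dn_inc n m x : (n <= m)%N -> dn n x <= dn m x.
Proof.
move=> /subnK <-; elim: (m - n)%N => [|k IH]; first by rewrite add0n.
apply: le_trans IH _; rewrite addSn /dn two.
have := it_step (k + n) x; rewrite ler_norml => /andP[h _].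
by rewrite -(two (k + n)) in h *; lra.
Qed.

Let dn_up n m x : dn n x <= up m x.
Proof.
have := dn_inc x (leq_maxl n m); have := up_dec x (leq_maxr n m).
move=> h1 h2; apply: le_trans h2 _; apply: le_trans h1.
rewrite /dn /up lerD2l; have : 0 <= 2 * (2^-1 : R) ^+ maxn n m * w x.
  by rewrite !mulr_ge0.
by lra.
Qed.

(** Banach's fixed point theorem for the distance weighted by [w]. The limit is taken as the infimum
    of the upper envelopes; local boundedness of [w] makes the convergence locally uniform, hence
    the limit continuous. *)
Lemma picard : exists2 u : X -> R, continuous u & forall x, u x = g x + P u x.
Proof.
pose u x := inf [set up n x | n in [set: nat]].
have u_le n x : u x <= up n x.
  apply: ge_inf; last by exists n.
  by exists (dn 0 x) => _ [m _ <-]; exact: dn_up.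
have le_u n x : dn n x <= u x.
  apply: lb_le_inf; first by exists (up 0 x), 0.
  by move=> _ [m _ <-]; exact: dn_up.
have dist n x : `|u x - it n x| <= 2 * 2^-1 ^+ n * w x.
  have := u_le n x; have := le_u n x; rewrite /up /dn ler_norml.
  by move=> h1 h2; apply/andP; split; lra.
have u_cont : continuous u.
  move=> x; apply/cvgrPdist_le => e e0.
  have [B HB] := w_loc x.
  have B0 : 0 <= B.
    by apply: le_trans (w0 x) _; exact: nbhs_singleton HB.
  have [n Hn] : exists n : nat, 2 * 2^-1 ^+ n * B <= e / 3.
    apply: contrapT => /forallNP H.
    suff : e / 3 = 0 by move=> /eqP; rewrite mulf_eq0 invr_eq0 gt_eqF//= gt_eqF.
    apply: (@halving_eq0 _ (2 * B)) => n; rewrite ger0_norm ?divr_ge0 ?ltW//.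
    by rewrite mulrAC ltNge; apply/negP/H.
  near=> y.
  rewrite (_ : u x - u y = (u x - it n x) + (it n x - it n y) + (it n y - u y)); last by ring.
  have d1 : `|u x - it n x| <= e / 3.
    apply: le_trans (dist n x) _; apply: le_trans Hn.
    by rewrite ler_wpM2l ?mulr_ge0//; exact: nbhs_singleton HB.
  have d2 : `|it n y - u y| <= e / 3.
    rewrite distrC; apply: le_trans (dist n y) _; apply: le_trans Hn.
    by rewrite ler_wpM2l ?mulr_ge0//; near: y.
  have d3 : `|it n x - it n y| <= e / 3.
    by near: y; have /cvgrPdist_le := @it_cont n x; apply; rewrite divr_gt0.
  apply: le_trans (ler_normD _ _) _; apply: le_trans (lerD (ler_normD _ _) d2) _.
  lra.
exists u => // x; apply/eqP; rewrite -subr_eq0; apply/eqP.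
apply: (@halving_eq0 _ (2 * w x)) => n.
rewrite (_ : _ - _ = (u x - it n.+1 x) + (P (it n) x - P u x)); last first.
  by rewrite /it iterS; ring.
apply: le_trans (ler_normD _ _) _.
have h1 := dist n.+1 x; rewrite two in h1.
have h2 : `|P (it n) x - P u x| <= 2 * 2^-1 ^+ n / 2 * w x.
  apply: P_half; [exact: it_cont|exact: u_cont|by rewrite mulr_ge0|].
  by move=> y; rewrite distrC.
apply: le_trans (lerD h1 h2) _.
by rewrite le_eqVlt; apply/orP; left; apply/eqP; field.
Unshelve. all: by end_near. Qed.

End Iteration.

(** Monotone bounds on growing squares are the raw material of the weights. The value 0 is adjoined
    so that the supremum is over a nonempty set for negative [r] too. *)
Lemma majorant (u : R -> R -> R) : cont2 u -> exists C : R -> R,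
  [/\ {homo C : x y / x <= y}, forall r, 0 <= C r &
      forall r y z, `|y| <= r -> `|z| <= r -> `|u y z| <= C r].
Proof.
move=> cu.
pose S r := [set x | x = 0 \/ exists y z, [/\ `|y| <= r, `|z| <= r & x = `|u y z|]].
have S0 r : S r 0 by left.
have bS r : has_ubound (S r).
  have [C C0 HC] := cont2_bounded (- r) r (- r) r cu.
  exists C => _ [->//|[y [z [yr zr ->]]]].
  by apply: HC; rewrite -ler_norml.
exists (fun r => sup (S r)); split.
- move=> r r' rr'; apply: sup_le_ub; first by exists 0.
  move=> _ [->|[y [z [yr zr ->]]]]; apply: (ub_le_sup (bS r')) => //; right.
  by exists y, z; split; rewrite ?(le_trans yr) ?(le_trans zr).
- by move=> r; exact: (ub_le_sup (bS r)).
- move=> r y z yr zr; apply: (ub_le_sup (bS r)); right.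
  by exists y, z.
Qed.

(** Each integration against the exponential gains the factor [1 / c]; this is the source of the
    halvings. *)
Lemma exp_oint (f : R -> R) (B c y s : R) : 0 < c -> 0 <= B -> locint f ->
  (forall z, Num.min s y <= z <= Num.max s y -> `|f z| <= B * expR (c * `|z - s|)) ->
  `|oint s y f| <= B / c * expR (c * `|y - s|).
Proof.
move=> c0 B0 lf H.
have K (d : R) (F : R -> R) : d = 1 \/ d = -1 ->
    F = (fun z => B / c * expR (d * c * (z - s)) * d) ->
    (forall x, ider F x (B * expR (d * c * (x - s)))) /\
    continuous (fun x => B * expR (d * c * (x - s))).
  move=> dd ->; split=> [x|].
    have h := ider_shift (ider_exp_lin (d * c) (x - s)).
    apply: ider_val.
      apply: eq_ider (iderZ (B / c * d) h) => z; ring.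
    by case: dd => ->; field; rewrite gt_eqF.
  apply: contM; first exact: cont_cst.
  apply: (cont_comp1 (u := @expR R)); first exact: continuous_expR'.
  apply: contM; first exact: cont_cst.
  by apply: contD; [exact: cont_id|exact: cont_cst].
have [sy|/ltW ys] := leP s y.
  have [dF cF] := K 1 _ (or_introl erefl) erefl.
  rewrite oint_ge//; apply: (@le_trans _ _ (\int[mu]_(x in `[s, y]) (B * expR (1 * c * (x - s))))).
    apply: le_int_norm => //; first exact: cont_locint.
    move=> z /andP[sz zy]; rewrite mul1r.
    by have := H z; rewrite min_l// max_r// sz zy (@ger0_norm _ (z - s)) ?subr_ge0//; exact.
  rewrite -oint_ge// (FTC _ _ cF dF) subrr !mulr0 expR0 !mulr1 !mul1r ger0_norm ?subr_ge0//.
  by rewrite lerBlDr lerDl divr_ge0// ltW.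
have [dF cF] := K (-1) _ (or_intror erefl) erefl.
rewrite ointC normrN oint_ge//.
apply: (@le_trans _ _ (\int[mu]_(x in `[y, s]) (B * expR (-1 * c * (x - s))))).
  apply: le_int_norm => //; first exact: cont_locint.
  move=> z /andP[yz zs].
  have := H z; rewrite min_r// max_l// yz zs (@ler0_norm _ (z - s)) ?subr_le0// => /(_ isT).
  by rewrite mulN1r mulNr mulrN.
rewrite -oint_ge// (FTC _ _ cF dF) subrr !mulr0 expR0 ler0_norm ?subr_le0//.
rewrite (_ : -1 * c * (y - s) = c * - (y - s)); last by ring.
have : 0 <= B / c by rewrite divr_ge0// ltW.
by move: (B / c) (expR _) => D E D0; lra.
Qed.

Lemma between_max (a b z : R) : Num.min a b <= z <= Num.max a b ->
  `|z| <= Num.max `|a| `|b|.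
Proof.
move=> /andP[z1 z2]; set M := Num.max _ _.
have : `|a| <= M by rewrite /M le_max lexx.
have : `|b| <= M by rewrite /M le_max lexx orbT.
rewrite !ler_norml => /andP[b1 b2] /andP[a1 a2]; apply/andP; split.
  by apply: le_trans z1; rewrite le_min a1 b1.
by apply: le_trans z2 _; rewrite ge_max a2 b2.
Qed.

(** The kernel is bounded on compact sets only, so the rate of the weight depends on the size [rho]
    of the point. Integration from [s] to [y] stays in the square of that size, where one constant
    serves. *)
Lemma volterra (k g : R -> R -> R) : cont2 k -> cont2 g ->
  exists2 u, cont2 u & forall y s, u y s = g y s + oint s y (fun z => k y z * u z s).
Proof.
move=> ck cg.
have [Ck [hCk Ck0 HCk]] := majorant ck.
have [Cg [hCg Cg0 HCg]] := majorant cg.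
pose C r := Ck r + Cg r + 1.
have hC : {homo C : x y / x <= y} by move=> x y xy; rewrite /C !lerD ?hCk ?hCg.
have C1 r : 1 <= C r by rewrite /C lerDr addr_ge0.
have C0 r : 0 < C r by rewrite (lt_le_trans ltr01).
pose rho (p : R * R) := Num.max `|p.1| `|p.2|.
have crho : continuous rho.
  by apply: cont_max; apply: cont_norm; [exact: continuous_fst|exact: continuous_snd].
(* [C] bounds both the kernel and the data; the rate [2 * C] leaves the factor 1/2 after one
   integration. *)
pose w (p : R * R) := C (rho p) * expR (2 * C (rho p) * `|p.1 - p.2|).
pose P (u : R * R -> R) (p : R * R) := oint p.2 p.1 (fun z => k p.1 z * u (z, p.2)).
have cP u : continuous u -> continuous (fun q : (R * R) * R => k q.1.1 q.2 * u (q.2, q.1.2)).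
  move=> cu; have c1 := @continuous_fst (R * R)%type R.
  have c2 := @continuous_snd (R * R)%type R.
  apply: contM.
    apply: (cont_comp2 (u := k)) => //.
    by apply: (cont_comp1 (u := fst)) => //; exact: continuous_fst.
  apply: (cont_comp1 (u := u)) => //; apply: cont_pair => //.
  by apply: (cont_comp1 (u := snd)) => //; exact: continuous_snd.
have sec (u : R * R -> R) p : continuous u -> locint (fun z => k p.1 z * u (z, p.2)).
  by move=> cu; apply: cont_locint; 
  exact: (@cont_sect R (R * R)%type (fun q z => k q.1 z * u (z, q.2)) p (cP u cu)).
have [||||||u cu Hu] := @picard (R * R)%type w P (fun p => g p.1 p.2).
- move=> p; exists (C (rho p + 1) * expR (2 * C (rho p + 1) * (`|p.1 - p.2| + 1))).
  near=> q.
  have h1 : rho q <= rho p + 1.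
    rewrite -lerBlDl; apply: le_trans (ler_norm _) _; rewrite distrC.
    by near: q; have /cvgrPdist_le := crho p; apply.
  have h2 : `|q.1 - q.2| <= `|p.1 - p.2| + 1.
    rewrite -lerBlDl; apply: le_trans (ler_norm _) _; rewrite distrC.
    near: q; have cd : continuous (fun q : R * R => `|q.1 - q.2|).
      by apply: cont_norm; apply: contD; [exact: continuous_fst|apply: contN; exact: continuous_snd].
    by have /cvgrPdist_le := cd p; apply.
  apply: ler_pM; [exact: ltW|exact: expR_ge0|exact: hC|].
  rewrite ler_expR; apply: ler_pM => //; first by rewrite mulr_ge0// ltW.
  by rewrite ler_wpM2l// hC.
- exact: cg.
- move=> u cu; apply: (@cont_oint R (R * R)%type (fun p z => k p.1 z * u (z, p.2)) snd fst).
  + exact: cP.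
  + exact: continuous_snd.
  + exact: continuous_fst.
- move=> u v A cu cv A0 H p; rewrite /P -ointB; [|exact: sec|exact: sec].
  set r := rho p; have Cr := C0 r.
  apply: (@le_trans _ _ (C r * (A * C r) / (2 * C r) * expR (2 * C r * `|p.1 - p.2|))); last first.
    rewrite /w -/r [X in _ <= X]mulrA ler_wpM2r ?expR_ge0// le_eqVlt; apply/orP; left; apply/eqP.
    by field; rewrite gt_eqF.
  apply: exp_oint.
  + by rewrite mulr_gt0.
  + by rewrite !mulr_ge0// ltW.
  + by apply: locintB; exact: sec.
  + move=> z zb; rewrite -mulrBr normrM -!mulrA.
    have zr : `|z| <= r.
      by rewrite /r /rho maxC; exact: between_max.
    have pr : `|p.1| <= r by rewrite /r /rho le_max lexx.
    have p2r : `|p.2| <= r by rewrite /r /rho le_max lexx orbT.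
    apply: ler_pM => //.
      apply: le_trans (HCk r _ _ pr zr) _.
      by rewrite /C -addrA lerDl addr_ge0.
    apply: le_trans (H (z, p.2)) _ => /=; rewrite ler_wpM2l// /w /=.
    have rz : rho (z, p.2) <= r by rewrite /rho/= ge_max zr p2r.
    apply: ler_pM; [exact: ltW|exact: expR_ge0|exact: hC|].
    by rewrite ler_expR -!mulrA ler_wpM2l// ler_wpM2r// hC.
- by move=> p; rewrite /P -[RHS](oint0 p.2 p.1); congr oint; apply/funext => z; rewrite mulr0.
- move=> p; rewrite /w; apply: (@le_trans _ _ (C (rho p))).
    have h := HCg (rho p) p.1 p.2.
    rewrite (le_trans (h _ _)) ?le_max ?lexx ?orbT//.
    by have := Ck0 (rho p); rewrite /C; lra.
  rewrite ler_peMr ?(ltW (C0 _))// -expR0 ler_expR !mulr_ge0// ltW//.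
exists (fun y s => u (y, s)).
  rewrite /cont2; have -> : (fun p : R * R => u (p.1, p.2)) = u by apply/funext => -[].
  exact: cu.
by move=> y s; rewrite Hu.
Unshelve. all: by end_near. Qed.

Lemma volterra1 (k : R -> R -> R) (g : R -> R) : cont2 k -> continuous g ->
  exists2 u, continuous u & forall y, u y = g y + oint 0 y (fun z => k y z * u z).
Proof.
move=> ck cg; have [|u cu Hu] := @volterra k (fun y _ => g y) ck.
  by apply: (cont_comp1 (u := g)) => //; exact: continuous_fst.
exists (u ^~ 0); last by move=> y; exact: Hu.
apply: (cont_comp2 (u := u)) => //; [exact: cont_id|exact: cst_continuous].
Qed.

End Picard.

(** * The resolvent and the Goursat kernel *)

Section Resolvent.
Context {R : realType}.
Notation mu := (@lebesgue_measure R).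
Implicit Types (f g phi : R -> R).

Lemma Ck_ider (n k : nat) f : Ck n f -> (k < n)%N ->
  forall x, ider (derive1n k f) x (derive1n k.+1 f x).
Proof.
move=> cf kn x; have [_ df] := cf k (ltnW kn).
by rewrite derive1nS; apply: derive1_ider; exact: df.
Qed.

Lemma Ck_cont (n k : nat) f : Ck n f -> (k <= n)%N -> continuous (derive1n k f).
Proof. by move=> cf kn; have [] := cf k kn. Qed.

Lemma derive1_fun f g : (forall x, ider f x (g x)) -> derive1 f = g.
Proof. by move=> h; apply/funext => x; exact: derive1_eq. Qed.

Lemma Ck2_intro f f1 f2 : (forall x, ider f x (f1 x)) ->
  (forall x, ider f1 x (f2 x)) -> continuous f2 -> Ck 2 f.
Proof.
move=> d1 d2 c2; have E1 := derive1_fun d1; have E2 := derive1_fun d2.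
have c1 := ider_cont d2; have c0 := ider_cont d1.
case=> [|[|[|//]]] _; rewrite ?derive1nS ?derive1n0 /= ?E1 ?E2; split=> // _ x.
- exact: derivable_ider (d1 x).
- exact: derivable_ider (d2 x).
Qed.

Section Existence.
Variable N : R -> R.
Hypothesis hN : Ck 3 N.
Let N1 := derive1n 1 N.
Let N2 := derive1n 2 N.
Let N3 := derive1n 3 N.
Let c1 : continuous N1. Proof. exact: Ck_cont hN _. Qed.
Let c2 : continuous N2. Proof. exact: Ck_cont hN _. Qed.
Let c3 : continuous N3. Proof. exact: Ck_cont hN _. Qed.
Let d1 x : ider N1 x (N2 x). Proof. exact: (Ck_ider hN). Qed.
Let d2 x : ider N2 x (N3 x). Proof. exact: (Ck_ider hN). Qed.

(** The equation is solved on the whole line with oriented integrals. Differentiating it twice uses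
    the three derivatives of [N] and makes the solution of class C^2 across 0. *)
Lemma resolvent_exists : exists r, is_resolvent N r.
Proof.
have ck : cont2 (fun y z => - N1 (y - z)).
  apply: contN; apply: (cont_comp1 (u := N1)) => //.
  by apply: contD; [exact: continuous_fst|apply: contN; exact: continuous_snd].
have [r cr Hr] := volterra1 ck c1.
have Hr' y : r y = N1 y - oint 0 y (fun z => N1 (y - z) * r z).
  rewrite Hr -ointN; last exact: conv_integrand_locint (cont_locint cr).
  by congr (_ + oint _ _ _); apply/funext => z; rewrite mulNr.
have co (a b : R -> R) : continuous a -> continuous b ->
    continuous (fun y => oint 0 y (fun z => a (y - z) * b z)).
  move=> ca cb; apply: (@cont_oint R R (fun y z => a (y - z) * b z) (fun=> 0) id).
  - exact: cont2_conv_kernel.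
  - exact: cont_cst.
  - exact: cont_id.
pose r1 y := N2 y - (N1 0 * r y + oint 0 y (fun z => N2 (y - z) * r z)).
have cr1 : continuous r1.
  apply: (contD c2); apply: contN; apply: contD; last exact: (co N2 r c2 cr).
  exact: (contM (@cont_cst R R (N1 0)) cr).
have dr y : ider r y (r1 y).
  apply: (@eq_ider _ (fun y => N1 y - oint 0 y (fun z => N1 (y - z) * r z))).
    by move=> z; rewrite Hr'.
  apply: iderB; first exact: d1.
  exact: (@ider_oint_conv R N1 N2 r y c1 c2 cr d1).
pose r2 y := N3 y - (N1 0 * r1 y + (N2 0 * r y + oint 0 y (fun z => N3 (y - z) * r z))).
have cr2 : continuous r2.
  apply: (contD c3); apply: contN; apply: contD.
    exact: (contM (@cont_cst R R (N1 0)) cr1).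
  apply: contD; last exact: (co N3 r c3 cr).
  exact: (contM (@cont_cst R R (N2 0)) cr).
have dr1 y : ider r1 y (r2 y).
  apply: iderB; first exact: d2.
  apply: iderD; first exact: (iderZ (N1 0) (dr y)).
  exact: (@ider_oint_conv R N2 N3 r y c2 c3 cr d2).
exists r; split; first exact: Ck2_intro dr dr1 cr2.
move=> t t0; rewrite Hr' oint_ge// -addrA -[X in _ + (_ + X)]opprK -opprB.
by rewrite /N1 subrr subr0.
Qed.

End Existence.

Lemma conv_ibp (a a' b b' : R -> R) (t : R) : 0 <= t ->
  continuous a' -> continuous b' ->
  (forall s, ider a s (a' s)) -> (forall s, ider b s (b' s)) -> b 0 = 0 ->
  conv a b' t = a 0 * b t + conv a' b t.
Proof.
move=> t0 ca' cb' da db b0.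
have ca := ider_cont da; have cb := ider_cont db.
have cc (c d : R -> R) : continuous c -> continuous d -> continuous (fun s => c (t - s) * d s).
  by move=> hc hd; apply: contM => //; exact: cont_rev.
have := @FTC R (fun s => a (t - s) * b s) (fun s => a (t - s) * b' s - a' (t - s) * b s) 0 t.
rewrite ointB; [|exact/cont_locint/cc|exact/cont_locint/cc].
rewrite -!conv_oint// subrr b0 mulr0 subr0 => H.
apply/eqP; rewrite -subr_eq; apply/eqP; apply: H.
  by apply: contD; [exact: cc|apply: contN; exact: cc].
by move=> x; apply: ider_val (iderM (ider_rev (da _)) (db x)) _; rewrite mulNr.
Qed.

Section ResolventFacts.
Variables (N : R -> R).
Hypothesis hN : Ck 3 N.
Hypothesis hN0 : N 0 = 1.
Notation N1 := (derive1 N).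
Notation r := (resolvent N).
Notation r1 := (derive1 r).
Notation r2 := (derive1n 2 r).

Lemma resolventP : is_resolvent N r.
Proof.
have [s Hs] := resolvent_exists hN.
exact: (@xgetPex _ (cst 0) [set r | is_resolvent N r] (ex_intro _ s Hs)).
Qed.

Lemma cont_N : continuous N. Proof. exact: (Ck_cont (k := 0) hN). Qed.
Lemma cont_N1 : continuous N1. Proof. exact: (Ck_cont (k := 1) hN). Qed.
Lemma ider_N x : ider N x (N1 x). Proof. exact: (Ck_ider (k := 0) hN). Qed.
Lemma cont_r : continuous r. Proof. exact: (Ck_cont (k := 0) resolventP.1). Qed.
Lemma cont_r1 : continuous r1. Proof. exact: (Ck_cont (k := 1) resolventP.1). Qed.
Lemma cont_r2 : continuous r2. Proof. exact: (Ck_cont (k := 2) resolventP.1). Qed.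
Lemma ider_r x : ider r x (r1 x). Proof. exact: (Ck_ider (k := 0) resolventP.1). Qed.
Lemma ider_r1 x : ider r1 x (r2 x). Proof. exact: (Ck_ider (k := 1) resolventP.1). Qed.

Lemma resolvent_eq t : 0 <= t -> r t + conv N1 r t = N1 t.
Proof. by move=> t0; have [_] := resolventP; apply. Qed.

(* (1 - r * )(1 + N' * ) = 1 *)
Lemma resolvent_conv phi t : 0 <= t -> continuous phi ->
  conv r (fun s => phi s + conv N1 phi s) t = conv N1 phi t.
Proof.
move=> t0 cphi; have lphi := cont_locint cphi.
have cN := cont_N1; have cr := cont_r.
have lc : locint (conv N1 phi) by exact/cont_locint/cont_conv.
rewrite convDr// convA// -convDl//; last exact: cont_conv.
apply: eq_conv => // s /andP[s0 _]; rewrite -resolvent_eq// convC//.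
Qed.

(** The same pair of inverses composed in the other order: the identity plus convolution with [N1],
    applied to [phi - conv r phi], returns [phi]. *)
Lemma resolvent_conv' phi t : 0 <= t -> continuous phi ->
  conv N1 (fun s => phi s - conv r phi s) t = conv r phi t.
Proof.
move=> t0 cphi; have lphi := cont_locint cphi.
have cN := cont_N1; have cr := cont_r.
have lc : locint (conv r phi) by exact/cont_locint/cont_conv.
have E : (fun s => phi s - conv r phi s) = (fun s => phi s + -1 * conv r phi s).
  by apply/funext => s; rewrite mulN1r.
rewrite E convDr//; last exact: locintZ.
rewrite convZr// convA// mulN1r; apply/eqP; rewrite subr_eq; apply/eqP.
rewrite -convDl//; last exact: cont_conv.
by apply: eq_conv => // s /andP[s0 _]; rewrite resolvent_eq.
Qed.

Lemma N_primitive t : 0 <= t -> N t = 1 + conv (fun=> 1) N1 t.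
Proof.
move=> t0; rewrite conv1 -oint_ge// (FTC _ _ cont_N1 ider_N) hN0; ring.
Qed.

Lemma ider_conv_N phi t : 0 < t -> continuous phi ->
  ider (conv N phi) t (phi t + conv N1 phi t).
Proof.
move=> t0 cphi; apply: ider_val (ider_conv t0 cont_N cont_N1 cphi ider_N) _.
by rewrite hN0 mul1r.
Qed.

(* The relation w_t = N * phi is equivalent to the second order relation
   w_tt = phi + r(0) w_t + r'(0) w + r'' * w. *)
Lemma second_order phi t : 0 <= t -> continuous phi ->
  phi t + conv N1 phi t = phi t + r 0 * conv N phi t
    + r1 0 * conv (fun=> 1) (conv N phi) t + conv r2 (conv (fun=> 1) (conv N phi)) t.
Proof.
move=> t0 cphi; rewrite -[in LHS]resolvent_conv// -!addrA; congr (_ + _).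
(* [conv] may fail to be differentiable at 0; these oriented integrals agree with it at nonnegative
   times and are differentiable on the whole line, as [conv_ibp] demands. *)
pose Y1 s := oint 0 s (fun z => N (s - z) * phi z).
pose Y2 s := phi s + oint 0 s (fun z => N1 (s - z) * phi z).
pose Y s := oint 0 s Y1.
have co (a : R -> R) : continuous a -> continuous (fun y => oint 0 y (fun z => a (y - z) * phi z)).
  move=> ca; apply: (@cont_oint R R (fun y z => a (y - z) * phi z) (fun=> 0) id).
  - exact: cont2_conv_kernel.
  - exact: cont_cst.
  - exact: cont_id.
have dY1 s : ider Y1 s (Y2 s).
  apply: ider_val (ider_oint_conv s cont_N cont_N1 cphi ider_N) _.
  by rewrite hN0 mul1r.
have cY2 : continuous Y2 by apply: contD => //; apply: co; exact: cont_N1.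
have cY1 : continuous Y1 := ider_cont dY1.
have dY s : ider Y s (Y1 s) by exact: ider_oint.
have cY : continuous Y := ider_cont dY.
have E1 s : 0 <= s -> conv N phi s = Y1 s by move=> s0; rewrite conv_oint.
have E0 s : 0 <= s -> conv (fun=> 1) (conv N phi) s = Y s.
  move=> s0; rewrite conv1 -oint_ge//; apply: eq_oint => z.
  by rewrite min_l// => /andP[/E1].
rewrite (@eq_conv _ r r _ Y2 t)//; last first.
  by move=> s /andP[s0 _]; rewrite conv_oint.
rewrite (conv_ibp t0 cont_r1 cY2 ider_r dY1); last exact: ointaa.
rewrite (conv_ibp t0 cont_r2 cY1 ider_r1 dY); last exact: ointaa.
rewrite E1// E0//; do 2 congr (_ + _).
by apply: eq_conv => // s /andP[s0 _]; rewrite E0.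
Qed.

(** Two integrations by parts rewrite the second order equation as [phi = w2 - conv r w2]. Inverting
    gives [w2 = phi + conv N1 phi], and one integration in time turns 1 + N' into N because N(0) =
    1. *)
Lemma second_order_inv (w w1 w2 phi : R -> R) t : 0 <= t -> continuous phi ->
  continuous w2 -> (forall s, ider w s (w1 s)) -> (forall s, ider w1 s (w2 s)) ->
  w 0 = 0 -> w1 0 = 0 ->
  (forall s, 0 <= s <= t -> w2 s = phi s + r 0 * w1 s + r1 0 * w s + conv r2 w s) ->
  w1 t = conv N phi t.
Proof.
move=> t0 cphi cw2 dw dw1 w0 w10 H.
have cw1 := ider_cont dw1; have cw := ider_cont dw.
have cN1 := cont_N1; have cr := cont_r.
have Hphi s : 0 <= s <= t -> phi s = w2 s - conv r w2 s.
  move=> st; have s0 : 0 <= s by case/andP: st.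
  rewrite H// (conv_ibp s0 cont_r1 cw2 ider_r dw1 w10).
  by rewrite (conv_ibp s0 cont_r2 cw1 ider_r1 dw w0); ring.
have Hw2 s : 0 <= s <= t -> w2 s = phi s + conv N1 phi s.
  move=> /[dup] st /andP[s0 sle]; rewrite Hphi//.
  rewrite (@eq_conv _ N1 N1 phi (fun s => w2 s - conv r w2 s) s)//; last first.
    by move=> z /andP[z0 zs]; rewrite Hphi// z0 (le_trans zs).
  by rewrite resolvent_conv'// subrK.
have -> : w1 t = conv (fun=> 1) w2 t.
  by rewrite conv1 -oint_ge// (FTC _ _ cw2 dw1) w10 subr0.
rewrite (@eq_conv _ (fun=> 1) (fun=> 1) w2 (fun s => phi s + conv N1 phi s) t)//.
have lphi := cont_locint cphi.
have c1 : continuous (fun _ : R => 1 : R) by exact: cont_cst.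
rewrite convDr//; last exact/cont_locint/cont_conv.
rewrite convA// -convDl//; last exact: cont_conv.
by apply: eq_conv => // s /andP[s0 _]; rewrite N_primitive.
Qed.

End ResolventFacts.

End Resolvent.

(** * The Goursat problem in retarded coordinates *)

Section GoursatKernel.
Context {R : realType}.
Notation mu := (@lebesgue_measure R).
Implicit Types (Q u : R -> R -> R) (x t : R).

(* The operator F |-> 1/2 int int F of the mild formulation, in the retarded
   coordinates (x, r) with r = t - x and in terms of the time primitive Q of F. *)
Definition goursat Q x t : R :=
  2^-1 * (oint 0 x (Q ^~ t) +
    (oint 0 (t / 2) (fun e => Q (x + e) (t - 2 * e)) -
     oint 0 (t / 2) (fun e => Q e (t - 2 * e)))).

Lemma cont2_swap Q : cont2 Q -> cont2 (fun x y => Q y x).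
Proof.
by move=> cQ; apply: (cont_comp2 (u := Q)) => //;
  [exact: continuous_snd|exact: continuous_fst].
Qed.

Lemma cont_sect2 Q t : cont2 Q -> continuous (Q ^~ t).
Proof. by move=> cQ; exact: (@cont_sect R R (fun s x => Q x s) t (cont2_swap cQ)). Qed.

Section Integrands.
Variable Q : R -> R -> R.
Hypothesis cQ : cont2 Q.

Let cont_half : continuous (fun p : R * R => p.2 / 2).
Proof. by apply: contM; [exact: continuous_snd|exact: cont_cst]. Qed.

Let cont_arg : continuous (fun q : (R * R) * R => q.1.2 - 2 * q.2).
Proof.
apply: contD; first by apply: (cont_comp1 (u := snd)); [exact: continuous_snd|exact: continuous_fst].
by apply: contN; apply: contM; [exact: cont_cst|exact: continuous_snd].
Qed.

Let cont_x1 : continuous (fun q : (R * R) * R => q.1.1).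
Proof. by apply: (cont_comp1 (u := fst)); exact: continuous_fst. Qed.

Let cont_t1 : continuous (fun q : (R * R) * R => q.1.2).
Proof. by apply: (cont_comp1 (u := snd)); [exact: continuous_snd|exact: continuous_fst]. Qed.

Let c1 : continuous (fun q : (R * R) * R => Q q.2 q.1.2).
Proof. by apply: (cont_comp2 (u := Q)) => //; exact: continuous_snd. Qed.

Let c2 : continuous (fun q : (R * R) * R => Q (q.1.1 + q.2) (q.1.2 - 2 * q.2)).
Proof. by apply: (cont_comp2 (u := Q)) => //; apply: contD => //; exact: continuous_snd. Qed.

Let c3 : continuous (fun q : (R * R) * R => Q q.2 (q.1.2 - 2 * q.2)).
Proof. by apply: (cont_comp2 (u := Q)) => //; exact: continuous_snd. Qed.

Lemma cont_goursat : cont2 (goursat Q).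
Proof.
apply: contM; first exact: cont_cst.
apply: contD.
  apply: (@cont_oint R (R * R)%type (fun p z => Q z p.2) (fun=> 0) fst) => //.
  - exact: cont_cst.
  - exact: continuous_fst.
apply: contD; last apply: contN.
  apply: (@cont_oint R (R * R)%type (fun p z => Q (p.1 + z) (p.2 - 2 * z)) (fun=> 0) (fun p => p.2 / 2)) => //.
  exact: cont_cst.
apply: (@cont_oint R (R * R)%type (fun p z => Q z (p.2 - 2 * z)) (fun=> 0) (fun p => p.2 / 2)) => //.
exact: cont_cst.
Qed.

Lemma goursat_locint x t :
  [/\ locint (Q ^~ t), locint (fun e => Q (x + e) (t - 2 * e)) &
      locint (fun e => Q e (t - 2 * e))].
Proof.
split; apply: cont_locint.
- exact: (@cont_sect R (R * R)%type (fun p z => Q z p.2) (x, t)).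
- exact: (@cont_sect R (R * R)%type (fun p z => Q (p.1 + z) (p.2 - 2 * z)) (x, t)).
- exact: (@cont_sect R (R * R)%type (fun p z => Q z (p.2 - 2 * z)) (x, t)).
Qed.

End Integrands.

Lemma goursatD Q Q' x t : cont2 Q -> cont2 Q' ->
  goursat (fun y s => Q y s + Q' y s) x t = goursat Q x t + goursat Q' x t.
Proof.
move=> cQ cQ'; have [a1 a2 a3] := goursat_locint cQ x t.
have [b1 b2 b3] := goursat_locint cQ' x t.
by rewrite /goursat !ointD//; ring.
Qed.

Lemma goursatB Q Q' x t : cont2 Q -> cont2 Q' ->
  goursat (fun y s => Q y s - Q' y s) x t = goursat Q x t - goursat Q' x t.
Proof.
move=> cQ cQ'; have [a1 a2 a3] := goursat_locint cQ x t.
have [b1 b2 b3] := goursat_locint cQ' x t.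
by rewrite /goursat !ointB//; ring.
Qed.

Lemma eq_goursat Q Q' x t : 0 <= t -> (forall y s, 0 <= s <= t -> Q y s = Q' y s) ->
  goursat Q x t = goursat Q' x t.
Proof.
move=> t0 H; rewrite /goursat; congr (_ * (_ + (_ - _))); apply: eq_oint => e.
- by rewrite H// t0 lexx.
- rewrite min_l ?divr_ge0// max_r ?divr_ge0// => /andP[e0 et].
  by apply: H; apply/andP; split; lra.
- rewrite min_l ?divr_ge0// max_r ?divr_ge0// => /andP[e0 et].
  by apply: H; apply/andP; split; lra.
Qed.

(** Along each of the three paths of integration [|y| + s] stays below [|x| + t] by the distance to
    one end of the path, so each integral gains [1 / c]; the resulting factor 3/2 is rounded up to
    2. *)
Lemma goursat_bound Q x t (B c : R) : 0 <= t -> 0 < c -> 0 <= B -> cont2 Q ->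
  (forall y s, 0 <= s -> `|y| + s <= `|x| + t -> `|Q y s| <= B * expR (c * (`|y| + s))) ->
  `|goursat Q x t| <= 2 * B / c * expR (c * (`|x| + t)).
Proof.
move=> t0 c0 B0 cQ H; have [l1 l2 l3] := goursat_locint cQ x t.
have h1 : `|oint 0 x (Q ^~ t)| <= B / c * expR (c * (`|x| + t)).
  have := @exp_oint R (Q ^~ t) (B * expR (c * t)) c x 0 c0 _ l1.
  rewrite subr0 => /(_ _ _)/le_trans; apply.
  - by rewrite mulr_ge0// expR_ge0.
  - move=> z /between_le; rewrite !subr0 => zx.
    apply: le_trans (H z t t0 _) _; first by rewrite lerD2r.
    by rewrite -mulrA -expRD -mulrDr (addrC t).
  - rewrite le_eqVlt; apply/orP; left; apply/eqP; rewrite mulrDr expRD.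
    by field; rewrite gt_eqF.
have aux f : locint f -> (forall e, 0 <= e <= t / 2 -> `|f e| <= B * expR (c * (`|x| + t - e))) ->
    `|oint 0 (t / 2) f| <= B / c * expR (c * (`|x| + t)).
  move=> lf Hf; rewrite ointC normrN.
  have := @exp_oint R f (B * expR (c * (`|x| + t - t / 2))) c 0 (t / 2) c0 _ lf.
  move=> /(_ _ _)/le_trans; apply.
  - by rewrite mulr_ge0// expR_ge0.
  - move=> z; rewrite min_r ?divr_ge0// max_l ?divr_ge0// => /[dup] zt /andP[z0 zt2].
    apply: le_trans (Hf z zt) _; rewrite (@ler0_norm _ (z - t / 2)) ?subr_le0// -mulrA -expRD -mulrDr.
    rewrite (_ : `|x| + t - t / 2 - (z - t / 2) = `|x| + t - z)//.
    by move: (t / 2) => t2; ring.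
  - rewrite sub0r normrN (ger0_norm (_ : 0 <= t / 2)) ?divr_ge0//.
    have -> : c * (`|x| + t) = c * (`|x| + t - t / 2) + c * (t / 2).
      by move: (t / 2) => t2; ring.
    rewrite expRD le_eqVlt; apply/orP; left; apply/eqP.
    by field; rewrite gt_eqF.
have h2 : `|oint 0 (t / 2) (fun e => Q (x + e) (t - 2 * e))| <= B / c * expR (c * (`|x| + t)).
  apply: aux => // e /andP[e0 et].
  have xe : `|x + e| + (t - 2 * e) <= `|x| + t - e.
    by have := ler_normD x e; rewrite (ger0_norm e0); lra.
  apply: le_trans (H _ _ _ _) _; [lra|lra|].
  by rewrite ler_wpM2l// ler_expR ler_wpM2l// ltW.
have h3 : `|oint 0 (t / 2) (fun e => Q e (t - 2 * e))| <= B / c * expR (c * (`|x| + t)).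
  apply: aux => // e /andP[e0 et].
  have xe : `|e| + (t - 2 * e) <= `|x| + t - e.
    by have := normr_ge0 x; rewrite (ger0_norm e0); lra.
  apply: le_trans (H _ _ _ _) _; [lra|lra|].
  by rewrite ler_wpM2l// ler_expR ler_wpM2l// ltW.
rewrite /goursat normrM ger0_norm ?invr_ge0//.
have h4 := le_trans (ler_normB _ _) (lerD h2 h3).
have h5 := le_trans (ler_normD _ _) (lerD h1 h4).
have : 0 <= B / c * expR (c * (`|x| + t)) by rewrite mulr_ge0 ?expR_ge0// divr_ge0// ltW.
rewrite (_ : 2 * B / c * expR _ = 2 * (B / c * expR (c * (`|x| + t)))); last by rewrite !mulrA.
move: (B / c * _) h5 => Z h5; lra.
Qed.

Variable l : R -> R -> R.
Hypothesis cl : cont2 l.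

(** The response to an impulse at x = 0: put W = delta(r) + u(x, r) in the mild formulation. In the
    application [l y] is the time primitive of (q(y) + alpha) delta + K, because [goursat] takes
    sources already integrated once in time. *)
Definition goursat_kernel_spec u :=
  cont2 u /\ forall x t, 0 <= t ->
    u x t = goursat (fun y s => l y s + conv (l y) (u y) s) x t.

Lemma cont2_conv u : cont2 u -> cont2 (fun y s => conv (l y) (u y) s).
Proof.
move=> cu; apply: (@cont_conv2 R (R * R)%type (fun p => l p.1) (fun p => u p.1) snd).
- apply: (cont_comp2 (u := l)) => //; last exact: continuous_snd.
  by apply: (cont_comp1 (u := fst)); exact: continuous_fst.
- apply: (cont_comp2 (u := u)) => //; last exact: continuous_snd.
  by apply: (cont_comp1 (u := fst)); exact: continuous_fst.
- exact: continuous_snd.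
Qed.

Lemma goursat_kernel_exists : exists u, goursat_kernel_spec u.
Proof.
(* Negative times are replaced by 0, so that the weight controls the domain of dependence
   [|y| + s <= |x| + t] on the whole plane. *)
pose pos t : R := Num.max t 0.
have cpos : continuous (fun p : R * R => pos p.2).
  by apply: cont_max; [exact: continuous_snd|exact: cont_cst].
have pos0 t : 0 <= pos t by rewrite /pos le_max lexx orbT.
have [Cl [hCl Cl0 HCl]] := majorant cl.
have [Cg [hCg Cg0 HCg]] := majorant (cont_goursat cl).
pose C r := Cl r + Cg r + 1.
have hC : {homo C : x y / x <= y} by move=> x y xy; rewrite /C !lerD ?hCl ?hCg.
have C1 r : 1 <= C r by rewrite /C lerDr addr_ge0.
have C0 r : 0 < C r by rewrite (lt_le_trans ltr01).
pose rho (p : R * R) := `|p.1| + pos p.2.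
have crho : continuous rho.
  by apply: contD => //; apply: cont_norm; exact: continuous_fst.
have rho0 p : 0 <= rho p by rewrite addr_ge0.
pose w (p : R * R) := C (rho p) * expR (4 * C (rho p) * rho p).
pose U (u : R * R -> R) y s := u (y, s).
pose P (u : R * R -> R) (p : R * R) :=
  goursat (fun y s => conv (l y) (U u y) s) p.1 (pos p.2).
have cU (u : R * R -> R) : continuous u -> cont2 (U u).
  by move=> cu; apply: (cont_comp1 (u := u)) => //; apply: cont_pair;
    [exact: continuous_fst|exact: continuous_snd].
have [||||||u cu Hu] := @picard R (R * R)%type w P (fun p => goursat l p.1 (pos p.2)).
- move=> p; exists (C (rho p + 1) * expR (4 * C (rho p + 1) * (rho p + 1))).
  near=> q.
  have h1 : rho q <= rho p + 1.
    rewrite -lerBlDl; apply: le_trans (ler_norm _) _; rewrite distrC.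
    by near: q; have /cvgrPdist_le := crho p; apply.
  apply: ler_pM; [exact: ltW|exact: expR_ge0|exact: hC|].
  rewrite ler_expR; apply: ler_pM => //; first by rewrite mulr_ge0// ltW.
  by rewrite ler_wpM2l// hC.
- apply: (cont_comp2 (u := goursat l)) => //; first exact: cont_goursat.
  exact: continuous_fst.
- move=> v cv; apply: (cont_comp2 (u := goursat (fun y s => conv (l y) (U v y) s))) => //.
    by apply: cont_goursat; apply: cont2_conv; exact: cU.
  exact: continuous_fst.
- move=> u v A cu cv A0 H p; rewrite /P -goursatB; [|exact/cont2_conv/cU|exact/cont2_conv/cU].
  have [c cE] : exists c, c = 4 * C (rho p) by eexists.
  have c0 : 0 < c by rewrite cE mulr_gt0.
  apply: (@le_trans _ _ (2 * (C (rho p) * (A * C (rho p)) / c) / c * expR (c * rho p))).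
    apply: goursat_bound => //.
    + by rewrite divr_ge0 ?mulr_ge0// ltW.
    + apply: contD; first exact/cont2_conv/cU.
      by apply: contN; exact/cont2_conv/cU.
    + move=> y s s0 ys.
      have lu (z : R * R -> R) : continuous z -> locint (U z y).
        by move=> cz; apply: cont_locint; exact: cont_sect (cU z cz).
      have cly : continuous (l y) by exact: cont_sect cl.
      have -> : conv (l y) (U u y) s - conv (l y) (U v y) s =
          oint 0 s (fun z => l y (s - z) * (u (y, z) - v (y, z))).
        rewrite !conv_oint// -ointB//; last 2 first.
        - exact: conv_integrand_locint (lu u cu).
        - exact: conv_integrand_locint (lu v cv).
        by congr oint; apply/funext => z; rewrite mulrBr.
      have := @exp_oint R (fun z => l y (s - z) * (u (y, z) - v (y, z)))
        (C (rho p) * (A * C (rho p)) * expR (c * `|y|)) c s 0 c0.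
      rewrite subr0 (ger0_norm s0) => /(_ _ _ _)/le_trans; apply.
      * by rewrite !mulr_ge0 ?expR_ge0// ltW.
      * apply: conv_integrand_locint => //.
        by have := locintB (lu u cu) (lu v cv); exact.
      * move=> z; rewrite min_l// max_r// => /andP[z0 zs]; rewrite subr0 (ger0_norm z0).
        rewrite normrM -!mulrA; apply: ler_pM => //.
          apply: le_trans (HCl (rho p) _ _ _ _) _.
          - by apply: le_trans ys; rewrite lerDl.
          - apply: le_trans ys; rewrite ger0_norm ?subr_ge0//.
            by have := normr_ge0 y; lra.
          - by rewrite /C -addrA lerDl addr_ge0.
        apply: le_trans (H (y, z)) _; rewrite ler_wpM2l// /w.
        have rz : rho (y, z) <= rho p.
          by rewrite {1}/rho/= /pos max_l//; apply: le_trans ys; rewrite lerD2l.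
        apply: ler_pM; [exact: ltW|exact: expR_ge0|exact: hC|].
        rewrite -expRD -mulrDr ler_expR.
        have -> : `|y| + z = rho (y, z) by rewrite /rho/= /pos max_l.
        by rewrite ler_wpM2r// cE ler_wpM2l// hC.
      * rewrite [c * (_ + _)]mulrDr expRD le_eqVlt; apply/orP; left; apply/eqP.
        by field; rewrite gt_eqF.
  rewrite /w -cE [X in _ <= X]mulrA ler_wpM2r ?expR_ge0// cE.
  have := C1 (rho p); move: (C (rho p)) => D D1.
  have D0 : D != 0 by rewrite gt_eqF// (lt_le_trans ltr01).
  (* One gain of [1 / c] comes from the convolution and one from [goursat]; with [c = 4 * D] there
     remains A / 8. *)
  have -> : 2 * (D * (A * D) / (4 * D)) / (4 * D) = A / 8 by field.
  rewrite -mulrA ler_wpM2l//; lra.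
- move=> p; rewrite /P.
  transitivity (goursat (fun _ _ => 0) p.1 (pos p.2)); last first.
    by rewrite /goursat !oint0 subrr addr0 mulr0.
  apply: eq_goursat => // y s _; rewrite /conv.
  rewrite -[RHS](Rintegral0 `[0, s]); apply: eq_Rintegral => z _.
  by rewrite mulr0.
- move=> p; rewrite /w; apply: (@le_trans _ _ (C (rho p))).
    apply: le_trans (HCg (rho p) _ _ _ _) _.
    + by rewrite lerDl.
    + by rewrite ger0_norm// lerDr.
    + by have := Cl0 (rho p); rewrite /C; lra.
  by rewrite ler_peMr ?(ltW (C0 _))// -expR0 ler_expR !mulr_ge0// ltW//.
exists (U u); split; first exact: cU.
move=> x t t0; rewrite {1}/U Hu/= /P /= /pos max_l// goursatD//.
exact/cont2_conv/cU.
Unshelve. all: by end_near. Qed.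

(** At x = 0 the two characteristic integrals coincide and cancel: the kernel does not disturb the
    boundary value. *)
Lemma goursat_x0 Q t : goursat Q 0 t = 0.
Proof.
rewrite /goursat ointaa add0r (_ : (fun e => Q (0 + e) _) = (fun e => Q e (t - 2 * e))).
  by rewrite subrr mulr0.
by apply/funext => e; rewrite add0r.
Qed.

End GoursatKernel.

(** * Convolution with merely integrable functions *)

Section IntegrableWeight.
Context {R : realType}.
Notation mu := (@lebesgue_measure R).
Implicit Types (g h : R -> R).

Lemma cont_primitive h (a : R) : locint h -> continuous (fun t => oint a t h).
Proof.
move=> lh t0.
have ab : t0 - 1 <= t0 + 1 by lra.
have := parameterized_integral_continuous ab (lh (t0 - 1) (t0 + 1)).
move=> H.
have H0 : {for t0, continuous (fun t => \int[mu]_(x in `[t0 - 1, t]) h x)}.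
  move: H; rewrite continuous_within_itvP; last by lra.
  by case=> + _ _; apply; rewrite in_itv/=; apply/andP; split; lra.
have H1 : {for t0, continuous (fun t => oint a (t0 - 1) h + \int[mu]_(x in `[t0 - 1, t]) h x)}.
  by apply: cvgD H0; exact: cvg_cst.
have E (t : R) : t0 - 1 < t -> oint a t h = oint a (t0 - 1) h + \int[mu]_(x in `[t0 - 1, t]) h x.
  by move=> t1; rewrite -oint_ge ?ltW// oint_cat.
have E0 : oint a t0 h = oint a (t0 - 1) h + \int[mu]_(x in `[t0 - 1, t0]) h x.
  by apply: E; lra.
rewrite /continuous_at E0; apply: cvg_trans H1; apply: near_eq_cvg.
near=> t; apply/esym/E; near: t.
exists 1 => //= y; rewrite /= ltr_norml => /andP[h1 h2]; lra.
Unshelve. all: by end_near. Qed.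

Lemma le_oint_norm (a b : R) g h : locint g -> locint h ->
  (forall x, Num.min a b <= x <= Num.max a b -> `|g x| <= h x) ->
  `|oint a b g| <= `|oint a b h|.
Proof.
move=> lg lh; wlog ab : a b / a <= b => [W|] H.
  case: (leP a b) => [|/ltW] ab; first by rewrite W.
  rewrite (ointC b a g) (ointC b a h) !normrN; apply: (W b a ab) => x.
  by rewrite minC maxC; exact: H.
rewrite !oint_ge//; apply: le_trans (ler_norm _).
by apply: le_int_norm => // x xab; apply: H; rewrite min_l// max_r.
Qed.

Lemma locint_norm g : locint g -> locint (fun x => `|g x|).
Proof. by move=> lg a b; exact: integrable_abse_fin. Qed.

(** As in [cont_oint], but against the integrable weight [g]: the moving bound is handled by
    continuity of the primitive, the moving factor [B] by uniform convergence times the mass [G]. *)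
Lemma cont_oint_weight (X : topologicalType) (B : X -> R -> R) (b : X -> R) g (a : R) :
  continuous (fun z : X * R => B z.1 z.2) -> continuous b -> locint g ->
  continuous (fun p => oint a (b p) (fun z => B p z * g z)).
Proof.
move=> cB cb lg p0; apply/cvgrPdist_le => e e0.
have lB p : locint (fun z => B p z * g z).
  by apply: cont_mul_locint => //; exact: cont_sect cB.
set M := `|a| + `|b p0| + 1.
set G := \int[mu]_(x in `[- M, M]) `|g x|.
have G0 : 0 <= G by apply: Rintegral_ge0.
pose e1 := e / 2 / (G + 1).
have e10 : 0 < e1 by rewrite !divr_gt0// ltr_wpDl.
have He1 : e1 * G <= e / 2.
  apply: (@le_trans _ _ (e1 * (G + 1))); first by rewrite ler_pM2l// lerDl.
  by rewrite -ler_pdivlMr// ltr_wpDl.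
have cprim := cont_primitive (a := a) (lB p0).
have cc : continuous (fun p => oint a (b p) (fun z => B p0 z * g z)).
  exact: (cont_comp1 (u := fun t => oint a t (fun z => B p0 z * g z)) cprim cb).
near=> p.
have nb : `|b p0 - b p| <= 1.
  by near: p; have /cvgrPdist_le := cb p0; apply.
have bp1 : `|b p| <= `|b p0| + 1.
  have := ler_normD (b p - b p0) (b p0); rewrite subrK => h; rewrite distrC in nb.
  by apply: le_trans h _; lra.
have nc : `|oint a (b p0) (fun z => B p0 z * g z) - oint a (b p) (fun z => B p0 z * g z)| <= e / 2.
  by near: p; have /cvgrPdist_le := cc p0; apply; rewrite divr_gt0.
have nu : forall y, - M <= y <= M -> `|B p y - B p0 y| < e1.
  by near: p; exact: unif_near.
have -> : oint a (b p0) (fun z => B p0 z * g z) - oint a (b p) (fun z => B p z * g z) =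
   (oint a (b p0) (fun z => B p0 z * g z) - oint a (b p) (fun z => B p0 z * g z)) -
   oint a (b p) (fun z => (B p z - B p0 z) * g z).
  rewrite [X in _ = _ - X](_ : _ = oint a (b p) (fun z => B p z * g z - B p0 z * g z)).
    by rewrite ointB//; ring.
  by congr oint; apply/funext => z; rewrite mulrBl.
apply: le_trans (ler_normB _ _) _; rewrite [leRHS](splitr e); apply: lerD => //.
have lg' := locintZ e1 (locint_norm lg).
apply: le_trans (le_oint_norm _ lg' _) _.
- have := locintB (lB p) (lB p0); congr locint; apply/funext => z.
  by rewrite mulrBl.
- move=> y /between_norm yM; rewrite normrM ler_wpM2r// ltW// nu// -ler_norml.
  by apply: le_trans yM _; rewrite /M -addrA lerD2l.
rewrite ointZ; last exact: locint_norm.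
rewrite normrM (ger0_norm (ltW e10)); apply: le_trans He1; rewrite ler_pM2l//.
have aM : - M <= a <= M by rewrite -ler_norml /M -addrA lerDl addr_ge0.
have bM : - M <= b p <= M.
  by rewrite -ler_norml /M -addrA -[X in X <= _]add0r lerD.
have key x y : - M <= x -> x <= y -> y <= M -> `|oint x y (fun z => `|g z|)| <= G.
  move=> Mx xy yM; have lng := locint_norm lg.
  rewrite oint_ge// ger0_norm; last exact: Rintegral_ge0.
  rewrite /G -(oint_ge _ (le_trans Mx (le_trans xy yM))) -(oint_cat (- M) x M lng).
  rewrite -(oint_cat x y M lng) !oint_ge//.
  by rewrite addrCA lerDl addr_ge0//; exact: Rintegral_ge0.
case/andP: aM => aM1 aM2; case/andP: bM => bM1 bM2.
have [ab|/ltW ba] := leP a (b p); first exact: key.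
by rewrite ointC normrN; exact: key.
Unshelve. all: by end_near. Qed.

Lemma cont2_conv_locint (B : R -> R -> R) g : cont2 B -> locint g ->
  cont2 (fun y s => conv (B y) g s).
Proof.
move=> cB lg; rewrite /cont2.
have -> : (fun p : R * R => conv (B p.1) g p.2) =
    (fun p => oint 0 (Num.max 0 p.2) (fun z => B p.1 (p.2 - z) * g z)).
  apply/funext => p; have [t0|t0] := leP 0 p.2; first by rewrite conv_oint.
  by rewrite ointaa conv_le0// ltW.
apply: (@cont_oint_weight (R * R)%type (fun p z => B p.1 (p.2 - z)) (fun p => Num.max 0 p.2)) => //.
  apply: (cont_comp2 (u := B)) => //.
    by apply: (cont_comp1 (u := fst)); exact: continuous_fst.
  apply: contD; last by apply: contN; exact: continuous_snd.
  by apply: (cont_comp1 (u := snd)); [exact: continuous_snd|exact: continuous_fst].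
by apply: cont_max; [exact: cont_cst|exact: continuous_snd].
Qed.

Lemma conv_locint_cont (a g : R -> R) : continuous a -> locint g -> continuous (conv a g).
Proof.
move=> ca lg; have c : cont2 (fun _ : R => a).
  by apply: (cont_comp1 (u := a)) => //; exact: continuous_snd.
exact: (@cont_sect R R (fun y s => conv a g s) 0 (cont2_conv_locint c lg)).
Qed.

Lemma conv_oint_fubini (B : R -> R -> R) g (x t : R) : cont2 B -> locint g ->
  conv (fun s => oint 0 x (B ^~ s)) g t = oint 0 x (fun y => conv (B y) g t).
Proof.
move=> cB lg.
have cA (p : R * R -> R) : True by [].
have c : cont2 (fun z y => B y (t - z)).
  apply: (cont_comp2 (u := B)) => //; first exact: continuous_snd.
  by apply: contD; [exact: cont_cst|apply: contN; exact: continuous_fst].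
have pos y1 y2 : y1 <= y2 ->
    conv (fun s => oint y1 y2 (B ^~ s)) g t = oint y1 y2 (fun y => conv (B y) g t).
  move=> y12; rewrite oint_ge// /conv.
  have := @fubini_rect R (fun z y => B y (t - z)) g (fun=> 1) 0 t y1 y2 c (lg 0 t)
    (@locint_cst R 1 y1 y2).
  have -> : \int[mu]_(z in `[0, t]) (g z * \int[mu]_(s in `[y1, y2]) (B s (t - z) * 1)) =
     \int[mu]_(s in `[0, t]) (oint y1 y2 (B^~ (t - s)) * g s).
    apply: eq_Rintegral => z _; rewrite mulrC oint_ge//; congr (_ * _).
    by apply: eq_Rintegral => y _; rewrite mulr1.
  by move=> ->; apply: eq_Rintegral => y _; rewrite mul1r.
have [x0|/ltW x0] := leP 0 x; first exact: pos.
rewrite ointC -pos//.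
have cc : continuous (fun s => oint x 0 (B ^~ s)).
  apply: (@cont_oint R R (fun s y => B y s) (fun=> x) (fun=> 0)); try exact: cont_cst.
  exact: cont2_swap.
rewrite -mulN1r -convZl//; apply: eq_conv => // s _.
by rewrite ointC mulN1r.
Qed.

Lemma conv_oint_tri (B : R -> R -> R) g (t : R) : 0 <= t -> cont2 B -> locint g ->
  conv (fun s => oint 0 (s / 2) (fun e => B e (s - 2 * e))) g t =
  oint 0 (t / 2) (fun e => conv (B e) g (t - 2 * e)).
Proof.
move=> t0 cB lg.
have half f (s : R) : continuous f -> oint 0 (s / 2) f = 2^-1 * oint 0 s (fun z => f (z / 2)).
  move=> cf; have := @oint_affine R 0 s 2^-1 0 f cf.
  rewrite mulr0 !addr0 (mulrC _ s) => <-; congr (_ * oint _ _ _).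
  by apply/funext => z; rewrite addr0 mulrC.
have cBs s : continuous (fun e => B e (s - 2 * e)).
  apply: (cont_comp2 (u := B)) => //; first exact: cont_id.
  apply: contD; first exact: cont_cst.
  by apply: contN; apply: contM; [exact: cont_cst|exact: cont_id].
have cG : continuous (fun e => conv (B e) g (t - 2 * e)).
  apply: (cont_comp2 (u := fun y s => conv (B y) g s)); first exact: cont2_conv_locint.
  - exact: cont_id.
  - apply: contD; first exact: cont_cst.
    by apply: contN; apply: contM; [exact: cont_cst|exact: cont_id].
rewrite half//.
(* The substitution e = (t - z) / 2 turns the characteristic integral into an integral over a
   triangle. *)
pose D z s := B ((t - z) / 2) (z - s).
have cD : cont2 D.
  apply: (cont_comp2 (u := B)) => //.
    apply: contM; last exact: cont_cst.
    by apply: contD; [exact: cont_cst|apply: contN; exact: continuous_fst].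
  by apply: contD; [exact: continuous_fst|apply: contN; exact: continuous_snd].
have two (z : R) : 2 * (z / 2) = z by rewrite mulrCA mulfV// mulr1.
have -> : oint 0 t (fun z => conv (B (z / 2)) g (t - 2 * (z / 2))) =
    \int[mu]_(z in `[0, t]) (1 * \int[mu]_(s in `[0, z]) (D z s * g s)).
  have [h hE] : exists h : R -> R, forall z, h z = \int[mu]_(s in `[0, z]) (D z s * g s).
    by eexists.
  have ch : continuous h.
    have cE : cont2 (fun y s => conv (B ((t - y) / 2)) g s).
      apply: (cont2_conv_locint (B := fun y => B ((t - y) / 2))) => //.
      apply: (cont_comp2 (u := B)) => //; last exact: continuous_snd.
      apply: contM; last exact: cont_cst.
      by apply: contD; [exact: cont_cst|apply: contN; exact: continuous_fst].
    rewrite (_ : h = fun z => conv (B ((t - z) / 2)) g z); last exact/funext.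
    exact: (cont_comp2 (u := fun y s => conv (B ((t - y) / 2)) g s) cE (@cont_id R) (@cont_id R)).
  transitivity (\int[mu]_(z in `[0, t]) h z); last first.
    by apply: eq_Rintegral => z _; rewrite mul1r hE.
  have := @oint_rev R 0 t t h ch; rewrite subrr subr0 (oint_ge h t0) => <-.
  congr oint; apply/funext => z; rewrite hE two /conv; apply: eq_Rintegral => s _.
  by rewrite /D subKr.
rewrite (@fubini_tri R D (fun=> 1) g 0 t cD (@locint_cst R 1 0 t) (lg 0 t)).
pose c s := oint s t (D ^~ s).
have cc : continuous c.
  apply: (@cont_oint R R (fun s z => D z s) id (fun=> t)).
  - exact: cont2_swap.
  - exact: cont_id.
  - exact: cont_cst.
have -> : \int[mu]_(s in `[0, t]) (g s * \int[mu]_(z in `[s, t]) (D z s * 1)) =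
    \int[mu]_(s in `[0, t]) (c s * g s).
  apply: eq_Rintegral => s; rewrite inE/= in_itv/= => /andP[s0 st].
  rewrite mulrC /c oint_ge//; congr (_ * _).
  by apply: eq_Rintegral => z _; rewrite mulr1.
rewrite -RintegralZl//; last exact: cont_mul_integrable cc (lg 0 t).
apply: eq_Rintegral => s; rewrite inE/= in_itv/= => /andP[s0 st].
rewrite half// mulrA; congr (_ * _ * _).
have cDs : continuous (D ^~ s) by exact: (@cont_sect R R (fun s z => D z s) s (cont2_swap cD)).
have := @oint_rev R 0 (t - s) t (D ^~ s) cDs.
rewrite subr0 subKr -/(c s) => <-; congr oint; apply/funext => z.
by rewrite /D two; congr (B (_ / 2) _); ring.
Qed.

(** [goursat] commutes with convolution in time, by Fubini for each of its three integrals. Applied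
    to the kernel equation, this produces the wave with boundary value [g]. *)
Lemma goursat_conv (Q : R -> R -> R) g (x t : R) : 0 <= t -> cont2 Q -> locint g ->
  conv (goursat Q x) g t = goursat (fun y s => conv (Q y) g s) x t.
Proof.
move=> t0 cQ lg.
have c1 : continuous (fun s => oint 0 x (Q ^~ s)).
  apply: (@cont_oint R R (fun s y => Q y s) (fun=> 0) (fun=> x)); try exact: cont_cst.
  exact: cont2_swap.
have cc (B : R -> R -> R) : cont2 B -> continuous (fun s : R => oint 0 (s / 2) (fun e => B e (s - 2 * e))).
  move=> cB; apply: (@cont_oint R R (fun s e => B e (s - 2 * e)) (fun=> 0) (fun s => s / 2)).
  - apply: (cont_comp2 (u := B)) => //; first exact: continuous_snd.
    apply: contD; first exact: continuous_fst.
    by apply: contN; apply: contM; [exact: cont_cst|exact: continuous_snd].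
  - exact: cont_cst.
  - by apply: contM; [exact: cont_id|exact: cont_cst].
have cQx : cont2 (fun e => Q (x + e)).
  apply: (cont_comp2 (u := Q)) => //; last exact: continuous_snd.
  by apply: contD; [exact: cont_cst|exact: continuous_fst].
have c2 := cc _ cQx; have c3 := cc _ cQ.
have c3' : continuous (fun s : R => -1 * oint 0 (s / 2) (fun e => Q e (s - 2 * e))).
  by apply: contM => //; exact: cont_cst.
rewrite {1}/goursat.
transitivity (2^-1 * (conv (fun s => oint 0 x (Q ^~ s)) g t +
  (conv (fun s => oint 0 (s / 2) (fun e => Q (x + e) (s - 2 * e))) g t +
   conv (fun s => -1 * oint 0 (s / 2) (fun e => Q e (s - 2 * e))) g t))).
  rewrite -(convDl _ c2 c3' lg) -(convDl _ c1 _ lg); last exact: contD.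
  rewrite -convZl//; last by apply: contD => //; exact: contD.
  by apply: eq_conv => // s _; rewrite mulN1r.
rewrite (convZl _ _ c3 lg) (conv_oint_fubini _ _ cQ lg) (conv_oint_tri t0 cQx lg).
by rewrite (conv_oint_tri t0 cQ lg) mulN1r.
Qed.

End IntegrableWeight.

(** * Waves with smooth boundary values *)

Section Unfolding.
Context {R : realType}.
Notation mu := (@lebesgue_measure R).

Lemma convE (a b : R -> R) t : conv a b t = \int[mu]_(s in `[0, t]) (a (t - s) * b s).
Proof. by []. Qed.

Lemma conv_eq0 (a b : R -> R) t : (forall s, 0 <= s <= t -> b s = 0) -> conv a b t = 0.
Proof.
move=> b0; rewrite convE -[RHS](Rintegral0 `[0, t]); apply: eq_Rintegral => s.
by rewrite inE/= in_itv/= => /b0 ->; rewrite mulr0.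
Qed.

Lemma goursatE (Q : R -> R -> R) x t : goursat Q x t =
  2^-1 * (oint 0 x (Q ^~ t) +
    (oint 0 (t / 2) (fun e => Q (x + e) (t - 2 * e)) -
     oint 0 (t / 2) (fun e => Q e (t - 2 * e)))).
Proof. by []. Qed.

End Unfolding.

Opaque oint conv goursat.

(** * Smooth and causal functions *)

Section SmoothControls.
Context {R : realType}.
Implicit Types (f g h : R -> R).

Definition causal g := forall t : R, t <= 0 -> g t = 0.

(** Left difference quotients alone force the derivative to vanish, so time 0 is included. *)
Lemma ider_causal g d t : causal g -> ider g t d -> t <= 0 -> d = 0.
Proof.
move=> g0 /iderP dg t0; apply/eqP; rewrite -normr_eq0 eq_le normr_ge0 andbT.
apply/ler_addgt0Pl => e e0; rewrite addr0.
have [r r0 H] := dg e e0.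
have r20 : 0 < r / 2 by rewrite divr_gt0.
have := H (- (r / 2)); rewrite normrN (gtr0_norm r20) => /(_ _).
rewrite !g0 ?subrr//; last by lra.
rewrite sub0r mulrN opprK normrM (gtr0_norm r20) ler_pM2r//; apply.
by lra.
Qed.

Lemma Ck_S (n : nat) f f1 : (forall x, ider f x (f1 x)) -> Ck n f1 -> Ck n.+1 f.
Proof.
move=> df c1; have E := derive1_fun df.
case=> [_|k kn].
  rewrite derive1n0; split; first exact: ider_cont df.
  by move=> _ x; exact: derivable_ider (df x).
rewrite derive1Sn E; have [ck dk] := c1 k kn; split=> // kn1 x; exact: dk.
Qed.

Lemma Ck_derive1 (n : nat) f : Ck n.+1 f -> Ck n (derive1 f).
Proof. by move=> cf k kn; have := cf k.+1 kn; rewrite derive1Sn. Qed.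

Lemma smooth_ider f x : smooth f -> ider f x (derive1 f x).
Proof. by move=> sf; apply: (Ck_ider (k := 0) (sf 1%N)). Qed.

Lemma smooth_derive1 f : smooth f -> smooth (derive1 f).
Proof. by move=> sf n; apply: Ck_derive1; exact: sf. Qed.

Lemma smooth_cont f : smooth f -> continuous f.
Proof. by move=> sf; exact: (Ck_cont (k := 0) (sf 0%N)). Qed.

(** Coinduction: smoothness follows from exhibiting a class of functions stable under
    differentiation, without computing higher derivatives. *)
Lemma smooth_intro (P : (R -> R) -> Prop) :
  (forall f, P f -> exists2 f1, P f1 & forall x, ider f x (f1 x)) ->
  forall f, P f -> smooth f.
Proof.
move=> H f Pf n; elim: n f Pf => [|n IH] f Pf; have [f1 Pf1 df] := H f Pf.
  by case=> // _; split=> //; rewrite derive1n0; exact: ider_cont df.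
by apply: Ck_S df _; exact: IH.
Qed.

Lemma CkD (n : nat) f g : Ck n f -> Ck n g -> Ck n (fun t => f t + g t).
Proof.
elim: n f g => [|n IH] f g cf cg.
  case=> // _; split=> //; rewrite derive1n0.
  by apply: contD; [exact: (Ck_cont (k := 0) cf)|exact: (Ck_cont (k := 0) cg)].
apply: (Ck_S (f1 := fun t => derive1 f t + derive1 g t)).
  by move=> x; apply: iderD; [exact: (Ck_ider (k := 0) cf)|exact: (Ck_ider (k := 0) cg)].
by apply: IH; exact: Ck_derive1.
Qed.

Lemma smoothD f g : smooth f -> smooth g -> smooth (fun t => f t + g t).
Proof. by move=> sf sg n; apply: CkD; [exact: sf|exact: sg]. Qed.

Lemma smoothM f g : smooth f -> smooth g -> smooth (fun t => f t * g t).
Proof.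
move=> sf sg n; elim: n f g sf sg => [|n IH] f g sf sg.
  case=> // _; split=> //; rewrite derive1n0.
  by apply: contM; exact: smooth_cont.
apply: (Ck_S (f1 := fun t => f t * derive1 g t + derive1 f t * g t)).
  by move=> x; apply: iderM; exact: smooth_ider.
apply: CkD.
  exact: (IH _ _ sf (smooth_derive1 sg)).
exact: (IH _ _ (smooth_derive1 sf) sg).
Qed.

Lemma smooth_cst (c : R) : smooth (fun=> c).
Proof.
apply: (@smooth_intro (fun h => exists c, h = fun=> c)); last by exists c.
by move=> _ [d ->]; exists (fun=> 0); [exists 0|move=> x; exact: ider_cst].
Qed.

Lemma smooth_exp (c : R) : smooth (fun t => expR (c * t)).
Proof.
apply: (@smooth_intro (fun h => exists d, h = fun t => d * expR (c * t))); last first.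
  by exists 1; apply/funext => t; rewrite mul1r.
move=> _ [d ->]; exists (fun t => (d * c) * expR (c * t)); first by exists (d * c).
by move=> x; rewrite -mulrA; apply: iderZ; exact: ider_exp_lin.
Qed.

Lemma smooth_local f : (forall M : R, exists2 h, smooth h & forall t, t < M -> f t = h t) ->
  smooth f.
Proof.
apply: (@smooth_intro (fun f => forall M : R,
  exists2 h, smooth h & forall t, t < M -> f t = h t)) => {}f H.
have df x : exists d, ider f x d.
  have [h sh fh] := H (x + 1); exists (derive1 h x).
  apply: (@oo_ider _ h _ _ (x - 1) (x + 1)); last exact: smooth_ider.
    by apply/andP; split; lra.
  by move=> y /andP[_ y1]; rewrite fh.
exists (derive1 f).
  move=> M; have [h sh fh] := H M; exists (derive1 h); first exact: smooth_derive1.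
  move=> t tM; apply: derive1_eq.
  apply: (@oo_ider _ h _ _ (t - 1) M); last exact: smooth_ider.
    by rewrite tM andbT; lra.
  by move=> y /andP[_ y1]; rewrite fh.
by move=> x; have [d Hd] := df x; rewrite (derive1_eq Hd).
Qed.

Lemma causal_derive1 g : smooth g -> causal g -> causal (derive1 g).
Proof. by move=> sg cg t; apply: (ider_causal cg); exact: smooth_ider. Qed.

Lemma conv_delay (a h : R -> R) (x t : R) : continuous a -> continuous h -> causal h ->
  0 <= x -> conv a (fun s => h (s - x)) t = conv a h (t - x).
Proof.
move=> ca ch h0 x0.
have chx : continuous (fun s => h (s - x)).
  by apply: (cont_comp1 (u := h)) => //; apply: contD; [exact: cont_id|exact: cont_cst].
have [tx|tx] := leP (t - x) 0.
  rewrite (conv_le0 _ _ tx) conv_eq0// => s /andP[s0 st]; apply: h0.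
  by apply: le_trans tx; rewrite lerD2r.
have t0 : 0 <= t by lra.
rewrite !conv_oint//; last exact: ltW.
have cI : continuous (fun s => a (t - s) * h (s - x)) by apply: contM => //; exact: cont_rev.
rewrite -(oint_cat 0 x t (cont_locint cI)).
have -> : oint 0 x (fun s => a (t - s) * h (s - x)) = 0.
  rewrite -[RHS](oint0 0 x); apply: eq_oint => s; rewrite max_r// => /andP[_ sx].
  by rewrite h0 ?mulr0// subr_le0.
rewrite add0r.
have := @oint_shift R 0 (t - x) x (fun s => a (t - s) * h (s - x)) cI.
rewrite add0r subrK => <-; congr oint; apply/funext => s.
by congr (a _ * h _); ring.
Qed.

End SmoothControls.

(** * Waves in retarded coordinates and their derivatives *)

Section Wave.
Context {R : realType}.
Notation mu := (@lebesgue_measure R).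
Variables (q l0 K : R -> R) (k : R -> R -> R).
Hypothesis cq : continuous q.
Hypothesis cK : continuous K.
Hypothesis dl0 : forall s, ider l0 s (K s).
Let l y s := q y + l0 s.
Hypothesis hk : goursat_kernel_spec l k.
Implicit Types (g h : R -> R) (x t : R).

Let cl0 : continuous l0. Proof. exact: ider_cont dl0. Qed.

Let cl : cont2 l.
Proof.
apply: contD; first by apply: (cont_comp1 (u := q)) => //; exact: continuous_fst.
by apply: (cont_comp1 (u := l0)) => //; exact: continuous_snd.
Qed.

Let cly y : continuous (l y). Proof. exact: cont_sect cl. Qed.
Let ck : cont2 k. Proof. exact: hk.1. Qed.
Let ckx x : continuous (k x). Proof. exact: cont_sect ck. Qed.

(** Retarded coordinates: this is the wave at position [x] and time [x + t]. The impulse itself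
    contributes [g], its tail the convolution. *)
Definition Zw g x t := g t + conv (k x) g t.
(** The potential and memory terms integrated once in time, as [Qw_int] shows; in this form they are
    continuous even for merely integrable [g]. *)
Definition Qw g x t := conv (l x) (Zw g x) t.

Lemma cont_Zc g : locint g -> cont2 (fun x t => conv (k x) g t).
Proof. by move=> lg; exact: cont2_conv_locint. Qed.

Lemma locint_Zw g x : locint g -> locint (Zw g x).
Proof.
move=> lg; apply: locintD => //; apply: cont_locint.
exact: (@cont_sect R R (fun x t => conv (k x) g t) x (cont_Zc lg)).
Qed.

Lemma Qw_split g x t : locint g -> Qw g x t = conv (l x) g t + conv (l x) (conv (k x) g) t.
Proof.
move=> lg; rewrite /Qw /Zw convDr//; apply: cont_locint.
exact: (@cont_sect R R (fun x t => conv (k x) g t) x (cont_Zc lg)).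
Qed.

Lemma cont_Qw g : locint g -> cont2 (Qw g).
Proof.
move=> lg; rewrite (_ : Qw g = fun x t => conv (l x) g t + conv (l x) (conv (k x) g) t).
  apply: contD; first exact: (cont2_conv_locint cl lg).
  exact: (cont2_conv cl (cont_Zc lg)).
by apply/funext => x; apply/funext => t; exact: Qw_split.
Qed.

(** The kernel equation convolved with [g], since l * g + (l * k) * g = l * (g + k * g). *)
Lemma Zw_goursat g x t : locint g -> 0 <= t -> conv (k x) g t = goursat (Qw g) x t.
Proof.
move=> lg t0; have [_ Hk] := hk.
have cA : cont2 (fun y s => l y s + conv (l y) (k y) s).
  by apply: contD => //; exact: (cont2_conv cl ck).
rewrite (@eq_conv _ (k x) (goursat (fun y s => l y s + conv (l y) (k y) s) x) g g)//; last first.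
  by move=> s /andP[s0 _]; exact: Hk.
rewrite (goursat_conv _ t0 cA lg); apply: (eq_goursat _ t0) => y s _.
rewrite Qw_split// convDl//; last exact: cont_conv.
by rewrite convA.
Qed.

Lemma Qw_int g x t : locint g -> 0 <= t ->
  Qw g x t = \int[mu]_(s in `[0, t]) ((q x + l0 0) * Zw g x s + conv K (Zw g x) s).
Proof.
move=> lg t0; have lZ := locint_Zw x lg.
have cc : locint (conv K (Zw g x)) by apply: cont_locint; exact: conv_locint_cont.
have c1 : continuous (fun _ : R => 1 : R) by exact: cont_cst.
rewrite -conv1 convDr//; last exact: locintZ.
rewrite convZr// convA// -convZl// -convDl//; last 2 first.
- by apply: contM => //; exact: cont_cst.
- exact: cont_conv.
apply: eq_conv => // s /andP[s0 _].
rewrite conv1 -oint_ge// (FTC _ _ cK dl0) /l; ring.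
Qed.

Lemma Zw_x0 g t : locint g -> 0 <= t -> Zw g 0 t = g t.
Proof. by move=> lg t0; rewrite /Zw Zw_goursat// goursat_x0 addr0. Qed.

Lemma eq_Zw g h x t : (forall s, s <= t -> g s = h s) -> Zw g x t = Zw h x t.
Proof.
move=> gh; rewrite /Zw gh//; congr (_ + _).
by apply: eq_conv => // s /andP[_ st]; exact: gh.
Qed.

Lemma Zw_vanish g x (e t : R) : (forall s, s <= e -> g s = 0) -> t <= e -> Zw g x t = 0.
Proof.
move=> g0 te; rewrite (@eq_Zw g (fun=> 0)); last by move=> s st; rewrite g0// (le_trans st).
by rewrite /Zw add0r conv_eq0.
Qed.

Lemma ZwD g h x t : locint g -> locint h ->
  Zw (fun s => g s + h s) x t = Zw g x t + Zw h x t.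
Proof. by move=> lg lh; rewrite /Zw convDr//; ring. Qed.

Lemma ZwZ (c : R) g x t : locint g -> Zw (fun s => c * g s) x t = c * Zw g x t.
Proof. by move=> lg; rewrite /Zw convZr//; ring. Qed.

Section Smooth.

Lemma cont_Zw g : continuous g -> cont2 (Zw g).
Proof.
move=> cg; apply: contD; last by apply: cont_Zc; exact: cont_locint.
by apply: (cont_comp1 (u := g)) => //; exact: continuous_snd.
Qed.

Lemma causal_Zw g x : causal g -> causal (Zw g x).
Proof. by move=> cg t; apply: Zw_vanish. Qed.

Lemma causal_Qw g x : causal (Qw g x).
Proof. by move=> t t0; rewrite /Qw conv_le0. Qed.

Variable g : R -> R.
Hypothesis sg : smooth g.
Hypothesis g0 : causal g.
Let cg : continuous g. Proof. exact: smooth_cont. Qed.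
Let lg : locint g. Proof. exact: cont_locint. Qed.
Notation g1 := (derive1 g).
Let sg1 : smooth g1. Proof. exact: smooth_derive1. Qed.
Let cg1 : continuous g1. Proof. exact: smooth_cont. Qed.
Let lg1 : locint g1. Proof. exact: cont_locint. Qed.
Let g10 : causal g1. Proof. exact: causal_derive1. Qed.

Lemma Zw_dt x t : ider (Zw g x) t (Zw g1 x t).
Proof.
apply: iderD; first exact: smooth_ider.
by apply: ider_conv_r => // s; exact: smooth_ider.
Qed.

Lemma Qw_dt x t : ider (Qw g x) t (Qw g1 x t).
Proof.
apply: ider_conv_r => //.
- exact: (@cont_sect R R (Zw g1) x (cont_Zw cg1)).
- exact: Zw_dt.
- exact: causal_Zw.
- exact: causal_Zw.
Qed.

Lemma Qw_eq x t : 0 <= t -> Qw g1 x t = (q x + l0 0) * Zw g x t + conv K (Zw g x) t.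
Proof.
move=> t0; rewrite /Qw (@conv_ibp R (l x) K (Zw g x) (Zw g1 x))//.
- exact: (@cont_sect R R (Zw g1) x (cont_Zw cg1)).
- by move=> s; apply: ider_val (iderD (ider_cst (q x) s) (dl0 s)) _; rewrite add0r.
- exact: Zw_dt.
- exact: causal_Zw.
Qed.

End Smooth.

Definition Yint g x t y := Qw g y (t + 2 * x - 2 * y).
(** The integral in [goursat] along the backward characteristic on which position plus time is
    constant. By causality [Qw] vanishes beyond [x + t / 2], so larger upper bounds give the same
    value; [x + |t|] is one for both signs of [t]. *)
Definition Yw g x t := oint x (x + `|t|) (Yint g x t).

Let cYint g : continuous g -> continuous (fun z : (R * R) * R => Yint g z.1.1 z.1.2 z.2).
Proof.
move=> cg; apply: (cont_comp2 (u := Qw g)).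
- by apply: cont_Qw; exact: cont_locint.
- exact: continuous_snd.
- have c1 := @continuous_fst (R * R)%type R; have c2 := @continuous_snd (R * R)%type R.
  apply: contD; last by apply: contN; apply: contM => //; exact: cont_cst.
  apply: contD.
    by apply: (cont_comp1 (u := snd)) => //; exact: continuous_snd.
  apply: contM; first exact: cont_cst.
  by apply: (cont_comp1 (u := fst)) => //; exact: continuous_fst.
Qed.

Lemma cont_Yw g : continuous g -> cont2 (Yw g).
Proof.
move=> cg; apply: (@cont_oint R (R * R)%type (fun p => Yint g p.1 p.2) fst (fun p => p.1 + `|p.2|)).
- exact: cYint.
- exact: continuous_fst.
- apply: contD; first exact: continuous_fst.
  by apply: cont_norm; exact: continuous_snd.
Qed.

Lemma Yw_eq g x t X : continuous g -> x + t / 2 <= X -> Yw g x t = oint x X (Yint g x t).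
Proof.
move=> cg xX; have lY : locint (Yint g x t).
  apply: cont_locint; exact: (@cont_sect R (R * R)%type (fun p => Yint g p.1 p.2) (x, t) (cYint cg)).
rewrite -(oint_cat x (x + `|t|) X lY) -[LHS]addr0; congr (_ + _).
rewrite -(oint0 (x + `|t|) X); apply: eq_oint => y /andP[y1 _].
rewrite /Yint causal_Qw//.
suff : x + t / 2 <= y by lra.
apply: le_trans y1; rewrite le_min xX lerD2l andbT.
have [t0|t0] := leP 0 t; [rewrite ger0_norm//|rewrite ltr0_norm//]; lra.
Qed.

Lemma causal_Yw g x : causal (Yw g x).
Proof.
move=> t t0; rewrite /Yw -[RHS](oint0 x (x + `|t|)); apply: eq_oint => y.
rewrite min_l ?lerDl// => /andP[xy _]; rewrite /Yint causal_Qw//; lra.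
Qed.

Section SmoothDerivatives.
Variable g : R -> R.
Hypothesis sg : smooth g.
Hypothesis g0 : causal g.
Let cg : continuous g. Proof. exact: smooth_cont. Qed.
Let lg : locint g. Proof. exact: cont_locint. Qed.
Notation g1 := (derive1 g).
Let sg1 : smooth g1. Proof. exact: smooth_derive1. Qed.
Let cg1 : continuous g1. Proof. exact: smooth_cont. Qed.
Let lg1 : locint g1. Proof. exact: cont_locint. Qed.

Let cYx (h : R -> R) t : continuous h -> cont2 (fun x y => Yint h x t y).
Proof.
move=> ch; apply: (cont_comp1 (u := fun z : (R * R) * R => Yint h z.1.1 z.1.2 z.2)
  (a := fun p : R * R => ((p.1, t), p.2))); first exact: cYint.
apply: cont_pair; last exact: continuous_snd.
by apply: cont_pair; [exact: continuous_fst|exact: cst_continuous].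
Qed.

Let cYt (h : R -> R) x : continuous h -> cont2 (fun t y => Yint h x t y).
Proof.
move=> ch; apply: (cont_comp1 (u := fun z : (R * R) * R => Yint h z.1.1 z.1.2 z.2)
  (a := fun p : R * R => ((x, p.1), p.2))); first exact: cYint.
apply: cont_pair; last exact: continuous_snd.
by apply: cont_pair; [exact: cst_continuous|exact: continuous_fst].
Qed.

Lemma Yw_dx x t : ider (Yw g ^~ t) x (2 * Yw g1 x t - Qw g x t).
Proof.
(* An upper bound common to all points near [x]: only the lower bound still varies. *)
set X := x + 1 + `|t|.
have tX y : y < x + 1 -> y + t / 2 <= X.
  move=> yx; rewrite /X; apply: lerD; first exact: ltW.
  by have [t0|t0] := leP 0 t; [rewrite ger0_norm//|rewrite ltr0_norm//]; lra.
apply: (@oo_ider _ (fun x => oint x X (Yint g x t)) _ _ (x - 1) (x + 1)).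
- by apply/andP; split; lra.
- by move=> y /andP[_ yx]; rewrite (@Yw_eq g y t X cg (tX _ yx)).
have := @leibniz_left R (fun x y => Yint g x t y) (fun x y => 2 * Yint g1 x t y) x X.
move=> H; apply: ider_val (H _ _ _) _.
- exact: cYx.
- by apply: contM; [exact: cont_cst|exact: cYx].
- move=> z y; rewrite mulrC /Yint.
  apply: (ider_comp (f := Qw g y) (g := fun z => t + 2 * z - 2 * y)); first exact: Qw_dt.
  apply: (@eq_ider _ (fun z => 2 * z + (t - 2 * y))); first by move=> ?; ring.
  exact: ider_lin.
- rewrite (@ointZ R x X 2 (Yint g1 x t)); last first.
    apply: cont_locint; apply: (@cont_sect R R (fun x y => Yint g1 x t y) x).
    exact: cYx.
  rewrite -(@Yw_eq g1 x t X cg1); last by apply: tX; lra.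
  rewrite /Yint (_ : t + 2 * x - 2 * x = t); last by ring.
  by [].
Qed.

Lemma Yw_dt x t : ider (Yw g x) t (Yw g1 x t).
Proof.
set X := x + `|t| + 1.
have tX s : t - 1 < s < t + 1 -> x + s / 2 <= X.
  move=> /andP[s1 s2]; rewrite /X -addrA lerD2l.
  by have [t0|t0] := leP 0 t; [rewrite ger0_norm//|rewrite ltr0_norm//]; lra.
apply: (@oo_ider _ (fun t => oint x X (Yint g x t)) _ _ (t - 1) (t + 1)).
- by apply/andP; split; lra.
- by move=> s ts; rewrite (@Yw_eq g x s X cg (tX _ ts)).
rewrite (@Yw_eq g1 x t X cg1); last by apply: tX; apply/andP; split; lra.
apply: leibniz_oint; [exact: cYt|exact: cYt|move=> s y].
rewrite -[Yint g1 x s y]mulr1; apply: (ider_comp (f := Qw g y) (g := fun s => s + 2 * x - 2 * y)).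
  exact: Qw_dt.
apply: (@eq_ider _ (fun s => 1 * s + (2 * x - 2 * y))); first by move=> ?; ring.
exact: ider_lin.
Qed.

Lemma goursat_Yw x t : 0 <= t -> goursat (Qw g) x t =
  2^-1 * (oint 0 x (Qw g ^~ t) + (Yw g x t - oint 0 (t / 2) (fun e => Qw g e (t - 2 * e)))).
Proof.
move=> t0.
have E : oint 0 (t / 2) (fun e => Qw g (x + e) (t - 2 * e)) = Yw g x t.
  rewrite (@Yw_eq g x t (x + t / 2) cg (lexx _)).
  have cY : continuous (Yint g x t).
    exact: (@cont_sect R (R * R)%type (fun p => Yint g p.1 p.2) (x, t) (cYint cg)).
  have := @oint_shift R 0 (t / 2) x (Yint g x t) cY.
  rewrite add0r (addrC _ x) => <-.
  congr oint; apply/funext => e; rewrite /Yint (addrC e).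
  have -> : t + 2 * x - 2 * (x + e) = t - 2 * e by ring.
  by [].
rewrite goursatE; exact: (congr1 (fun z => 2^-1 * (oint 0 x (Qw g ^~ t) +
  (z - oint 0 (t / 2) (fun e => Qw g e (t - 2 * e))))) E).
Qed.

(** The derivative of [goursat] is half of Qw g + (2 Yw g1 - Qw g): the terms in [Qw] cancel. *)
Lemma Zw_dx x t : ider (Zw g ^~ t) x (Yw g1 x t).
Proof.
have [t0|/ltW t0] := leP 0 t; last first.
  rewrite (causal_Yw g1 x t0); apply: (@eq_ider _ (fun=> 0)); last exact: ider_cst.
  by move=> y; rewrite causal_Zw.
pose c := oint 0 (t / 2) (fun e => Qw g e (t - 2 * e)).
apply: (@eq_ider _ (fun x => g t + 2^-1 * (oint 0 x (Qw g ^~ t) + (Yw g x t - c)))).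
  by move=> y; rewrite /Zw (Zw_goursat _ lg t0) (goursat_Yw _ t0).
have cQt : continuous (Qw g ^~ t).
  exact: (@cont_sect R R (fun t x => Qw g x t) t (cont2_swap (cont_Qw lg))).
apply: ider_val (iderD (ider_cst (g t) x) (iderZ 2^-1 (iderD (ider_oint 0 x cQt)
  (iderB (Yw_dx x t) (ider_cst c x))))) _.
by field.
Qed.

End SmoothDerivatives.

Definition Ww g x t := Zw g x (t - x).
(** Back in physical time, [Wx] and [Wxx] are the chain rule for the argument [t - x] applied to
    [Zw_dx] and [Yw_dx]. *)
Definition Wx g x t := Yw (derive1 g) x (t - x) - Zw (derive1 g) x (t - x).
Definition Wxx g x t := Zw (derive1 (derive1 g)) x (t - x) - Qw (derive1 g) x (t - x).

Let cont_ret (u : R -> R -> R) : cont2 u -> cont2 (fun x t => u x (t - x)).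
Proof.
move=> cu; apply: (cont_comp2 (u := u)) => //; first exact: continuous_fst.
by apply: contD; [exact: continuous_snd|apply: contN; exact: continuous_fst].
Qed.

Section WaveEquation.
Variable g : R -> R.
Hypothesis sg : smooth g.
Hypothesis g0 : causal g.
Let cg : continuous g. Proof. exact: smooth_cont. Qed.
Notation g1 := (derive1 g).
Let sg1 : smooth g1. Proof. exact: smooth_derive1. Qed.
Let cg1 : continuous g1. Proof. exact: smooth_cont. Qed.
Let g10 : causal g1. Proof. exact: causal_derive1. Qed.
Notation g2 := (derive1 g1).
Let sg2 : smooth g2. Proof. exact: smooth_derive1. Qed.
Let cg2 : continuous g2. Proof. exact: smooth_cont. Qed.

Lemma cont_Ww : cont2 (Ww g). Proof. exact/cont_ret/cont_Zw. Qed.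

Lemma cont_Wx : cont2 (Wx g).
Proof.
apply: contD; first exact: (cont_ret (cont_Yw cg1)).
by apply: contN; exact: (cont_ret (cont_Zw cg1)).
Qed.

Lemma cont_Wxx : cont2 (Wxx g).
Proof.
apply: contD; first exact: (cont_ret (cont_Zw cg2)).
by apply: contN; exact: (cont_ret (cont_Qw (cont_locint cg1))).
Qed.

Lemma Ww_dt x t : ider (Ww g x) t (Ww g1 x t).
Proof. by apply: ider_shift; exact: Zw_dt. Qed.

Lemma Wx_dt x t : ider (Wx g x) t (Wx g1 x t).
Proof.
apply: iderB; first by apply: (ider_shift (f := Yw g1 x)); exact: Yw_dt.
by apply: (ider_shift (f := Zw g1 x)); exact: Zw_dt.
Qed.

Let d_ret x t : ider (fun x => t - x) x (-1).
Proof. by apply: ider_val (iderB (ider_cst t x) (ider_id x)) _; rewrite sub0r. Qed.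

Lemma Ww_dx x t : ider (Ww g ^~ t) x (Wx g x t).
Proof.
apply: ider_val (ider_chainT (u1 := Yw g1) (u2 := Zw g1) _ _ _ (ider_id x) (d_ret x t)) _.
- exact: cont_Yw.
- exact: Zw_dx.
- exact: Zw_dt.
- by rewrite /Wx; ring.
Qed.

Lemma Wx_dx x t : ider (Wx g ^~ t) x (Wxx g x t).
Proof.
have h1 : ider (fun x => Yw g1 x (t - x)) x
    ((2 * Yw g2 x (t - x) - Qw g1 x (t - x)) * 1 + Yw g2 x (t - x) * -1).
  apply: (ider_chainT (u1 := fun x t => 2 * Yw g2 x t - Qw g1 x t) (u2 := Yw g2)).
  - apply: contD.
      by apply: contM; [exact: cont_cst|exact: cont_Yw].
    by apply: contN; exact: (cont_Qw (cont_locint cg1)).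
  - exact: Yw_dx.
  - exact: Yw_dt.
  - exact: ider_id.
  - exact: d_ret.
have h2 : ider (fun x => Zw g1 x (t - x)) x (Yw g2 x (t - x) * 1 + Zw g2 x (t - x) * -1).
  apply: (ider_chainT (u1 := Yw g2) (u2 := Zw g2)).
  - exact: cont_Yw.
  - exact: Zw_dx.
  - exact: Zw_dt.
  - exact: ider_id.
  - exact: d_ret.
by apply: ider_val (iderB h1 h2) _; rewrite /Wxx; ring.
Qed.

(** By the form of [Wxx], W_tt - W_xx is [Qw g1] at the retarded time; [Qw_eq] turns it into the
    potential and memory terms, and causality lets the delay pass through the convolution. *)
Lemma wave_eq x t : 0 <= x ->
  Ww g2 x t = Wxx g x t + (q x + l0 0) * Ww g x t + conv K (Ww g x) t.
Proof.
move=> x0; rewrite /Wxx; suff : Qw g1 x (t - x) = (q x + l0 0) * Ww g x t + conv K (Ww g x) t.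
  by move=> ->; rewrite /Ww; ring.
have -> : conv K (Ww g x) t = conv K (Zw g x) (t - x).
  apply: (conv_delay (h := Zw g x)) => //; last exact: causal_Zw.
  exact: (@cont_sect R R (Zw g) x (cont_Zw cg)).
rewrite /Ww; have [tx|/ltW tx] := leP 0 (t - x); first by rewrite Qw_eq.
by rewrite causal_Qw// causal_Zw// conv_le0//; ring.
Qed.

Lemma Ww_vanish x (e t : R) : (forall s, s <= e -> g s = 0) -> t <= e + x -> Ww g x t = 0.
Proof. by move=> ge te; apply: (@Zw_vanish g x e) => //; rewrite lerBlDr. Qed.

End WaveEquation.

Lemma smooth_Ww g x : smooth g -> causal g -> smooth (Ww g x).
Proof.
move=> sg g0; apply: (@smooth_intro R (fun h => exists g, [/\ smooth g, causal g & h = Ww g x])).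
  move=> _ [f [sf f0 ->]]; exists (Ww (derive1 f) x).
    by exists (derive1 f); split; [exact: smooth_derive1|exact: causal_derive1|].
  by move=> t; exact: Ww_dt.
by exists g.
Qed.

End Wave.

(** * Classical solutions *)

Lemma within_retract (T U : topologicalType) (D : set T) (r : T -> T) (f : T -> U) :
  continuous r -> (forall x, D (r x)) -> {within D, continuous f} ->
  continuous (fun x => f (r x)).
Proof.
move=> cr Dr /subspace_continuousP cf x; apply: (cvg_comp r f _ (cf _ (Dr x))).
move=> P WP; have := cr x _ WP; rewrite !nbhs_simpl/=; apply: filterS => y; apply; exact: Dr.
Qed.

(** * Twice differentiable functions bundled with their derivatives *)

Section Jets.
Context {R : realType}.

(* The index 1 stands for a derivative in x, the index 2 for one in t. *)
Record jet := Jet {j0 : R -> R -> R; j1 : R -> R -> R; j2 : R -> R -> R;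
  j11 : R -> R -> R; j12 : R -> R -> R; j22 : R -> R -> R}.

Definition isC2 (j : jet) :=
  [/\ [/\ cont2 (j0 j), cont2 (j1 j) & cont2 (j2 j)],
      [/\ cont2 (j11 j), cont2 (j12 j) & cont2 (j22 j)] &
      forall x t, [/\ ider (j0 j ^~ t) x (j1 j x t), ider (j0 j x) t (j2 j x t),
        ider (j1 j ^~ t) x (j11 j x t), ider (j1 j x) t (j12 j x t) &
        ider (j2 j x) t (j22 j x t)]].

Lemma isC2_C2_on (D : set (R * R)) u j : isC2 j ->
  (forall p, D p -> u p.1 p.2 = j0 j p.1 p.2) -> C2_on D u.
Proof.
move=> [[c0 c1 c2] [c11 c12 c22] dj] uj.
exists (j1 j), (j2 j), (j11 j), (j12 j), (j22 j); split.
- split; try exact: continuous_subspaceT.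
  apply: (@subspace_eq_continuous _ _ _ (fun p : R * R => j0 j p.1 p.2)).
    by move=> p; rewrite inE => /uj h; rewrite /from_subspace/= h.
  exact: continuous_subspaceT.
- by split; exact: continuous_subspaceT.
- move=> x t Dxt; have [d1 d2 d3 d4 d5] := dj x t.
  have nD : \forall p \near (x, t), D p by exact: Dxt.
  split; try by [exact: d3|exact: d4|exact: d5].
  + apply: near_ider d1; case: nD => -[P Q]/= [nP nQ] PQ.
    apply: filterS nP => y Py; rewrite (uj (y, t))//; apply: PQ; split=> //=.
    exact: nbhs_singleton nQ.
  + apply: near_ider d2; case: nD => -[P Q]/= [nP nQ] PQ.
    apply: filterS nQ => y Qy; rewrite (uj (x, y))//; apply: PQ; split=> //=.
    exact: nbhs_singleton nP.
Qed.

Definition jetD (a b : jet) := let s u v := fun x t : R => u x t + v x t : R in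
  Jet (s (j0 a) (j0 b)) (s (j1 a) (j1 b)) (s (j2 a) (j2 b))
      (s (j11 a) (j11 b)) (s (j12 a) (j12 b)) (s (j22 a) (j22 b)).

Lemma isC2D a b : isC2 a -> isC2 b -> isC2 (jetD a b).
Proof.
move=> [[? ? ?] [? ? ?] da] [[? ? ?] [? ? ?] db]; split.
- by split; apply: contD.
- by split; apply: contD.
- move=> x t; have [? ? ? ? ?] := da x t; have [? ? ? ? ?] := db x t.
  by split; apply: iderD.
Qed.

Definition jet_flip (L : R) (a : jet) :=
  Jet (fun x t => j0 a (L - x) t) (fun x t => - j1 a (L - x) t) (fun x t => j2 a (L - x) t)
      (fun x t => j11 a (L - x) t) (fun x t => - j12 a (L - x) t) (fun x t => j22 a (L - x) t).

Lemma cont_flip L (u : R -> R -> R) : cont2 u -> cont2 (fun x t => u (L - x) t).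
Proof.
move=> cu; apply: (cont_comp2 (u := u)) => //; last exact: continuous_snd.
by apply: contD; [exact: cont_cst|apply: contN; exact: continuous_fst].
Qed.

Lemma isC2_flip L a : isC2 a -> isC2 (jet_flip L a).
Proof.
move=> [[? ? ?] [? ? ?] da]; split.
- by split; try apply: contN; exact: cont_flip.
- by split; try apply: contN; exact: cont_flip.
- move=> x t; have [? ? d3 ? ?] := da (L - x) t; split => //=.
  + by apply: (ider_rev (f := j0 a ^~ t)).
  + by apply: ider_val (iderN (ider_rev (f := j1 a ^~ t) d3)) _; rewrite opprK.
  + exact: iderN.
Qed.

Definition jet_exp (c : R) (a : jet) := let E t := expR (c * t) in
  Jet (fun x t => E t * j0 a x t) (fun x t => E t * j1 a x t)
      (fun x t => E t * (c * j0 a x t + j2 a x t))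
      (fun x t => E t * j11 a x t) (fun x t => E t * (c * j1 a x t + j12 a x t))
      (fun x t => E t * (c * (c * j0 a x t + j2 a x t) + (c * j2 a x t + j22 a x t))).

Lemma jet_expE c a x t : j0 (jet_exp c a) x t = expR (c * t) * j0 a x t.
Proof. by []. Qed.

Lemma isC2_exp c a : isC2 a -> isC2 (jet_exp c a).
Proof.
move=> [[c0 c1 c2] [c11 c12 c22] da].
have cE (u : R -> R -> R) : cont2 u -> cont2 (fun x t => expR (c * t) * u x t).
  move=> cu; apply: contM => //; apply: (cont_comp1 (u := @expR R)).
    exact: continuous_expR'.
  by apply: contM; [exact: cont_cst|exact: continuous_snd].
have cc (u : R -> R -> R) : cont2 u -> cont2 (fun x t => c * u x t).
  by move=> cu; apply: contM => //; exact: cont_cst.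
have c02 : cont2 (fun x t => c * j0 a x t + j2 a x t) by apply: contD => //; exact: cc.
have c12' : cont2 (fun x t => c * j1 a x t + j12 a x t) by apply: contD => //; exact: cc.
have c22' : cont2 (fun x t => c * (c * j0 a x t + j2 a x t) + (c * j2 a x t + j22 a x t)).
  apply: contD; first exact: (cc _ c02).
  by apply: contD => //; exact: cc.
split; first by split; exact: cE.
  by split; exact: cE.
move=> x t; have [d1 d2 d3 d4 d5] := da x t.
have dE : ider (fun s => expR (c * s)) t (c * expR (c * t)) by exact: ider_exp_lin.
have dt (u : R -> R) (u' : R) : ider u t u' ->
    ider (fun s => expR (c * s) * u s) t (expR (c * t) * (c * u t + u')).
  by move=> du; apply: ider_val (iderM dE du) _; ring.
split.
- exact: (iderZ (expR (c * t)) d1).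
- exact: dt.
- exact: (iderZ (expR (c * t)) d3).
- exact: dt.
- apply: (dt (fun s => c * j0 a x s + j2 a x s)).
  by apply: iderD => //; exact: iderZ.
Qed.

End Jets.

(** * Existence of classical solutions *)

Section ClassicalExistence.
Context {R : realType}.
Notation mu := (@lebesgue_measure R).
Variable N : R -> R.
Hypothesis hN : Ck 3 N.
Hypothesis hN0 : N 0 = 1.
Notation gam := (gamma N).
Notation K := (memory N).

(** Time primitive of alpha delta + K; the value [alpha N] at 0 is the jump due to the Dirac
    mass. *)
Definition lmem s := alpha N + oint 0 s K.

Lemma cont_memory : continuous K.
Proof.
apply: contM; last exact: cont_r2.
apply: (cont_comp1 (u := @expR R)); first exact: continuous_expR'.
by apply: contN; apply: contM; [exact: cont_cst|exact: cont_id].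
Qed.

Lemma ider_lmem s : ider lmem s (K s).
Proof.
apply: ider_val (iderD (ider_cst _ s) (ider_oint 0 s cont_memory)) _.
by rewrite add0r.
Qed.

Lemma lmem0 : lmem 0 = alpha N.
Proof. by rewrite /lmem ointaa addr0. Qed.

Definition wkernel (q : R -> R) : R -> R -> R :=
  xget (fun _ _ => 0) [set k | goursat_kernel_spec (fun y s => q y + lmem s) k].

Lemma wkernelP q : continuous q ->
  goursat_kernel_spec (fun y s => q y + lmem s) (wkernel q).
Proof.
move=> cq; have [|k Hk] := @goursat_kernel_exists R (fun y s => q y + lmem s).
  apply: contD; first by apply: (cont_comp1 (u := q)) => //; exact: continuous_fst.
  apply: (cont_comp1 (u := lmem)); last exact: continuous_snd.
  exact: ider_cont ider_lmem.
exact: (@xgetPex _ (fun _ _ => 0) [set k | goursat_kernel_spec (fun y s => q y + lmem s) k] (ex_intro _ k Hk)).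
Qed.

Definition wave q g := Ww (wkernel q) g.

Definition wave_jet q g : jet := let l := lmem in let k := wkernel q in
  Jet (Ww k g) (Wx q l k g) (Ww k (derive1 g)) (Wxx q l k g)
      (Wx q l k (derive1 g)) (Ww k (derive1 (derive1 g))).

Section OneWave.
Variables (q : R -> R) (cq : continuous q).
Let hk := wkernelP cq.

Lemma wave_jetC2 g : smooth g -> causal g -> isC2 (wave_jet q g).
Proof.
move=> sg g0; have sg1 := smooth_derive1 sg; have g10 := causal_derive1 sg g0.
have sg2 := smooth_derive1 sg1.
split.
- split; [exact: (cont_Ww hk)|exact: (cont_Wx cq ider_lmem hk)|exact: (cont_Ww hk)].
- split; [exact: (cont_Wxx cq ider_lmem hk)|exact: (cont_Wx cq ider_lmem hk)|exact: (cont_Ww hk)].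
- move=> x t; split.
  + exact: (Ww_dx cq ider_lmem hk).
  + exact: (Ww_dt hk).
  + exact: (Wx_dx cq ider_lmem hk).
  + exact: (Wx_dt cq ider_lmem hk).
  + exact: (Ww_dt hk).
Qed.

Lemma wave_jet_eq g x t : smooth g -> causal g -> 0 <= x ->
  j22 (wave_jet q g) x t = j11 (wave_jet q g) x t + (q x + alpha N) * j0 (wave_jet q g) x t
    + conv K (j0 (wave_jet q g) x) t.
Proof.
move=> sg g0 x0; rewrite -lmem0.
exact: (wave_eq cont_memory ider_lmem hk).
Qed.

Lemma wave_x0 g t : continuous g -> causal g -> wave q g 0 t = g t.
Proof.
move=> cg g0; rewrite /wave /Ww subr0; have [t0|/ltW t0] := leP 0 t.
  by apply: (Zw_x0 cq ider_lmem hk) => //; exact: cont_locint.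
by rewrite (causal_Zw _ _ g0) // g0.
Qed.

End OneWave.

(* Equation satisfied by w = e^(gamma t) W. *)
Lemma viscoelastic_of_wave (j : jet) (qx x t : R) : isC2 j ->
  (forall t, t <= 0 -> j0 j x t = 0) ->
  (forall t, 0 <= t -> j22 j x t = j11 j x t + (qx + alpha N) * j0 j x t + conv K (j0 j x) t) ->
  0 <= t ->
  j2 (jet_exp gam j) x t =
    conv N (fun s => j11 (jet_exp gam j) x s + qx * j0 (jet_exp gam j) x s) t.
Proof.
move=> cj jc Hj t0.
have [[c0 c1 c2] [c11 c12 c22] dj] := isC2_exp gam cj.
have sec (u : R -> R -> R) : cont2 u -> continuous (u x) by move=> cu; exact: cont_sect cu.
have dj0 s : ider (j0 j x) s (j2 j x s) by have [_ _ H] := cj; have [] := H x s.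
have j20 : j2 j x 0 = 0 by apply: (@ider_causal _ (j0 j x)) (dj0 0) _.
pose phi s := j11 (jet_exp gam j) x s + qx * j0 (jet_exp gam j) x s.
have cphi : continuous phi.
  by apply: contD; [exact: sec|apply: contM; [exact: cont_cst|exact: sec]].
have z0 : j0 (jet_exp gam j) x 0 = 0 by rewrite jet_expE jc// mulr0.
have z1 : j2 (jet_exp gam j) x 0 = 0 by rewrite /= jc// j20 mulr0 add0r mulr0.
have D1 s : ider (j0 (jet_exp gam j) x) s (j2 (jet_exp gam j) x s) by have [] := dj x s.
have D2 s : ider (j2 (jet_exp gam j) x) s (j22 (jet_exp gam j) x s) by have [] := dj x s.
apply: (@second_order_inv R N hN hN0 (j0 (jet_exp gam j) x) (j2 (jet_exp gam j) x)
  (j22 (jet_exp gam j) x) phi t t0 cphi (sec _ c22) D1 D2 z0 z1).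
move=> s /andP[s0 _]; rewrite /phi /=; rewrite (Hj s s0).
(* The weight in [memory] is made for this: multiplication by e^(gamma t) turns convolution with [K]
   into convolution with r''. *)
have -> : conv (derive1n 2 (resolvent N)) (fun t => expR (gam * t) * j0 j x t) s =
    expR (gam * s) * conv K (j0 j x) s.
  have cj0 : continuous (j0 j x) by have [[cj0 _ _] _ _] := cj; exact: cont_sect cj0.
  rewrite -convZr; [|exact: cont_memory|exact: cont_locint].
  rewrite !convE; apply: eq_Rintegral => z _.
  rewrite /memory (_ : gam * s = gam * (s - z) + gam * z); last by ring.
  rewrite expRD -mulrA; set a := derive1n _ _ _.
  have : expR (- (gam * (s - z))) * expR (gam * (s - z)) = 1 by rewrite -expRD addNr expR0.
  move: (expR (gam * (s - z))) (expR (- (gam * (s - z)))) (expR (gam * z)) (j0 j x z).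
  by move=> E F G J EF; rewrite (_ : F * (a * _) = (F * E) * (a * (G * J))); [rewrite EF mul1r|ring].
(* With r(0) = 2 gamma the terms in W_t cancel, and alpha absorbs the remaining gamma^2. *)
have -> : resolvent N 0 = 2 * gam by rewrite /gamma; field.
have -> : derive1 (resolvent N) 0 = alpha N - gam ^+ 2 by rewrite /alpha /gamma; field.
by ring.
Qed.

(** * Reflections at both ends *)

Section Reflections.
Variables (L : R) (q : R -> R).
Hypothesis L0 : 0 < L.
Hypothesis cq : continuous q.
Let qr x := q (L - x).
Let cqr : continuous qr. Proof. exact: cont_rev. Qed.

(* The amplitude at x = 0, delayed by 2 L, of a wave reflected at x = L and then at x = 0. *)
Definition echo g := wave qr (wave q g L) L.

Lemma wave_causal p g x : causal g -> 0 <= x -> causal (wave p g x).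
Proof.
move=> g0 x0 t t0; apply: (@Ww_vanish _ (wkernel p) g x 0) => //.
by rewrite add0r (le_trans t0).
Qed.

Lemma wave_vanish p g (x e t : R) : (forall s, s <= e -> g s = 0) -> t <= e + x ->
  wave p g x t = 0.
Proof. exact: Ww_vanish. Qed.

Lemma wave_smooth p g x : continuous p -> smooth g -> causal g -> smooth (wave p g x).
Proof. by move=> cp sg g0; exact: (smooth_Ww (wkernelP cp)). Qed.

Lemma echo_causal g : causal g -> causal (echo g).
Proof. by move=> g0; do 2 (apply: wave_causal; last exact: ltW). Qed.

Lemma echo_smooth g : smooth g -> causal g -> smooth (echo g).
Proof.
move=> sg g0; apply: (wave_smooth _ cqr (wave_smooth _ cq sg g0)).
by apply: wave_causal => //; exact: ltW.
Qed.

(** Two crossings of the interval delay the signal by [2 * L]; hence only finitely many echoes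
    matter at a given time. *)
Lemma echo_vanish g (e : R) : (forall s, s <= e -> g s = 0) ->
  forall t, t <= e + 2 * L -> echo g t = 0.
Proof.
move=> ge t te; apply: (@wave_vanish _ _ L (e + L)) => [s se|]; last by lra.
exact: (@wave_vanish _ _ L e).
Qed.

Lemma eq_wave p g h x t : (forall s, s <= t - x -> g s = h s) -> wave p g x t = wave p h x t.
Proof. by move=> gh; exact: eq_Zw. Qed.

Lemma eq_echo g h t : (forall s, s <= t - 2 * L -> g s = h s) -> echo g t = echo h t.
Proof.
move=> gh; apply: eq_wave => s st; apply: eq_wave => z zs; apply: gh; lra.
Qed.

Lemma waveD p g h x t : continuous p -> continuous g -> continuous h ->
  wave p (fun s => g s + h s) x t = wave p g x t + wave p h x t.
Proof.
by move=> cp cg ch; apply: (ZwD (wkernelP cp)); exact: cont_locint.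
Qed.

Lemma waveN p g x t : continuous p -> continuous g ->
  wave p (fun s => - g s) x t = - wave p g x t.
Proof.
move=> cp cg; rewrite -mulN1r -(ZwZ (wkernelP cp)); last exact: cont_locint.
by apply: eq_wave => s _; rewrite mulN1r.
Qed.
Opaque wave.

Variable g : R -> R.
Hypothesis sg : smooth g.
Hypothesis g0 : causal g.

Let Sg n := iter n echo g.
Let Sg_causal n : causal (Sg n).
Proof. by elim: n => [//|n IH]; exact: echo_causal. Qed.
Let Sg_smooth n : smooth (Sg n).
Proof. by elim: n => [//|n IH]; exact: echo_smooth. Qed.
Let Sg_vanish n t : t <= 2 * L * n%:R -> Sg n t = 0.
Proof.
elim: n t => [|n IH] t; first by rewrite mulr0; exact: g0.
move=> tn; apply: (echo_vanish IH); move: tn; rewrite -natr1; lra.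
Qed.

Let Ap m t := \sum_(n < m) Sg n t.

Let Ap_eq m m' t : t <= 2 * L * m%:R -> t <= 2 * L * m'%:R -> Ap m t = Ap m' t.
Proof.
wlog mm' : m m' / (m <= m')%N => [W|] h h'.
  by case: (leqP m m') => [|/ltnW] le; [exact: W|apply/esym; exact: W].
rewrite -(subnK mm'); elim: (m' - m)%N => [|d IH]; first by rewrite add0n.
rewrite addSn /Ap big_ord_recr/= -/(Ap (d + m) t) -IH Sg_vanish ?addr0//.
by apply: le_trans h _; rewrite ler_wpM2l ?mulr_ge0 ?(ltW L0)// ler_nat leq_addl.
Qed.

Let bnd (t : R) := Num.bound (`|t| / (2 * L)).
Let bndP t : t <= 2 * L * (bnd t)%:R.
Proof.
have L2 : 0 < 2 * L by rewrite mulr_gt0.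
apply: le_trans (ler_norm _) _; rewrite -ler_pdivrMl// mulrC ltW//.
by apply: archi_boundP; rewrite divr_ge0// ltW.
Qed.

(* The sum over n of the n-fold echoes of g; finitely many of them have arrived at time t. *)
Definition source t := Ap (bnd t) t.

Let source_eq m t : t <= 2 * L * m%:R -> source t = Ap m t.
Proof. by move=> h; apply: Ap_eq. Qed.

Let Ap_smooth m : smooth (Ap m) /\ causal (Ap m).
Proof.
split; last by move=> t t0; rewrite /Ap big1// => i _; exact: Sg_causal.
elim: m => [|m IH].
  rewrite (_ : Ap 0 = fun=> 0); first exact: smooth_cst.
  by apply/funext => t; rewrite /Ap big_ord0.
rewrite (_ : Ap m.+1 = fun t => Ap m t + Sg m t); first exact: (smoothD IH (Sg_smooth m)).
by apply/funext => t; rewrite /Ap big_ord_recr.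
Qed.

Lemma source_causal : causal source.
Proof. by move=> t t0; rewrite /source; apply: (Ap_smooth _).2. Qed.

Lemma source_smooth : smooth source.
Proof.
apply: smooth_local => M; exists (Ap (bnd M)); first exact: (Ap_smooth _).1.
move=> t tM; apply: source_eq; apply: le_trans (ltW tM) _; exact: bndP.
Qed.

Lemma source_early t : t <= 2 * L -> source t = g t.
Proof.
by move=> tL; rewrite (@source_eq 1) ?mulr1// /Ap big_ord_recr/= big_ord0 add0r.
Qed.

Let echo_Ap m t : echo (Ap m) t = Ap m.+1 t - g t.
Proof.
have S0 s : echo (fun=> 0) s = 0.
  by apply: (@echo_vanish _ s) => //; rewrite lerDl mulr_ge0// ltW.
elim: m t => [|m IH] t.
  rewrite (_ : Ap 0 = fun=> 0); last by apply/funext => s; rewrite /Ap big_ord0.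
  by rewrite S0 /Ap big_ord_recr/= big_ord0 add0r subrr.
rewrite (_ : Ap m.+1 = fun s => Ap m s + Sg m s); last first.
  by apply/funext => s; rewrite /Ap big_ord_recr.
have cA : continuous (Ap m) by exact: (smooth_cont (Ap_smooth m).1).
have cS : continuous (Sg m) by exact: (smooth_cont (Sg_smooth m)).
have E : wave q (fun s => Ap m s + Sg m s) L = fun s => wave q (Ap m) L s + wave q (Sg m) L s.
  by apply/funext => s; exact: waveD.
rewrite {1}/echo E waveD//; last 2 first.
- exact: (smooth_cont (wave_smooth _ cq (Ap_smooth m).1 (Ap_smooth m).2)).
- exact: (smooth_cont (wave_smooth _ cq (Sg_smooth m) (@Sg_causal m))).
rewrite -/(echo (Ap m) t) -/(echo (Sg m) t) IH.
rewrite [in RHS]/Ap [in RHS]big_ord_recr/= -/(Ap m.+1 t) -/(Sg m.+1).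
by rewrite (_ : echo (Sg m) t = Sg m.+1 t)//; ring.
Qed.

(** The geometric series of echoes solves this fixed point equation; the delay lets a partial sum
    stand for the series at each time. *)
Lemma source_echo t : source t = g t + echo source t.
Proof.
have tm := bndP t; set m := bnd t in tm.
rewrite (@eq_echo source (Ap m)); last first.
  move=> s st; apply: source_eq; apply: le_trans st _; apply: le_trans tm.
  by rewrite gerBl mulr_ge0// ltW.
rewrite echo_Ap (@source_eq m.+1); first by rewrite addrC subrK.
by apply: le_trans tm _; rewrite ler_wpM2l ?mulr_ge0 ?(ltW L0)// ler_nat.
Qed.

(** Boundary value at x = L of the leftward wave, chosen to cancel the rightward wave arriving
    there. *)
Definition reflected t := - wave q source L t.

Lemma reflected_causal : causal reflected.
Proof.
move=> t t0; rewrite /reflected (wave_causal _ source_causal)//; first exact: oppr0.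
exact: ltW.
Qed.

Lemma reflected_smooth : smooth reflected.
Proof.
have sW := wave_smooth L cq source_smooth source_causal.
have := smoothM (smooth_cst (- 1)) sW.
by congr smooth; apply/funext => t; rewrite mulN1r.
Qed.

Definition bounce_jet := jetD (wave_jet q source) (jet_flip L (wave_jet qr reflected)).

Lemma bounceE x t :
  j0 bounce_jet x t = wave q source x t + wave qr reflected (L - x) t.
Proof. by []. Qed.

Lemma bounce_jetC2 : isC2 bounce_jet.
Proof.
apply: isC2D; first exact: (wave_jetC2 cq source_smooth source_causal).
exact: isC2_flip (wave_jetC2 cqr reflected_smooth reflected_causal).
Qed.

Lemma bounce_causal x t : 0 <= x <= L -> t <= 0 -> j0 bounce_jet x t = 0.
Proof.
move=> /andP[x0 xL] t0; rewrite bounceE (wave_causal _ source_causal x0 t0).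
have Lx : 0 <= L - x by rewrite subr_ge0.
by rewrite (wave_causal _ reflected_causal Lx t0) addr0.
Qed.

(** The leftward wave brings back minus the echo of [source], and [source_echo] leaves exactly
    [g]. *)
Lemma bounce_x0 t : j0 bounce_jet 0 t = g t.
Proof.
have sc : continuous source by exact: smooth_cont source_smooth.
rewrite bounceE subr0 (wave_x0 cq t sc source_causal).
have -> : wave qr reflected L t = - echo source t.
  rewrite /echo -waveN//; apply: smooth_cont.
  exact: wave_smooth cq source_smooth source_causal.
by rewrite source_echo; ring.
Qed.

Lemma bounce_xL t : j0 bounce_jet L t = 0.
Proof.
have sc : continuous reflected by exact: smooth_cont reflected_smooth.
by rewrite bounceE subrr (wave_x0 cqr t sc reflected_causal) /reflected subrr.
Qed.

(** The reflected wave leaves x = L only at time [L]. This identity later links the classical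
    solution with the mild one. *)
Lemma bounce_early x t : 0 <= x <= L -> t <= L -> j0 bounce_jet x t = wave q g x t.
Proof.
move=> /andP[x0 xL] tL; rewrite bounceE.
have refl0 s : s <= L -> reflected s = 0.
  move=> sL; rewrite /reflected (@wave_vanish _ _ L 0) ?oppr0//.
    exact: source_causal.
  by rewrite add0r.
rewrite (@wave_vanish qr reflected (L - x) L t)// ?addr0; last by lra.
by apply: eq_wave => s st; apply: source_early; lra.
Qed.

Lemma bounce_eq x t : 0 <= x <= L ->
  j22 bounce_jet x t = j11 bounce_jet x t + (q x + alpha N) * j0 bounce_jet x t
    + conv K (j0 bounce_jet x) t.
Proof.
move=> /andP[x0 xL].
have e1 := wave_jet_eq cq t source_smooth source_causal x0.
have Lx : 0 <= L - x by rewrite subr_ge0.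
have e2 := wave_jet_eq cqr t reflected_smooth reflected_causal Lx.
have c1 : continuous (j0 (wave_jet q source) x).
  by have [[c _ _] _ _] := wave_jetC2 cq source_smooth source_causal; exact: cont_sect c.
have c2 : continuous (j0 (wave_jet qr reflected) (L - x)).
  by have [[c _ _] _ _] := wave_jetC2 cqr reflected_smooth reflected_causal; exact: cont_sect c.
have E : conv K (j0 bounce_jet x) t = conv K (j0 (wave_jet q source) x) t +
    conv K (j0 (wave_jet qr reflected) (L - x)) t.
  by rewrite -convDr; [|exact: cont_memory|exact: cont_locint|exact: cont_locint].
have E22 : j22 bounce_jet x t = j22 (wave_jet q source) x t + j22 (wave_jet qr reflected) (L - x) t by [].
have E11 : j11 bounce_jet x t = j11 (wave_jet q source) x t + j11 (wave_jet qr reflected) (L - x) t by [].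
have E0 : j0 bounce_jet x t = j0 (wave_jet q source) x t + j0 (wave_jet qr reflected) (L - x) t by [].
have qq : qr (L - x) = q x by rewrite /qr subKr.
have alg (a b c d a' b' c' d' u : R) : a = b + u * c + d -> a' = b' + u * c' + d' ->
    a + a' = (b + b') + u * (c + c') + (d + d') by move=> -> ->; ring.
rewrite qq in e2; rewrite E E22 E11 E0; exact: (alg _ _ _ _ _ _ _ _ _ e1 e2).
Qed.

End Reflections.

Definition amplitude (f : R -> R) t := expR (- (gam * t)) * f t.

Lemma amplitude_smooth f : smooth f -> smooth (amplitude f).
Proof.
move=> sf; have := smoothM (smooth_exp (- gam)) sf.
by congr smooth; apply/funext => t; rewrite /amplitude mulNr.
Qed.

Lemma amplitude_causal f : causal f -> causal (amplitude f).
Proof. by move=> f0 t t0; rewrite /amplitude f0// mulr0. Qed.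

Lemma control_causal (f : R -> R) : control f -> causal f.
Proof. by move=> [_ [e e0 fe]] t t0; apply: fe; apply: le_trans t0 (ltW e0). Qed.

Definition extend (L : R) (q : R -> R) x := q (clampr 0 L x).

Lemma extend_cont (L : R) (q : R -> R) :
  0 < L -> {within `[0, L], continuous q} -> continuous (extend L q).
Proof.
move=> L0; apply: (within_retract (r := clampr 0 L)); first exact: clampr_cont.
by move=> x; rewrite /= in_itv/= clampr_in// ltW.
Qed.

Lemma extend_id (L : R) (q : R -> R) x : 0 <= x <= L -> extend L q x = q x.
Proof. by move=> xL; rewrite /extend clampr_id. Qed.

Theorem classical_exists (L : R) (q f : R -> R) : 0 < L -> {within `[0, L], continuous q} ->
  smooth f -> causal f ->
  exists j : jet, [/\ isC2 j, is_classical L q N f (j0 j),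
    (forall x t, 0 <= x <= L -> t <= 0 -> j0 j x t = 0),
    (forall x t, 0 <= x <= L -> 0 <= t ->
      j2 j x t = conv N (fun s => j11 j x s + q x * j0 j x s) t) &
    (forall x t, 0 <= x <= L -> t <= L ->
      j0 j x t = expR (gam * t) * wave (extend L q) (amplitude f) x t)].
Proof.
move=> L0 cq sf f0.
have cqe := extend_cont L0 cq.
have sg := amplitude_smooth sf; have g0 := amplitude_causal f0.
set g := amplitude f in sg g0; set p := extend L q in cqe.
pose B := bounce_jet L p g.
have cB : isC2 B by exact: bounce_jetC2.
have BK x : 0 <= x <= L -> forall t, 0 <= t -> j2 (jet_exp gam B) x t =
    conv N (fun s => j11 (jet_exp gam B) x s + q x * j0 (jet_exp gam B) x s) t.
  move=> xL t t0; apply: viscoelastic_of_wave cB _ _ t0.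
    by move=> s; exact: bounce_causal.
  move=> s s0; rewrite -(extend_id q xL); exact: bounce_eq.
have Bc x t : 0 <= x <= L -> t <= 0 -> j0 (jet_exp gam B) x t = 0.
  by move=> xL t0; rewrite jet_expE bounce_causal// mulr0.
exists (jet_exp gam B); split.
- exact: isC2_exp.
- have [_ _ dj] := isC2_exp gam cB; split.
  + by apply: (isC2_C2_on (isC2_exp gam cB)) => z _.
  + move=> x t xL t0.
    have xL' : 0 <= x <= L by case/andP: xL => ? ?; rewrite !ltW.
    have [_ d2 _ _ _] := dj x t.
    rewrite (derive1_eq d2) (BK x xL' t (ltW t0)) convE; apply: eq_Rintegral => s _.
    have [d1 _ _ _ _] := dj x s.
    congr (_ * (_ + _)).
    have E : derive1 (j0 (jet_exp gam B) ^~ s) = j1 (jet_exp gam B) ^~ s.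
      by apply/funext => y; have [dy _ _ _ _] := dj y s; rewrite (derive1_eq dy).
    have [_ _ d3 _ _] := dj x s.
    have -> : derive1n 2 (j0 (jet_exp gam B) ^~ s) x = derive1 (derive1 (j0 (jet_exp gam B) ^~ s)) x by [].
    by rewrite E (derive1_eq d3).
  + by move=> x xL; exact: Bc.
  + move=> t t0; split.
    * rewrite jet_expE bounce_x0// /g /amplitude mulrA -expRD subrr expR0 mul1r.
      by [].
    * by rewrite jet_expE bounce_xL// mulr0.
- by move=> x t xL; exact: Bc.
- by move=> x t xL; exact: BK.
- by move=> x t xL tL; rewrite jet_expE bounce_early.
Qed.

End ClassicalExistence.

(** * Uniqueness by characteristics *)

Section RealHelpers.
Context {R : realType}.

(** The tool that carries identities from open regions to their boundary. *)
Lemma cont0_closed (f : R -> R) (a b x : R) : continuous f -> a < b ->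
  (forall y, a < y < b -> f y = 0) -> a <= x <= b -> f x = 0.
Proof.
move=> cf ab f0 /andP[ax xb]; apply/eqP; rewrite -normr_eq0; apply/negPn/negP => fx.
have {}fx : 0 < `|f x| by rewrite lt_neqAle eq_sym fx/=.
have /cvgrPdist_lt /(_ _ fx) /nbhs_ballP[r /= r0 H] := cf x.
suff [y yab yx] : exists2 y, a < y < b & `|x - y| < r.
  by have := H y yx; rewrite /= (f0 _ yab) subr0 ltxx.
have [xb'|bx] := ltP x b.
- pose d := Num.min (r / 2) ((b - x) / 2).
  have d0 : 0 < d by rewrite lt_min !divr_gt0// subr_gt0.
  have d1 : d <= r / 2 by rewrite ge_min lexx.
  have d2 : d <= (b - x) / 2 by rewrite ge_min lexx orbT.
  exists (x + d); first by apply/andP; split; lra.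
  rewrite opprD addNKr normrN gtr0_norm//; lra.
- pose d := Num.min (r / 2) ((b - a) / 2).
  have d0 : 0 < d by rewrite lt_min !divr_gt0// subr_gt0.
  have d1 : d <= r / 2 by rewrite ge_min lexx.
  have d2 : d <= (b - a) / 2 by rewrite ge_min lexx orbT.
  exists (x - d); first by apply/andP; split; lra.
  rewrite subKr gtr0_norm//; lra.
Qed.

Lemma growth_bound (F f : R -> R) (a b K lam : R) : a <= b -> 0 < lam ->
  continuous F -> (forall x, a < x < b -> ider F x (f x)) ->
  (forall x, a < x < b -> `|f x| <= K * expR (lam * x)) ->
  0 <= K -> `|F b| <= `|F a| + K / lam * expR (lam * b).
Proof.
move=> ab lam0 cF dF bf K0.
have dE x : ider (fun y => K / lam * expR (lam * y)) x (K * expR (lam * x)).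
  by apply: ider_val (iderZ (K / lam) (ider_exp_lin lam x)) _; field; rewrite gt_eqF.
have cE : continuous (fun y => K / lam * expR (lam * y)) by exact: ider_cont dE.
have E0 : 0 <= K / lam * expR (lam * a).
  by rewrite mulr_ge0 ?divr_ge0 ?expR_ge0// ltW.
have mono (G g : R -> R) : continuous G -> (forall x, a < x < b -> ider G x (g x)) ->
    (forall x, a < x < b -> g x <= 0) -> G b <= G a.
  move=> cG dG g0.
  apply: (@ler0_derive1_nincr _ G a b) => //.
  - by move=> x; rewrite in_itv/= => /dG /derivable_ider.
  - by move=> x; rewrite in_itv/= => xab; rewrite (derive1_eq (dG x xab)) g0.
  - exact: continuous_subspaceT.
have h1 : F b - K / lam * expR (lam * b) <= F a - K / lam * expR (lam * a).
  apply: (mono (fun y => F y - K / lam * expR (lam * y)) (fun y => f y - K * expR (lam * y))).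
  - by apply: contD => //; exact: contN.
  - by move=> x xab; apply: iderB; [exact: dF|exact: dE].
  - by move=> x xab; rewrite subr_le0; apply: le_trans (bf x xab); exact: ler_norm.
have h2 : - F b - K / lam * expR (lam * b) <= - F a - K / lam * expR (lam * a).
  apply: (mono (fun y => - F y - K / lam * expR (lam * y)) (fun y => - f y - K * expR (lam * y))).
  - by apply: contD; exact: contN.
  - by move=> x xab; apply: iderB; [exact/iderN/dF|exact: dE].
  - by move=> x xab; rewrite subr_le0; apply: le_trans (bf x xab); rewrite -normrN ler_norm.
have n1 := ler_norm (F a); have n2 := ler_norm (- F a); rewrite normrN in n2.
move: h1 h2 E0; move: (K / lam * expR (lam * a)) (K / lam * expR (lam * b)) => u v h1 h2 u0.
by rewrite ler_norml; apply/andP; split; lra.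
Qed.

(** Derivatives exist in the interior only, while [x] may be an edge. The integrated identity
    between [u2] and the increments of [u] passes to the edge by continuity and is differentiated
    there. *)
Lemma edge_derivative (u u2 : R -> R -> R) (a b c d x : R) : cont2 u -> cont2 u2 ->
  a < b -> c < d ->
  (forall y t, a < y < b -> c < t < d -> ider (u y) t (u2 y t)) ->
  a <= x <= b -> (forall t, c <= t <= d -> u x t = 0) ->
  forall t, c <= t <= d -> u2 x t = 0.
Proof.
move=> cu cu2 ab cd du xab u0.
have I t : c <= t <= d -> oint c t (u2 x) = 0.
  move=> /andP[ct td].
  pose G y := oint c t (u2 y) - (u y t - u y c).
  have cG : continuous G.
    apply: contD.
      apply: (@cont_oint R R u2 (fun=> c) (fun=> t)) => //; exact: cst_continuous.
    apply: contN; apply: contD; last apply: contN.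
      exact: (cont_sect2 cu).
    exact: (cont_sect2 cu).
  have G0 y : a < y < b -> G y = 0.
    move=> yab; rewrite /G oint_ge// (FTC_oo (F := u y)) ?subrr//.
    - exact: cont_sect cu2.
    - by move=> s /andP[cs st]; apply: du => //; rewrite cs (lt_le_trans st).
    - by apply: continuous_subspaceT; exact: cont_sect cu.
  have := cont0_closed cG ab G0 xab; rewrite /G u0 ?ct//.
  by rewrite u0 ?lexx ?(ltW cd)// subrr subr0.
move=> t0; apply: (@cont0_closed (u2 x) c d) => //; first exact: cont_sect cu2.
move=> t tcd.
apply: (@ider_unique _ (fun t => oint c t (u2 x)) t).
  by apply: ider_oint; exact: cont_sect cu2.
apply: (@oo_ider _ (fun=> 0) _ t c d) => //; last exact: ider_cst.
by move=> s /andP[cs sd]; rewrite I// !ltW.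
Qed.

Lemma right_quotient (f g : R -> R) (e : R) : 0 < e -> continuous g ->
  (forall h, 0 <= h < e -> f h - f 0 = oint 0 h g) ->
  (h^-1 * (f h - f 0) @[h --> 0^'+] --> g 0).
Proof.
move=> e0 cg fg.
have /iderP H := @ider_oint R 0 g 0 cg.
apply/cvgrPdist_le => eps eps0; have [d d0 Hd] := H _ eps0.
near=> h.
have h0 : 0 < h by near: h; exact: nbhs_right_gt.
have he : h < e by near: h; exact: nbhs_right_lt.
have hd : h < d by near: h; exact: nbhs_right_lt.
rewrite fg ?(ltW h0)//.
have := Hd h; rewrite gtr0_norm// => /(_ hd).
rewrite add0r ointaa subr0 => Hh.
have -> : g 0 - h^-1 * oint 0 h g = - (h^-1 * (oint 0 h g - g 0 * h)).
  by field; rewrite gt_eqF.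
by rewrite normrN normrM (gtr0_norm (_ : 0 < h^-1)) ?invr_gt0// ler_pdivrMl// (mulrC h).
Unshelve. all: by end_near. Qed.

End RealHelpers.

(** * Derivatives in an open region and transport along characteristics *)

Section Interior.
Context {R : realType}.
Implicit Types (O : R -> R -> Prop) (j : @jet R).

(** The components are continuous on the whole plane although the relations hold on [O] only;
    composition with a retraction, in [C2_on_jet], obtains this from continuity up to the
    boundary. *)
Definition C2_in O j :=
  [/\ [/\ cont2 (j0 j), cont2 (j1 j) & cont2 (j2 j)],
      [/\ cont2 (j11 j), cont2 (j12 j) & cont2 (j22 j)] &
      forall x t, O x t -> [/\ ider (j0 j ^~ t) x (j1 j x t),
        ider (j0 j x) t (j2 j x t), ider (j1 j ^~ t) x (j11 j x t),
        ider (j1 j x) t (j12 j x t) & ider (j2 j x) t (j22 j x t)]].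

Lemma isC2_in O j : isC2 j -> C2_in O j.
Proof. by move=> [c0 c2 dj]; split=> // x t _; exact: dj. Qed.

Definition jetB (a b : jet) := let s u v := fun x t : R => u x t - v x t : R in
  Jet (s (j0 a) (j0 b)) (s (j1 a) (j1 b)) (s (j2 a) (j2 b))
      (s (j11 a) (j11 b)) (s (j12 a) (j12 b)) (s (j22 a) (j22 b)).

Lemma C2_inB O a b : C2_in O a -> C2_in O b -> C2_in O (jetB a b).
Proof.
have cB (u v : R -> R -> R) : cont2 u -> cont2 v -> cont2 (fun x t => u x t - v x t).
  by move=> cu cv; apply: contD => //; exact: contN.
move=> [[? ? ?] [? ? ?] da] [[? ? ?] [? ? ?] db]; split.
- by split; apply: cB.
- by split; apply: cB.
- move=> x t Oxt; have [? ? ? ? ?] := da x t Oxt; have [? ? ? ? ?] := db x t Oxt.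
  by split; apply: iderB.
Qed.

Lemma C2_in_flip O (L : R) j : C2_in O j ->
  C2_in (fun x t => O (L - x) t) (jet_flip L j).
Proof.
move=> [[? ? ?] [? ? ?] da]; split.
- by split; try apply: contN; exact: cont_flip.
- by split; try apply: contN; exact: cont_flip.
- move=> x t Oxt; have [? ? d3 ? ?] := da (L - x) t Oxt; split => //=.
  + by apply: (ider_rev (f := j0 j ^~ t)).
  + by apply: ider_val (iderN (ider_rev (f := j1 j ^~ t) d3)) _; rewrite opprK.
  + exact: iderN.
Qed.

Lemma C2_on_jet (D : set (R * R)) (r : R * R -> R * R) O (u : R -> R -> R) :
  continuous r -> (forall p, D (r p)) -> (forall p, D p -> r p = p) ->
  (forall x t, O x t -> interior D (x, t)) -> C2_on D u ->
  exists j, C2_in O j /\ forall x t, D (x, t) -> j0 j x t = u x t.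
Proof.
move=> cr Dr rid OD [u1 [u2 [u11 [u12 [u22 [[c0 c1 c2] [c11 c12 c22] du]]]]]].
pose E (v : R -> R -> R) x t := v (r (x, t)).1 (r (x, t)).2.
have cE (v : R -> R -> R) : {within D, continuous (fun p => v p.1 p.2)} -> cont2 (E v).
  move=> cv; have := within_retract cr Dr cv.
  rewrite /cont2 /E; set F := fun p => _; set G := fun p => _.
  by rewrite (_ : F = G)//; apply/funext => -[].
have Eid (v : R -> R -> R) x t : D (x, t) -> E v x t = v x t.
  by move=> Dxt; rewrite /E rid.
have nD x t : O x t -> \forall p \near (x, t), D p by move=> /OD.
have d1 (v v1 : R -> R -> R) x t : O x t -> ider (v ^~ t) x (v1 x t) ->
    ider (E v ^~ t) x (E v1 x t).
  move=> Oxt dv; have n := nD _ _ Oxt.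
  rewrite (Eid v1); last exact: nbhs_singleton n.
  apply: near_ider dv; case: n => -[P Q]/= [nP nQ] PQ.
  apply: filterS nP => y Py; rewrite Eid//; apply: PQ; split=> //=.
  exact: nbhs_singleton nQ.
have d2 (v v1 : R -> R -> R) x t : O x t -> ider (v x) t (v1 x t) ->
    ider (E v x) t (E v1 x t).
  move=> Oxt dv; have n := nD _ _ Oxt.
  rewrite (Eid v1); last exact: nbhs_singleton n.
  apply: near_ider dv; case: n => -[P Q]/= [nP nQ] PQ.
  apply: filterS nQ => y Qy; rewrite Eid//; apply: PQ; split=> //=.
  exact: nbhs_singleton nP.
exists (Jet (E u) (E u1) (E u2) (E u11) (E u12) (E u22)); split; last by move=> x t; exact: Eid.
split; [by split; exact: cE|by split; exact: cE|].
move=> x t Oxt; have [e1 e2 e3 e4 e5] := du x t (OD _ _ Oxt).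
by split; [exact: d1|exact: d2|exact: d1|exact: d2|exact: d2].
Qed.

Section Characteristics.
Variables (O : R -> R -> Prop) (j : @jet R).
Hypothesis openO : forall x t, O x t -> \forall p \near (x, t), O p.1 p.2.
Hypothesis Cj : C2_in O j.

(** Only one mixed derivative belongs to the jet. The other order comes from writing the increment
    of [j0] as an integral of [j1] and differentiating under the integral sign. *)
Lemma schwarz x t : O x t -> ider (j2 j ^~ t) x (j12 j x t).
Proof.
have [[c0 c1 c2] [c11 c12 c22] dj] := Cj.
move=> Oxt; have /nbhs_ballP[e /= e0 He] := openO Oxt.
have box y s : `|y - x| < e -> `|s - t| < e -> O y s.
  by move=> yx st; apply: (He (y, s)); split; rewrite /ball/= distrC.
have sect2 (u : R -> R -> R) s : cont2 u -> continuous (u ^~ s).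
  by move=> cu; exact: (cont_sect2 cu).
pose a := x - e / 2.
have inbox y : a <= y <= x + e / 2 -> `|y - x| < e.
  by move=> /andP[ay ye]; rewrite ltr_norml; apply/andP; split; rewrite /a in ay; lra.
have I b s : a <= b <= x + e / 2 -> `|s - t| < e ->
    j0 j b s - j0 j a s = \int[@lebesgue_measure R]_(y in `[a, b]) j1 j y s.
  move=> /andP[ab be] st; rewrite (FTC_oo (F := j0 j ^~ s))//.
  - exact: sect2.
  - move=> y /andP[ay yb]; have [] := dj y s => //.
    apply: box => //; apply: inbox; rewrite (ltW ay)/=; apply: ltW; exact: lt_le_trans be.
  - by apply: continuous_subspaceT; exact: sect2.
have J b : a < b < x + e / 2 -> j2 j b t - j2 j a t = oint a b (j12 j ^~ t).
  move=> /andP[ab be].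
  have tt : `|t - t| < e by rewrite subrr normr0.
  have Ob : O b t by apply: box => //; apply: inbox; rewrite !ltW.
  have Oa : O a t by apply: box => //; apply: inbox; rewrite lexx /a; lra.
  have h1 : ider (fun s => j0 j b s - j0 j a s) t (j2 j b t - j2 j a t).
    by apply: iderB; [have [] := dj b t Ob|have [] := dj a t Oa].
  have h2 : ider (fun s => \int[@lebesgue_measure R]_(y in `[a, b]) j1 j y s) t
      (\int[@lebesgue_measure R]_(y in `[a, b]) j12 j y t).
    apply: (@leibniz R (fun s y => j1 j y s) (fun s y => j12 j y s) t e a b) => //.
    - exact: ltW.
    - by move=> s _; apply: cont_locint; exact: sect2.
    - exact: cont2_swap.
    - move=> s y st /andP[ay yb]; have [] := dj y s => //.
      apply: box => //; apply: inbox; rewrite (ltW ay)/=; apply: ltW; exact: lt_trans be.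
  rewrite oint_ge ?(ltW ab)//; apply: ider_unique h1 _.
  apply: (@oo_ider _ _ _ t (t - e) (t + e)) h2; first by apply/andP; split; lra.
  move=> s /andP[s1 s2]; rewrite I ?(ltW ab) ?(ltW be)//.
  by rewrite ltr_norml; apply/andP; split; lra.
apply: (@oo_ider _ (fun b => j2 j a t + oint a b (j12 j ^~ t)) _ x a (x + e / 2)).
- by rewrite /a; apply/andP; split; lra.
- by move=> b /J <-; rewrite addrC subrK.
apply: ider_val (iderD (ider_cst (j2 j a t) x) (ider_oint a x (sect2 _ t c12))) _.
by rewrite add0r.
Qed.

(* With [c = 1] or [c = -1], z_t + c z_x is transported along dx/dt = - c. *)
Lemma char_growth (c x t a K lam : R) : c * c = 1 -> a <= t -> 0 < lam -> 0 <= K ->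
  (forall s, a < s < t -> O (x + c * (t - s)) s /\
     `|j22 j (x + c * (t - s)) s - j11 j (x + c * (t - s)) s| <= K * expR (lam * s)) ->
  `|j2 j x t + c * j1 j x t| <=
    `|j2 j (x + c * (t - a)) a + c * j1 j (x + c * (t - a)) a| + K / lam * expR (lam * t).
Proof.
move=> cc at_ lam0 K0 H.
have [[c0 c1 c2] [c11 c12 c22] dj] := Cj.
pose X s := x + c * (t - s).
have dX s : ider X s (- c).
  apply: ider_val (iderD (ider_cst x s) (iderZ c (iderB (ider_cst t s) (ider_id s)))) _.
  by ring.
pose F s := j2 j (X s) s + c * j1 j (X s) s.
have XE : X t = x by rewrite /X subrr mulr0 addr0.
have -> : j2 j x t + c * j1 j x t = F t by rewrite /F XE.
rewrite -/(X a) -/(F a).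
have cX : continuous X by exact: ider_cont dX.
have cline (u : R -> R -> R) : cont2 u -> continuous (fun s => u (X s) s).
  by move=> cu; apply: (cont_comp2 (u := u)) => //; exact: cont_id.
apply: (@growth_bound R F (fun s => j22 j (X s) s - j11 j (X s) s)) => //.
- by apply: contD; [exact: cline|apply: contM; [exact: cont_cst|exact: cline]].
- move=> s sab; have [OX _] := H s sab; have nO := openO OX.
  have [d1 d2 d3 d4 d5] := dj _ _ OX.
  have e2 : ider (fun s => j2 j (X s) s) s (j12 j (X s) s * - c + j22 j (X s) s * 1).
    apply: (ider_chain (u := j2 j) (u1 := j12 j) (a := X) (b := id)) => //; last exact: ider_id.
    + by apply: filterS nO => p; exact: schwarz.
    + exact: c12.
  have e1 : ider (fun s => j1 j (X s) s) s (j11 j (X s) s * - c + j12 j (X s) s * 1).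
    apply: (ider_chain (u := j1 j) (u1 := j11 j) (a := X) (b := id)) => //; last exact: ider_id.
    + by apply: filterS nO => p Op; have [] := dj _ _ Op.
    + exact: c11.
  apply: ider_val (iderD e2 (iderZ c e1)) _.
  move: (j11 _ _ _) (j12 _ _ _) (j22 _ _ _) => u v w.
  by rewrite mulrDr (_ : c * (u * - c) = - (c * c) * u); [rewrite cc; ring|ring].
- by move=> s sab; have [_] := H s sab.
Qed.

Lemma time_growth (x t a K lam : R) : a <= t -> 0 < lam -> 0 <= K ->
  (forall s, a < s < t -> O x s /\ `|j2 j x s| <= K * expR (lam * s)) ->
  `|j0 j x t| <= `|j0 j x a| + K / lam * expR (lam * t).
Proof.
move=> at_ lam0 K0 H; have [[c0 c1 c2] _ dj] := Cj.
apply: (@growth_bound R (j0 j x) (j2 j x)) => //.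
- exact: cont_sect c0.
- by move=> s /H[/dj[]].
- by move=> s /H[].
Qed.

End Characteristics.

End Interior.

(** * Uniqueness in the strip and in the triangle *)

Section Uniqueness.
Context {R : realType}.
Implicit Types (j : @jet R).

Lemma near_lt (X : topologicalType) (f g : X -> R) (p : X) :
  continuous f -> continuous g -> f p < g p -> \forall x \near p, f x < g x.
Proof.
move=> cf cg fg.
have h := contD cg (contN cf).
have : \forall y \near g p - f p, 0 < y by apply: lt_nbhsr; rewrite subr_gt0.
by move=> /(h p); rewrite nbhs_simpl/=; apply: filterS => x /=; rewrite subr_gt0.
Qed.

Lemma exp_ge1 (x : R) : 0 <= x -> 1 <= expR x.
Proof. by rewrite -(@expR0 R) ler_expR. Qed.

Lemma conv_exp_bound (a b : R -> R) (T t Ca B lam : R) : continuous a -> continuous b ->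
  0 <= t <= T -> 0 <= Ca -> 0 <= B -> 0 < lam -> (forall s, 0 <= s <= T -> `|a s| <= Ca) ->
  (forall s, 0 <= s <= t -> `|b s| <= B * expR (lam * s)) ->
  `|conv a b t| <= T * Ca * B * expR (lam * t).
Proof.
move=> ca cb /andP[t0 tT] Ca0 B0 lam0 Ha Hb; rewrite conv_oint//.
apply: le_trans (oint_bound (C := Ca * (B * expR (lam * t))) _ _) _.
- exact: conv_integrand_locint ca (cont_locint cb).
- rewrite min_l// max_r// => s /andP[s0 st]; rewrite normrM ler_pM//.
    by apply: Ha; apply/andP; split; lra.
  apply: le_trans (Hb s _) _; first by rewrite s0.
  by rewrite ler_wpM2l// ler_expR ler_pM2l.
- rewrite subr0 ger0_norm// (_ : T * Ca * B * _ = Ca * (B * expR (lam * t)) * T); last by ring.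
  by rewrite ler_wpM2l// !mulr_ge0// expR_ge0.
Qed.

Section Strip.
Variable L : R.
Hypothesis L0 : 0 < L.

Definition strip (x t : R) : Prop := 0 < x < L /\ 0 < t.

Lemma strip_open x t : strip x t -> \forall p \near (x, t), strip p.1 p.2.
Proof.
move=> [/andP[x0 xL] t0].
have h1 := @near_lt _ (fun=> 0) (fun p : R * R => p.1) (x, t) (@cont_cst R (R * R)%type 0) (@continuous_fst R R) x0.
have h2 := @near_lt _ (fun p : R * R => p.1) (fun=> L) (x, t) (@continuous_fst R R) (@cont_cst R (R * R)%type L) xL.
have h3 := @near_lt _ (fun=> 0) (fun p : R * R => p.2) (x, t) (@cont_cst R (R * R)%type 0) (@continuous_snd R R) t0.
by apply: filterS3 h1 h2 h3 => p a b c; split=> //; rewrite a.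
Qed.

Section Step.
Variables (T A K kap lam : R).
Hypotheses (lam0 : 0 < lam) (K0 : 0 <= K) (A0 : 0 <= A) (kap0 : 0 <= kap).
Hypotheses (kl : kap <= lam) (kL : 4 <= expR (kap * L)) (KA : 4 * K <= A * lam).

(** The characteristic through [(x, t)] is followed backwards. It meets the initial line, where the
    data vanish, or the wall x = L, where the vanishing of [j2] turns the combination into its
    mirror image. There the weight of the new bound is e^(kap L), at least 4 times that of the old
    one, and this pays for the halving. *)
Lemma strip_step j x t : C2_in strip j -> 0 <= x <= L -> 0 <= t <= T ->
  (forall x t, strip x t -> t <= T -> `|j22 j x t - j11 j x t| <= K * expR (lam * t)) ->
  (forall x, 0 <= x <= L -> j2 j x 0 + 1 * j1 j x 0 = 0) ->
  (forall t, 0 <= t <= T -> j2 j L t = 0) ->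
  (forall t, 0 <= t <= T -> `|j2 j L t + -1 * j1 j L t| <= A * expR (lam * t)) ->
  `|j2 j x t + 1 * j1 j x t| <= A / 2 * expR (lam * t + kap * x).
Proof.
move=> Cj /andP[x0 xL] /andP[t0 tT] HS Hp0 HL HA.
have cc : 1 * 1 = 1 :> R by rewrite mulr1.
have KA' : K / lam <= A / 4 by rewrite ler_pdivrMr// mulrAC ler_pdivlMr// mulrC.
have Ex : expR (lam * t) <= expR (lam * t + kap * x) by rewrite ler_expR lerDl mulr_ge0.
have A42 : A / 4 <= A / 2 by have := A0; lra.
have KE : K / lam * expR (lam * t) <= A / 4 * expR (lam * t + kap * x).
  by apply: ler_pM => //; rewrite divr_ge0// ltW.
have E0 := expR_ge0 (lam * t + kap * x).
have [tx|xt] := leP t (L - x).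
  apply: le_trans (char_growth strip_open Cj cc t0 lam0 K0 _) _.
    move=> s /andP[s0 st]; have O : strip (x + 1 * (t - s)) s.
      by split=> //; apply/andP; split; lra.
    by split=> //; apply: HS => //; lra.
  rewrite Hp0 ?normr0 ?add0r; last by apply/andP; split; lra.
  apply: le_trans KE _; exact: ler_wpM2r.
pose a := t - (L - x).
have a0 : 0 <= a <= t by rewrite /a; apply/andP; split; lra.
have /andP[a1 a2] := a0.
apply: le_trans (char_growth strip_open Cj cc a2 lam0 K0 _) _.
  move=> s /andP[s0 st]; rewrite /a in s0 a1; have O : strip (x + 1 * (t - s)) s.
    by split; [apply/andP; split; lra|lra].
  by split=> //; apply: HS => //; lra.
have -> : x + 1 * (t - a) = L by rewrite /a; ring.
have aT : 0 <= a <= T by apply/andP; split; lra.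
have -> : `|j2 j L a + 1 * j1 j L a| = `|j2 j L a + -1 * j1 j L a|.
  by rewrite !HL// !add0r mulN1r mul1r normrN.
have Ha : `|j2 j L a + -1 * j1 j L a| <= A / 4 * expR (lam * t + kap * x).
  apply: le_trans (HA _ aT) _.
  rewrite -mulrA; apply: ler_wpM2l => //.
  rewrite ler_pdivlMl//.
  apply: le_trans (_ : expR (kap * L) * expR (lam * a) <= _); first by apply: ler_wpM2r => //; exact: expR_ge0.
  rewrite -expRD ler_expR /a -subr_ge0.
  rewrite (_ : _ - _ = (lam - kap) * (L - x)); last by ring.
  by rewrite mulr_ge0// subr_ge0.
apply: le_trans (lerD Ha KE) _; rewrite -mulrDl; apply: ler_wpM2r => //; lra.
Qed.

End Step.

Lemma strip_unique j (T : R) : C2_in strip j -> 0 < T ->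
  (forall x, 0 <= x <= L -> [/\ j0 j x 0 = 0, j1 j x 0 = 0 & j2 j x 0 = 0]) ->
  (forall t, 0 <= t <= T -> [/\ j0 j 0 t = 0, j2 j 0 t = 0, j0 j L t = 0 & j2 j L t = 0]) ->
  (exists2 C, 0 <= C & forall B lam, 0 <= B -> 0 < lam ->
    (forall x t, 0 <= x <= L -> 0 <= t <= T -> [/\ `|j0 j x t| <= B * expR (lam * t),
       `|j1 j x t| <= B * expR (lam * t) & `|j2 j x t| <= B * expR (lam * t)]) ->
    forall x t, strip x t -> t <= T -> `|j22 j x t - j11 j x t| <= C * B * expR (lam * t)) ->
  forall x t, 0 <= x <= L -> 0 <= t <= T -> j0 j x t = 0.
Proof.
move=> Cj T0 Hx Ht [C C0 HS].
have [[c0 c1 c2] _ _] := Cj.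
(* With this rate e^(kap L) = e^2, above the 4 asked for by [strip_step]; [M] bounds the spatial
   weight on the interval. *)
pose M := expR (2 : R); pose kap := 2 / L.
have M4 : 4 <= M.
  have e1 : 2 <= expR (1 : R) by apply: le_trans (expR_ge1Dx 1); lra.
  rewrite /M (_ : 2 = 1 + 1 :> R) // expRD (_ : 4 = 2 * 2); last by ring.
  by apply: ler_pM.
have kap0 : 0 < kap by rewrite divr_gt0.
have kL : kap * L = 2 by rewrite /kap mulfVK// gt_eqF.
have CM0 : 0 <= C * M by rewrite mulr_ge0// expR_ge0.
(* The summands secure, in this order, [kap <= lam], the halving of the source terms, and the
   halving of [j0] through [time_growth]. *)
have [lam lamE] : exists l, l = kap + 1 + 4 * (C * M) + 2 * M by eexists.
have lam0 : 0 < lam by rewrite lamE; lra.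
have kl : kap <= lam by rewrite lamE; lra.
(* The two combinations carry mirrored spatial weights, so that a reflection at either wall meets
   the gain of [strip_step]. *)
pose P A := forall x t, 0 <= x <= L -> 0 <= t <= T ->
  [/\ `|j0 j x t| <= A * expR (lam * t),
      `|j2 j x t + 1 * j1 j x t| <= A * expR (lam * t + kap * x) &
      `|j2 j x t + -1 * j1 j x t| <= A * expR (lam * t + kap * (L - x))].
have step A : 0 <= A -> P A -> P (A / 2).
  move=> A0 PA.
  have eM x : 0 <= x <= L -> expR (kap * x) <= M.
    by move=> /andP[_ xL]; rewrite /M ler_expR -kL ler_wpM2l// ltW.
  have B0 : 0 <= A * M by rewrite mulr_ge0// expR_ge0.
  have BA x t : 0 <= x <= L -> A * expR (lam * t + kap * x) <= A * M * expR (lam * t).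
    move=> xL; rewrite expRD -mulrA ler_wpM2l// mulrC ler_wpM2r ?expR_ge0//.
    exact: eM.
  have bnd x t : 0 <= x <= L -> 0 <= t <= T -> [/\ `|j0 j x t| <= A * M * expR (lam * t),
       `|j1 j x t| <= A * M * expR (lam * t) & `|j2 j x t| <= A * M * expR (lam * t)].
    move=> xL tT; have [z0 zp zm] := PA x t xL tT.
    have xL' : 0 <= L - x <= L by case/andP: xL => ? ?; apply/andP; split; lra.
    have {}zp := le_trans zp (BA x t xL).
    have {}zm := le_trans zm (BA (L - x) t xL').
    split.
    - apply: le_trans z0 _; rewrite ler_wpM2r ?expR_ge0// ler_peMr//; lra.
    - move: zp zm; rewrite !ler_norml => /andP[? ?] /andP[? ?]; apply/andP; split; lra.
    - move: zp zm; rewrite !ler_norml => /andP[? ?] /andP[? ?]; apply/andP; split; lra.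
  have KS := HS _ _ B0 lam0 bnd.
  have K0 : 0 <= C * (A * M) by rewrite mulr_ge0.
  have KA : 4 * (C * (A * M)) <= A * lam.
    rewrite (_ : 4 * _ = A * (4 * (C * M))); last by ring.
    by rewrite ler_wpM2l// lamE; lra.
  have kL4 : 4 <= expR (kap * L) by rewrite kL.
  have zE x t : 0 <= x <= L -> 0 <= t <= T -> `|j0 j x t| <= A / 2 * expR (lam * t).
    move=> /andP[x0 xL] /[dup] tT /andP[t0 tT'].
    have pos : 0 <= A / 2 * expR (lam * t) by rewrite mulr_ge0 ?expR_ge0// divr_ge0.
    have [j00 _ jL0 _] := Ht t tT.
    have [->|xn0] := eqVneq x 0; first by rewrite j00 normr0.
    have [->|xnL] := eqVneq x L; first by rewrite jL0 normr0.
    have x0' : 0 < x by rewrite lt_neqAle eq_sym xn0.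
    have xL' : x < L by rewrite lt_neqAle xnL.
    apply: le_trans (time_growth (K := A * M) Cj t0 lam0 B0 _) _.
      move=> s /andP[s0 st]; split; first by split=> //; rewrite x0'.
      have [||_ _ //] := bnd x s; first by rewrite x0.
      by apply/andP; split; lra.
    have [-> _ _] : [/\ j0 j x 0 = 0, j1 j x 0 = 0 & j2 j x 0 = 0] by apply: Hx; rewrite x0.
    rewrite normr0 add0r ler_wpM2r ?expR_ge0// ler_pdivrMr// -mulrA ler_wpM2l//.
    rewrite lamE; lra.
  move=> x t xL tT; split; first exact: zE.
    apply: (strip_step lam0 K0 A0 (ltW kap0) kl kL4 KA Cj xL tT KS).
    - by move=> y /Hx[_ -> ->]; rewrite mulr0 addr0.
    - by move=> s /Ht[].
    - move=> s sT; have LL : 0 <= L <= L by rewrite lexx ltW.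
      by have [_ _] := PA L s LL sT; rewrite subrr mulr0 addr0.
  have xL' : 0 <= L - x <= L by case/andP: xL => ? ?; apply/andP; split; lra.
  have Cf : C2_in strip (jet_flip L j).
    have [a b H] := C2_in_flip L Cj; split=> // y s [/andP[y0 yL] s0]; apply: H.
    by split=> //; apply/andP; split; lra.
  have E y s : j2 (jet_flip L j) y s + 1 * j1 (jet_flip L j) y s =
      j2 j (L - y) s + -1 * j1 j (L - y) s by rewrite /= mul1r mulN1r.
  have E' y s : j2 (jet_flip L j) y s + -1 * j1 (jet_flip L j) y s =
      j2 j (L - y) s + 1 * j1 j (L - y) s by rewrite /= mul1r mulN1r opprK.
  have := @strip_step T A (C * (A * M)) kap lam lam0 K0 A0 (ltW kap0) kl kL4 KA
    (jet_flip L j) (L - x) t Cf xL' tT.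
  rewrite E subKr; apply.
  - move=> y s [/andP[y0 yL] s0] sT; apply: KS => //.
    by split=> //; apply/andP; split; lra.
  - move=> y /andP[y0 yL]; rewrite E; have [|_ -> ->] := Hx (L - y).
      by apply/andP; split; lra.
    by rewrite mulr0 addr0.
  - by move=> s /Ht[_ h _ _]; rewrite /= subrr.
  - move=> s sT; rewrite E' subrr; have LL : (0 : R) <= 0 <= L by rewrite lexx ltW.
    by have [_ + _] := PA 0 s LL sT; rewrite mulr0 addr0.
have [Z0 Z00 HZ0] := cont2_bounded 0 L 0 T c0.
have [Z1 Z10 HZ1] := cont2_bounded 0 L 0 T c1.
have [Z2 Z20 HZ2] := cont2_bounded 0 L 0 T c2.
pose A0 := Z0 + Z1 + Z2.
have A00 : 0 <= A0 by rewrite !addr_ge0.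
have P0 : P A0.
  move=> x t xL tT.
  have z0 := HZ0 x t xL tT; have z1 := HZ1 x t xL tT; have z2 := HZ2 x t xL tT.
  have e1 : 1 <= expR (lam * t) by case/andP: tT => t0 _; rewrite exp_ge1// mulr_ge0// ltW.
  have e2 : 1 <= expR (lam * t + kap * x).
    by case/andP: xL => x0 _; rewrite expRD; apply: mulr_ege1 => //; rewrite exp_ge1// mulr_ge0// ltW.
  have e3 : 1 <= expR (lam * t + kap * (L - x)).
    case/andP: xL => _ x0; rewrite expRD; apply: mulr_ege1 => //.
    by rewrite exp_ge1// mulr_ge0 ?subr_ge0// ltW.
  have big e a : 1 <= e -> a <= A0 -> a <= A0 * e.
    by move=> e1' aA; apply: le_trans aA _; rewrite ler_peMr.
  split; apply: big => //; rewrite /A0.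
  - lra.
  - rewrite mul1r; apply: le_trans (ler_normD _ _) _; lra.
  - rewrite mulN1r; apply: le_trans (ler_normB _ _) _; lra.
have Pn n : P (A0 * 2^-1 ^+ n).
  elim: n => [|n IH]; first by rewrite expr0 mulr1.
  rewrite exprSr mulrA; apply: step IH.
  by rewrite mulr_ge0// exprn_ge0// invr_ge0.
move=> x t xL tT; apply: (@halving_eq0 R _ (A0 * expR (lam * t))) => n.
by have [H _ _] := Pn n x t xL tT; rewrite mulrAC.
Qed.

End Strip.

Section TriangleUniqueness.
Variable tau : R.

Definition tri (s t : R) : Prop := [/\ 0 < s, 0 < t & s + t < tau].

Lemma tri_open s t : tri s t -> \forall p \near (s, t), tri p.1 p.2.
Proof.
move=> [s0 t0 st].
have h1 := @near_lt _ (fun=> 0) (fun p : R * R => p.1) (s, t) (@cont_cst R (R * R)%type 0) (@continuous_fst R R) s0.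
have h2 := @near_lt _ (fun=> 0) (fun p : R * R => p.2) (s, t) (@cont_cst R (R * R)%type 0) (@continuous_snd R R) t0.
have h3 := @near_lt _ (fun p : R * R => p.1 + p.2) (fun=> tau) (s, t)
  (contD (@continuous_fst R R) (@continuous_snd R R)) (@cont_cst R (R * R)%type tau) st.
by apply: filterS3 h1 h2 h3.
Qed.

(** Both legs carry vanishing data, so a characteristic followed backwards ends on a leg without
    being reflected, and a weight in time alone suffices. *)
Lemma tri_unique j : C2_in tri j ->
  (forall r, 0 <= r < tau -> [/\ j0 j r 0 = 0, j1 j r 0 = 0 & j2 j r 0 = 0]) ->
  (forall r, 0 <= r < tau -> [/\ j0 j 0 r = 0, j1 j 0 r = 0 & j2 j 0 r = 0]) ->
  (exists2 C, 0 <= C & forall B lam, 0 <= B -> 0 < lam ->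
    (forall s t, 0 <= s -> 0 <= t -> s + t < tau -> [/\ `|j0 j s t| <= B * expR (lam * t),
       `|j1 j s t| <= B * expR (lam * t) & `|j2 j s t| <= B * expR (lam * t)]) ->
    forall s t, tri s t -> `|j22 j s t - j11 j s t| <= C * B * expR (lam * t)) ->
  forall s t, 0 <= s -> 0 <= t -> s + t < tau -> j0 j s t = 0.
Proof.
move=> Cj H0 H0' [C C0 HS]; have [[c0 c1 c2] _ _] := Cj.
have [lam lamE] : exists l, l = 2 * (C + 1) by eexists.
have lam0 : 0 < lam by rewrite lamE; lra.
pose P A := forall s t, 0 <= s -> 0 <= t -> s + t < tau -> [/\ `|j0 j s t| <= A * expR (lam * t),
       `|j1 j s t| <= A * expR (lam * t) & `|j2 j s t| <= A * expR (lam * t)].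
have step A : 0 <= A -> P A -> P (A / 2).
  move=> A0 PA; have KS := HS _ _ A0 lam0 PA.
  have K0 : 0 <= C * A by rewrite mulr_ge0.
  have KA : C * A / lam <= A / 2.
    rewrite ler_pdivrMr// (_ : A / 2 * lam = (C + 1) * A); last by rewrite lamE; field.
    by rewrite ler_wpM2r//; lra.
  have A2 : A / lam <= A / 2.
    by rewrite ler_pdivrMr// (_ : A / 2 * lam = (C + 1) * A); [rewrite ler_peMl//; lra|rewrite lamE; field].
  move=> s t s0 t0 st.
  have E0 := expR_ge0 (lam * t).
  have zp : `|j2 j s t + 1 * j1 j s t| <= A / 2 * expR (lam * t).
    have cc : 1 * 1 = 1 :> R by rewrite mulr1.
    apply: le_trans (char_growth tri_open Cj cc t0 lam0 K0 _) _.
      move=> r /andP[r0 rt]; have O : tri (s + 1 * (t - r)) r by split; lra.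
      by split=> //; exact: KS.
    have [|_ -> ->] := H0 (s + 1 * (t - 0)); first by apply/andP; split; lra.
    by rewrite mulr0 addr0 normr0 add0r ler_wpM2r.
  have zm : `|j2 j s t + -1 * j1 j s t| <= A / 2 * expR (lam * t).
    have cc : -1 * -1 = 1 :> R by rewrite mulrNN mulr1.
    have [ts|st'] := leP t s.
      apply: le_trans (char_growth tri_open Cj cc t0 lam0 K0 _) _.
        move=> r /andP[r0 rt]; have O : tri (s + -1 * (t - r)) r by split; lra.
        by split=> //; exact: KS.
      have [|_ -> ->] := H0 (s + -1 * (t - 0)); first by apply/andP; split; lra.
      by rewrite mulr0 addr0 normr0 add0r ler_wpM2r.
    have a1 : t - s <= t by lra.
    apply: le_trans (char_growth tri_open Cj cc a1 lam0 K0 _) _.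
      move=> r /andP[r0 rt]; have O : tri (s + -1 * (t - r)) r by split; lra.
      by split=> //; exact: KS.
    have -> : s + -1 * (t - (t - s)) = 0 by ring.
    have [|_ -> ->] := H0' (t - s); first by apply/andP; split; lra.
    by rewrite mulr0 addr0 normr0 add0r ler_wpM2r.
  split.
  - have [->|sn0] := eqVneq s 0.
      by have [|-> _ _] := H0' t; [apply/andP; split; lra|rewrite normr0 mulr_ge0// divr_ge0].
    have {}sn0 : 0 < s by rewrite lt_neqAle eq_sym sn0.
    apply: le_trans (time_growth (K := A) Cj t0 lam0 A0 _) _.
      move=> r /andP[r0 rt]; split; first by split=> //; lra.
      by have [|||_ _ //] := PA s r; lra.
    have [|-> _ _] := H0 s; first by apply/andP; split; lra.
    by rewrite normr0 add0r ler_wpM2r.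
  - move: zp zm; rewrite !ler_norml => /andP[? ?] /andP[? ?]; apply/andP; split; lra.
  - move: zp zm; rewrite !ler_norml => /andP[? ?] /andP[? ?]; apply/andP; split; lra.
have [Z0 Z00 HZ0] := cont2_bounded 0 tau 0 tau c0.
have [Z1 Z10 HZ1] := cont2_bounded 0 tau 0 tau c1.
have [Z2 Z20 HZ2] := cont2_bounded 0 tau 0 tau c2.
pose A0 := Z0 + Z1 + Z2.
have A00 : 0 <= A0 by rewrite !addr_ge0.
have P0 : P A0.
  move=> s t s0 t0 st.
  have sT : 0 <= s <= tau by apply/andP; split; lra.
  have tT : 0 <= t <= tau by apply/andP; split; lra.
  have z0 := HZ0 s t sT tT; have z1 := HZ1 s t sT tT; have z2 := HZ2 s t sT tT.
  have e1 : 1 <= expR (lam * t) by rewrite exp_ge1// mulr_ge0// ltW.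
  have big a : a <= A0 -> a <= A0 * expR (lam * t).
    by move=> aA; apply: le_trans aA _; rewrite ler_peMr.
  by split; apply: big; rewrite /A0; lra.
have Pn n : P (A0 * 2^-1 ^+ n).
  elim: n => [|n IH]; first by rewrite expr0 mulr1.
  rewrite exprSr mulrA; apply: step IH.
  by rewrite mulr_ge0// exprn_ge0// invr_ge0.
move=> s t s0 t0 st; apply: (@halving_eq0 R _ (A0 * expR (lam * t))) => n.
by have [H _ _] := Pn n s t s0 t0 st; rewrite mulrAC.
Qed.

End TriangleUniqueness.

End Uniqueness.

Opaque wave.

Section Kernel.
Context {R : realType}.
Notation mu := (@lebesgue_measure R).
Variable N : R -> R.
Hypothesis hN : Ck 3 N.
Hypothesis hN0 : N 0 = 1.
Notation r := (resolvent N).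

(* A first order equation y' = N * phi becomes local in y'' and phi. *)
Lemma second_order_local (y y1 phi : R -> R) (t T y2 : R) : 0 < t < T ->
  continuous phi -> continuous y -> continuous y1 -> y 0 = 0 ->
  (forall s, 0 < s < T -> ider y s (y1 s)) ->
  (forall s, 0 < s < T -> y1 s = conv N phi s) -> ider y1 t y2 ->
  y2 = phi t + r 0 * y1 t + derive1 r 0 * y t + conv (derive1n 2 r) y t.
Proof.
move=> /[dup] tT /andP[t0 _] cphi cy cy1 y0 dy y1E dy2.
have cNp : continuous (conv N phi) by apply: cont_conv => //; exact: cont_N.
have -> : y2 = phi t + conv (derive1 N) phi t.
  apply: ider_unique dy2 _.
  by apply: (@oo_ider _ (conv N phi) _ t 0 T) => //; [move=> s /y1E|exact: ider_conv_N].
have E s : 0 <= s <= t -> conv (fun=> 1) (conv N phi) s = y s.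
  move=> /andP[s0 st]; rewrite conv1 (_ : y s = y s - y 0); last by rewrite y0 subr0.
  have dys z : 0 < z < s -> ider y z (y1 z).
    by move=> /andP[z0 zs]; apply: dy; move: tT => /andP[? ?]; apply/andP; split; lra.
  rewrite -(FTC_oo s0 cy1 dys); last exact: continuous_subspaceT.
  apply: eq_int_oo => [|z /andP[z0 zs]].
    by apply: measurable_funTS; exact: continuous_measurable_fun.
  by rewrite y1E//; move: tT => /andP[? ?]; apply/andP; split; lra.
rewrite (second_order hN hN0 (ltW t0) cphi) -y1E//.
have tt : 0 <= t <= t by rewrite lexx ltW.
have -> : conv (derive1n 2 r) (conv (fun=> 1) (conv N phi)) t = conv (derive1n 2 r) y t.
  exact: eq_conv.
by rewrite (E t tt).
Qed.

End Kernel.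

(** * Uniqueness of the classical solution, and its response *)

Section Classical.
Context {R : realType}.
Notation mu := (@lebesgue_measure R).
Variables (L : R) (q N : R -> R).
Hypothesis L0 : 0 < L.
Hypothesis hq : {within `[0, L], continuous q}.
Hypothesis hN : Ck 3 N.
Hypothesis hN0 : N 0 = 1.
Notation r := (resolvent N).
Implicit Types (j : @jet R).

Lemma potential_bounded : exists2 Q : R, 0 <= Q & forall x, 0 <= x <= L -> `|q x| <= Q.
Proof.
have [Q Q0 HQ] := cont_bounded 0 L (extend_cont L0 hq).
by exists Q => // x xL; rewrite -(extend_id q xL); exact: HQ.
Qed.

(** [second_order_local] expresses [j22 - j11] through terms of order at most one and a memory term,
    all controlled by the weighted bounds; then [strip_unique] applies. The derivatives at t = 0 and
    on the walls are recovered by continuity. *)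
Lemma homogeneous_zero j : C2_in (strip L) j ->
  (forall x, 0 <= x <= L -> j0 j x 0 = 0) ->
  (forall t, 0 <= t -> j0 j 0 t = 0 /\ j0 j L t = 0) ->
  (forall x t, strip L x t ->
     j2 j x t = conv N (fun s => j11 j x s + q x * j0 j x s) t) ->
  forall x t, 0 <= x <= L -> 0 <= t -> j0 j x t = 0.
Proof.
move=> Cj Hx0 Ht Heq; have [[c0 c1 c2] [c11 c12 c22] dj] := Cj.
have cphi x : continuous (fun s => j11 j x s + q x * j0 j x s).
  apply: contD; first exact: cont_sect c11.
  by apply: contM; [exact: cont_cst|exact: cont_sect c0].
have z20 x : 0 <= x <= L -> j2 j x 0 = 0.
  apply: (@cont0_closed R (fun x => j2 j x 0)) => //.
    exact: (cont_sect2 c2).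
  move=> {}x xL.
  have ch : continuous (fun s => j2 j x s - conv N (fun s => j11 j x s + q x * j0 j x s) s).
    apply: contD; first exact: cont_sect c2.
    by apply: contN; apply: cont_conv => //; exact: (cont_N hN).
  have h01 : (0 : R) <= (0 : R) <= 1 by apply/andP; split; [exact: lexx|exact: ler01].
  have := cont0_closed ch ltr01 _ h01; rewrite conv_le0// subr0; apply.
  by move=> s /andP[s0 _]; rewrite Heq ?subrr//; split.
have z10 x : 0 <= x <= L -> j1 j x 0 = 0.
  apply: (@edge_derivative R (fun t x => j0 j x t) (fun t x => j1 j x t) 0 1 0 L 0) => //.
  - exact: cont2_swap.
  - exact: cont2_swap.
  - by move=> s y /andP[s0 _] yL; have [] := dj y s.
  - by apply/andP; split; [exact: lexx|exact: ler01].
have edge x (T : R) : 0 < T -> 0 <= x <= L -> (forall t, 0 <= t -> j0 j x t = 0) ->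
    forall t, 0 <= t <= T -> j2 j x t = 0.
  move=> T0 xL z0; apply: (@edge_derivative R (j0 j) (j2 j) 0 L 0 T x) => //.
    by move=> y s yL /andP[s0 _]; have [] := dj y s.
  by move=> t /andP[t0 _]; exact: z0.
move=> x t xL t0; pose T := t + 1.
have T0 : 0 < T by rewrite /T; lra.
have L00 : (0 : R) <= 0 <= L by rewrite lexx ltW.
have LL : 0 <= L <= L by rewrite lexx ltW.
apply: (@strip_unique R L L0 j T Cj T0) => //.
- by move=> y yL; split; [exact: Hx0|exact: z10|exact: z20].
- move=> s /[dup] sT /andP[s0 _]; have [h1 h2] := Ht s s0.
  split=> //; first by apply: (edge 0 T) => // z /Ht[].
  by apply: (edge L T) => // z /Ht[].
- have [Q Q0 HQ] := potential_bounded.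
  have [R2 R20 HR2] := cont_bounded 0 T (cont_r2 hN).
  exists (Q + `|r 0| + `|derive1 r 0| + T * R2); first by rewrite !addr_ge0// mulr_ge0// ltW.
  move=> B lam B0 lam0 HB y s Oys sT; have [yL s0] := Oys.
  have yL' : 0 <= y <= L by case/andP: yL => ? ?; rewrite !ltW.
  have sT' : 0 < s < s + 1 by rewrite s0/=; lra.
  have dz : ider (j2 j y) s (j22 j y s) by have [] := dj y s.
  have E : j22 j y s = (j11 j y s + q y * j0 j y s) + r 0 * j2 j y s
     + derive1 r 0 * j0 j y s + conv (derive1n 2 r) (j0 j y) s.
    apply: (second_order_local hN hN0 sT' (cphi y) _ _ (Hx0 y yL') _ _ dz).
    - exact: cont_sect c0.
    - exact: cont_sect c2.
    - by move=> z /andP[z0 _]; have [] := dj y z.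
    - by move=> z /andP[z0 _]; exact: Heq.
  have sT2 : 0 <= s <= T by rewrite (ltW s0).
  have [b0 b1 b2] := HB y s yL' sT2.
  have b3 : `|conv (derive1n 2 r) (j0 j y) s| <= T * R2 * B * expR (lam * s).
    apply: conv_exp_bound => //; [exact: (cont_r2 hN)|exact: cont_sect c0|].
    move=> z /andP[z0 zs]; have zT : 0 <= z <= T by rewrite z0/=; lra.
    by have [] := HB y z yL' zT.
  rewrite E (_ : _ - _ = q y * j0 j y s + r 0 * j2 j y s + derive1 r 0 * j0 j y s
     + conv (derive1n 2 r) (j0 j y) s); last by ring.
  have m (a b C : R) : `|a| <= C -> `|b| <= B * expR (lam * s) -> `|a * b| <= C * (B * expR (lam * s)).
    by move=> aC bB; rewrite normrM; apply: ler_pM.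
  have m1 := m _ _ _ (HQ y yL') b0.
  have m2 := m _ _ _ (lexx `|r 0|) b2.
  have m3 := m _ _ _ (lexx `|derive1 r 0|) b0.
  rewrite (_ : (_ + _ + _ + _) * B * _ = Q * (B * expR (lam * s)) + `|r 0| * (B * expR (lam * s))
    + `|derive1 r 0| * (B * expR (lam * s)) + T * R2 * B * expR (lam * s)); last by ring.
  apply: le_trans (ler_normD _ _) _; apply: lerD b3.
  apply: le_trans (ler_normD _ _) _; apply: lerD m3.
  by apply: le_trans (ler_normD _ _) _; exact: lerD.
- by rewrite t0 /T; lra.
Qed.

Let D : set (R * R) := `[0, L] `*` `[0, +oo[.

Lemma strip_interior x t : strip L x t -> interior D (x, t).
Proof.
move=> Oxt; have := strip_open Oxt; apply: filterS => -[y s] /= [yL s0].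
by split; rewrite /= in_itv/= ?andbT; [case/andP: yL => ? ?; rewrite !ltW|exact: ltW].
Qed.

Lemma strip_jet w : C2_on D w ->
  exists j, C2_in (strip L) j /\ forall x t, 0 <= x <= L -> 0 <= t -> j0 j x t = w x t.
Proof.
have DE x t : 0 <= x <= L -> 0 <= t -> D (x, t).
  by move=> xL t0; split; rewrite /= in_itv/= ?andbT.
pose ret (p : R * R) := (clampr 0 L p.1, Num.max 0 p.2).
move=> /(@C2_on_jet R D ret (strip L)) []; last 1 first.
- by move=> j [Cj jw]; exists j; split=> // x t xL t0; apply: jw; exact: DE.
- apply: cont_pair.
    apply: (cont_comp1 (u := clampr 0 L)); [exact: clampr_cont|exact: continuous_fst].
  by apply: cont_max; [exact: cont_cst|exact: continuous_snd].
- move=> p; apply: DE; first by rewrite clampr_in// ltW.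
  by rewrite le_max lexx.
- move=> [x t] [/= xL t0]; rewrite in_itv/= in xL; rewrite in_itv/= andbT in t0.
  by rewrite /ret/= clampr_id// max_r.
- exact: strip_interior.
Qed.

Lemma derive1n2_jet (O : R -> R -> Prop) j w x t : C2_in O j ->
  (\forall y \near x, O y t /\ w y t = j0 j y t) -> derive1n 2 (w ^~ t) x = j11 j x t.
Proof.
move=> [_ _ dj] nO.
have -> : derive1n 2 (w ^~ t) x = derive1 (derive1 (w ^~ t)) x by [].
apply: derive1_eq.
have [_ _ d3 _ _] : [/\ ider (j0 j ^~ t) x (j1 j x t),
        ider (j0 j x) t (j2 j x t), ider (j1 j ^~ t) x (j11 j x t),
        ider (j1 j x) t (j12 j x t) & ider (j2 j x) t (j22 j x t)].
  by apply: dj; have [] := nbhs_singleton nO.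
apply: near_ider d3; near=> y; apply/esym/derive1_eq.
have ny : \forall z \near y, O z t /\ w z t = j0 j z t.
  by near: y; exact: nbhs_interior.
have [d1 _ _ _ _] := dj _ _ (nbhs_singleton ny).1.
by apply: near_ider d1; apply: filterS ny => z [_ ->].
Unshelve. all: by end_near. Qed.

Lemma classical_jet_eq f w j : is_classical L q N f w -> C2_in (strip L) j ->
  (forall x t, 0 <= x <= L -> 0 <= t -> j0 j x t = w x t) ->
  forall x t, strip L x t -> j2 j x t = conv N (fun s => j11 j x s + q x * j0 j x s) t.
Proof.
move=> [_ Hw _ _] Cj jw x t Oxt; have [xL t0] := Oxt.
have [[c0 c1 c2] [c11 c12 c22] dj] := Cj.
have nO s : 0 < s -> \forall y \near x, strip L y s /\ w y s = j0 j y s.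
  move=> s0; have xI : x \in `]0, L[ by rewrite in_itv.
  apply: filterS (near_in_itvoo xI) => y; rewrite in_itv/= => yL.
  by split=> //; rewrite jw ?(ltW s0)//; case/andP: yL => ? ?; rewrite !ltW.
have xL' : 0 <= x <= L by case/andP: xL => ? ?; rewrite !ltW.
have [_ d2 _ _ _] := dj x t Oxt.
have <- : derive1 (w x) t = j2 j x t.
  apply: derive1_eq; apply: (@oo_ider _ _ _ t 0 (t + 1)) d2; first by rewrite t0 /=; lra.
  by move=> s /andP[s0 _]; rewrite jw// ltW.
rewrite Hw// convE; apply: eq_int_oo.
  apply: measurable_funTS; apply: continuous_measurable_fun.
  apply: contM; first by apply: cont_rev; exact: (cont_N hN).
  apply: contD; first exact: cont_sect c11.
  by apply: contM; [exact: cont_cst|exact: cont_sect c0].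
move=> s /andP[s0 _]; rewrite (derive1n2_jet Cj (nO s s0)) -jw// ltW//.
Qed.

Lemma classical_unique f w j : is_classical L q N f w -> isC2 j ->
  is_classical L q N f (j0 j) ->
  (forall x t, 0 <= x <= L -> 0 <= t ->
      j2 j x t = conv N (fun s => j11 j x s + q x * j0 j x s) t) ->
  forall x t, 0 <= x <= L -> 0 <= t -> w x t = j0 j x t.
Proof.
move=> Hw Cj Hj Heq x t xL t0.
have [Cw _ w0 wb] := Hw; have [_ _ z0 zb] := Hj.
have [J [CJ Jw]] := strip_jet Cw.
have L00 : (0 : R) <= 0 <= L by rewrite lexx ltW.
have LL : 0 <= L <= L by rewrite lexx ltW.
have Cj' : C2_in (strip L) j by exact: isC2_in.
have Cd := C2_inB CJ Cj'.
have Jeq := classical_jet_eq Hw CJ Jw.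
have [[a0 a1 a2] [a11 a12 a22] _] := CJ; have [[b0 b1 b2] [b11 b12 b22] _] := Cj.
have sE (u : R -> R -> R) y : cont2 u -> continuous (u y) by move=> cu; exact: cont_sect cu.
have cph (u v : R -> R -> R) y : cont2 u -> cont2 v -> continuous (fun s => u y s + q y * v y s).
  by move=> cu cv; apply: contD; [exact: sE|apply: contM; [exact: cont_cst|exact: sE]].
have Hd0 y : 0 <= y <= L -> j0 (jetB J j) y 0 = 0.
  by move=> yL; rewrite /= Jw// w0// z0// subrr.
have Hdb s : 0 <= s -> j0 (jetB J j) 0 s = 0 /\ j0 (jetB J j) L s = 0.
  move=> s0; have [e1 e2] := wb s s0; have [e3 e4] := zb s s0.
  by rewrite /= !Jw// e1 e2 e3 e4 !subrr.
have := homogeneous_zero Cd Hd0 Hdb _ xL t0.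
rewrite /= Jw// => /(_ _)/eqP; rewrite subr_eq0 => H; apply/eqP; apply: H.
move=> y s /[dup] Oys [yL s0]; have yL' : 0 <= y <= L by case/andP: yL => ? ?; rewrite !ltW.
rewrite (Jeq y s Oys) (Heq y s yL' (ltW s0)) -[X in _ - X]mul1r -mulNr mulN1r.
rewrite -[X in _ + X]mulN1r -(convZr _ _ (cont_N hN)); last exact/cont_locint/cph.
rewrite -convDr; [|exact: (cont_N hN)|exact/cont_locint/cph|].
  by apply: eq_conv => // z _; ring.
by apply: locintZ; exact/cont_locint/cph.
Qed.

(** What is used later about the classical solution. The chosen solution is known on the strip only;
    the jet is of class C^2 on the plane, and its last clause is the explicit wave valid up to time
    [L]. *)
Definition jet_of (f : R -> R) (j : jet) := [/\ isC2 j,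
  (forall x t, 0 <= x <= L -> 0 <= t -> classical_solution L q N f x t = j0 j x t) /\
  (forall x t, 0 <= x <= L -> t <= 0 -> j0 j x t = 0),
  (forall t, 0 <= t -> j0 j 0 t = f t /\ j0 j L t = 0),
  (forall x t, 0 <= x <= L -> 0 <= t ->
      j2 j x t = conv N (fun s => j11 j x s + q x * j0 j x s) t) &
  (forall x t, 0 <= x <= L -> t <= L ->
      j0 j x t = expR (gamma N * t) * wave N (extend L q) (amplitude N f) x t)].

Lemma jet_of_control f : control f -> exists j, jet_of f j.
Proof.
move=> cf; have f0 := control_causal cf.
have [j [Cj Hj jc jeq je]] := classical_exists hN hN0 L0 hq cf.1 f0.
exists j; split=> //; last by have [_ _ _] := Hj.
split=> // x t xL t0; apply: (classical_unique (f := f)) => //.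
exact: (@xgetPex _ (fun _ _ => 0) [set w | is_classical L q N f w] (ex_intro _ _ Hj)).
Qed.

Lemma response_jet f j t : jet_of f j -> 0 <= t -> response L q N f t = j1 j 0 t.
Proof.
move=> [Cj [jw _] _ _ _] t0; have [[_ c1 _] _ dj] := Cj.
have L00 : (0 : R) <= 0 <= L by rewrite lexx ltW.
rewrite /response; apply/cvg_lim => //.
have cj1 : continuous (j1 j ^~ t) by exact: (cont_sect2 c1).
apply: (@right_quotient R (classical_solution L q N f ^~ t) (j1 j ^~ t) L L0 cj1).
move=> h /andP[h0 hL]; rewrite !jw//; last by rewrite h0 ltW.
rewrite (FTC (F := j0 j ^~ t))//; first by move=> x; have [] := dj x t.
Qed.

End Classical.

(** * The Blagoveshchenskii equation *)

Section Blagoveshchenskii.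
Context {R : realType}.
Notation mu := (@lebesgue_measure R).
Variables (L : R) (q N : R -> R).
Hypothesis L0 : 0 < L.
Hypothesis hq : {within `[0, L], continuous q}.
Hypothesis hN : Ck 3 N.
Hypothesis hN0 : N 0 = 1.
Notation r := (resolvent N).
Implicit Types (j k : @jet R).

Lemma conv_ibp_oo (a a' b b' : R -> R) (t : R) : 0 <= t -> continuous a' -> continuous b ->
  continuous b' -> (forall s, ider a s (a' s)) -> (forall s, 0 < s < t -> ider b s (b' s)) ->
  b 0 = 0 -> conv a b' t = a 0 * b t + conv a' b t.
Proof.
move=> t0 ca' cb cb' da db b0.
have ca : continuous a by exact: ider_cont da.
have cra : continuous (fun s => a (t - s)) by exact: cont_rev.
have cra' : continuous (fun s => a' (t - s)) by exact: cont_rev.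
have E := @FTC_oo R (fun s => a (t - s) * b s) (fun s => a (t - s) * b' s - a' (t - s) * b s) 0 t t0.
have {}E : \int[mu]_(s in `[0, t]) (a (t - s) * b' s - a' (t - s) * b s) = a 0 * b t.
  rewrite E; first by rewrite b0 mulr0 subr0 subrr.
  - by apply: contD; [exact: contM|apply: contN; exact: contM].
  - move=> s st; apply: ider_val (iderM (ider_rev (da (t - s))) (db s st)) _; ring.
  - by apply: continuous_subspaceT; exact: contM.
rewrite !convE -E RintegralB//; first by rewrite subrK.
- by apply: cont_locint; exact: contM.
- by apply: cont_locint; exact: contM.
Qed.

Lemma eq_conv_oo (a b b' : R -> R) (t : R) : continuous a -> continuous b' ->
  (forall s, 0 < s < t -> b s = b' s) -> conv a b t = conv a b' t.
Proof.
move=> ca cb' bb; rewrite !convE; apply: eq_int_oo.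
  apply: measurable_funTS; apply: continuous_measurable_fun; apply: contM => //.
  exact: cont_rev.
by move=> s /bb ->.
Qed.

Section Source.
Variables (f g yf yg yf' yg' : R -> R).
Hypotheses (cf : continuous f) (cg : continuous g) (cyf : continuous yf') (cyg : continuous yg').
Hypotheses (yfE : forall t, 0 <= t -> yf t = yf' t) (ygE : forall t, 0 <= t -> yg t = yg' t).

(** [blago_Phi] written with functions continuous on the whole line, to which the responses are tied
    at nonnegative times only. *)
Definition greens_source s t := conv N (fun z => f z * yg' s - yf' z * g s) t.

Lemma greens_source_cont t : continuous (greens_source ^~ t).
Proof.
have ct (u v : R -> R) : continuous u -> continuous v ->
    continuous (fun z : R * R => u z.2 * v z.1).
  move=> cu cv; apply: contM.
    by apply: (cont_comp1 (u := u)) => //; exact: continuous_snd.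
  by apply: (cont_comp1 (u := v)) => //; exact: continuous_fst.
apply: (@cont_conv2 R R (fun=> N) (fun s z => f z * yg' s - yf' z * g s) (fun=> t)).
- by apply: (cont_comp1 (u := N)); [exact: (cont_N hN)|exact: continuous_snd].
- by apply: contD; [exact: ct|apply: contN; exact: ct].
- exact: cst_continuous.
Qed.

Lemma blago_PhiE s t : 0 <= s -> blago_Phi N f g yf yg s t = greens_source s t.
Proof.
move=> s0; rewrite /blago_Phi /greens_source convE; apply: eq_Rintegral => z.
by rewrite inE/= in_itv/= => /andP[z0 _]; rewrite ygE// yfE.
Qed.

(** Since Psi = N * Phi in s and N(0) = 1, the derivative of Psi is 1 + N' applied to Phi, and the
    resolvent undoes this. So the source of the equation is Phi itself. *)
Lemma blago_FE s t : 0 < s -> blago_F N f g yf yg s t = greens_source s t.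
Proof.
move=> s0; have cG : continuous (greens_source ^~ t) by exact: greens_source_cont.
have PsiE : blago_Psi N f g yf yg ^~ t = conv N (greens_source ^~ t).
  apply/funext => z; rewrite /blago_Psi convE; apply: eq_Rintegral => w.
  by rewrite inE/= in_itv/= => /andP[w0 _]; rewrite blago_PhiE.
have dPsi z : 0 < z -> derive1 (blago_Psi N f g yf yg ^~ t) z =
    greens_source z t + conv (derive1 N) (greens_source ^~ t) z.
  by move=> z0; rewrite PsiE; apply: derive1_eq; exact: ider_conv_N.
rewrite /blago_F -(convE r) (dPsi s s0).
have -> : conv r (derive1 (blago_Psi N f g yf yg ^~ t)) s =
    conv r (fun z => greens_source z t + conv (derive1 N) (greens_source ^~ t) z) s.
  apply: eq_conv_oo; first exact: (cont_r hN).
    exact: (contD cG (cont_conv (cont_N1 hN) cG)).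
  by move=> z /andP[z0 _]; exact: dPsi.
by rewrite (resolvent_conv hN (ltW s0) cG) addrK.
Qed.

End Source.

(** The operator 1 - R in the first variable applied to the second derivative in that variable; the
    equation convolves it with [N] in the second variable and adds the source. *)
Definition mixed_source j (s xi : R) := j11 j s xi - conv r (j11 j ^~ xi) s.

Lemma mixed_source_cont j s : cont2 (j11 j) -> continuous (mixed_source j s).
Proof.
move=> c11; apply: contD; first exact: cont_sect c11.
apply: contN; apply: (@cont_conv2 R R (fun=> r) (fun xi nu => j11 j nu xi) (fun=> s)).
- by apply: (cont_comp1 (u := r)); [exact: (cont_r hN)|exact: continuous_snd].
- exact: cont2_swap c11.
- exact: cst_continuous.
Qed.

Lemma conv_mixed_source j s t : cont2 (j11 j) ->
  conv N (mixed_source j s) t =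
  conv N (j11 j s) t - conv r (fun nu => conv N (j11 j nu) t) s.
Proof.
move=> c11; have c11s : continuous (j11 j s) by exact: cont_sect c11.
have cr := cont_r hN; have cN := cont_N hN.
have cc : continuous (fun xi => conv r (j11 j ^~ xi) s).
  apply: (@cont_conv2 R R (fun=> r) (fun xi nu => j11 j nu xi) (fun=> s)).
  - by apply: (cont_comp1 (u := r)) => //; exact: continuous_snd.
  - exact: cont2_swap c11.
  - exact: cst_continuous.
rewrite /mixed_source.
have -> : conv N (fun xi => j11 j s xi - conv r (j11 j ^~ xi) s) t =
    conv N (j11 j s) t + conv N (fun xi => -1 * conv r (j11 j ^~ xi) s) t.
  rewrite -convDr//; [|exact: cont_locint|by apply: locintZ; exact: cont_locint].
  by apply: eq_conv => // z _; rewrite mulN1r.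
rewrite convZr//; last exact: cont_locint.
rewrite mulN1r; congr (_ - _).
have ir : mu.-integrable `[0, s] (EFin \o (fun nu => r (s - nu))) by apply: cont_locint; exact: cont_rev.
have iN : mu.-integrable `[0, t] (EFin \o (fun xi => N (t - xi))) by apply: cont_locint; exact: cont_rev.
have := fubini_rect c11 ir iN; rewrite !convE => E.
transitivity (\int[mu]_(xi in `[0, t]) (N (t - xi) * \int[mu]_(nu in `[0, s]) (j11 j nu xi * r (s - nu)))).
  apply: eq_Rintegral => xi _; rewrite convE; congr (_ * _); apply: eq_Rintegral => nu _.
  by rewrite mulrC.
rewrite -E; apply: eq_Rintegral => nu _; rewrite convE; congr (_ * _).
by apply: eq_Rintegral => xi _; rewrite mulrC.
Qed.

(** * The Blagoveshchenskii equation in terms of a jet *)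

Section Reduction.
Variables (tau : R) (j : @jet R) (H : R -> R -> R).
Hypothesis Cj : C2_in (tri tau) j.
Hypothesis Hj : forall s t, triangle tau (s, t) -> H s t = j0 j s t.

Let tri_triangle s t : tri tau s t -> triangle tau (s, t).
Proof. by move=> [s0 t0 st]; split; rewrite /= ltW. Qed.

Lemma tri_derive s t : tri tau s t -> derive1 (H s) t = j2 j s t.
Proof.
move=> /[dup] Ost [s0 t0 st]; have [_ _ dj] := Cj; have [_ d2 _ _ _] := dj s t Ost.
apply: derive1_eq; apply: (@oo_ider _ _ _ t 0 (tau - s)) d2.
  by apply/andP; split; lra.
by move=> z /andP[z0 zs]; rewrite Hj//; apply: tri_triangle; split=> //; lra.
Qed.

Lemma tri_near s t : tri tau s t ->
  \forall y \near s, tri tau y t /\ H y t = j0 j y t.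
Proof.
move=> [s0 t0 st]; have sI : s \in `]0, (tau - t)[ by rewrite in_itv/= s0/=; lra.
apply: filterS (near_in_itvoo sI) => y; rewrite in_itv/= => /andP[y0 yt].
have O : tri tau y t by split=> //; lra.
by split=> //; apply: Hj; exact: tri_triangle.
Qed.

Lemma tri_conv_derive2 s t : tri tau s t ->
  derive1n 2 (fun s' => \int[mu]_(xi in `[0, t]) (N (t - xi) * H s' xi)) s =
  conv N (j11 j s) t.
Proof.
move=> [s0 t0 st]; have [[c0 c1 c2] [c11 c12 c22] dj] := Cj.
pose e := Num.min s (tau - t - s).
have e0 : 0 < e by rewrite lt_min s0/=; lra.
have es : e <= s by rewrite ge_min lexx.
have et : e <= tau - t - s by rewrite ge_min lexx orbT.
have O y xi : `|y - s| < e -> 0 < xi < t -> tri tau y xi.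
  by rewrite ltr_norml => /andP[? ?] /andP[? ?]; split=> //; lra.
have cNt : cont2 (fun _ xi : R => N (t - xi)).
  apply: (cont_comp1 (u := fun xi => N (t - xi))); last exact: continuous_snd.
  by apply: cont_rev; exact: (cont_N hN).
have cS (u : R -> R -> R) y : cont2 u -> locint (fun xi => N (t - xi) * u y xi).
  move=> cu; apply: cont_locint; apply: contM; last exact: cont_sect cu.
  by apply: cont_rev; exact: (cont_N hN).
have L1 y : `|y - s| < e -> ider (fun s' => \int[mu]_(xi in `[0, t]) (N (t - xi) * j0 j s' xi)) y
    (\int[mu]_(xi in `[0, t]) (N (t - xi) * j1 j y xi)).
  move=> ys; have d0 : 0 < e - `|y - s| by rewrite subr_gt0.
  apply: (@leibniz R (fun s' xi => N (t - xi) * j0 j s' xi) (fun s' xi => N (t - xi) * j1 j s' xi)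
     y _ 0 t d0 (ltW t0)).
  - by move=> z _; exact: cS.
  - exact: contM.
  - move=> z xi zy xit; apply: iderZ; have [] // := dj z xi; apply: O => //.
    rewrite (_ : z - s = (z - y) + (y - s)); last by ring.
    by apply: le_lt_trans (ler_normD _ _) _; rewrite -ltrBrDr.
have L2 : ider (fun s' => \int[mu]_(xi in `[0, t]) (N (t - xi) * j1 j s' xi)) s
    (\int[mu]_(xi in `[0, t]) (N (t - xi) * j11 j s xi)).
  apply: (@leibniz R (fun s' xi => N (t - xi) * j1 j s' xi) (fun s' xi => N (t - xi) * j11 j s' xi)
     s _ 0 t e0 (ltW t0)).
  - by move=> z _; exact: cS.
  - exact: contM.
  - by move=> z xi zs xit; apply: iderZ; have [] := dj z xi (O _ _ zs xit).
set F := fun s' => _.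
have -> : derive1n 2 F s = derive1 (derive1 F) s by [].
rewrite convE; apply: derive1_eq.
have FE y : `|y - s| < e -> F y = \int[mu]_(xi in `[0, t]) (N (t - xi) * j0 j y xi).
  move=> ys; apply: eq_Rintegral => xi; rewrite inE/= in_itv/= => /andP[x0 xt].
  rewrite Hj//; move: ys; rewrite ltr_norml => /andP[? ?]; split => //=; lra.
have se : s - e < s < s + e by apply/andP; split; lra.
have ne y : s - e < y < s + e -> `|y - s| < e.
  by move=> /andP[? ?]; rewrite ltr_norml; apply/andP; split; lra.
apply: (oo_ider se _ L2) => y ye; apply/esym/derive1_eq.
apply: (oo_ider ye _ (L1 y (ne y ye))) => z ze.
by rewrite FE//; exact: ne.
Qed.

(** The iterated derivatives in the equation are pointwise and agree with the jet in the open
    triangle; the integrals do not see the end points. *)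
Lemma tri_rhs s t : tri tau s t ->
  derive1n 2 (fun s' => \int[mu]_(xi in `[0, t]) (N (t - xi) * H s' xi)) s
      - \int[mu]_(nu in `[0, s]) (r (s - nu) *
          \int[mu]_(xi in `[0, t]) (N (t - xi) * derive1n 2 (H ^~ xi) nu)) =
  conv N (mixed_source j s) t.
Proof.
move=> /[dup] Ost [s0 t0 st]; have [_ [c11 _ _] _] := Cj.
rewrite (tri_conv_derive2 Ost) (conv_mixed_source s t c11); congr (_ - _).
rewrite -(convE r); apply: eq_conv_oo; first exact: (cont_r hN).
  apply: (@cont_conv2 R R (fun=> N) (fun nu xi => j11 j nu xi) (fun=> t)) => //.
  - by apply: (cont_comp1 (u := N)); [exact: (cont_N hN)|exact: continuous_snd].
  - exact: cst_continuous.
move=> nu /andP[nu0 nus]; rewrite -(convE N); apply: eq_conv_oo; first exact: (cont_N hN).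
  exact: cont_sect c11.
move=> xi /andP[xi0 xit]; apply: (derive1n2_jet Cj); apply: tri_near.
by split=> //; lra.
Qed.

End Reduction.

(** The convolution with [N] in t is removed by [second_order_local], the one with R in s by two
    integrations by parts, thanks to the vanishing data. What remains is H_tt - H_ss with terms of
    lower order, to which [tri_unique] applies. *)
Lemma tri_homogeneous_zero (tau : R) j : C2_in (tri tau) j ->
  (forall r, 0 <= r < tau -> [/\ j0 j r 0 = 0, j1 j r 0 = 0 & j2 j r 0 = 0]) ->
  (forall r, 0 <= r < tau -> [/\ j0 j 0 r = 0, j1 j 0 r = 0 & j2 j 0 r = 0]) ->
  (forall s t, tri tau s t -> j2 j s t = conv N (mixed_source j s) t) ->
  forall s t, 0 <= s -> 0 <= t -> s + t < tau -> j0 j s t = 0.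
Proof.
move=> Cj Hs Ht Heq; have [[c0 c1 c2] [c11 c12 c22] dj] := Cj.
have cT (u : R -> R -> R) t : cont2 u -> continuous (u ^~ t).
  by move=> cu; exact: (cont_sect2 cu).
have cr2 := cont_r2 hN.
have [R2 R20 HR2] := cont_bounded 0 tau cr2.
have [tau0|/ltW tau0] := leP tau 0; first by move=> s t s0 t0 st; exfalso; lra.
apply: (tri_unique Cj Hs Ht).
exists (`|r 0| + `|r 0| + tau * R2 + tau * R2).
  by rewrite !addr_ge0// mulr_ge0.
move=> B lam B0 lam0 HB s t /[dup] Ost [s0 t0 st].
have [b0 b1 b2] := HB s t (ltW s0) (ltW t0) st.
have dz : ider (j2 j s) t (j22 j s t) by have [] := dj s t Ost.
have tT : 0 < t < tau - s by apply/andP; split; lra.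
have s_tau : 0 <= s < tau by apply/andP; split; lra.
have t_tau : 0 <= t < tau by apply/andP; split; lra.
have O z : 0 < z < tau - s -> tri tau s z by move=> /andP[? ?]; split=> //; lra.
have [z00 z10 z20] := Hs s s_tau.
have E : j22 j s t = mixed_source j s t + r 0 * j2 j s t
     + derive1 r 0 * j0 j s t + conv (derive1n 2 r) (j0 j s) t.
  have cm : continuous (mixed_source j s) by exact: mixed_source_cont.
  apply: (second_order_local hN hN0 tT cm _ _ z00 _ _ dz).
  - exact: cont_sect c0.
  - exact: cont_sect c2.
  - by move=> z /O Oz; have [] := dj s z Oz.
  - by move=> z /O; exact: Heq.
have O' z : 0 < z < s -> tri tau z t by move=> /andP[? ?]; split=> //; lra.
have [y00 y10 y20] := Ht t t_tau.
have E1 : conv r (j11 j ^~ t) s = r 0 * j1 j s t + derive1 r 0 * j0 j s t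
    + conv (derive1n 2 r) (j0 j ^~ t) s.
  rewrite (@conv_ibp_oo r (derive1 r) (j1 j ^~ t) (j11 j ^~ t) s (ltW s0) (cont_r1 hN)
     (cT _ _ c1) (cT _ _ c11) (ider_r hN))//; last first.
    by move=> z /O' Oz; have [] := dj z t Oz.
  rewrite (@conv_ibp_oo (derive1 r) (derive1n 2 r) (j0 j ^~ t) (j1 j ^~ t) s (ltW s0) cr2
     (cT _ _ c0) (cT _ _ c1) (ider_r1 hN))//; last first.
    by move=> z /O' Oz; have [] := dj z t Oz.
  by rewrite addrA.
have b3 : `|conv (derive1n 2 r) (j0 j s) t| <= tau * R2 * B * expR (lam * t).
  apply: conv_exp_bound => //; [exact: cont_sect c0|by apply/andP; split; lra|].
  by move=> z /andP[z0 zt]; have [|h _ _] := HB s z (ltW s0) z0; [lra|exact: h].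
have b4 : `|conv (derive1n 2 r) (j0 j ^~ t) s| <= tau * R2 * B * expR (lam * t).
  rewrite conv_oint ?(ltW s0)//.
  apply: le_trans (oint_bound (C := R2 * (B * expR (lam * t))) _ _) _.
  - exact: conv_integrand_locint cr2 (cont_locint (cT _ _ c0)).
  - rewrite min_l ?(ltW s0)// max_r ?(ltW s0)// => z /andP[z0 zs]; rewrite normrM; apply: ler_pM => //.
      by apply: HR2; apply/andP; split; lra.
    by have [|h _ _] := HB z t z0 (ltW t0); [lra|exact: h].
  - rewrite subr0 ger0_norm ?(ltW s0)// (_ : tau * R2 * B * _ = R2 * (B * expR (lam * t)) * tau); last by ring.
    by rewrite ler_wpM2l//; [rewrite !mulr_ge0// expR_ge0|lra].
rewrite E /mixed_source E1.
rewrite (_ : _ - _ = r 0 * j2 j s t - r 0 * j1 j s t + conv (derive1n 2 r) (j0 j s) t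
  - conv (derive1n 2 r) (j0 j ^~ t) s); last first.
  move: (conv _ _ _) (conv _ _ _) (r 0) (derive1 r 0) (j11 j s t) (j2 j s t) (j1 j s t) (j0 j s t).
  by move=> *; ring.
have m1 : `|r 0 * j2 j s t| <= `|r 0| * (B * expR (lam * t)) by rewrite normrM ler_wpM2l.
have m2 : `|r 0 * j1 j s t| <= `|r 0| * (B * expR (lam * t)) by rewrite normrM ler_wpM2l.
rewrite (_ : (_ + _ + _ + _) * B * _ = `|r 0| * (B * expR (lam * t)) + `|r 0| * (B * expR (lam * t))
    + tau * R2 * B * expR (lam * t) + tau * R2 * B * expR (lam * t)); last by ring.
apply: le_trans (ler_normB _ _) _; apply: lerD b4.
apply: le_trans (ler_normD _ _) _; apply: lerD b3.
by apply: le_trans (ler_normB _ _) _; exact: lerD.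
Qed.

(** * Correlations of two waves *)

Section Pairing.
Implicit Types u v : R -> R -> R.

Definition pairing u v (s t : R) := oint 0 L (fun x => u x t * v x s).

Lemma pairingE u v s t : pairing u v s t = \int[mu]_(x in `[0, L]) (u x t * v x s).
Proof. by rewrite /pairing oint_ge// ltW. Qed.

Let cont_uv u v : cont2 u -> cont2 v ->
  continuous (fun z : (R * R) * R => u z.2 z.1.2 * v z.2 z.1.1).
Proof.
move=> cu cv; have c1 := @continuous_fst (R * R)%type R.
apply: contM.
  apply: (cont_comp2 (u := u)) => //; first exact: continuous_snd.
  by apply: (cont_comp1 (u := snd)) => //; exact: continuous_snd.
apply: (cont_comp2 (u := v)) => //; first exact: continuous_snd.
by apply: (cont_comp1 (u := fst)) => //; exact: continuous_fst.
Qed.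

Lemma cont_pairing u v : cont2 u -> cont2 v -> cont2 (pairing u v).
Proof.
move=> cu cv; apply: (@cont_oint R (R * R)%type (fun p x => u x p.2 * v x p.1) (fun=> 0) (fun=> L)).
- exact: cont_uv.
- exact: cst_continuous.
- exact: cst_continuous.
Qed.

Let cont_s u v t : cont2 u -> cont2 v -> cont2 (fun s x => u x t * v x s).
Proof.
move=> cu cv; apply: contM; last exact: cont2_swap.
apply: (cont_comp1 (u := u ^~ t)); last exact: continuous_snd.
exact: (cont_sect2 cu).
Qed.

Let cont_t u v s : cont2 u -> cont2 v -> cont2 (fun t x => u x t * v x s).
Proof.
move=> cu cv; apply: contM; first exact: cont2_swap.
apply: (cont_comp1 (u := v ^~ s)); last exact: continuous_snd.
exact: (cont_sect2 cv).
Qed.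

Lemma pairing_ds u v v' s t : cont2 u -> cont2 v -> cont2 v' ->
  (forall x s, ider (v x) s (v' x s)) -> ider (pairing u v ^~ t) s (pairing u v' s t).
Proof.
move=> cu cv cv' dv; apply: (@leibniz_oint R (fun s x => u x t * v x s) (fun s x => u x t * v' x s)).
- exact: cont_s.
- exact: cont_s.
- by move=> z x; apply: iderZ.
Qed.

Lemma pairing_dt u u' v s t : cont2 u -> cont2 u' -> cont2 v ->
  (forall x t, ider (u x) t (u' x t)) -> ider (pairing u v s) t (pairing u' v s t).
Proof.
move=> cu cu' cv du; apply: (@leibniz_oint R (fun t x => u x t * v x s) (fun t x => u' x t * v x s)).
- exact: cont_t.
- exact: cont_t.
- move=> z x; apply: (@eq_ider _ (fun t => v x s * u x t)); first by move=> ?; rewrite mulrC.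
  by rewrite mulrC; apply: iderZ.
Qed.

(** The first variable is the time of the second factor, so derivatives with index 1 fall on [k]. *)
Definition pairing_jet j k := Jet (pairing (j0 j) (j0 k)) (pairing (j0 j) (j2 k))
  (pairing (j2 j) (j0 k)) (pairing (j0 j) (j22 k)) (pairing (j2 j) (j2 k)) (pairing (j22 j) (j0 k)).

Lemma pairing_jetC2 j k : isC2 j -> isC2 k -> isC2 (pairing_jet j k).
Proof.
move=> [[a0 a1 a2] [a11 a12 a22] da] [[b0 b1 b2] [b11 b12 b22] db].
have da0 x t : ider (j0 j x) t (j2 j x t) by have [] := da x t.
have da2 x t : ider (j2 j x) t (j22 j x t) by have [] := da x t.
have db0 x t : ider (j0 k x) t (j2 k x t) by have [] := db x t.
have db2 x t : ider (j2 k x) t (j22 k x t) by have [] := db x t.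
split; [by split; exact: cont_pairing|by split; exact: cont_pairing|].
move=> s t; split.
- exact: pairing_ds.
- exact: pairing_dt.
- exact: pairing_ds.
- exact: pairing_dt.
- exact: pairing_dt.
Qed.

Section Correlation.
Variables (f g : R -> R) (j k : @jet R).
Hypotheses (jf : jet_of L q N f j) (kg : jet_of L q N g k).

Lemma correlation_pairing s t : 0 <= s -> 0 <= t ->
  correlation L q N f g s t = pairing (j0 j) (j0 k) s t.
Proof.
move=> s0 t0; rewrite pairingE; apply: eq_Rintegral => x; rewrite inE/= in_itv/= => xL.
have [_ [jw _] _ _ _] := jf; have [_ [kw _] _ _ _] := kg.
by rewrite jw// kw.
Qed.

Let psi j x s := j11 j x s + q x * j0 j x s.

Lemma jet_of_d0 h i x : jet_of L q N h i -> 0 <= x <= L -> j0 i x 0 = 0 /\ j2 i x 0 = 0.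
Proof.
move=> [Ci [_ ic] _ ieq _] xL; rewrite ieq// conv_le0//; split=> //; exact: ic.
Qed.

Let ext_cont : continuous (extend L q). Proof. exact: extend_cont. Qed.
Let psi' j x s := j11 j x s + extend L q x * j0 j x s.

Let psi'_cont i : isC2 i -> cont2 (psi' i).
Proof.
move=> [[c0 _ _] [c11 _ _] _]; apply: contD => //; apply: contM => //.
by apply: (cont_comp1 (u := extend L q)) => //; exact: continuous_fst.
Qed.

Let psiE h i x t : jet_of L q N h i -> 0 <= x <= L -> 0 <= t ->
  j2 i x t = conv N (psi' i x) t.
Proof.
move=> [_ _ _ ieq _] xL t0; rewrite ieq//; apply: eq_conv => // s _.
by rewrite /psi' extend_id.
Qed.

(* (1 - R * )(1 + N' * ) = 1 turns v_tt back into v_xx + q v *)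
Let psi_resolvent h i x s : jet_of L q N h i -> 0 <= x <= L -> 0 < s ->
  j22 i x s - conv r (j22 i x) s = psi' i x s.
Proof.
move=> hi xL s0; have [Ci _ _ _ _] := hi; have [[c0 c1 c2] [c11 c12 c22] dj] := Ci.
have cp : continuous (psi' i x) by exact: (@cont_sect R R (psi' i) x (psi'_cont Ci)).
have E z : 0 < z -> j22 i x z = psi' i x z + conv (derive1 N) (psi' i x) z.
  move=> z0; have [_ _ _ _ d22] := dj x z; apply: ider_unique d22 _.
  apply: (@oo_ider _ (conv N (psi' i x)) _ z 0 (z + 1)); last exact: ider_conv_N.
    by rewrite z0/=; lra.
  by move=> y /andP[y0 _]; rewrite (psiE hi xL (ltW y0)).
rewrite E//.
have -> : conv r (j22 i x) s = conv r (fun z => psi' i x z + conv (derive1 N) (psi' i x) z) s.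
  apply: eq_conv_oo; first exact: (cont_r hN).
    by apply: contD => //; apply: cont_conv => //; exact: (cont_N1 hN).
  by move=> z /andP[z0 _]; exact: E.
by rewrite (resolvent_conv hN (ltW s0) cp) addrK.
Qed.

(** H_ss puts two time derivatives on the second wave v; the operator 1 - R trades them for v_xx + q
    v, by [psi_resolvent]. *)
Let pairing_mixed s xi : 0 < s ->
  mixed_source (pairing_jet j k) s xi = oint 0 L (fun x => j0 j x xi * psi' k x s).
Proof.
move=> s0; have [[[a0 a1 a2] [a11 a12 a22] da] _ _ _ _] := jf.
have [Ck _ _ _ _] := kg; have [[b0 b1 b2] [b11 b12 b22] db] := Ck.
have sx (u : R -> R -> R) t : cont2 u -> continuous (u ^~ t).
  by move=> cu; exact: (cont_sect2 cu).
have crs : continuous (fun nu => r (s - nu)) by apply: cont_rev; exact: (cont_r hN).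
have ir : mu.-integrable `[0, s] (EFin \o (fun nu => r (s - nu))) by exact: cont_locint.
have ij : mu.-integrable `[0, L] (EFin \o (j0 j ^~ xi)) by exact/cont_locint/sx.
have E := fubini_rect (cont2_swap b22) ir ij.
rewrite /mixed_source.
have -> : conv r (j11 (pairing_jet j k) ^~ xi) s =
    oint 0 L (fun x => j0 j x xi * conv r (j22 k x) s).
  rewrite (oint_ge _ (ltW L0)) convE.
  transitivity (\int[mu]_(z in `[0, s]) (r (s - z) * \int[mu]_(x in `[0, L]) (j22 k x z * j0 j x xi))).
    apply: eq_Rintegral => z _; congr (_ * _); rewrite /= pairingE.
    by apply: eq_Rintegral => x _; rewrite mulrC.
  rewrite E; apply: eq_Rintegral => x _; congr (_ * _); rewrite convE.
  by apply: eq_Rintegral => z _; rewrite mulrC.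
have cc : continuous (fun x => conv r (j22 k x) s).
  apply: (@cont_conv2 R R (fun=> r) (fun x => j22 k x) (fun=> s)).
  - by apply: (cont_comp1 (u := r)); [exact: (cont_r hN)|exact: continuous_snd].
  - exact: b22.
  - exact: cst_continuous.
rewrite /= /pairing -ointB; last 2 first.
- by apply: cont_locint; apply: contM; exact: sx.
- by apply: cont_locint; apply: contM; [exact: sx|exact: cc].
apply: eq_oint => x; rewrite (min_l (ltW L0)) (max_r (ltW L0)) => xL.
by rewrite -mulrBr (psi_resolvent kg xL s0).
Qed.

(** The potential terms cancel, both waves vanish at x = L, and at x = 0 there remain controls
    against fluxes: this is where the response enters. *)
Let green xi s : 0 <= xi -> 0 <= s ->
  oint 0 L (fun x => psi' j x xi * j0 k x s) - oint 0 L (fun x => j0 j x xi * psi' k x s) =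
  f xi * j1 k 0 s - j1 j 0 xi * g s.
Proof.
move=> xi0 s0; have [Cj _ jb _ _] := jf; have [Ck _ kb _ _] := kg.
have [[a0 a1 a2] [a11 a12 a22] da] := Cj; have [[b0 b1 b2] [b11 b12 b22] db] := Ck.
have sx (u : R -> R -> R) t : cont2 u -> continuous (u ^~ t).
  by move=> cu; exact: (cont_sect2 cu).
have cj := sx _ xi (psi'_cont Cj); have ck := sx _ s (psi'_cont Ck).
have cj0 := sx _ xi a0; have ck0 := sx _ s b0.
rewrite -ointB; [|by apply: cont_locint; exact: contM|by apply: cont_locint; exact: contM].
have [j00 j0L] := jb xi xi0; have [k00 k0L] := kb s s0.
rewrite (_ : (fun x => _) = fun x => j11 j x xi * j0 k x s - j0 j x xi * j11 k x s); last first.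
  by apply/funext => x; rewrite /psi'; ring.
have -> := @FTC R (fun x => j1 j x xi * j0 k x s - j0 j x xi * j1 k x s)
  (fun x => j11 j x xi * j0 k x s - j0 j x xi * j11 k x s) 0 L.
- by rewrite j00 j0L k00 k0L; ring.
- by apply: contD; [|apply: contN]; apply: contM => //; exact: sx.
- move=> x; have [d1 _ d11 _ _] := da x xi; have [e1 _ e11 _ _] := db x s.
  by apply: ider_val (iderB (iderM d11 e1) (iderM d1 e11)) _; ring.
Qed.

(** H_t is the convolution of N with the pairing of w_xx + q w and v; [green] moves the space
    operator to v at the price of the boundary term. *)
Lemma correlation_equation s t : 0 < s -> 0 < t ->
  j2 (pairing_jet j k) s t = conv N (mixed_source (pairing_jet j k) s) t
    + greens_source f g (j1 j 0) (j1 k 0) s t.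
Proof.
move=> s0 t0; have [Cj _ jb _ _] := jf; have [Ck _ kb _ _] := kg.
have [[a0 a1 a2] [a11 a12 a22] da] := Cj; have [[b0 b1 b2] [b11 b12 b22] db] := Ck.
have sx (u : R -> R -> R) z : cont2 u -> continuous (u ^~ z).
  by move=> cu; exact: (cont_sect2 cu).
have iN : mu.-integrable `[0, t] (EFin \o (fun xi => N (t - xi))).
  by apply: cont_locint; apply: cont_rev; exact: (cont_N hN).
have ik : mu.-integrable `[0, L] (EFin \o (j0 k ^~ s)) by exact/cont_locint/sx.
have E := fubini_rect (psi'_cont Cj) ik iN.
have E1 : j2 (pairing_jet j k) s t = conv N (fun xi => oint 0 L (fun x => psi' j x xi * j0 k x s)) t.
  rewrite /= pairingE convE.
  transitivity (\int[mu]_(z in `[0, L]) (j0 k z s * \int[mu]_(xi in `[0, t]) (psi' j z xi * N (t - xi)))).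
    apply: eq_Rintegral => x; rewrite inE/= in_itv/= => xL; rewrite mulrC; congr (_ * _).
    rewrite (psiE jf xL (ltW t0)) convE; apply: eq_Rintegral => z _; exact: mulrC.
  rewrite E; apply: eq_Rintegral => z _; congr (_ * _); rewrite oint_ge ?(ltW L0)//.
have cpk : cont2 (fun xi x => psi' j x xi * j0 k x s).
  exact: (cont_t (psi'_cont Cj) b0).
have cjp : cont2 (fun xi x => j0 j x xi * psi' k x s).
  exact: (cont_t a0 (psi'_cont Ck)).
have ci (u : R -> R -> R) : cont2 u -> continuous (fun xi => oint 0 L (u xi)).
  move=> cu; apply: (@cont_oint R R u (fun=> 0) (fun=> L) cu); exact: cst_continuous.
pose A xi := oint 0 L (fun x => psi' j x xi * j0 k x s).
pose B xi := oint 0 L (fun x => j0 j x xi * psi' k x s).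
have cA : continuous A := ci _ cpk.
have cB : continuous B := ci _ cjp.
rewrite E1 /greens_source -/A.
have -> : mixed_source (pairing_jet j k) s = B.
  by apply/funext => xi; rewrite pairing_mixed.
have -> : conv N (fun z => f z * j1 k 0 s - j1 j 0 z * g s) t = conv N (fun z => A z - B z) t.
  by apply: eq_conv => [//|z /andP[z0 _]]; rewrite -(green z0 (ltW s0)).
have cAB : continuous (fun z => A z - B z) := contD cA (contN cB).
rewrite -convDr; [|exact: (cont_N hN)|exact: cont_locint|exact: cont_locint].
by apply: eq_conv => [//|z _]; rewrite addrC subrK.
Qed.

Hypotheses (cf : continuous f) (cg : continuous g).

Lemma correlation_blago (tau : R) : blago_problem N tau f g (response L q N f)
  (response L q N g) (correlation L q N f g).
Proof.
have [Cj _ jb _ _] := jf; have [Ck _ kb _ _] := kg.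
have CP := pairing_jetC2 Cj Ck.
have Hj s t : triangle tau (s, t) -> correlation L q N f g s t = j0 (pairing_jet j k) s t.
  by move=> [/= s0 t0 _]; exact: correlation_pairing.
have [[a0 a1 a2] [a11 a12 a22] da] := Cj; have [[b0 b1 b2] [b11 b12 b22] db] := Ck.
have z1 s : pairing (j0 j) (j0 k) s 0 = 0.
  rewrite /pairing -[RHS](oint0 0 L); apply: eq_oint => x; rewrite min_l ?(ltW L0)// max_r ?(ltW L0)// => xL.
  by have [-> _] := jet_of_d0 jf xL; rewrite mul0r.
have z2 t : pairing (j0 j) (j0 k) 0 t = 0.
  rewrite /pairing -[RHS](oint0 0 L); apply: eq_oint => x; rewrite min_l ?(ltW L0)// max_r ?(ltW L0)// => xL.
  by have [-> _] := jet_of_d0 kg xL; rewrite mulr0.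
have z3 s : pairing (j2 j) (j0 k) s 0 = 0.
  rewrite /pairing -[RHS](oint0 0 L); apply: eq_oint => x; rewrite min_l ?(ltW L0)// max_r ?(ltW L0)// => xL.
  by have [_ ->] := jet_of_d0 jf xL; rewrite mul0r.
have z4 t : pairing (j0 j) (j2 k) 0 t = 0.
  rewrite /pairing -[RHS](oint0 0 L); apply: eq_oint => x; rewrite min_l ?(ltW L0)// max_r ?(ltW L0)// => xL.
  by have [_ ->] := jet_of_d0 kg xL; rewrite mulr0.
have [[p0 p1 p2] _ dp] := CP.
split.
- by apply: (isC2_C2_on CP) => -[s t]; exact: Hj.
- by move=> z /andP[z0 _]; rewrite !correlation_pairing// z1 z2.
- move=> z /andP[z0 _]; split.
  + rewrite -[X in _ --> X](z3 z).
    apply: (@right_quotient R (correlation L q N f g z) (pairing (j2 j) (j0 k) z) 1 ltr01).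
      exact: (@cont_sect R R (pairing (j2 j) (j0 k)) z p2).
    move=> h /andP[h0 _]; rewrite !correlation_pairing//.
    rewrite (@FTC R (pairing (j0 j) (j0 k) z))//; first exact: (@cont_sect R R (pairing (j2 j) (j0 k)) z p2).
    by move=> x; have [] := dp z x.
  + rewrite -[X in _ --> X](z4 z).
    have cz : continuous (pairing (j0 j) (j2 k) ^~ z).
      exact: (@cont_sect R R (fun t x => pairing (j0 j) (j2 k) x t) z (cont2_swap p1)).
    apply: (@right_quotient R (correlation L q N f g ^~ z) (pairing (j0 j) (j2 k) ^~ z) 1 ltr01 cz).
    move=> h /andP[h0 _]; rewrite !correlation_pairing//.
    rewrite (@FTC R (pairing (j0 j) (j0 k) ^~ z))//.
    by move=> x; have [] := dp x z.
- move=> s t s0 t0 st; have Ost : tri tau s t by split.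
  have CPt : C2_in (tri tau) (pairing_jet j k) by exact: isC2_in.
  rewrite (tri_rhs CPt Hj Ost) (tri_derive CPt Hj Ost).
  have yfE z : 0 <= z -> response L q N f z = j1 j 0 z by exact: response_jet.
  have ygE z : 0 <= z -> response L q N g z = j1 k 0 z by exact: response_jet.
  have c1 : continuous (j1 j 0) by exact: cont_sect a1.
  have c2 : continuous (j1 k 0) by exact: cont_sect b1.
  by rewrite (blago_FE cf cg c1 c2 yfE ygE t s0) correlation_equation.
Qed.

End Correlation.

End Pairing.

(** * Uniqueness for the Blagoveshchenskii problem *)

Section BlagoUniqueness.
Variable tau : R.
Hypothesis tau0 : 0 < tau.

(** The first coordinate is clamped, then the second is clamped to the height left under the
    hypotenuse. *)
Definition tri_retract (p : R * R) : R * R :=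
  let a := clampr 0 tau p.1 in (a, Num.max 0 (Num.min p.2 (tau - a))).

Lemma triangle_jet H : C2_on (triangle tau) H ->
  exists j, C2_in (tri tau) j /\ forall s t, triangle tau (s, t) -> j0 j s t = H s t.
Proof.
apply: (@C2_on_jet R (triangle tau) tri_retract (tri tau)).
- have c1 : continuous (fun p : R * R => clampr 0 tau p.1).
    by apply: (cont_comp1 (u := clampr 0 tau)); [exact: clampr_cont|exact: continuous_fst].
  apply: cont_pair => //; apply: cont_max; first exact: cont_cst.
  apply: cont_min; first exact: continuous_snd.
  by apply: contD; [exact: cont_cst|exact: contN].
- move=> p; have /andP[a0 aT] := clampr_in p.1 (ltW tau0).
  split=> //=; first by rewrite le_max lexx.
  rewrite -lerBrDl ge_max ge_min lexx orbT andbT; lra.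
- move=> [s t] [/= s0 t0 st]; rewrite /tri_retract/= clampr_id; last by apply/andP; split; lra.
  by rewrite min_l ?max_r//; lra.
- move=> s t Ost; have := tri_open Ost; apply: filterS => -[x y] /= [x0 y0 xy].
  by split; rewrite /= ltW.
Qed.

Section Data.
Variables (f g yf yg : R -> R) (H : R -> R -> R) (j : @jet R).
Hypothesis HB : blago_problem N tau f g yf yg H.
Hypothesis Cj : C2_in (tri tau) j.
Hypothesis jH : forall s t, triangle tau (s, t) -> j0 j s t = H s t.

Let z0 s : 0 <= s <= tau -> j0 j s 0 = 0 /\ j0 j 0 s = 0.
Proof.
move=> /[dup] sT /andP[s0 st]; have [_ Hz _ _] := HB; have [e1 e2] := Hz s sT.
by rewrite !jH ?e1 ?e2//; split; rewrite /= ?lexx ?addr0 ?add0r.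
Qed.

Let half s : 0 <= s < tau -> exists d, [/\ 0 < d, s <= d & d < tau].
Proof.
by move=> /andP[s0 st]; exists ((s + tau) / 2); split; have := tau0; lra.
Qed.

(** Derivatives along the legs, from [edge_derivative] in rectangles of sides [d] and [tau - d],
    which lie in the triangle. *)
Let z1 s : 0 <= s < tau -> j1 j s 0 = 0 /\ j2 j 0 s = 0.
Proof.
move=> /[dup] sT /andP[s0 st]; have [[c0 c1 c2] _ dj] := Cj.
have [d [d0 sd dt]] := half sT.
have td : 0 < tau - d by rewrite subr_gt0.
have x00 : (0 : R) <= (0 : R) <= tau - d by rewrite lexx/= ltW.
have sd' : 0 <= s <= d by rewrite s0.
split.
- apply: (@edge_derivative R (fun t s => j0 j s t) (fun t s => j1 j s t) 0 (tau - d) 0 d 0) => //.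
  + exact: cont2_swap.
  + exact: cont2_swap.
  + move=> t y /andP[t0 tt] /andP[y0 yd].
    by have [] := dj y t; first by split=> //; lra.
  + by move=> y /andP[y0 yd]; have [|] := z0 (s := y); first by rewrite y0/=; lra.
- apply: (@edge_derivative R (j0 j) (j2 j) 0 (tau - d) 0 d 0) => //.
  + move=> t y /andP[t0 tt] /andP[y0 yd].
    by have [] := dj t y; first by split=> //; lra.
  + by move=> y /andP[y0 yd]; have [|] := z0 (s := y); first by rewrite y0/=; lra.
Qed.

(** Normal derivatives on the legs: the one-sided quotients tend to 0 by the problem, and to the
    derivative in the jet by [right_quotient]. *)
Let z2 s : 0 < s < tau -> j2 j s 0 = 0 /\ j1 j 0 s = 0.
Proof.
move=> /andP[s0 st]; have [[c0 c1 c2] _ dj] := Cj; have [_ _ Hq _] := HB.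
have sT : 0 <= s < tau by rewrite ltW.
have ts : 0 < tau - s by rewrite subr_gt0.
have [q1 q2] := Hq s sT.
have cS (u : R -> R -> R) x : cont2 u -> continuous (u x) by move=> cu; exact: cont_sect cu.
have cT (u : R -> R -> R) x : cont2 u -> continuous (u ^~ x).
  by move=> cu; exact: (cont_sect2 cu).
split.
- have := @right_quotient R (H s) (j2 j s) (tau - s) ts (cS _ s c2).
  move=> /(_ _) h; apply: (cvg_unique _ (h _) q1) => // z /andP[z0' zs].
  rewrite -!jH; last 2 first.
  + by split; rewrite /= ?lexx//; lra.
  + by split; rewrite /= ?lexx//; lra.
  rewrite oint_ge// (FTC_oo (F := j0 j s))//; first exact: cS.
    by move=> y /andP[y0 yz]; have [] := dj s y; first by split=> //; lra.
  by apply: continuous_subspaceT; exact: cS.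
- have := @right_quotient R (H ^~ s) (j1 j ^~ s) (tau - s) ts (cT _ s c1).
  move=> /(_ _) h; apply: (cvg_unique _ (h _) q2) => // z /andP[z0' zs].
  rewrite -!jH; last 2 first.
  + by split; rewrite /= ?lexx//; lra.
  + by split; rewrite /= ?lexx//; lra.
  rewrite oint_ge// (FTC_oo (F := j0 j ^~ s))//; first exact: cT.
    by move=> y /andP[y0 yz]; have [] := dj y s; first by split=> //; lra.
  by apply: continuous_subspaceT; exact: cT.
Qed.

Lemma blago_data_s s : 0 <= s < tau -> [/\ j0 j s 0 = 0, j1 j s 0 = 0 & j2 j s 0 = 0].
Proof.
move=> /[dup] sT /andP[s0 st]; have [h1 h2] := z1 sT.
split=> //; first by have [|] := z0 (s := s); first by rewrite s0 ltW.
have [s00|sn0] := eqVneq s 0; first by move: h2; rewrite s00.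
by have [|] := z2 (s := s); first by rewrite lt_neqAle eq_sym sn0 s0.
Qed.

Lemma blago_data_t s : 0 <= s < tau -> [/\ j0 j 0 s = 0, j1 j 0 s = 0 & j2 j 0 s = 0].
Proof.
move=> /[dup] sT /andP[s0 st]; have [h1 h2] := z1 sT.
split=> //; first by have [|] := z0 (s := s); first by rewrite s0 ltW.
have [s00|sn0] := eqVneq s 0; first by move: h1; rewrite s00.
by have [|] := z2 (s := s); first by rewrite lt_neqAle eq_sym sn0 s0.
Qed.

End Data.

Lemma blago_unique f g yf yg H H' : blago_problem N tau f g yf yg H ->
  blago_problem N tau f g yf yg H' ->
  forall s t, triangle tau (s, t) -> H s t = H' s t.
Proof.
move=> HB HB'; have [CH _ _ Heq] := HB; have [CH' _ _ Heq'] := HB'.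
have [j [Cj jH]] := triangle_jet CH; have [j' [Cj' jH']] := triangle_jet CH'.
have Cd := C2_inB Cj Cj'.
have Z s t : 0 <= s -> 0 <= t -> s + t < tau -> j0 (jetB j j') s t = 0.
  apply: (tri_homogeneous_zero Cd).
  - move=> z zT; have [e1 e2 e3] := blago_data_s HB Cj jH zT.
    by have [e4 e5 e6] := blago_data_s HB' Cj' jH' zT; rewrite /= e1 e2 e3 e4 e5 e6 subrr.
  - move=> z zT; have [e1 e2 e3] := blago_data_t HB Cj jH zT.
    by have [e4 e5 e6] := blago_data_t HB' Cj' jH' zT; rewrite /= e1 e2 e3 e4 e5 e6 subrr.
  - move=> {}s {}t /[dup] Ost [s0 t0 st].
    have Hj u v : triangle tau (u, v) -> H u v = j0 j u v by move=> /jH ->.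
    have Hj' u v : triangle tau (u, v) -> H' u v = j0 j' u v by move=> /jH' ->.
    have e : j2 j s t = conv N (mixed_source j s) t + blago_F N f g yf yg s t.
      have := Heq s t s0 t0 st.
      by rewrite (tri_rhs Cj Hj Ost) (tri_derive Cj Hj Ost).
    have e' : j2 j' s t = conv N (mixed_source j' s) t + blago_F N f g yf yg s t.
      have := Heq' s t s0 t0 st.
      by rewrite (tri_rhs Cj' Hj' Ost) (tri_derive Cj' Hj' Ost).
    move: (blago_F N f g yf yg s t) e e' => S e e'.
    have [_ [c11 _ _] _] := Cj; have [_ [c11' _ _] _] := Cj'.
    have cm : continuous (mixed_source j s) by exact: mixed_source_cont.
    have cm' : continuous (mixed_source j' s) by exact: mixed_source_cont.
    have cmd : continuous (mixed_source (jetB j j') s).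
      by apply: mixed_source_cont; have [_ [] ] := Cd.
    have cS (u : R -> R -> R) x : cont2 u -> continuous (u ^~ x).
      by move=> cu; exact: (cont_sect2 cu).
    have E z : mixed_source j s z = mixed_source (jetB j j') s z + mixed_source j' s z.
      rewrite /mixed_source.
      have -> : conv r (j11 j ^~ z) s = conv r (j11 (jetB j j') ^~ z) s + conv r (j11 j' ^~ z) s.
        rewrite -convDr; [|exact: (cont_r hN)| |].
        - by apply: eq_conv => // y _; rewrite /= subrK.
        - by apply: cont_locint; apply: cS; have [_ [] ] := Cd.
        - by apply: cont_locint; exact: cS.
      by rewrite /=; ring.
    have -> : j2 (jetB j j') s t = j2 j s t - j2 j' s t by [].
    rewrite e e'.
    have -> : conv N (mixed_source j s) t =
        conv N (mixed_source (jetB j j') s) t + conv N (mixed_source j' s) t.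
      rewrite -convDr; [|exact: (cont_N hN)|exact: cont_locint|exact: cont_locint].
      by apply: eq_conv => // z _; exact: E.
    by rewrite -[X in X - _]addrA addrK.
move=> s t [/= s0 t0 st]; have [c0 _ _] := Cd; have [cj _ _] := c0.
have Ts : triangle tau (s, t) by [].
suff : j0 (jetB j j') s t = 0 by rewrite /= jH// jH'// => /eqP; rewrite subr_eq0 => /eqP.
have h01 : (0 : R) <= (1 : R) <= 1 by rewrite ler01 lexx.
(* Vanishing is known in the open triangle. Continuity along the ray from the origin adds the
   hypotenuse, on which the point (T, T) lies when tau = 2 T. *)
have cl : continuous (fun z : R => j0 (jetB j j') (z * s) (z * t)).
  apply: (cont_comp2 (u := j0 (jetB j j'))) => //; apply: contM; try exact: cont_id; exact: cont_cst.
have := cont0_closed cl ltr01 _ h01; rewrite !mul1r; apply.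
move=> z /andP[z0 z1]; apply: Z; [by rewrite mulr_ge0// ltW|by rewrite mulr_ge0// ltW|].
rewrite -mulrDr; have [st0|st0] := ltP 0 (s + t).
  by apply: lt_le_trans st; rewrite gtr_pMl.
by apply: le_lt_trans tau0; rewrite mulr_ge0_le0// ltW.
Qed.

End BlagoUniqueness.

End Blagoveshchenskii.

(** * Square integrable functions and Volterra operators *)

Section SquareIntegrableFunctions.
Context {R : realType}.
Notation mu := (@lebesgue_measure R).
Implicit Types (a b c : R) (f g h : R -> R).

Lemma ae_imp (P Q : R -> Prop) : {ae mu, forall x, P x} -> (forall x, P x -> Q x) ->
  {ae mu, forall x, Q x}.
Proof. by move=> aP PQ; apply: (@filterS _ _ (ae_filter_ringOfSetsType mu)) aP. Qed.

Lemma ae_imp2 (P Q S : R -> Prop) : {ae mu, forall x, P x} -> {ae mu, forall x, Q x} ->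
  (forall x, P x -> Q x -> S x) -> {ae mu, forall x, S x}.
Proof. by move=> aP aQ PQ; apply: (@filterS2 _ _ (ae_filter_ringOfSetsType mu)) aP aQ. Qed.

Lemma integrable_funD (D : set R) f g : measurable D -> mu.-integrable D (EFin \o f) ->
  mu.-integrable D (EFin \o g) -> mu.-integrable D (EFin \o (fun x => f x + g x)).
Proof. by move=> mD hf hg; have := integrableD _ hf hg; exact. Qed.

Lemma integrable_funZ (D : set R) c f : measurable D -> mu.-integrable D (EFin \o f) ->
  mu.-integrable D (EFin \o (fun x => c * f x)).
Proof. by move=> mD hf; have := integrableZl _ c hf; exact. Qed.

Definition cut a f : R -> R := f \_ `]0, a[.

Lemma cutT a f x : 0 < x < a -> cut a f x = f x.
Proof. by move=> xa; rewrite /cut patchT//= in_itv. Qed.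

Lemma cutC a f x : ~~ (0 < x < a) -> cut a f x = 0.
Proof. by move=> xa; rewrite /cut patchC//= in_itv/=; exact/negP. Qed.

Lemma cutP a f x : cut a f x = if 0 < x < a then f x else 0.
Proof. by case: ifPn => h; [rewrite cutT|rewrite cutC]. Qed.

Lemma finite_norm_sq (F : R -> R) : measurable_fun setT F ->
  (finite_norm mu 2%:E F <-> mu.-integrable setT (EFin \o (fun x => F x ^+ 2))) /\
  (finite_norm mu 2%:E F -> 0 <= fine (Lnorm mu 2%:E (EFin \o F)) /\
    fine (Lnorm mu 2%:E (EFin \o F)) ^+ 2 = \int[mu]_x (F x ^+ 2)).
Proof.
move=> mF; have N0 : (0 <= Lnorm mu 2%:E (EFin \o F))%E by exact: Lnorm_ge0.
have msq : measurable_fun setT (fun x => F x ^+ 2) by exact: measurable_funX.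
have E : (Lnorm mu 2%:E (EFin \o F) `^ 2 = \int[mu]_x (F x ^+ 2)%:E)%E.
  rewrite poweR_Lnorm//; apply: eq_integral => x _.
  by rewrite /= powR_mulrn// real_normK// num_real.
have Eabs : (\int[mu]_x `|(F x ^+ 2)%:E| = \int[mu]_x (F x ^+ 2)%:E)%E.
  by apply: eq_integral => x _; rewrite gee0_abs// lee_fin sqr_ge0.
split.
  split=> [fn|/integrableP[_]].
    apply/integrableP; split; first exact/measurable_EFinP.
    by rewrite /= Eabs -E; exact: (poweR_lty 2 fn).
  rewrite /= Eabs -E /finite_norm; case: (Lnorm _ _ _) N0 => [x _ _|_|//]; first exact: ltry.
  by rewrite /= pnatr_eq0.
move=> fn; have Nf : Lnorm mu 2%:E (EFin \o F) \is a fin_num by rewrite ge0_fin_numE.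
split; first exact: fine_ge0.
move: E; rewrite -{1}(fineK Nf); move: (fine_ge0 N0); move: (fine _) => n n0 /=.
by rewrite powR_mulrn// /Rintegral => <-.
Qed.

Lemma measurable_cut a f : measurable_fun `]0, a[ f <-> measurable_fun setT (cut a f).
Proof. exact: measurable_restrictT. Qed.

Lemma cut_sq a f : (fun x => cut a f x ^+ 2) = cut a (fun x => f x ^+ 2).
Proof. by apply/funext => x; rewrite !cutP; case: ifP => //; rewrite expr0n. Qed.

Lemma integrable_cut a f : mu.-integrable `]0, a[ (EFin \o f) <->
  mu.-integrable setT (EFin \o cut a f).
Proof. by rewrite integrable_mkcond// restrict_EFin. Qed.

Lemma int_cut a f : \int[mu]_(x in `]0, a[) f x = \int[mu]_x cut a f x.
Proof. by rewrite Rintegral_mkcond. Qed.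

Lemma L2P a f : L2 a f <-> measurable_fun `]0, a[ f /\
  mu.-integrable `]0, a[ (EFin \o (fun x => f x ^+ 2)).
Proof.
rewrite /L2 -/(cut a f) measurable_cut integrable_cut -cut_sq; split.
  move=> /andP[]; rewrite !inE/= => mf fn; split=> //.
  exact: ((finite_norm_sq mf).1.1 fn).
move=> [mf isq]; apply/andP; rewrite !inE/=; split=> //.
exact: ((finite_norm_sq mf).1.2 isq).
Qed.

(** The squared norm: estimates with integrals of squares avoid the extended-real powers in
    [Lnorm]. *)
Definition sqn a f := \int[mu]_(x in `]0, a[) (f x ^+ 2).

Lemma L2norm_sq a f : L2 a f -> 0 <= L2norm a f /\ L2norm a f ^+ 2 = sqn a f.
Proof.
move=> /andP[]; rewrite !inE/= => mf fn.
have [_ /(_ fn)[n0 nE]] := finite_norm_sq mf.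
by split=> //; rewrite /L2norm nE /sqn int_cut -cut_sq.
Qed.

Lemma L2norm_sqrt a f : L2 a f -> L2norm a f = Num.sqrt (sqn a f).
Proof. by move=> /L2norm_sq[n0 <-]; rewrite sqrtr_sqr ger0_norm. Qed.

Lemma sqn_ge0 a f : 0 <= sqn a f.
Proof. by apply: Rintegral_ge0 => x _; exact: sqr_ge0. Qed.

Lemma L2_measurable a f : L2 a f -> measurable_fun `]0, a[ f.
Proof. by move=> /L2P[]. Qed.

Lemma L2_sq a f : L2 a f -> mu.-integrable `]0, a[ (EFin \o (fun x => f x ^+ 2)).
Proof. by move=> /L2P[]. Qed.

Let moo a : measurable (`]0, a[ : set R). Proof. by []. Qed.

Lemma L2_le a f g : measurable_fun `]0, a[ f ->
  mu.-integrable `]0, a[ (EFin \o g) ->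
  (forall x, 0 < x < a -> f x ^+ 2 <= g x) -> L2 a f.
Proof.
move=> mf ig fg; apply/L2P; split=> //.
apply: (@dominated_integrable R _ (fun x => f x ^+ 2) g) => //.
- exact: measurable_funX.
- by move=> x; rewrite /= in_itv/= => xa; rewrite ger0_norm ?sqr_ge0// fg.
Qed.

Lemma integrable_cst_oo a c : mu.-integrable `]0, a[ (EFin \o (fun=> c)).
Proof.
have := @locint_cst R c 0 a; apply: integrableS => //.
exact: subset_itv_oo_cc.
Qed.

Lemma L2_prod a f g : L2 a f -> L2 a g ->
  mu.-integrable `]0, a[ (EFin \o (fun x => f x * g x)).
Proof.
move=> Lf Lg.
apply: (@dominated_integrable R _ _ (fun x => f x ^+ 2 + g x ^+ 2)) => //.
- by apply: measurable_funM; exact: L2_measurable.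
- move=> x _; rewrite normrM.
  have := sqr_ge0 (`|f x| - `|g x|); rewrite sqrrB !real_normK ?num_real//.
  have := sqr_ge0 (f x); have := sqr_ge0 (g x); rewrite mulr2n; lra.
- exact: (integrable_funD (moo a) (L2_sq Lf) (L2_sq Lg)).
Qed.

Lemma L2_cst a c : L2 a (fun=> c).
Proof. by apply: (@L2_le _ _ (fun=> c ^+ 2)) => //; exact: integrable_cst_oo. Qed.

Lemma L2_int a f : L2 a f -> mu.-integrable `]0, a[ (EFin \o f).
Proof.
by move=> Lf; have := L2_prod Lf (L2_cst a 1); under [X in EFin \o X]funext do rewrite mulr1.
Qed.

Lemma cut_integrable a f : L2 a f -> mu.-integrable setT (EFin \o cut a f).
Proof. by move=> /L2_int; rewrite integrable_cut. Qed.

Lemma cut_locint a f : L2 a f -> locint (cut a f).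
Proof. by move=> /cut_integrable h b c; apply: integrableS h. Qed.

Lemma L2_bounded_mul a (m f : R -> R) (C : R) : measurable_fun `]0, a[ m ->
  (forall x, 0 < x < a -> `|m x| <= C) -> L2 a f -> L2 a (fun x => m x * f x).
Proof.
move=> mm mC Lf; apply: (@L2_le _ _ (fun x => C ^+ 2 * f x ^+ 2)).
- by apply: measurable_funM => //; exact: L2_measurable.
- exact: (integrable_funZ (C ^+ 2) (moo a) (L2_sq Lf)).
- move=> x xa; rewrite exprMn ler_wpM2r ?sqr_ge0//.
  by rewrite -[m x ^+ 2]real_normK ?num_real// lerXn2r ?nnegrE ?(le_trans _ (mC x xa)) ?mC.
Qed.

Lemma cont_bounded_oo a (m : R -> R) : continuous m ->
  exists2 C, 0 <= C & forall x, 0 < x < a -> `|m x| <= C.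
Proof.
move=> cm; have [C C0 HC] := cont_bounded 0 a cm; exists C => // x /andP[x0 xa].
by apply: HC; rewrite !ltW.
Qed.

Lemma continuous_measurable_oo a (m : R -> R) : continuous m -> measurable_fun `]0, a[ m.
Proof. by move=> cm; apply: measurable_funTS; exact: continuous_measurable_fun. Qed.

Lemma L2_cont_mul a (m f : R -> R) : continuous m -> L2 a f -> L2 a (fun x => m x * f x).
Proof.
move=> cm Lf; have [C _ HC] := cont_bounded_oo a cm.
by apply: (L2_bounded_mul _ HC Lf); exact: continuous_measurable_oo.
Qed.

Lemma L2Z a c f : L2 a f -> L2 a (fun x => c * f x).
Proof. by apply: L2_cont_mul; exact: cont_cst. Qed.

Lemma L2_cont a (m : R -> R) : continuous m -> L2 a m.
Proof.
move=> cm; have := L2_cont_mul cm (L2_cst a 1).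
by rewrite (_ : (fun x => m x * 1) = m)//; apply/funext => x; rewrite mulr1.
Qed.

Lemma L2D a f g : L2 a f -> L2 a g -> L2 a (fun x => f x + g x).
Proof.
move=> Lf Lg; apply: (@L2_le _ _ (fun x => f x ^+ 2 + g x ^+ 2 + 2 * (f x * g x))).
- by apply: measurable_funD; exact: L2_measurable.
- have h1 := integrable_funD (moo a) (L2_sq Lf) (L2_sq Lg).
  have h2 := integrable_funZ 2 (moo a) (L2_prod Lf Lg).
  exact: (integrable_funD (moo a) h1 h2).
- move=> x _; rewrite sqrrD mulr2n; lra.
Qed.

Lemma L2B a f g : L2 a f -> L2 a g -> L2 a (fun x => f x - g x).
Proof.
move=> Lf Lg; have := L2D Lf (L2Z (-1) Lg).
by rewrite (_ : (fun x => f x + -1 * g x) = (fun x => f x - g x))//; apply/funext => x; rewrite mulN1r.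
Qed.

Lemma eq_L2 a f g : (forall x, 0 < x < a -> f x = g x) -> L2 a f -> L2 a g.
Proof.
move=> fg; rewrite /L2 -/(cut a f) -/(cut a g) (_ : cut a f = cut a g)//.
by apply/funext => x; rewrite !cutP; case: ifP => // /fg.
Qed.

Lemma eq_int_on a f g : (forall x, 0 < x < a -> f x = g x) ->
  \int[mu]_(x in `]0, a[) f x = \int[mu]_(x in `]0, a[) g x.
Proof. by move=> fg; apply: eq_Rintegral => x; rewrite inE/= in_itv/= => /fg. Qed.

Lemma L2innerC a f g : L2inner a f g = L2inner a g f.
Proof. by apply: eq_Rintegral => x _; rewrite mulrC. Qed.

Lemma L2innerDl a f g h : L2 a f -> L2 a g -> L2 a h ->
  L2inner a (fun x => f x + g x) h = L2inner a f h + L2inner a g h.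
Proof.
move=> Lf Lg Lh; rewrite /L2inner -RintegralD//; try exact: L2_prod.
by apply: eq_Rintegral => x _; rewrite mulrDl.
Qed.

Lemma L2innerZl a c f h : L2 a f -> L2 a h ->
  L2inner a (fun x => c * f x) h = c * L2inner a f h.
Proof.
move=> Lf Lh; rewrite /L2inner RintegralZl_gen//; last exact: L2_prod.
by apply: eq_Rintegral => x _; rewrite mulrA.
Qed.

Lemma L2innerBl a f g h : L2 a f -> L2 a g -> L2 a h ->
  L2inner a (fun x => f x - g x) h = L2inner a f h - L2inner a g h.
Proof.
move=> Lf Lg Lh; rewrite /L2inner -RintegralB//; try exact: L2_prod.
by apply: eq_Rintegral => x _; rewrite mulrBl.
Qed.

Lemma eqL2P a f g : (forall x, 0 < x < a -> f x = g x) -> eqL2 a f g.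
Proof. by move=> fg; apply/aeW => x /fg. Qed.

Lemma eqL2_sym a f g : eqL2 a f g -> eqL2 a g f.
Proof. by move=> /ae_imp; apply => x fg xa; rewrite fg. Qed.

Lemma eqL2_trans a g f h : eqL2 a f g -> eqL2 a g h -> eqL2 a f h.
Proof. by move=> h1 h2; apply: (ae_imp2 h1 h2) => x fg gh xa; rewrite fg ?gh. Qed.

Lemma eqL2_inner a f g h : L2 a f -> L2 a g -> L2 a h -> eqL2 a f g ->
  L2inner a f h = L2inner a g h.
Proof.
move=> Lf Lg Lh fg; congr fine; apply: ae_eq_integral => //.
- by apply/measurable_EFinP; apply: measurable_funM; exact: L2_measurable.
- by apply/measurable_EFinP; apply: measurable_funM; exact: L2_measurable.
- by apply: (ae_imp fg) => x {}fg; rewrite /= in_itv/= => /fg ->.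
Qed.

Lemma sqn_inner a f : sqn a f = L2inner a f f. Proof. by []. Qed.

Lemma eqL2_sqn a f g : L2 a f -> L2 a g -> eqL2 a f g -> sqn a f = sqn a g.
Proof.
move=> Lf Lg fg; rewrite !sqn_inner (eqL2_inner Lf Lg Lf fg) L2innerC.
exact: eqL2_inner.
Qed.

Lemma sqn0_eqL2 a f : L2 a f -> sqn a f = 0 -> eqL2 a f (fun=> 0).
Proof.
move=> Lf S0; have /integrableP[msq fin] := L2_sq Lf.
have : (\int[mu]_(x in `]0%R, a[) `|(EFin \o (fun x => (f x ^+ 2)%R)) x| = 0)%E.
  rewrite -[LHS]fineK; last by rewrite ge0_fin_numE//; exact: integral_ge0.
  congr EFin; rewrite -[RHS]S0; congr fine; apply: eq_integral => x _ /=.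
  by rewrite ger0_norm ?sqr_ge0.
move=> /(ae_eq_integral_abs mu (moo a) msq) /ae_imp; apply => x h xa.
by move: h; rewrite /= in_itv/= => /(_ xa) [] /eqP; rewrite sqrf_eq0 => /eqP.
Qed.

Lemma eqL2_of_inner a f g : L2 a f -> L2 a g ->
  (forall h, L2 a h -> L2inner a f h = L2inner a g h) -> eqL2 a f g.
Proof.
move=> Lf Lg H; have Ld := L2B Lf Lg.
have := sqn0_eqL2 Ld; rewrite sqn_inner L2innerBl// H// subrr => /(_ erefl).
by move=> /ae_imp; apply => x h /h /eqP; rewrite subr_eq0 => /eqP.
Qed.

Lemma sqn_eq0 a f : L2 a f -> eqL2 a f (fun=> 0) -> sqn a f = 0.
Proof.
move=> Lf f0; rewrite (eqL2_sqn Lf (L2_cst a 0) f0) /sqn.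
by rewrite -[RHS](@Rintegral0 R `]0, a[); apply: eq_Rintegral => x _; rewrite expr0n.
Qed.

Lemma sqnZ a c f : L2 a f -> sqn a (fun x => c * f x) = c ^+ 2 * sqn a f.
Proof.
move=> Lf; rewrite /sqn RintegralZl_gen//; last exact: L2_sq.
by apply: eq_Rintegral => x _; rewrite exprMn.
Qed.

Lemma sqnN a f : sqn a (fun x => - f x) = sqn a f.
Proof. by apply: eq_Rintegral => x _; rewrite sqrrN. Qed.

Lemma le_sqn a f g : L2 a f -> L2 a g -> (forall x, 0 < x < a -> `|f x| <= `|g x|) ->
  sqn a f <= sqn a g.
Proof.
move=> Lf Lg fg; apply: le_Rintegral => //; [exact: L2_sq|exact: L2_sq|].
move=> x; rewrite /= in_itv/= => /fg h.
by rewrite -[f x ^+ 2]real_normK ?num_real// -[g x ^+ 2]real_normK ?num_real// lerXn2r// nnegrE.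
Qed.

Lemma sqnD a f g : L2 a f -> L2 a g ->
  sqn a (fun x => f x + g x) <= 2 * sqn a f + 2 * sqn a g.
Proof.
move=> Lf Lg; rewrite /sqn !RintegralZl_gen; try exact: L2_sq; try by [].
rewrite -RintegralD//; last 2 first.
- exact: (integrable_funZ 2 (moo a) (L2_sq Lf)).
- exact: (integrable_funZ 2 (moo a) (L2_sq Lg)).
apply: le_Rintegral => //; first exact: (L2_sq (L2D Lf Lg)).
  exact: (integrable_funD (moo a) (integrable_funZ 2 (moo a) (L2_sq Lf)) (integrable_funZ 2 (moo a) (L2_sq Lg))).
move=> x _; have := sqr_ge0 (f x - g x); rewrite sqrrB sqrrD !mulr2n; lra.
Qed.

Lemma sqnB a f g : L2 a f -> L2 a g ->
  sqn a (fun x => f x - g x) <= 2 * sqn a f + 2 * sqn a g.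
Proof.
move=> Lf Lg; rewrite -(sqnN a g).
have Lg' : L2 a (fun x => - g x).
  by apply: eq_L2 (L2Z (-1) Lg) => x _; rewrite mulN1r.
exact: sqnD.
Qed.

Lemma sqn_cst a c : 0 <= a -> sqn a (fun=> c) = c ^+ 2 * a.
Proof.
move=> a0; rewrite /sqn -[in RHS](subr0 a) -(int_cst _ a0).
rewrite (Rintegral_itv_bndo_bndc (integrable_cst_oo _ _)).
apply: Rintegral_itv_obnd_cbnd; have := @locint_cst R (c ^+ 2) 0 a.
by apply: integrableS => //; exact: subset_itv_oc_cc.
Qed.

End SquareIntegrableFunctions.

(** * Invariance of Lebesgue measure under reflections and translations *)

Section Reflection.
Context {R : realType}.
Notation mu := (@lebesgue_measure R).
Notation mR := (measurableTypeR R).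

Section Preserving.
Variable phi : R -> R.
Hypothesis mphi : measurable_fun setT (phi : mR -> mR).
Hypothesis pres : forall a b : R, a <= b -> mu (phi @^-1` `]a, b]) = (b - a)%:E.

Let phi_mixin := isMeasurableFun.Build _ _ _ _ _ mphi.
Let phi_pack : {mfun mR >-> mR} := HB.pack phi phi_mixin.

(** Lebesgue measure is determined by its values on half-open intervals. *)
Lemma measure_preserving (A : set R) : measurable A -> pushforward mu phi A = mu A.
Proof.
move=> mA; have H := @lebesgue_measure_unique R (pushforward mu phi_pack).
apply/esym/H => // X [[a b] /= ab <-]; rewrite /pushforward.
rewrite lebesgue_measure_itv/= lte_fin.
have [ba|ab'] := ltP a b; first by rewrite pres ?(ltW ba)// EFinB.
by rewrite set_itv_ge ?preimage_set0 ?measure0// bnd_simp -leNgt.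
Qed.

Lemma preserving_int F : mu.-integrable setT (EFin \o F) ->
  mu.-integrable setT (EFin \o (fun x => F (phi x))) /\
  \int[mu]_x F (phi x) = \int[mu]_x F x.
Proof.
move=> iF; have mF : measurable_fun setT (EFin \o F) := measurable_int _ iF.
have mFphi : measurable_fun setT (EFin \o (fun x => F (phi x))).
  by apply: (measurableT_comp mF).
have i2 : mu.-integrable setT (EFin \o (fun x => F (phi x))).
  apply/integrableP; split=> //; have /integrableP[_] := iF; apply: le_lt_trans.
  rewrite -[X in (_ <= X)%E](@eq_measure_integral _ _ _ setT mu (pushforward mu phi_pack)); last first.
    by move=> A mA _; exact: measure_preserving.
  rewrite (ge0_integral_pushforward mphi)//; exact: measurableT_comp.
split=> //; congr fine.
rewrite -[RHS](@eq_measure_integral _ _ _ setT mu (pushforward mu phi_pack)); last first.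
  by move=> A mA _; exact: measure_preserving.
by rewrite (integral_pushforward mphi).
Qed.

End Preserving.

Lemma int_reflect (c : R) F : mu.-integrable setT (EFin \o F) ->
  mu.-integrable setT (EFin \o (fun x => F (c - x))) /\
  \int[mu]_x F (c - x) = \int[mu]_x F x.
Proof.
apply: (@preserving_int (fun x => c - x)).
  by apply: continuous_measurable_fun; apply: contD; [exact: cont_cst|apply: contN; exact: cont_id].
move=> a b ab; have -> : (fun x => c - x) @^-1` `]a, b] = `[(c - b), (c - a)[%classic.
  by apply/seteqP; split=> x; rewrite /= !in_itv/= => /andP[? ?]; apply/andP; split; lra.
rewrite lebesgue_measure_itv/= lte_fin; case: ltP => h; first by rewrite -EFinB; congr EFin; ring.
by congr EFin; lra.
Qed.

Lemma int_translate (c : R) F : mu.-integrable setT (EFin \o F) ->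
  mu.-integrable setT (EFin \o (fun x => F (x - c))) /\
  \int[mu]_x F (x - c) = \int[mu]_x F x.
Proof.
apply: (@preserving_int (fun x => x - c)).
  by apply: continuous_measurable_fun; apply: contD; [exact: cont_id|exact: cont_cst].
move=> a b ab; have -> : (fun x => x - c) @^-1` `]a, b] = `](a + c), (b + c)]%classic.
  by apply/seteqP; split=> x; rewrite /= !in_itv/= => /andP[? ?]; apply/andP; split; lra.
rewrite lebesgue_measure_itv/= lte_fin; case: ltP => h; first by rewrite -EFinB; congr EFin; ring.
by congr EFin; lra.
Qed.

End Reflection.

(** * Volterra operators in L^2 *)

Section VolterraOperators.
Context {R : realType}.
Notation mu := (@lebesgue_measure R).
Variable a : R.
Hypothesis a0 : 0 < a.
Implicit Types (k kap rho : R -> R -> R) (f g h : R -> R).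

(** The argument is cut to ]0, a[, so that its values elsewhere do not matter; [vopT] is the
    transposed operator. *)
Definition vop k f y := oint 0 y (fun s => k y s * cut a f s).
Definition vopT k h s := oint s a (fun y => k y s * cut a h y).

Lemma vop_cont k f : cont2 k -> L2 a f -> continuous (vop k f).
Proof.
move=> ck Lf; apply: (@cont_oint_weight R R k id (cut a f) 0) => //; last exact: cut_locint.
exact: cont_id.
Qed.

Lemma vopT_cont k h : cont2 k -> L2 a h -> continuous (vopT k h).
Proof.
move=> ck Lh; rewrite (_ : vopT k h = fun s => - oint a s (fun y => k y s * cut a h y)).
  apply: contN; apply: (@cont_oint_weight R R (fun s y => k y s) id (cut a h) a) => //.
  - exact: cont2_swap.
  - exact: cont_id.
  - exact: cut_locint.
by apply/funext => s; rewrite /vopT ointC.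
Qed.

Lemma int_cut_cc f g : \int[mu]_(x in `[0, a]) (cut a f x * g x) =
  \int[mu]_(x in `]0, a[) (f x * g x).
Proof.
transitivity (\int[mu]_x (cut a f x * g x)); last apply/esym.
  apply: eq_int_patch => // x; rewrite /= in_itv/= => /negP xa.
  by rewrite cutC ?mul0r//; apply: contraNN xa => /andP[? ?]; rewrite !ltW.
apply: eq_int_patch => x; rewrite /= in_itv/=; first by move=> xa; rewrite cutT.
by move=> /negP xa; rewrite cutC ?mul0r.
Qed.

Lemma cut_cc_integrable f (p q : R) : L2 a f -> mu.-integrable `[p, q] (EFin \o cut a f).
Proof. by move=> /cut_locint. Qed.

Lemma vop_adjoint k f h : cont2 k -> L2 a f -> L2 a h ->
  L2inner a (vop k f) h = L2inner a f (vopT k h).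
Proof.
move=> ck Lf Lh.
have E := fubini_tri ck (cut_cc_integrable 0 a Lh) (cut_cc_integrable 0 a Lf).
rewrite L2innerC /L2inner -int_cut_cc -int_cut_cc.
transitivity (\int[mu]_(z in `[0, a]) (cut a h z * \int[mu]_(s in `[0, z]) (k z s * cut a f s))).
  apply: eq_Rintegral => z; rewrite inE/= in_itv/= => /andP[z0 _].
  by rewrite /vop oint_ge.
rewrite E; apply: eq_Rintegral => z; rewrite inE/= in_itv/= => /andP[_ za].
by rewrite /vopT oint_ge.
Qed.

Lemma eq_vop k f g y : 0 <= y <= a -> (forall s, 0 < s < a -> f s = g s) ->
  vop k f y = vop k g y.
Proof.
by move=> _ fg; congr oint; apply/funext => s; rewrite !cutP; case: ifP => // /fg ->.
Qed.

Lemma vopD k f g y : cont2 k -> L2 a f -> L2 a g ->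
  vop k (fun s => f s + g s) y = vop k f y + vop k g y.
Proof.
move=> ck Lf Lg; have cy : continuous (k y) by exact: cont_sect ck.
have l u : L2 a u -> locint (fun s => k y s * cut a u s).
  by move=> Lu; exact: (cont_mul_locint cy (cut_locint Lu)).
rewrite /vop -ointD; [|exact: l|exact: l]; congr oint; apply/funext => s.
by rewrite !cutP; case: ifP => _; ring.
Qed.

Lemma vopZ k (c : R) f y : cont2 k -> L2 a f -> vop k (fun s => c * f s) y = c * vop k f y.
Proof.
move=> ck Lf; have cy : continuous (k y) by exact: cont_sect ck.
rewrite /vop -ointZ; last exact: (cont_mul_locint cy (cut_locint Lf)).
by congr oint; apply/funext => s; rewrite !cutP; case: ifP => _; ring.
Qed.

(** The hypothesis is the resolvent identity for kernels; Fubini on the triangle carries it over to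
    the operators. *)
Lemma vop_comp rho kap f y : cont2 rho -> cont2 kap -> L2 a f -> 0 < y < a ->
  (forall s, 0 <= s <= y -> rho y s + kap y s + oint s y (fun z => rho y z * kap z s) = 0) ->
  vop rho (vop kap f) y = - vop rho f y - vop kap f y.
Proof.
move=> cr ck Lf /andP[y0 ya] H.
have cy k : cont2 k -> continuous (k y) by move=> c; exact: cont_sect c.
have ir : mu.-integrable `[0, y] (EFin \o rho y) by exact/cont_locint/cy.
have E := fubini_tri ck ir (cut_cc_integrable 0 y Lf).
have l k : cont2 k -> locint (fun s => k y s * cut a f s).
  by move=> c; exact: (cont_mul_locint (cy _ c) (cut_locint Lf)).
rewrite /vop oint_ge ?(ltW y0)//.
transitivity (\int[mu]_(z in `[0, y]) (rho y z * \int[mu]_(s in `[0, z]) (kap z s * cut a f s))).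
  apply: eq_Rintegral => z; rewrite inE/= in_itv/= => /andP[z0 zy]; congr (_ * _).
  rewrite -oint_ge//; have [->|zn0] := eqVneq z 0; first by rewrite cutC ?ointaa// ltxx.
  by rewrite cutT// (le_lt_trans zy ya) andbT lt_neqAle eq_sym zn0.
rewrite E.
have -> : - oint 0 y (fun s => rho y s * cut a f s) - oint 0 y (fun s => kap y s * cut a f s) =
    oint 0 y (fun s => -1 * (rho y s * cut a f s + kap y s * cut a f s)).
  rewrite ointZ; last by apply: locintD; exact: l.
  by rewrite ointD; [ring|exact: l|exact: l].
rewrite oint_ge ?(ltW y0)//; apply: eq_Rintegral => s; rewrite inE/= in_itv/= => /andP[s0 sy].
have := H s; rewrite s0 sy => /(_ isT); rewrite oint_ge// => Hs.
have -> : \int[mu]_(z in `[s, y]) (kap z s * rho y z) = \int[mu]_(z in `[s, y]) (rho y z * kap z s).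
  by apply: eq_Rintegral => z _; rewrite mulrC.
by move: Hs; move: (Rintegral _ _ _) (rho y s) (kap y s) => I u v /eqP; rewrite addrC addr_eq0 => /eqP ->; ring.
Qed.

(** Cauchy-Schwarz as nonnegativity of a variance: expand the integral of (|f| - m)^2 with [m] the
    mean of |f|. *)
Lemma int_abs_sq f : L2 a f -> (\int[mu]_(x in `]0, a[) `|f x|) ^+ 2 <= a * sqn a f.
Proof.
move=> Lf; set I := \int[mu]_(x in `]0, a[) `|f x|.
have Labs : L2 a (fun x => `|f x|).
  apply: (@L2_le _ _ _ (fun x => f x ^+ 2)).
  - by apply: measurableT_comp => //; exact: L2_measurable.
  - exact: L2_sq.
  - by move=> x _; rewrite real_normK// num_real.
pose m := I / a.
have Lm : L2 a (fun=> m) by exact: L2_cst.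
have := sqn_ge0 a (fun x => `|f x| - m).
have -> : sqn a (fun x => `|f x| - m) = sqn a f + -2 * m * I + m ^+ 2 * a.
  rewrite -(sqn_cst m (ltW a0)) /sqn /I RintegralZl_gen//; last exact: L2_int.
  rewrite -RintegralD//; [|exact: L2_sq|by apply: integrable_funZ => //; exact: L2_int].
  rewrite -RintegralD//; [|by apply: integrable_funD => //; [exact: L2_sq|apply: integrable_funZ => //; exact: L2_int]|exact: L2_sq].
  apply: eq_Rintegral => x _; rewrite sqrrB real_normK ?num_real// mulr2n; ring.
rewrite (_ : _ + _ + _ = (a * sqn a f - I ^+ 2) / a); last by rewrite /m; field; rewrite gt_eqF.
by rewrite pmulr_lge0 ?invr_gt0// subr_ge0.
Qed.

Lemma vop_bound k : cont2 k -> exists2 C, 0 <= C &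
  forall f, L2 a f -> sqn a (vop k f) <= C * sqn a f.
Proof.
move=> ck; have [B B0 HB] := cont2_bounded 0 a 0 a ck.
exists (B ^+ 2 * a * a); first by rewrite !mulr_ge0 ?sqr_ge0// ltW.
move=> f Lf; set I := \int[mu]_(x in `]0, a[) `|f x|.
have cv := vop_cont ck Lf.
have I0 : 0 <= I by exact: Rintegral_ge0.
have vI y : 0 < y < a -> `|vop k f y| <= B * I.
  move=> /andP[y0 ya]; rewrite /vop oint_ge ?(ltW y0)//.
  have ln : locint (fun s => B * `|cut a f s|) by apply: locintZ; apply: locint_norm; exact: cut_locint.
  apply: le_trans (@le_int_norm _ 0 y _ (fun s => B * `|cut a f s|) _ ln _) _.
  - by apply: cont_mul_locint; [exact: cont_sect ck|exact: cut_locint].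
  - move=> s /andP[s0 sy]; rewrite normrM ler_wpM2r//.
    by apply: HB; apply/andP; split; lra.
  have -> : B * I = \int[mu]_(s in `[0, a]) (B * `|cut a f s|).
    rewrite -RintegralZl_gen//; last by apply: locint_norm; exact: cut_locint.
    congr (_ * _); rewrite /I int_cut; apply/esym/eq_int_patch => s; rewrite /= in_itv/=.
      by move=> _; rewrite !cutP; case: ifP => //; rewrite normr0.
    move=> /negP sa; rewrite cutC//; apply: contraNN sa => /andP[? ?].
    by rewrite !ltW.
  rewrite -!oint_ge ?(ltW y0) ?(ltW a0)// -(oint_cat 0 y a ln) lerDl oint_ge ?(ltW ya)//.
  by apply: Rintegral_ge0 => s _; rewrite mulr_ge0.
have -> : B ^+ 2 * a * a * sqn a f = (B ^+ 2 * (a * sqn a f)) * a by ring.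
apply: le_trans (_ : (B * I) ^+ 2 * a <= _); last first.
  by rewrite ler_wpM2r ?(ltW a0)// exprMn ler_wpM2l ?sqr_ge0// int_abs_sq.
rewrite -(sqn_cst _ (ltW a0)); apply: le_sqn; [exact: L2_cont|exact: L2_cst|].
by move=> y /vI h; apply: le_trans h (ler_norm _).
Qed.

Definition uop k f y := f y + vop k f y.
Definition uopT k h s := h s + vopT k h s.

Lemma vop_L2 k f : cont2 k -> L2 a f -> L2 a (vop k f).
Proof. by move=> ck Lf; apply: L2_cont; exact: vop_cont. Qed.

Lemma uop_L2 k f : cont2 k -> L2 a f -> L2 a (uop k f).
Proof. by move=> ck Lf; apply: L2D => //; exact: vop_L2. Qed.

Lemma vopT_L2 k h : cont2 k -> L2 a h -> L2 a (vopT k h).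
Proof. by move=> ck Lf; apply: L2_cont; exact: vopT_cont. Qed.

Lemma uopT_L2 k h : cont2 k -> L2 a h -> L2 a (uopT k h).
Proof. by move=> ck Lf; apply: L2D => //; exact: vopT_L2. Qed.

Lemma uop_adjoint k f h : cont2 k -> L2 a f -> L2 a h ->
  L2inner a (uop k f) h = L2inner a f (uopT k h).
Proof.
move=> ck Lf Lh; rewrite L2innerDl//; last exact: vop_L2.
rewrite vop_adjoint// [RHS]L2innerC L2innerDl//; last exact: vopT_L2.
by rewrite (L2innerC _ h) (L2innerC _ (vopT k h)).
Qed.

Lemma uop_lin k (c : R) f g y : cont2 k -> L2 a f -> L2 a g ->
  uop k (fun x => c * f x + g x) y = c * uop k f y + uop k g y.
Proof.
move=> ck Lf Lg; rewrite /uop vopD//; last exact: L2Z.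
by rewrite vopZ//; ring.
Qed.

Lemma eq_uop k f g y : (forall s, 0 < s < a -> f s = g s) -> 0 < y < a ->
  uop k f y = uop k g y.
Proof.
by move=> fg /[dup] ya /andP[y0 ya']; rewrite /uop fg// (eq_vop k _ fg)// !ltW.
Qed.

Lemma vopT_lin k (c : R) f g y : cont2 k -> L2 a f -> L2 a g ->
  vopT k (fun x => c * f x + g x) y = c * vopT k f y + vopT k g y.
Proof.
move=> ck Lf Lg; have cy : continuous (k ^~ y).
  exact: (cont_sect2 ck).
have l u : L2 a u -> locint (fun s => k s y * cut a u s).
  by move=> Lu; exact: (cont_mul_locint cy (cut_locint Lu)).
rewrite /vopT -ointZ; last exact: l.
rewrite -ointD; [|by apply: locintZ; exact: l|exact: l].
by congr oint; apply/funext => s; rewrite !cutP; case: ifP => _; ring.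
Qed.

Lemma uopT_lin k (c : R) f g y : cont2 k -> L2 a f -> L2 a g ->
  uopT k (fun x => c * f x + g x) y = c * uopT k f y + uopT k g y.
Proof. by move=> ck Lf Lg; rewrite /uopT vopT_lin//; ring. Qed.

(** A right inverse with kernel [r1] and a left inverse with kernel [r2'] come from two Volterra
    equations; associativity makes them agree, so [r1] serves on both sides. *)
Lemma volterra_inverse k : cont2 k -> exists2 rho, cont2 rho & forall f, L2 a f ->
  forall y, 0 < y < a -> uop rho (uop k f) y = f y /\ uop k (uop rho f) y = f y.
Proof.
move=> ck.
have cN (u : R -> R -> R) : cont2 u -> cont2 (fun x y => - u x y) by move=> cu; exact: contN.
have [r1 cr1 Hr1] := volterra (cN _ ck) (cN _ ck).
have ck' := cont2_swap ck.
(* The left resolvent solves an equation with swapped arguments. The swap reverses the oriented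
   integral, hence the plus sign of the kernel here. *)
have [r2 cr2 Hr2] := volterra ck' (cN _ ck').
pose r2' x y := r2 y x; have cr2' : cont2 r2' by exact: cont2_swap.
have cy (u : R -> R -> R) y : cont2 u -> continuous (u y) by move=> c; exact: cont_sect c.
have cx (u : R -> R -> R) y : cont2 u -> continuous (u ^~ y).
  by move=> c; exact: (cont_sect2 c).
have sum rho kap f : cont2 rho -> cont2 kap ->
    (forall y s, rho y s + kap y s + oint s y (fun z => rho y z * kap z s) = 0) ->
    L2 a f -> forall y, 0 < y < a -> uop rho (uop kap f) y = f y.
  move=> cr cka H Lf y ya; rewrite /uop vopD//; last exact: vop_L2.
  by rewrite vop_comp//; ring.
have E1 y s : k y s + r1 y s + oint s y (fun z => k y z * r1 z s) = 0.
  rewrite {1}Hr1; have -> : (fun z => - k y z * r1 z s) = fun z => -1 * (k y z * r1 z s).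
    by apply/funext => z; ring.
  rewrite ointZ; first by ring.
  by apply: cont_locint; apply: contM; [exact: cy|exact: cx].
have E2 y s : r2' y s + k y s + oint s y (fun z => r2' y z * k z s) = 0.
  rewrite {1}/r2' Hr2 ointC.
  have -> : (fun z => k z s * r2 z y) = fun z => r2' y z * k z s.
    by apply/funext => z; rewrite mulrC.
  by move: (oint _ _ _) => I; ring.
exists r1 => // f Lf y ya; split; last exact: sum.
have L1 := uop_L2 cr1 (uop_L2 ck Lf).
rewrite -(sum r2' k _ cr2' ck E2 L1 y ya).
rewrite (@eq_uop r2' (uop k (uop r1 (uop k f))) (uop k f) y) => [|s sa|//].
  exact: sum.
by rewrite (sum k r1)//; exact: uop_L2.
Qed.

End VolterraOperators.

Lemma L2inner0 (R : realType) (a : R) f : L2inner a f (fun=> 0) = 0.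
Proof.
rewrite /L2inner -[RHS](@Rintegral0 R `]0, a[).
by apply: eq_Rintegral => x _; rewrite mulr0.
Qed.

Opaque L2 L2inner sqn vop vopT.

(** * Bounded operators and inversion of the Gram operator *)

Section BoundedOperators.
Context {R : realType}.
Notation mu := (@lebesgue_measure R).
Implicit Types (A B : (R -> R) -> R -> R) (f g h : R -> R).

Lemma bounded_opI (a b : R) A : (forall f, L2 a f -> L2 b (A f)) ->
  (forall c f g, L2 a f -> L2 a g ->
        eqL2 b (A (fun x => c * f x + g x)) (fun x => c * A f x + A g x)) ->
  (exists2 C, 0 <= C & forall f, L2 a f -> sqn b (A f) <= C * sqn a f) ->
  bounded_op a b A.
Proof.
move=> AL Alin [C C0 HC]; split=> //; exists (Num.sqrt C) => f Lf.
rewrite !L2norm_sqrt//; last exact: AL.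
by rewrite -sqrtrM// ler_wsqrtr// HC.
Qed.

Lemma bounded_op_sqn (a b : R) A : bounded_op a b A -> exists2 C, 0 <= C &
  forall f, L2 a f -> sqn b (A f) <= C * sqn a f.
Proof.
move=> [AL _ [C HC]]; exists (C ^+ 2); first exact: sqr_ge0.
move=> f Lf; have [n0 <-] := L2norm_sq (AL f Lf); have [m0 <-] := L2norm_sq Lf.
by rewrite -exprMn lerXn2r ?nnegrE//; [exact: le_trans n0 (HC _ Lf)|exact: HC].
Qed.

(** Operators act on representatives; linearity and the norm bound force them to respect almost
    everywhere equality. *)
Lemma bounded_op_eq (a b : R) A f g : bounded_op a b A -> L2 a f -> L2 a g ->
  eqL2 a f g -> eqL2 b (A f) (A g).
Proof.
move=> bA Lf Lg fg; have [AL Alin _] := bA; have [C C0 HC] := bounded_op_sqn bA.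
pose d x := -1 * g x + f x; have Ld : L2 a d by apply: L2D => //; exact: L2Z.
have d0 : sqn a d = 0.
  by apply: sqn_eq0 => //; apply: (ae_imp fg) => x h xa; rewrite /d h//; ring.
have := HC d Ld; rewrite d0 mulr0 => Ad; have {}Ad : sqn b (A d) = 0.
  by apply/eqP; rewrite eq_le Ad sqn_ge0.
have := sqn0_eqL2 (AL d Ld) Ad => z; apply: (ae_imp2 z (Alin (-1) g f Lg Lf)) => x h1 h2 xb.
have := h2 xb; rewrite -/d h1// => /eqP; rewrite eq_sym mulN1r addrC subr_eq0 => /eqP.
by [].
Qed.

Lemma eq_bounded_op (a b : R) A B : bounded_op a b A ->
  (forall f, L2 a f -> L2 b (B f) /\ eqL2 b (B f) (A f)) -> bounded_op a b B.
Proof.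
move=> bA BA; have [AL Alin _] := bA; have [C C0 HC] := bounded_op_sqn bA.
apply: bounded_opI.
- by move=> f /BA[].
- move=> c f g Lf Lg; have [_ e1] := BA f Lf; have [_ e2] := BA g Lg.
  have [_ e3] := BA _ (L2D (L2Z c Lf) Lg).
  apply: eqL2_trans e3 _; apply: eqL2_trans (Alin c f g Lf Lg) _.
  by apply: (ae_imp2 e1 e2) => x h1 h2 xb; rewrite h1// h2.
- exists C => // f Lf; have [LB e] := BA f Lf.
  by rewrite (eqL2_sqn LB (AL f Lf) e) HC.
Qed.

Section GramOperator.
Variables (a : R) (k : R -> R -> R) (m : R -> R).
Hypotheses (a0 : 0 < a) (ck : cont2 k) (cm : continuous m) (m0 : forall y, 0 < m y).

Definition gram_op f := uopT a k (fun y => m y * uop a k f y).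

Lemma uop_bounded : bounded_op a a (uop a k).
Proof.
have [C C0 HC] := vop_bound a0 ck; apply: bounded_opI.
- by move=> f; exact: uop_L2.
- by move=> c f g Lf Lg; apply: eqL2P => x _; exact: uop_lin.
- exists (2 + 2 * C); first by rewrite addr_ge0// mulr_ge0.
  move=> f Lf; apply: le_trans (sqnD Lf (vop_L2 ck Lf)) _.
  rewrite (_ : (2 + 2 * C) * _ = 2 * sqn a f + 2 * (C * sqn a f)); last by ring.
  by rewrite lerD2l ler_wpM2l// HC.
Qed.

(** Boundedness passes to the transpose by duality: with h = U^T f, expanding the squared norm of C
    f - U h and using the bound C for U gives C |h|^2 <= C^2 |f|^2. The case C = 0 is separate,
    since C cannot be divided out. *)
Lemma uopT_bounded : bounded_op a a (uopT a k).
Proof.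
have [C C0 HC] := bounded_op_sqn uop_bounded; apply: bounded_opI.
- by move=> f; exact: uopT_L2.
- by move=> c f g Lf Lg; apply: eqL2P => x _; exact: uopT_lin.
- exists C; first exact: C0.
  move=> f Lf; set h := uopT a k f; have Lh : L2 a h by exact: uopT_L2.
  have := sqn_ge0 a (fun x => C * f x - uop a k h x).
  have LU := uop_L2 ck Lh; have LC := L2Z C Lf.
  have -> : sqn a (fun x => C * f x - uop a k h x) =
      C ^+ 2 * sqn a f - 2 * C * sqn a h + sqn a (uop a k h).
    have LB := L2B LC LU.
    rewrite sqn_inner (L2innerBl LC LU LB) (L2innerZl C Lf LB).
    rewrite (L2innerC a f) (L2innerBl LC LU Lf) (L2innerZl C Lf Lf) (uop_adjoint ck Lh Lf) -/h.
    rewrite (L2innerC a (uop a k h)) (L2innerBl LC LU LU) (L2innerZl C Lf LU).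
    rewrite (L2innerC a f) (uop_adjoint ck Lh Lf) -/h -!sqn_inner.
    by move: (sqn a f) (sqn a h) (sqn a _) => u v w; ring.
  have HU := HC h Lh => H.
  have {}H : C * sqn a h <= C * (C * sqn a f).
    by move: HU H; move: (sqn a (uop a k h)) (sqn a h) (sqn a f) => u v w HU H; nra.
  have [C00|Cn0] := eqVneq C 0; last by move: H; rewrite ler_pM2l// lt_neqAle eq_sym Cn0.
  have h0 := uop_adjoint ck Lh Lf; rewrite -/h -sqn_inner in h0.
  have U0 : eqL2 a (uop a k h) (fun=> 0).
    apply: (sqn0_eqL2 LU); apply/eqP; rewrite eq_le sqn_ge0 andbT.
    by move: HU; rewrite C00 mul0r.
  by rewrite C00 mul0r -h0 (eqL2_inner LU (L2_cst a 0) Lf U0) L2innerC L2inner0.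
Qed.

End GramOperator.

Lemma mul_bounded (a : R) (m : R -> R) : continuous m -> bounded_op a a (fun f y => m y * f y).
Proof.
move=> cm; have [C C0 HC] := cont_bounded_oo a cm; apply: bounded_opI.
- by move=> f; exact: L2_cont_mul.
- by move=> c f g _ _; apply: eqL2P => x _; ring.
- exists (C ^+ 2); first exact: sqr_ge0.
  move=> f Lf; rewrite -sqnZ//; apply: le_sqn; [exact: L2_cont_mul|exact: L2Z|].
  by move=> x xa; rewrite !normrM ler_wpM2r// (ger0_norm C0) HC.
Qed.

Lemma comp_bounded (a b c : R) A B : bounded_op a b A -> bounded_op b c B ->
  bounded_op a c (fun f => B (A f)).
Proof.
move=> bA bB; have [AL Alin _] := bA; have [BL Blin _] := bB.
have [C C0 HC] := bounded_op_sqn bA; have [D D0 HD] := bounded_op_sqn bB.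
apply: bounded_opI.
- by move=> f /AL/BL.
- move=> e f g Lf Lg; apply: eqL2_trans (Blin e _ _ (AL f Lf) (AL g Lg)).
  apply: (bounded_op_eq bB) (Alin e f g Lf Lg).
    by apply: AL; apply: L2D => //; exact: L2Z.
  by apply: L2D; [apply: L2Z|]; exact: AL.
- exists (D * C); first exact: mulr_ge0.
  move=> f Lf; apply: le_trans (HD _ (AL f Lf)) _.
  by rewrite -mulrA ler_wpM2l// HC.
Qed.

(** The inverse composes the inverses of the transpose, of the multiplication by [m] and of U. The
    transpose is inverted by testing against L^2 functions. *)
Lemma gram_op_inverse (a : R) (k : R -> R -> R) (m : R -> R) : 0 < a -> cont2 k -> continuous m ->
  (forall y, 0 < m y) ->
  bounded_op a a (gram_op a k m) /\
  exists2 rho, cont2 rho &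
    (forall f, L2 a f -> forall y, 0 < y < a ->
      uop a rho (uop a k f) y = f y /\ uop a k (uop a rho f) y = f y) /\
    is_inverse a (gram_op a k m) (fun f => uop a rho (fun y => (m y)^-1 * uopT a rho f y)).
Proof.
move=> a0 ck cm m0.
have cmV : continuous (fun y => (m y)^-1).
  by move=> y; apply: cvgV; [rewrite gt_eqF|exact: cm].
have bG : bounded_op a a (gram_op a k m).
  have b1 := comp_bounded (uop_bounded a0 ck) (mul_bounded a cm).
  exact: (comp_bounded b1 (uopT_bounded a0 ck)).
split; first by [].
have [rho cr Hr] := volterra_inverse a ck; exists rho; first by [].
split; first exact: Hr.
have bU := uop_bounded a0 ck; have bUT := uopT_bounded a0 ck.
have bP := uop_bounded a0 cr; have bPT := uopT_bounded a0 cr.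
have invT (k1 k2 : R -> R -> R) f : cont2 k1 -> cont2 k2 ->
    (forall f, L2 a f -> forall y, 0 < y < a -> uop a k1 (uop a k2 f) y = f y) ->
    L2 a f -> eqL2 a (uopT a k2 (uopT a k1 f)) f.
  move=> c1 c2 H Lf; apply: eqL2_of_inner => //; first by apply: uopT_L2 => //; exact: uopT_L2.
  move=> h Lh; rewrite L2innerC -uop_adjoint//; last exact: uopT_L2.
  rewrite -uop_adjoint//; last exact: uop_L2.
  by rewrite (L2innerC a f); apply: eq_int_on => x xa; rewrite H.
split; first exact: bG.
- exact: (comp_bounded (comp_bounded bPT (mul_bounded a cmV)) bP).
- move=> f Lf; have L1 := uopT_L2 cr Lf; have L2 := L2_cont_mul cmV L1.
  apply: eqL2_trans (invT rho k f cr ck _ Lf); last by move=> g Lg y ya; exact: (Hr g Lg y ya).1.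
  apply: (bounded_op_eq bUT _ L1).
    exact: (L2_cont_mul cm (uop_L2 ck (uop_L2 cr L2))).
  apply: eqL2P => y ya; rewrite (Hr _ L2 y ya).2 mulrA mulfV ?mul1r//.
  by rewrite gt_eqF.
- move=> f Lf; have L1 := uop_L2 ck Lf; have L2 := L2_cont_mul cm L1.
  have e1 : eqL2 a (uopT a rho (gram_op a k m f)) (fun y => m y * uop a k f y).
    by apply: (invT k rho _ ck cr _ L2) => g Lg y ya; exact: (Hr g Lg y ya).2.
  apply: eqL2_trans (eqL2P (fun y ya => (Hr f Lf y ya).1)).
  apply: (bounded_op_eq bP _ L1).
    exact: (L2_cont_mul cmV (uopT_L2 cr (uopT_L2 ck L2))).
  by apply: (ae_imp e1) => y h ya; rewrite h// mulrA mulVf ?mul1r// gt_eqF.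
Qed.

End BoundedOperators.

(** * Density of the smooth controls *)

Transparent L2 L2inner sqn vop vopT.

(** * A smooth function flat at the origin *)

Section Bump.
Context {R : realType}.

(** The derivatives of e^(-1/t), prolonged by 0, are combinations of these functions; each is O(t^2)
    at 0 by [flat_bound], hence differentiable there. *)
Definition flat_term (n : nat) (t : R) : R :=
  if 0 < t then t^-1 ^+ n * expR (- t^-1) else 0.

Lemma flat_bound (n : nat) : exists2 C : R, 0 <= C & forall t, `|flat_term n t| <= C * t ^+ 2.
Proof.
exists (n.+2)`!%:R => // t; rewrite /flat_term; case: ifPn => [t0|_]; last first.
  by rewrite normr0 mulr_ge0 ?sqr_ge0.
have [u uE] : exists u, u = t^-1 by eexists.
have u0 : 0 < u by rewrite uE invr_gt0.
have -> : t ^+ 2 = (u ^+ 2)^-1 by rewrite uE exprVn invrK.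
rewrite -uE ger0_norm; last by rewrite mulr_ge0 ?expR_ge0// exprn_ge0// ltW.
have f0 : 0 < (n.+2)`!%:R :> R by rewrite ltr0n fact_gt0.
have h1 : u ^+ n.+2 / (n.+2)`!%:R <= expR u.
  by apply: le_trans (expR_ge1Dxn n.+1 (ltW u0)); rewrite lerDr.
rewrite ler_pdivrMr// in h1.
rewrite ler_pdivlMr ?exprn_gt0// mulrAC -exprD addn2.
rewrite expRN ler_pdivrMr ?expR_gt0// mulrC; exact: h1.
Qed.

Lemma ider_invX (n : nat) (t : R) : t != 0 ->
  ider (fun t : R => t^-1 ^+ n) t (- n%:R * t^-1 ^+ n.+1).
Proof.
move=> t0; have d1 : ider (fun t : R => t^-1) t (- t^-1 ^+ 2).
  have := @is_deriveV R id t 1 1 t0 (ider_id t).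
  by rewrite /ider /GRing.scale/= mulr1 exprVn.
elim: n => [|n IH].
  by apply: (@eq_ider _ (fun=> 1)) => //; apply: ider_val (ider_cst 1 t) _; rewrite oppr0 mul0r.
apply: (@eq_ider _ (fun t => t^-1 * t^-1 ^+ n)); first by move=> y; rewrite exprS.
apply: ider_val (iderM d1 IH) _; rewrite -natr1 !exprS; ring.
Qed.

Lemma ider_flat (n : nat) t : ider (flat_term n) t (flat_term n.+2 t - n%:R * flat_term n.+1 t).
Proof.
have [t0|t0|->] := ltgtP t 0.
- rewrite /flat_term (lt_gtF t0) mulr0 subrr.
  apply: (@oo_ider _ (fun=> 0) _ _ (t - 1) 0); [|move=> y /andP[_ y0]|exact: ider_cst].
    by apply/andP; split; lra.
  by rewrite (lt_gtF y0).
- have tn : t != 0 by rewrite gt_eqF.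
  apply: (@oo_ider _ (fun t => t^-1 ^+ n * expR (- t^-1)) _ _ 0 (t + 1)).
  + by apply/andP; split; lra.
  + by move=> y /andP[y0 _]; rewrite /flat_term y0.
  have d1 := ider_invX n tn; have d2 := ider_invX 1 tn.
  have d3 : ider (fun t => expR (- t^-1)) t (expR (- t^-1) * t^-1 ^+ 2).
    apply: (ider_comp (f := @expR R) (g := fun t => - t^-1)); first exact: ider_expR.
    apply: ider_val (iderN d2) _; by rewrite mulN1r opprK.
  apply: ider_val (iderM d1 d3) _; rewrite /flat_term t0 !exprS; ring.
- have F0 k : flat_term k 0 = 0 by rewrite /flat_term ltxx.
  rewrite !F0 mulr0 subrr; apply/iderP => e e0.
  have [C C0 HC] := flat_bound n.
  have C1 : 0 < C + 1 by rewrite ltr_wpDl.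
  exists (e / (C + 1)); first by rewrite divr_gt0.
  move=> h he; rewrite F0 mul0r !subr0 add0r.
  apply: le_trans (HC h) _; rewrite -[h ^+ 2]real_normK ?num_real// expr2 mulrA ler_wpM2r//.
  apply: le_trans (_ : (C + 1) * (e / (C + 1)) <= _); last by rewrite mulrCA divff ?mulr1// gt_eqF.
  by apply: ler_pM => //; [rewrite lerDl|exact: ltW].
Qed.

(** Linear combinations coded by lists of coefficients and exponents: the class stable under
    differentiation that [smooth_intro] asks for. *)
Definition flat_sum (s : seq (R * nat)) (t : R) := \sum_(c <- s) c.1 * flat_term c.2 t.

Lemma smooth_flat n : smooth (flat_term n).
Proof.
apply: (@smooth_intro R (fun f => exists s, f = flat_sum s)); last first.
  exists [:: (1, n)]; apply/funext => t.
  by rewrite /flat_sum big_cons big_nil addr0 mul1r.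
move=> _ [s ->].
pose s' := flatten [seq [:: (c.1, c.2.+2); (- c.1 * c.2%:R, c.2.+1)] | c <- s].
exists (flat_sum s'); first by exists s'.
rewrite {}/s'; elim: s => [|c s IH] t.
  apply: (@eq_ider _ (fun=> 0)); first by move=> y; rewrite /flat_sum big_nil.
  by rewrite /flat_sum /= big_nil; exact: ider_cst.
apply: (@eq_ider _ (fun t => c.1 * flat_term c.2 t + flat_sum s t)).
  by move=> y; rewrite /flat_sum big_cons.
rewrite /flat_sum /= !big_cons /= -/(flat_sum _ t).
apply: ider_val (iderD (iderZ c.1 (ider_flat c.2 t)) (IH t)) _.
by rewrite /flat_sum; ring.
Qed.

Lemma smooth_affine (f : R -> R) (d c : R) : smooth f -> smooth (fun t => f (d * t + c)).
Proof.
move=> sf; apply: (@smooth_intro R (fun h => exists e f, smooth f /\ h = fun t => e * f (d * t + c))).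
  move=> _ [e [g [sg ->]]]; exists (fun t => e * d * derive1 g (d * t + c)).
    by exists (e * d), (derive1 g); split; first exact: smooth_derive1.
  move=> t; rewrite -mulrA; apply: iderZ; rewrite mulrC.
  by apply: (ider_comp (f := g) (g := fun t => d * t + c)); [exact: smooth_ider|exact: ider_lin].
by exists 1, f; split=> //; apply/funext => t; rewrite mul1r.
Qed.

(* Smooth approximations of the indicator function of ]a, +oo[. *)
Definition ramp (a : R) (n : nat) (t : R) := flat_term 0 (n.+1%:R * t + - (n.+1%:R * a)).

Lemma rampE a n t : ramp a n t = if a < t then expR (- (n.+1%:R * (t - a))^-1) else 0.
Proof.
by rewrite /ramp /flat_term expr0 mul1r -mulrBr pmulr_rgt0// subr_gt0.
Qed.

Lemma ramp_control a n : 0 < a -> control (ramp a n).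
Proof.
move=> a0; split; first exact: (smooth_affine n.+1%:R (- (n.+1%:R * a)) (smooth_flat 0)).
by exists a => // t ta; rewrite rampE ltNge ta.
Qed.

Lemma ramp_le1 a n t : `|ramp a n t| <= 1.
Proof.
rewrite rampE; case: ifP => [ta|_]; last by rewrite normr0.
rewrite ger0_norm ?expR_ge0// -expR0 ler_expR oppr_le0 invr_ge0.
by rewrite mulr_ge0// subr_ge0 ltW.
Qed.

Lemma ramp_cvg a t : ramp a n t @[n --> \oo] --> ((if a < t then 1 else 0) : R).
Proof.
case: ifPn => [ta|ta]; last first.
  by apply: cvg_near_cst; apply: nearW => n; rewrite rampE (negbTE ta).
have E : (fun n => ramp a n t) = fun n => expR (- (n.+1%:R^-1 * (t - a)^-1)).
  by apply/funext => n; rewrite rampE ta invfM.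
have c : - (n.+1%:R^-1 * (t - a)^-1) @[n --> \oo] --> (0 : R).
  rewrite -oppr0 -(mul0r (t - a)^-1); apply: cvgN.
  apply: (@cvgM _ _ _ _ harmonic (fun=> (t - a)^-1)); first exact: cvg_harmonic.
  exact: cvg_cst.
by rewrite E; have := cvg_comp _ _ c (@continuous_expR R 0); rewrite expR0.
Qed.

End Bump.

(** * Approximation in L^2 by smooth controls *)

Section Approximation.
Context {R : realType}.
Notation mu := (@lebesgue_measure R).
Implicit Types (T : R) (f g : R -> R).

Lemma Rdominated_cvg (D : set R) (f_ : nat -> R -> R) (f g : R -> R) : measurable D ->
  (forall n, measurable_fun D (f_ n)) -> measurable_fun D f ->
  (forall x, D x -> f_ n x @[n --> \oo] --> f x) ->
  mu.-integrable D (EFin \o g) -> (forall n x, D x -> `|f_ n x| <= g x) ->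
  \int[mu]_(x in D) f_ n x @[n --> \oo] --> \int[mu]_(x in D) f x.
Proof.
move=> mD mf_ mf cf ig fg.
have h1 n : measurable_fun D (EFin \o f_ n) by apply/measurable_EFinP.
have h2 : measurable_fun D (EFin \o f) by apply/measurable_EFinP.
have [||i1 _ c] := @dominated_convergence _ _ _ mu D mD (fun n => EFin \o f_ n) (EFin \o f) (EFin \o g)
  h1 h2 _ ig.
- by apply/aeW => x Dx; apply: cvg_EFin; [exact: nearW|exact: cf].
- by apply/aeW => x n Dx; rewrite /= lee_fin; exact: fg.
have fin : (\int[mu]_(x in D) (EFin \o f) x)%E \is a fin_num by exact: integrable_fin_num.
by move: c; rewrite -(fineK fin) => /fine_cvg.
Qed.

Lemma clampr_lip (M u v : R) : 0 <= M -> `|clampr (- M) M u - clampr (- M) M v| <= `|u - v|.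
Proof.
move=> M0; rewrite /clampr.
have h1 := ler_norm (u - v); have h2 := ler_norm (- (u - v)); rewrite normrN in h2.
have h3 := normr_ge0 (u - v).
have N (x y d : R) : x - y <= d -> y - x <= d -> `|x - y| <= d.
  by move=> a b; rewrite ler_norml; apply/andP; split; lra.
have lmin : `|Num.min u M - Num.min v M| <= `|u - v|.
  by apply: N; case: (leP u M) => ?; case: (leP v M) => ?; lra.
apply: le_trans lmin; move: (Num.min u M) (Num.min v M) => a b.
have h4 := ler_norm (a - b); have h5 := ler_norm (- (a - b)); rewrite normrN in h5.
have h6 := normr_ge0 (a - b).
by apply: N; case: (leP (- M) a) => ?; case: (leP (- M) b) => ?; lra.
Qed.

(** Truncation at height n, then approximation in L^1 by continuous functions truncated at the same
    height: between functions bounded by n the L^1 distance controls the squared L^2 distance. *)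
Lemma L2_dense_cont (a : R) f (e : R) : 0 < a -> L2 a f -> 0 < e ->
  exists2 g : R -> R, continuous g & sqn a (fun x => f x - g x) < e.
Proof.
move=> a0 Lf e0; pose D : set R := `]0, a[%classic.
have mD : measurable D by exact: measurable_itv.
have mf : measurable_fun D f := L2_measurable Lf.
pose tr (n : nat) x := clampr (- n%:R) n%:R (f x).
have ctr n : continuous (clampr (- n%:R) (n%:R : R)) by exact: clampr_cont.
have mtr n : measurable_fun D (tr n).
  by apply: (measurableT_comp _ mf); apply: continuous_measurable_fun; exact: ctr.
have inb (n : nat) (x : R) : - n%:R <= clampr (- n%:R) n%:R x <= n%:R.
  by apply: clampr_in; rewrite (le_trans _ (ler0n _ n))// oppr_le0.
have c0 n : clampr (- n%:R) n%:R 0 = 0 :> R.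
  by rewrite clampr_id// oppr_le0 !ler0n.
have dtr n x : `|f x - tr n x| <= `|f x|.
  rewrite /tr /clampr; case: (leP (f x) n%:R) => h1.
    case: (leP (- n%:R) (f x)) => h2; first by rewrite subrr normr0.
    have n0 : 0 <= n%:R :> R by []. 
    rewrite ltr0_norm ?ltr0_norm; lra.
  have n0 : 0 <= n%:R :> R by [].
  rewrite max_r; last by lra.
  by rewrite gtr0_norm ?gtr0_norm; lra.
have S1 : sqn a (fun x => f x - tr n x) @[n --> \oo] --> (0 : R).
  rewrite -[X in _ --> X](@Rintegral0 R D).
  apply: (@Rdominated_cvg D (fun n x => (f x - tr n x) ^+ 2) _ (fun x => f x ^+ 2)) => //.
  - by move=> n; apply: measurable_funX; apply: measurable_funB.
  - move=> x _; apply: cvg_near_cst; near=> n.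
    suff -> : tr n x = f x by rewrite subrr expr0n.
    have fn : `|f x| <= n%:R.
      apply: le_trans (_ : (Num.bound `|f x|)%:R <= _).
        by apply: ltW; apply: archi_boundP.
      by rewrite ler_nat; near: n; exact: nbhs_infty_ge.
    by rewrite /tr clampr_id//; move: fn; rewrite ler_norml.
  - exact: (L2_sq Lf).
  - move=> n x _; rewrite ger0_norm ?sqr_ge0//.
    by rewrite -[X in X <= _]real_normK ?num_real// -[f x ^+ 2]real_normK ?num_real// lerXn2r// nnegrE.
have e8 : 0 < e / 8 by rewrite divr_gt0.
have /cvgrPdist_lt /(_ _ e8) [n _ /(_ n (leqnn n)) Hn] := S1.
have {}Hn : sqn a (fun x => f x - tr n x) < e / 8.
  by move: Hn; rewrite /= sub0r normrN ger0_norm// sqn_ge0.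
have Ltr : L2 a (tr n).
  apply: (@L2_le _ _ _ (fun=> n%:R ^+ 2)) => //; first exact: integrable_cst_oo.
  move=> x _; rewrite -[tr n x ^+ 2]real_normK ?num_real// lerXn2r ?nnegrE//.
  by rewrite ler_norml; exact: inb.
have muD : (mu D < +oo)%E by rewrite lebesgue_measure_itv/= lte_fin a0 -EFinB ltry.
have [g_ [cg ig cvg_g]] := @approximation_continuous_integrable R D (tr n) mD muD (L2_int Ltr).
(* Differences of values in [-n, n] are at most 2 n; the added 1 keeps [M] positive when n = 0. *)
pose M : R := 2 * n%:R + 1.
have M0 : 0 < M by rewrite /M ltr_wpDl// mulr_ge0.
have e8M : 0 < e / 8 / M by rewrite divr_gt0.
have /fine_cvgP[_ /cvgrPdist_lt /(_ _ e8M) [k _ /(_ k (leqnn k)) Hk]] := cvg_g.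
pose g x := clampr (- n%:R) n%:R (g_ k x).
have cgg : continuous g by apply: (cont_comp1 (u := clampr (- n%:R) n%:R)); [exact: ctr|exact: cg].
exists g => //.
have Lg : L2 a g by exact: L2_cont.
have Hg : sqn a (fun x => tr n x - g x) < e / 8.
  have i1 : mu.-integrable D (EFin \o (fun x => `|tr n x - g_ k x|)).
    apply: integrable_abse_fin => //.
    by have := integrableB _ (L2_int Ltr) (ig k); exact.
  apply: le_lt_trans (_ : M * \int[mu]_(x in D) `|tr n x - g_ k x| < _); last first.
    rewrite -ltr_pdivlMl// mulrC; move: Hk; rewrite /= sub0r normrN => /(le_lt_trans _); apply.
    by apply: le_trans (ler_norm _).
  rewrite RintegralZl_gen//; apply: le_Rintegral => //.
  - exact: (L2_sq (L2B Ltr Lg)).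
  - exact: integrable_funZ.
  move=> x _; rewrite -real_normK ?num_real// expr2; apply: ler_pM => //.
    have := inb n (f x); have := inb n (g_ k x); rewrite -/(tr n x) -/(g x).
    rewrite ler_norml /M => /andP[? ?] /andP[? ?]; apply/andP; split; lra.
  have -> : tr n x - g x = clampr (- n%:R) n%:R (f x) - clampr (- n%:R) n%:R (g_ k x) by [].
  have tt : tr n x = clampr (- n%:R) n%:R (tr n x) by rewrite [RHS]clampr_id//; exact: inb.
  by rewrite -/(tr n x) {1}tt; exact: clampr_lip.
have E : sqn a (fun x => f x - g x) = sqn a (fun x => (f x - tr n x) + (tr n x - g x)).
  by congr sqn; apply/funext => x; ring.
rewrite E; apply: le_lt_trans (sqnD (L2B Lf Ltr) (L2B Ltr Lg)) _; lra.
Unshelve. all: by end_near. Qed.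

(** Testing with ramps, the integral of [h] over ]b, T[ vanishes for every b > 0. So the primitive
    of [h] is constant on ]0, T[, and Lebesgue differentiation gives 0 almost everywhere. *)
Lemma controls_total (T : R) h : 0 < T -> L2 T h ->
  (forall phi, control phi -> L2inner T h phi = 0) -> eqL2 T h (fun=> 0).
Proof.
move=> T0 Lh H; pose D : set R := `]0, T[%classic; have mD : measurable D by exact: measurable_itv.
have mh : measurable_fun D h := L2_measurable Lh.
have tail b : 0 < b -> \int[mu]_(x in D) (h x * (if b < x then 1 else 0)) = 0.
  move=> b0; have mr n : continuous (ramp b n) by apply: smooth_cont; have [] := ramp_control n b0.
  have c : \int[mu]_(x in D) (h x * ramp b n x) @[n --> \oo] -->
      \int[mu]_(x in D) (h x * (if b < x then 1 else 0)).
    apply: (@Rdominated_cvg D (fun n x => h x * ramp b n x) _ (fun x => `|h x|)) => //.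
    - move=> n; apply: measurable_funM => //; exact: continuous_measurable_oo.
    - apply: measurable_funM => //; apply: measurable_fun_if => //.
        by apply: measurable_fun_ltr.
    - by move=> x _; apply: cvgMr; exact: ramp_cvg.
    - by apply: integrable_abse_fin => //; exact: L2_int.
    - by move=> n x _; rewrite normrM ler_piMr// ramp_le1.
  have z n : \int[mu]_(x in D) (h x * ramp b n x) = 0 by exact: H (ramp_control n b0).
  have z' : (fun n => \int[mu]_(x in D) (h x * ramp b n x)) = fun=> 0 by apply/funext.
  by move: c; rewrite z' => c; exact: (cvg_unique _ c (@cvg_cst _ _ _ _ _)).
pose F := cut T h; have iF := cut_integrable Lh.
have lF : locally_integrable setT F by exact: open_integrable_locally openT iF.
have iD (A : set R) : measurable A -> mu.-integrable A (EFin \o F).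
  by move=> mA; exact: integrableS iF.
have Ftail b : 0 < b -> \int[mu]_(t in `]-oo, b]) F t = \int[mu]_x F x.
  move=> b0; have := @Rintegral_setU _ _ _ mu `]-oo, b]%classic `]b, +oo[%classic F.
  rewrite (_ : `]-oo, b] `|` `]b, +oo[ = setT); last first.
    by apply/seteqP; split=> // x _; rewrite /= !in_itv/= andbT; case: (leP x b); [left|right].
  move=> -> //; last first.
    apply/disj_setPS => x [] /=; rewrite !in_itv/= andbT => xb bx.
    by have := lt_le_trans bx xb; rewrite ltxx.
  rewrite (_ : \int[mu]_(x in `]b, +oo[) F x = 0) ?addr0// -[RHS](tail b b0).
  transitivity (\int[mu]_x (cut T h x * (if b < x then 1 else 0))).
    apply: eq_int_patch => x; rewrite /= in_itv/= andbT; first by move=> ->; rewrite mulr1.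
    by move=> /negP/negbTE ->; rewrite mulr0.
  apply/esym/eq_int_patch => x; rewrite /D/= in_itv/= => xT; first by rewrite cutT.
  by rewrite cutC ?mul0r//; exact/negP.
have := FTC1Ny (fun y => iD _ (measurable_itv _)) lF => H2.
apply: (ae_imp H2) => x [_ dF] xT; rewrite -(cutT h xT) -/F -dF.
apply: derive1_eq; apply: (@oo_ider _ (fun=> \int[mu]_x F x) _ x 0 T) => //; last exact: ider_cst.
by move=> y /andP[y0 _]; rewrite Ftail.
Qed.

Lemma step_cut (T b e : R) : 0 < T -> 0 <= b -> 0 < e -> exists2 phi, control phi &
  sqn T (fun x => (if b < x then 1 else 0) - phi x) < e.
Proof.
move=> T0 b0 e0; pose D : set R := `]0, T[%classic; have mD : measurable D by exact: measurable_itv.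
have mstep c : measurable_fun D (fun x : R => (if c < x then 1 else 0) : R).
  by apply: measurable_fun_if => //; exact: measurable_fun_ltr.
have Lstep c : L2 T (fun x : R => if c < x then 1 else 0).
  apply: (@L2_le _ _ _ (fun=> 1)) => //; first exact: integrable_cst_oo.
  by move=> x _; case: ifP => _; rewrite ?expr1n ?expr0n.
have pos c d : 0 < c -> 0 < d -> exists2 phi, control phi &
    sqn T (fun x => (if c < x then 1 else 0) - phi x) < d.
  move=> c0 d0; have cr n : continuous (ramp c n) by apply: smooth_cont; have [] := ramp_control n c0.
  have S : sqn T (fun x => (if c < x then 1 else 0) - ramp c n x) @[n --> \oo] --> (0 : R).
    rewrite -[X in _ --> X](@Rintegral0 R D).
    apply: (@Rdominated_cvg D (fun n x => ((if c < x then 1 else 0) - ramp c n x) ^+ 2) _ (fun=> 2 ^+ 2)) => //.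
    - move=> n; apply: measurable_funX; apply: measurable_funB => //.
      exact: continuous_measurable_oo.
    - move=> x _; have h := @ramp_cvg R c x.
      have [A AE] : exists A : R, A = if c < x then 1 else 0 by eexists.
      rewrite -AE in h; under [X in X @ _]funext do rewrite -AE.
      have h2 : A - ramp c n x @[n --> \oo] --> (0 : R).
        by rewrite -[X in _ --> X](subrr A); apply: cvgB => //; exact: cvg_cst.
      have h3 : (A - ramp c n x) * (A - ramp c n x) @[n --> \oo] --> (0 : R).
        by rewrite -[X in _ --> X](mul0r 0); exact: (cvgM h2 h2).
      exact: h3.
    - exact: integrable_cst_oo.
    - move=> n x _; rewrite ger0_norm ?sqr_ge0// -real_normK ?num_real// lerXn2r ?nnegrE//.
      apply: le_trans (ler_normB _ _) _; have := ramp_le1 c n x.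
      by case: ifP => _; rewrite ?normr1 ?normr0; lra.
  have /cvgrPdist_lt /(_ _ d0) [n _ /(_ n (leqnn n)) Hn] := S.
  exists (ramp c n); first exact: ramp_control.
  by move: Hn; rewrite /= sub0r normrN ger0_norm// sqn_ge0.
have [->|bn0] := eqVneq b 0; last by apply: pos => //; rewrite lt_neqAle eq_sym bn0.
(* Controls vanish near 0: the step at 0 is replaced by the step at a small [c], at squared distance
   at most [c]. *)
pose c := Num.min (e / 8) (T / 2).
have c0 : 0 < c by rewrite lt_min !divr_gt0.
have c1 : c <= e / 8 by rewrite ge_min lexx.
have c2 : c <= T / 2 by rewrite ge_min lexx orbT.
have e4 : 0 < e / 4 by rewrite divr_gt0.
have [phi cphi Hphi] := pos c (e / 4) c0 e4; exists phi => //.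
have Lphi : L2 T phi by apply: L2_cont; apply: smooth_cont; have [] := cphi.
have -> : sqn T (fun x => (if 0 < x then 1 else 0) - phi x) =
    sqn T (fun x => ((if 0 < x then 1 else 0) - (if c < x then 1 else 0)) + ((if c < x then 1 else 0) - phi x)).
  by congr sqn; apply/funext => x; ring.
apply: le_lt_trans (sqnD (L2B (Lstep 0) (Lstep c)) (L2B (Lstep c) Lphi)) _.
suff : sqn T (fun x : R => (if 0 < x then 1 else 0) - (if c < x then 1 else 0)) <= c by lra.
rewrite /sqn -[X in _ <= X]subr0 -[X in _ <= X]mul1r -(int_cst _ (ltW c0)).
rewrite le_eqVlt; apply/orP; left; apply/eqP.
transitivity (\int[mu]_x (if 0 < x <= c then 1 else 0 : R)).
  apply: eq_int_patch => x; rewrite /= in_itv/= => xT.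
    case/andP: xT => -> _; rewrite /=; case: (ltP c x) => _; by rewrite ?subrr ?subr0 ?expr0n ?expr1n.
  case: ifP => // /andP[x0 xc]; exfalso; apply: xT; rewrite x0/=; lra.
apply/esym; rewrite -Rintegral_itv_obnd_cbnd; last first.
  have := @locint_cst R 1 0 c; apply: integrableS => //; exact: subset_itv_oc_cc.
apply: eq_int_patch => x; rewrite /= in_itv/= => xc; first by rewrite xc.
by case: ifP.
Qed.

Lemma controlD (f g : R -> R) : control f -> control g -> control (fun x => f x + g x).
Proof.
move=> [sf [e e0 fe]] [sg [d d0 gd]]; split; first exact: smoothD.
exists (Num.min e d); first by rewrite lt_min e0.
by move=> t; rewrite le_min => /andP[te td]; rewrite fe// gd// addr0.
Qed.

Lemma controlZ (c : R) (f : R -> R) : control f -> control (fun x => c * f x).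
Proof.
move=> [sf [e e0 fe]]; split; first exact: smoothM (smooth_cst c) sf.
by exists e => // t te; rewrite fe// mulr0.
Qed.

Definition approximable T f := L2 T f /\ forall e, 0 < e -> exists2 phi, control phi &
  sqn T (fun x => f x - phi x) < e.

Lemma control_L2 T (phi : R -> R) : control phi -> L2 T phi.
Proof. by move=> [sp _]; apply: L2_cont; exact: smooth_cont. Qed.

Lemma approximableD T f g : approximable T f -> approximable T g ->
  approximable T (fun x => f x + g x).
Proof.
move=> [Lf Hf] [Lg Hg]; split; first exact: L2D.
move=> e e0; have e4 : 0 < e / 4 by rewrite divr_gt0.
have [p cp hp] := Hf _ e4; have [r cr hr] := Hg _ e4.
exists (fun x => p x + r x); first exact: controlD.
have -> : sqn T (fun x => f x + g x - (p x + r x)) = sqn T (fun x => (f x - p x) + (g x - r x)).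
  by congr sqn; apply/funext => x; ring.
apply: le_lt_trans (sqnD (L2B Lf (control_L2 T cp)) (L2B Lg (control_L2 T cr))) _; lra.
Qed.

Lemma approximableZ T (c : R) f : approximable T f -> approximable T (fun x => c * f x).
Proof.
move=> [Lf Hf]; split; first exact: L2Z.
move=> e e0; have e4 : 0 < e / (c ^+ 2 + 1) by rewrite divr_gt0// ltr_wpDl// sqr_ge0.
have c1 : 0 < c ^+ 2 + 1 by rewrite ltr_wpDl// sqr_ge0.
have [p cp hp] := Hf _ e4; exists (fun x => c * p x); first exact: controlZ.
have -> : sqn T (fun x => c * f x - c * p x) = sqn T (fun x => c * (f x - p x)).
  by congr sqn; apply/funext => x; ring.
rewrite sqnZ; last exact: L2B Lf (control_L2 T cp).
rewrite ltr_pdivlMr// in hp; apply: le_lt_trans hp; rewrite mulrC ler_wpM2l ?sqn_ge0// lerDl.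
by [].
Qed.

Lemma approximable_closed T f : L2 T f ->
  (forall e, 0 < e -> exists2 g, approximable T g & sqn T (fun x => f x - g x) < e) ->
  approximable T f.
Proof.
move=> Lf H; split=> // e e0; have e4 : 0 < e / 4 by rewrite divr_gt0.
have [g [Lg Hg] h1] := H _ e4; have [p cp h2] := Hg _ e4; exists p => //.
have -> : sqn T (fun x => f x - p x) = sqn T (fun x => (f x - g x) + (g x - p x)).
  by congr sqn; apply/funext => x; ring.
apply: le_lt_trans (sqnD (L2B Lf Lg) (L2B Lg (control_L2 T cp))) _; lra.
Qed.

Lemma approximable_step T (b : R) : 0 < T -> 0 <= b ->
  approximable T (fun x => if b < x then 1 else 0).
Proof.
move=> T0 b0; split; last by move=> e; exact: step_cut.
apply: (@L2_le _ _ _ (fun=> 1)) => //.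
- by apply: measurable_fun_if => //; exact: measurable_fun_ltr.
- exact: integrable_cst_oo.
- by move=> x _; case: ifP => _; rewrite ?expr1n ?expr0n.
Qed.

Lemma approximable_cont T (g : R -> R) : 0 < T -> continuous g -> approximable T g.
Proof.
move=> T0 cg; apply: approximable_closed => [|e e0]; first exact: L2_cont.
pose d := Num.min 1 (e / (T + 1)).
have T1 : 0 < T + 1 by rewrite ltr_wpDl// ltW.
have d0 : 0 < d by rewrite lt_min ltr01 divr_gt0.
have d1 : d <= 1 by rewrite ge_min lexx.
have d2 : d <= e / (T + 1) by rewrite ge_min lexx orbT.
have cu : continuous (fun z : R * R => g (z.2 + z.1)).
  apply: (cont_comp1 (u := g)) => //; apply: contD; [exact: continuous_snd|exact: continuous_fst].
have /nbhs_ballP[r /= r0 Hr] := @unif_near R R (fun h y => g (y + h)) 0 0 T d cu d0.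
have [n [n0 nr]] : exists n : nat, (0 < n)%N /\ T / n%:R < r.
  exists (Num.bound (T / r)).+1; split=> //.
  rewrite ltr_pdivrMr ?ltr0n// -ltr_pdivrMl// mulrC.
  apply: lt_le_trans (archi_boundP _) _; first by rewrite divr_ge0// ltW.
  by rewrite ler_nat leqnSn.
have n0' : 0 < n%:R :> R by rewrite ltr0n.
pose x_ (i : nat) : R := i%:R * (T / n%:R).
have x_mono i j : (i <= j)%N -> x_ i <= x_ j.
  by move=> ij; rewrite /x_ ler_wpM2r ?ler_nat// divr_ge0// ltW.
(* A telescoping sum of steps, equal to the value of [g] at the left end of each interval of the
   subdivision. *)
pose s := fix s m t := if m is k.+1 then s k t + (g (x_ m) - g (x_ k)) * (if x_ m < t then 1 else 0)
  else g 0 * (if 0 < t then 1 else 0).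
have sP m : approximable T (s m).
  elim: m => [|m IH]; first by apply: approximableZ; exact: approximable_step.
  apply: approximableD => //; apply: approximableZ; apply: approximable_step => //.
  by rewrite mulr_ge0// divr_ge0// ltW.
have sE m t : 0 < t -> exists j, [/\ (j <= m)%N, s m t = g (x_ j), x_ j < t &
    (j < m)%N -> t <= x_ j.+1].
  move=> t0; elim: m => [|m [j [jm sj xj tj]]].
    by exists 0%N; split=> //; rewrite /= /x_ ?mul0r// t0 mulr1.
  have [tm|mt] := leP t (x_ m.+1).
    exists j; split=> //; [exact: leqW| |].
      by rewrite /= ltNge tm mulr0 addr0 sj.
    rewrite ltnS leq_eqVlt => /orP[/eqP ->//|]; exact: tj.
  have jE : j = m.
    apply/eqP; move: jm; rewrite leq_eqVlt => /orP[//|jm]; exfalso.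
    have := tj jm; rewrite leNgt => /negP; apply; apply: le_lt_trans mt.
    exact/x_mono/leqW.
  exists m.+1; split=> //; last by rewrite ltnn.
  by rewrite /= mt mulr1 sj jE addrC subrK.
exists (s n) => //; have [Ls _] := sP n.
apply: le_lt_trans (_ : sqn T (fun=> d) < _); last first.
  rewrite sqn_cst ?(ltW T0)//; apply: le_lt_trans (_ : d * T < _).
    by rewrite ler_wpM2r ?(ltW T0)// expr2 ler_piMr// ltW.
  apply: le_lt_trans (_ : e / (T + 1) * T < _); first by rewrite ler_wpM2r// ltW.
  by rewrite mulrAC ltr_pdivrMr// ltr_pM2l// ltrDl.
apply: le_sqn; [exact: L2B (L2_cont T cg) Ls|exact: L2_cst|].
move=> t /andP[t0 tT]; have [j [jn -> xj tj]] := sE n t t0.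
rewrite (gtr0_norm d0) ltW//.
have tn : j = n \/ (j < n)%N by move: jn; rewrite leq_eqVlt => /orP[/eqP|]; [left|right].
have xn : x_ n = T by rewrite /x_ mulrCA divff ?mulr1// gt_eqF.
case: tn => [jE|jn']; first by exfalso; move: xj; rewrite jE xn; lra.
have tx : t - x_ j <= T / n%:R.
  by have := tj jn'; rewrite /x_ -natr1 mulrDl mul1r; lra.
have xj0 : 0 <= x_ j by rewrite mulr_ge0// divr_ge0// ltW.
have Hb : ball (0 : R) r (t - x_ j).
  by rewrite /ball/= sub0r normrN gtr0_norm ?subr_gt0//; exact: le_lt_trans tx nr.
have := Hr _ Hb (x_ j); rewrite /= addr0 (addrC (x_ j)) subrK; apply.
by apply/andP; split; lra.
Qed.

Lemma controls_dense T f (e : R) : 0 < T -> L2 T f -> 0 < e ->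
  exists2 phi, control phi & sqn T (fun x => f x - phi x) < e.
Proof.
move=> T0 Lf e0; have [_] : approximable T f; last exact.
apply: approximable_closed => // d d0; have [g cg Hg] := L2_dense_cont T0 Lf d0.
by exists g => //; exact: approximable_cont.
Qed.

Lemma L2_reflect_cut (a c t : R) h : L2 a h -> L2 c (fun x => cut a h (t - x)).
Proof.
move=> Lh; have mF : measurable_fun setT (cut a h) by apply/measurable_cut; exact: L2_measurable.
have iF2 : mu.-integrable setT (EFin \o (fun x => cut a h x ^+ 2)).
  by rewrite cut_sq -integrable_cut; exact: L2_sq.
have [i2 _] := int_reflect t iF2; apply/L2P; split.
  apply: measurable_funTS; apply: (measurableT_comp mF); apply: continuous_measurable_fun.
  by apply: contD; [exact: cont_cst|apply: contN; exact: cont_id].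
exact: integrableS i2.
Qed.

(** Translates of a continuous approximant are uniformly close on [[0, L]], and the approximation
    error does not grow under translation and reflection. *)
Lemma translate_cont (T L : R) f (t0 e : R) : 0 < T -> 0 < L -> L2 T f -> 0 <= t0 <= T -> 0 < e ->
  exists2 d, 0 < d & forall t, 0 <= t <= T -> `|t - t0| < d ->
    sqn L (fun x => cut T f (t - x) - cut T f (t0 - x)) < e.
Proof.
(* Shifting by [c] places all the arguments [t - x] inside ]0, a[, where the density result
   applies. *)
move=> T0 L0 Lf t0T e0; pose c := L + 1; pose a := c + T + 1.
have a0 : 0 < a by rewrite /a /c; lra.
pose h y := cut T f (y - c).
have mF : measurable_fun setT (cut T f) by apply/measurable_cut; exact: L2_measurable.
have mh : measurable_fun setT h.
  apply: (measurableT_comp mF); apply: continuous_measurable_fun.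
  by apply: contD; [exact: cont_id|exact: cont_cst].
have iF2 : mu.-integrable setT (EFin \o (fun x => cut T f x ^+ 2)).
  by rewrite cut_sq -integrable_cut; exact: L2_sq.
have Lh : L2 a h.
  apply/L2P; split; first exact: measurable_funTS.
  have [i2 _] := int_translate c iF2; exact: integrableS i2.
have e8 : 0 < e / 16 by rewrite divr_gt0.
have [g cg Hg] := L2_dense_cont a0 Lh e8.
have Lg : L2 a g by exact: L2_cont.
have Ltr t (_ : 0 <= t <= T) : L2 L (fun x => cut T f (t - x)) by exact: L2_reflect_cut.
have cG t : continuous (fun x => g (t - x + c)).
  apply: (cont_comp1 (u := g)) => //; apply: contD; last exact: cont_cst.
  by apply: contD; [exact: cont_cst|apply: contN; exact: cont_id].
have near t : 0 <= t <= T -> sqn L (fun x => cut T f (t - x) - g (t - x + c)) < e / 16.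
  move=> /andP[t0' tT]; apply: le_lt_trans Hg.
  pose H := cut a (fun y => (h y - g y) ^+ 2).
  have iH : mu.-integrable setT (EFin \o H) by apply/integrable_cut; exact: L2_sq (L2B Lh Lg).
  have [i2 E] := int_reflect (t + c) iH.
  rewrite [X in _ <= X]/sqn int_cut -/H -E /sqn.
  have H0 y : 0 <= H y by rewrite /H cutP; case: ifP => // _; exact: sqr_ge0.
  rewrite (@eq_int_on _ L _ (fun x => H (t + c - x))); last first.
    move=> x /andP[x0 xL]; rewrite /H (@cutT _ a); last by rewrite /a /c; apply/andP; split; lra.
    have -> : t + c - x = t - x + c by ring.
    by rewrite /h addrK.
  rewrite int_cut; apply: le_Rintegral => //.
    by apply/integrable_cut; exact: integrableS i2.
  by move=> x _; rewrite cutP; case: ifP.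
have cu : continuous (fun z : R * R => g (z.1 - z.2 + c)).
  apply: (cont_comp1 (u := g)) => //; apply: contD; last exact: cont_cst.
  by apply: contD; [exact: continuous_fst|apply: contN; exact: continuous_snd].
pose d := Num.min 1 (e / 16 / L).
have d0 : 0 < d by rewrite lt_min ltr01 !divr_gt0.
have d1 : d <= 1 by rewrite ge_min lexx.
have d2 : d <= e / 16 / L by rewrite ge_min lexx orbT.
have /nbhs_ballP[r /= r0 Hr] := @unif_near R R (fun t x => g (t - x + c)) t0 0 L d cu d0.
exists r => // t tT tr.
have Lg1 := L2_cont L (cG t); have Lg0 := L2_cont L (cG t0).
have mid : sqn L (fun x => g (t - x + c) - g (t0 - x + c)) <= e / 16.
  apply: le_trans (_ : sqn L (fun=> d) <= _).
    apply: le_sqn; [exact: L2B|exact: L2_cst|].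
    move=> x /andP[x0 xL]; rewrite (gtr0_norm d0) ltW//; apply: Hr; last by rewrite !ltW.
    by rewrite /ball/= distrC.
  rewrite sqn_cst ?(ltW L0)// -ler_pdivlMr//; apply: le_trans d2.
  by rewrite expr2 ler_piMr// ltW.
have -> : sqn L (fun x => cut T f (t - x) - cut T f (t0 - x)) =
  sqn L (fun x => ((cut T f (t - x) - g (t - x + c)) + (g (t - x + c) - g (t0 - x + c)))
    - (cut T f (t0 - x) - g (t0 - x + c))).
  by congr sqn; apply/funext => x; ring.
have B1 := L2B (Ltr t tT) Lg1; have B0 := L2B (Ltr t0 t0T) Lg0; have B2 := L2B Lg1 Lg0.
apply: le_lt_trans (sqnB (L2D B1 B2) B0) _.
have := sqnD B1 B2; have := near t tT; have := near t0 t0T; lra.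
Qed.

End Approximation.

(** * Mild solutions *)

Section FubiniSections.
Context {R : realType}.
Notation mu := (@lebesgue_measure R).
Notation rr := (measurableTypeR R * measurableTypeR R)%type.
Implicit Types (F : R -> R -> R) (f g h : R -> R).

Lemma integrable_fine (u : R -> \bar R) : mu.-integrable setT u ->
  mu.-integrable setT (EFin \o (fun x => fine (u x))).
Proof.
move=> iu; have mu' : measurable_fun setT u := measurable_int _ iu.
apply: (le_integrable _ _ _ iu) => //.
  by apply/measurable_EFinP; exact: (measurableT_comp (@fine_measurable R setT measurableT) mu').
by move=> x _ /=; case: (u x) => [r| |] //=; rewrite normr0 ?leey.
Qed.

(* Tonelli's criterion gives the integrability on the plane. *)
Lemma fubini_sections F h : measurable_fun setT (fun p : rr => F p.1 p.2) ->
  (forall y, mu.-integrable setT (EFin \o F ^~ y)) ->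
  (forall y, \int[mu]_x `|F x y| <= h y) -> mu.-integrable setT (EFin \o h) ->
  [/\ \int[mu]_x \int[mu]_y F x y = \int[mu]_y \int[mu]_x F x y,
      mu.-integrable setT (EFin \o (fun x => \int[mu]_y F x y)),
      mu.-integrable setT (EFin \o (fun y => \int[mu]_x F x y)) &
      {ae mu, forall x, mu.-integrable setT (EFin \o F x)}].
Proof.
move=> mF i2 Fh ih.
have mFe : measurable_fun setT (fun p : rr => (F p.1 p.2)%:E) by exact/measurable_EFinP.
have iabs y := integrable_abse_fin measurableT (i2 y).
have iF : (mu \x mu)%E.-integrable setT (fun p : rr => (F p.1 p.2)%:E).
  apply/integrable21ltyP => //.
  have mG : measurable_fun setT (fun y => (\int[mu]_x `|(F x y)%:E|)%E).
    apply: (@measurable_fun_fubini_tonelli_G _ _ _ _ _ mu (fun p : rr => `|(F p.1 p.2)%:E|)%E) => //.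
    by apply: measurableT_comp.
  have /integrableP[mh hfin] := ih; apply: le_lt_trans hfin.
  apply: ge0_le_integral => //.
  - by move=> y _; exact: integral_ge0.
  - exact: measurableT_comp.
  - move=> y _ /=.
    have -> : (\int[mu]_x `|(F x y)%:E|)%E = (\int[mu]_x `|F x y|)%:E.
      by rewrite /Rintegral fineK//; exact: (integrable_fin_num measurableT (iabs y)).
    by rewrite lee_fin (le_trans (Fh y))// ler_norm.
have ae1 := ae_integrable1 iF.
have iF1 := integrable_fubini_F iF.
have e1 : mu.-integrable setT (EFin \o (fun x => \int[mu]_y F x y)) by exact: integrable_fine iF1.
have e2 : mu.-integrable setT (EFin \o (fun y => \int[mu]_x F x y)).
  apply: (dominated_integrable _ _ _ ih) => //.
  - apply/measurable_EFinP.
    have := measurable_fubini_G iF.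
    congr measurable_fun; apply/funext => y; rewrite /= /Rintegral fineK//.
    exact: (integrable_fin_num _ (i2 y)).
  - by move=> y _; apply: le_trans (Fh y); exact: le_normr_Rintegral.
split; [|exact: e1|exact: e2|exact: ae1]; rewrite /Rintegral; congr fine.
transitivity (\int[mu]_x \int[mu]_y (F x y)%:E)%E.
  apply: ae_eq_integral => //; first exact: (measurable_int _ e1).
    exact: (measurable_int _ iF1).
  apply: filterS ae1 => x ix _ /=; rewrite fineK//; exact: (integrable_fin_num _ ix).
rewrite (Fubini iF); apply: eq_integral => y _.
by rewrite fineK//; exact: (integrable_fin_num _ (i2 y)).
Qed.

Lemma int_beyond (a b c : R) f : (forall x, c < x -> f x = 0) ->
  \int[mu]_(x in `[a, b]) f x = \int[mu]_(x in `[a, Num.min b c]) f x.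
Proof.
move=> f0; pose g x := if (a <= x <= b) && (x <= c) then f x else 0.
transitivity (\int[mu]_x g x); last symmetry; apply: eq_int_patch => x /=; rewrite in_itv/= /g.
- move=> ->/=; case: leP => // xc; exact: f0.
- by move/negP/negPf => ->.
- by rewrite le_min andbA => ->.
- by rewrite le_min andbA => /negP/negPf ->.
Qed.

Lemma le_Rint (D : set R) f g : measurable D -> mu.-integrable D (EFin \o f) ->
  mu.-integrable D (EFin \o g) -> (forall x, D x -> f x <= g x) ->
  \int[mu]_(x in D) f x <= \int[mu]_(x in D) g x.
Proof. by move=> mD i1 i2 fg; apply: le_Rintegral. Qed.

(** The norm in space in which uniqueness of mild solutions is proved: it bounds the integrals over
    all intervals. *)
Definition nrm1 (a : R) f := \int[mu]_(x in `]0, a[) `|f x|.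

Lemma nrm1_integrable (a : R) f : L2 a f -> mu.-integrable `]0, a[ (EFin \o (fun x => `|f x|)).
Proof. by move=> /L2_int; apply: integrable_abse_fin; exact: measurable_itv. Qed.

Lemma nrm1_ge0 (a : R) f : 0 <= nrm1 a f.
Proof. by rewrite fine_ge0//; apply: integral_ge0 => x _; rewrite lee_fin. Qed.

Lemma nrm1_cut (a : R) f : nrm1 a f = \int[mu]_x `|cut a f x|.
Proof.
rewrite /nrm1 int_cut; apply: eq_Rintegral => x _; rewrite !cutP; case: ifP => //.
by rewrite normr0.
Qed.

Lemma oint_cut_le (a p r : R) f : L2 a f -> `|oint p r (cut a f)| <= nrm1 a f.
Proof.
move=> Lf; have key u v : u <= v -> `|oint u v (cut a f)| <= nrm1 a f.
  move=> uv; rewrite oint_ge//; have i1 := cut_locint Lf u v.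
  apply: le_trans (le_normr_Rintegral _ i1) _ => //.
  have iT := integrable_abse_fin measurableT (cut_integrable Lf).
  rewrite nrm1_cut (@eq_int_patch _ `[u, v] _ ((fun x => `|cut a f x|) \_ `[u, v])); last 2 first.
  - by move=> x Dx; rewrite patchT.
  - by move=> x Dx; rewrite patchC.
  apply: le_Rint => //.
    by apply: patch_integrable; [exact: measurable_itv|exact: integrable_abse_fin].
  by move=> x _; rewrite /patch; case: ifP => // _; exact: normr_ge0.
by case: (leP p r) => [/key//|/ltW /key]; rewrite ointC normrN.
Qed.

Lemma nrm1_sq (a : R) f : 0 < a -> L2 a f -> nrm1 a f <= Num.sqrt a * L2norm a f.
Proof.
move=> a0 Lf; rewrite L2norm_sqrt// -sqrtrM; last exact: ltW.
rewrite -(ler_pXn2r (n := 2)) ?nnegrE ?sqrtr_ge0 ?nrm1_ge0// sqr_sqrtr.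
  exact: int_abs_sq.
by rewrite mulr_ge0 ?sqn_ge0// ltW.
Qed.

Lemma nrm1_mul_le (a C : R) (m f : R -> R) : L2 a (fun x => m x * f x) -> L2 a f ->
  (forall x, 0 < x < a -> `|m x| <= C) -> nrm1 a (fun x => m x * f x) <= C * nrm1 a f.
Proof.
move=> Lmf Lf mC; rewrite /nrm1 RintegralZl_gen//; last exact: nrm1_integrable.
apply: le_Rint => //; [exact: nrm1_integrable| |].
  by apply: integrable_funZ => //; exact: nrm1_integrable.
by move=> x /=; rewrite in_itv/= => /mC; rewrite normrM => mx; rewrite ler_wpM2r.
Qed.

Lemma nrm1_dist (a : R) f g : L2 a f -> L2 a g ->
  `|nrm1 a f - nrm1 a g| <= nrm1 a (fun x => f x - g x).
Proof.
have key u v : L2 a u -> L2 a v -> nrm1 a u - nrm1 a v <= nrm1 a (fun x => u x - v x).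
  move=> Lu Lv; have Luv := L2B Lu Lv.
  rewrite lerBlDr /nrm1 -RintegralD//; [|exact: nrm1_integrable|exact: nrm1_integrable].
  apply: le_Rint => //; first exact: nrm1_integrable.
    by apply: integrable_funD => //; exact: nrm1_integrable.
  by move=> x _; have := ler_normD (u x - v x) (v x); rewrite subrK.
move=> Lf Lg; rewrite ler_norml key// andbT.
have -> : nrm1 a (fun x => f x - g x) = nrm1 a (fun x => g x - f x).
  by apply: eq_Rintegral => x _; rewrite distrC.
by have := key g f Lg Lf; lra.
Qed.

End FubiniSections.

Lemma int_addf (R : realType) (a b : R) (f g : R -> R) :
  (@lebesgue_measure R).-integrable `[a, b] (EFin \o f) ->
  (@lebesgue_measure R).-integrable `[a, b] (EFin \o g) ->
  \int[@lebesgue_measure R]_(x in `[a, b]) (f x + g x) =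
  \int[@lebesgue_measure R]_(x in `[a, b]) f x + \int[@lebesgue_measure R]_(x in `[a, b]) g x.
Proof. by move=> i1 i2; rewrite RintegralD. Qed.

Lemma add_sub_swap (V : zmodType) (a b c d : V) : (a + b) - (c + d) = (a - c) + (b - d).
Proof. by rewrite opprD addrACA. Qed.

Lemma sub_common (R : pzRingType) (e h a b : R) : (e + h * a) - (e + h * b) = h * (a - b).
Proof. by rewrite add_sub_swap subrr add0r mulrBr. Qed.

Lemma cone_le (R : realType) (x t s : R) : 0 <= x -> s <= t -> `|x - t + s| <= x + t - s.
Proof. by move=> x0 st; rewrite ler_norml; lra. Qed.

(** * Uniqueness of mild solutions *)

Section MildUniqueness.
Context {R : realType}.
Notation mu := (@lebesgue_measure R).
Notation rr := (measurableTypeR R * measurableTypeR R)%type.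
Variables (L T : R) (q N : R -> R).
Hypotheses (L0 : 0 < L) (T0 : 0 < T).
Hypothesis hq : {within `[0, L], continuous q}.
Hypothesis hN : Ck 3 N.
Implicit Types (W : R -> R -> R) (c : R -> R).
Notation K := (memory N).
Let cK : continuous K. Proof. exact: cont_memory. Qed.
(** Times are clamped to [[0, T]], so that quantities depending on time become continuous on the
    whole line. *)
Notation sl := (clampr 0 T).

Let sl_in s : 0 <= sl s <= T. Proof. exact: clampr_in (ltW T0). Qed.

Definition L2_path W :=
  [/\ measurable_fun (`]0, L[ `*` `[0, T]) (fun p : rr => W p.1 p.2),
      forall t, 0 <= t <= T -> L2 L (W ^~ t) &
      forall t0, 0 <= t0 <= T ->
        L2norm L (fun x => W x t - W x t0) @[t --> within `[0, T] (nbhs t0)] --> (0 : R)].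

Section OnePath.
Variable W : R -> R -> R.
Hypothesis hW : L2_path W.

Let WL s : L2 L (W ^~ (sl s)). Proof. by have [_ h _] := hW; exact/h/sl_in. Qed.

Lemma path_nrm1_cont s0 :
  nrm1 L (fun x => W x (sl s) - W x (sl s0)) @[s --> s0] --> (0 : R).
Proof.
have [_ _ /(_ (sl s0) (sl_in s0)) h] := hW.
have c1 : (fun s => L2norm L (fun x => W x (sl s) - W x (sl s0))) @ s0 --> (0 : R).
  move=> A AnA; have nB : nbhs (sl s0) [set t | `[0, T]%classic t -> A (L2norm L (fun x => W x t - W x (sl s0)))].
    exact: (h A AnA).
  have nC := @clampr_cont R 0 T s0 _ nB.
  suff : nbhs s0 [set s | A (L2norm L (fun x => W x (sl s) - W x (sl s0)))] by [].
  near=> s; have /= : (sl @^-1` [set t | `[0, T]%classic t -> A (L2norm L (fun x => W x t - W x (sl s0)))]) s.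
    by near: s; exact: nC.
  by apply; rewrite in_itv/=; exact: sl_in.
have c2 : (fun s => Num.sqrt L * L2norm L (fun x => W x (sl s) - W x (sl s0))) @ s0 --> (0 : R).
  by rewrite -[X in _ --> X](mulr0 (Num.sqrt L)); apply: cvgM => //; exact: cvg_cst.
apply: (squeeze_cvgr _ (cvg_cst (0 : R)) c2); apply: nearW => s.
rewrite nrm1_ge0/=; apply: nrm1_sq => //; exact: (L2B (WL s) (WL s0)).
Unshelve. all: by end_near.
Qed.

Definition avg c z s := oint 0 z (cut L (fun x => c x * W x (sl s))).

Let cWL c s : continuous c -> L2 L (fun x => c x * W x (sl s)).
Proof. by move=> cc; exact: L2_cont_mul. Qed.

Lemma avgB c a b s : continuous c ->
  avg c b s - avg c a s = oint a b (cut L (fun x => c x * W x (sl s))).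
Proof.
move=> cc; rewrite /avg; have lc := cut_locint (cWL s cc).
rewrite -(oint_cat 0 a b lc); ring.
Qed.

Lemma cutB (u v : R -> R) x : cut L (fun x => u x - v x) x = cut L u x - cut L v x.
Proof. by rewrite !cutP; case: ifP; rewrite ?subr0. Qed.

Lemma cont_avg c : continuous c -> cont2 (avg c).
Proof.
move=> cc [z0 s0]; apply/cvgrPdist_lt => e e0 /=.
have [C C0 HC] := cont_bounded_oo L cc.
have C1 : 0 < C + 1 by rewrite ltr_wpDl.
have n1 := path_nrm1_cont s0.
have e1 : 0 < e / 2 / (C + 1) by rewrite !divr_gt0.
have /cvgrPdist_lt/(_ _ e1) n2 := n1.
have e2 : 0 < e / 2 by rewrite divr_gt0.
have /cvgrPdist_lt/(_ _ e2) n3 := @cont_primitive R _ 0 (cut_locint (cWL s0 cc)) z0.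
exists ([set z | `|avg c z0 s0 - avg c z s0| < e / 2],
  [set s | `|0 - nrm1 L (fun x => W x (sl s) - W x (sl s0))| < e / 2 / (C + 1)]) => //=.
move=> [z s] /= [H1 H2].
have H3 : `|avg c z s - avg c z s0| < e / 2.
  rewrite /avg -ointB; [|exact: cut_locint (cWL s cc)|exact: cut_locint (cWL s0 cc)].
  have -> : (fun x => cut L (fun x => c x * W x (sl s)) x - cut L (fun x => c x * W x (sl s0)) x) =
      cut L (fun x => c x * (W x (sl s) - W x (sl s0))).
    by apply/funext => x; rewrite -cutB; congr cut; apply/funext => y; ring.
  have LW := L2B (WL s) (WL s0); have LcW := L2_cont_mul cc LW.
  apply: le_lt_trans (oint_cut_le _ _ LcW) _; apply: le_lt_trans (nrm1_mul_le LcW LW HC) _.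
  move: H2; rewrite sub0r normrN ger0_norm ?nrm1_ge0// ltr_pdivlMr// => H2.
  apply: le_lt_trans H2; rewrite mulrC ler_wpM2l ?nrm1_ge0//; lra.
have -> : avg c z0 s0 - avg c z s = (avg c z0 s0 - avg c z s0) - (avg c z s - avg c z s0) by ring.
by apply: le_lt_trans (ler_normB _ _) _; lra.
Qed.

Definition mass s := nrm1 L (W ^~ (sl s)).

Lemma cont_mass : continuous mass.
Proof.
move=> s0; apply/cvgrPdist_lt => e e0 /=.
have /cvgrPdist_lt/(_ _ e0) := path_nrm1_cont s0; apply: filterS => s.
rewrite sub0r normrN ger0_norm ?nrm1_ge0// => H; apply: le_lt_trans H.
by rewrite distrC; exact: nrm1_dist.
Qed.

(* Integrating in x first replaces the values of the L^2 function W by continuous averages. *)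
Lemma int_mild_source a b tau : 0 <= a -> a <= b -> 0 <= tau <= T ->
  \int[mu]_(x in `[a, b]) mild_source L q N W x tau =
  (avg (fun x => extend L q x + alpha N) b tau - avg (fun x => extend L q x + alpha N) a tau)
  + conv K (fun s => avg (fun=> 1) b s - avg (fun=> 1) a s) tau.
Proof.
move=> a0 ab tT; have [mW WL2 _] := hW.
have slE s : 0 <= s <= tau -> sl s = s.
  move=> /andP[s0 st]; apply: clampr_id; rewrite s0 (le_trans st)//.
  by case/andP: tT.
have slt : sl tau = tau by apply: slE; case/andP: tT => -> _; rewrite lexx.
pose c1 x := extend L q x + alpha N.
have cc1 : continuous c1 by apply: contD; [exact: extend_cont|exact: cont_cst].
have [CK CK0 HK] := @cont_bounded R K 0 tau cK.
(* Both factors are cut off, [W] to the rectangle on which it is measurable, so that Fubini can be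
   applied on the whole plane. *)
pose A (x s : R) := if (a <= x <= b) && (0 <= s <= tau) then K (tau - s) else 0.
pose Wp (p : rr) := ((fun p : rr => W p.1 p.2) \_ (`]0, L[ `*` `[0, T])) p.
pose F x s := A x s * Wp (x, s).
have AE x s : `|A x s| <= CK * (if 0 <= s <= tau then 1 else 0).
  rewrite /A; case: ifP => [/andP[_ /andP[s0 st]]|_]; last first.
    by rewrite normr0 mulr_ge0//; case: ifP.
  by rewrite s0 st mulr1 HK//; lra.
have WpE x s : 0 <= s <= tau -> Wp (x, s) = cut L (W ^~ s) x.
  move=> /andP[s0 st]; have sT : s <= T by case/andP: tT => _; exact: le_trans.
  rewrite cutP /Wp; case: ifPn => [xL|xL].
    rewrite /patch mem_set//=; split; rewrite /= in_itv//=; exact/andP.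
  by rewrite /patch memNset//= => -[/=]; rewrite in_itv/= (negPf xL).
have FE x s : F x s = if (a <= x <= b) && (0 <= s <= tau)
    then K (tau - s) * cut L (W ^~ s) x else 0.
  rewrite /F /A; case: ifP => [/andP[_ h]|_]; last by rewrite mul0r.
  by rewrite WpE.
have mF : measurable_fun setT (fun p : rr => F p.1 p.2).
  apply: measurable_funM.
  - apply: (@measurable_kernel_if _ (fun _ s => K (tau - s)) (fun x s => (a <= x <= b) && (0 <= s <= tau))).
      apply: (cont_comp1 (u := K)) => //; apply: contD; first exact: cont_cst.
      by apply: contN; exact: continuous_snd.
    have m1 := measurable_fst_snd (@cont_id R) (@cont_id R).
    by apply: measurable_and; apply: measurable_and;
      apply: measurable_fun_ler; rewrite ?m1; first [exact: measurable_cst|exact: m1.1|exact: m1.2].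
  - have := (measurable_restrictT (fun p : rr => W p.1 p.2)
       (measurableX (measurable_itv `]0, L[) (measurable_itv `[0, T]))).1 mW.
    by congr measurable_fun; apply/funext => -[].
clearbody F; clear A Wp AE WpE.
have mFs s : measurable_fun setT (F ^~ s) by exact: section_measurable2.
have Fle x s : `|F x s| <= CK * `|cut L (W ^~ (sl s)) x|.
  rewrite FE; case: ifP => [/andP[_ h]|_]; last by rewrite normr0 mulr_ge0.
  by rewrite normrM slE// ler_wpM2r// HK//; case/andP: h; lra.
have iabs s : mu.-integrable setT (EFin \o (fun x => CK * `|cut L (W ^~ (sl s)) x|)).
  apply: integrable_funZ => //; apply: integrable_abse_fin => //.
  exact: cut_integrable.
pose h s := CK * (if 0 <= s <= tau then mass s else 0).
have [] := @fubini_sections R F h mF.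
- move=> s; apply: (dominated_integrable measurableT (mFs s) _ (iabs s)) => x _; exact: Fle.
- move=> s; rewrite /h; case: ifPn => hs; last first.
    rewrite (_ : (fun x => `|F x s|) = fun=> 0) ?Rintegral0 ?mulr0//.
    by apply/funext => x; rewrite FE (negPf hs) andbF normr0.
  rewrite /mass nrm1_cut RintegralZl_gen//; last first.
    by apply: integrable_abse_fin => //; exact: cut_integrable.
  apply: le_Rint; [exact: measurableT| |exact: iabs|by move=> x _; exact: Fle].
  apply: integrable_abse_fin; first exact: measurableT.
  apply: (dominated_integrable measurableT (mFs s) _ (iabs s)) => x _; exact: Fle.
- apply: integrable_funZ => //.
  have : mu.-integrable setT (EFin \o (mass \_ `[0, tau])).
    apply: patch_integrable; first exact: measurable_itv.
    by apply: cont_locint; exact: cont_mass.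
  congr (integrable _ _ _); apply/funext => s; rewrite /= patchE; congr EFin.
  by rewrite mem_setE in_itv.
move=> fub iG _ _; clear h; have [G GE] : exists G : R -> R, G = fun x => \int[mu]_s F x s by eexists.
rewrite -GE in iG fub.
have iT : mu.-integrable setT (EFin \o G) := iG.
have iGab : mu.-integrable `[a, b] (EFin \o G) by apply: integrableS iT.
have c1L : locint (cut L (fun x => c1 x * W x tau)).
  by have := cut_locint (cWL tau cc1); rewrite slt.
pose b' := Num.min b L.
have GL x : L < x -> G x = 0.
  move=> Lx; rewrite GE -[RHS](@Rintegral0 R setT); apply: eq_Rintegral => s _.
  by rewrite FE cutC ?mulr0 ?if_same// negb_and -!leNgt (ltW Lx) orbT.
rewrite (@int_beyond _ a b L); last by move=> x Lx; rewrite /mild_source leNgt Lx.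
rewrite -/b'.
transitivity (\int[mu]_(x in `[a, b']) (cut L (fun x => c1 x * W x tau) x + G x)).
  have iGb : mu.-integrable `]a, b'[ (EFin \o G).
    by apply: integrableS iT => //; exact: measurable_itv.
  apply: eq_int_oo.
    apply: measurable_funD; last by apply/measurable_EFinP; exact: (measurable_int _ iGb).
    have : mu.-integrable `[a, b'] (EFin \o cut L (fun x => c1 x * W x tau)) by exact: c1L.
    move=> /(measurable_int _)/measurable_EFinP; apply: measurable_funS => //.
    by apply: subset_itvW; rewrite bnd_simp.
  move=> x /andP[ax]; rewrite lt_min => /andP[xb xL].
  have x0 : 0 < x by exact: le_lt_trans ax.
  rewrite /mild_source (ltW xL) cutT ?x0// /c1 extend_id ?(ltW x0) ?(ltW xL)//; congr (_ + _).
  rewrite GE; apply: eq_int_patch => s /=; rewrite in_itv/= FE (ltW ax) (ltW xb)/=.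
    by move=> ->; rewrite cutT// x0 xL.
  by move=> /negP/negPf ->.
transitivity (\int[mu]_(x in `[a, b]) (cut L (fun x => c1 x * W x tau) x + G x)).
  rewrite [RHS](@int_beyond _ a b L) => [//|x Lx]; rewrite GL// cutC ?addr0//.
  by rewrite negb_and -!leNgt (ltW Lx) orbT.
rewrite (int_addf (c1L a b) iGab).
rewrite -oint_ge// avgB// slt; congr (_ + _).
transitivity (\int[mu]_x G x).
  apply: eq_int_patch => x //; rewrite /= in_itv/= => /negP/negPf nx.
  rewrite GE -[RHS](@Rintegral0 R setT); apply: eq_Rintegral => s _.
  by rewrite FE nx.
rewrite [LHS]fub convE; symmetry; apply: eq_int_patch => s /=; rewrite in_itv/=.
- move=> hs; rewrite avgB; last exact: cont_cst.
  rewrite (slE s hs) (oint_ge _ ab) RintegralZl_gen//; last first.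
    rewrite (_ : (fun x => 1 * W x s) = W ^~ s); last by apply/funext => x; rewrite mul1r.
    by apply: cut_locint; apply: WL2; case/andP: hs => -> hs/=; case/andP: tT => _; exact: le_trans.
  apply: eq_int_patch => x /=; rewrite in_itv/= FE.
    by move=> ->; rewrite hs/= !cutP; case: ifP; rewrite ?mul1r.
  by move=> /negP/negPf ->.
- move=> /negP/negPf hs; rewrite -[RHS](@Rintegral0 R setT); apply: eq_Rintegral => x _.
  by rewrite FE hs andbF.
Qed.

End OnePath.

Lemma nrm1_ae_le (u : R -> R) (c : R) : 0 <= c -> L2 L u ->
  {ae mu, forall x, 0 < x < L -> `|u x| <= c} -> nrm1 L u <= c * L.
Proof.
move=> c0 Lu H; rewrite -[X in _ <= c * X]subr0 -(int_cst _ (ltW L0)).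
have iu := nrm1_integrable Lu.
have ic : mu.-integrable `[0, L] (EFin \o (fun=> c)) by exact: locint_cst.
have -> : \int[mu]_(x in `[0, L]) c = \int[mu]_(x in `]0, L[) c.
  by rewrite /Rintegral integral_itv_bndo_bndc// integral_itv_obnd_cbnd.
have ic' := @integrable_cst_oo R L c.
rewrite /nrm1 /Rintegral fine_le//; [exact: integrable_fin_num iu|exact: integrable_fin_num ic'|].
apply: ae_ge0_le_integral => //.
- exact: measurable_int iu.
Qed.

Lemma nrm1_triangle (u v : R -> R) : L2 L u -> L2 L v ->
  nrm1 L (fun x => u x - v x) <= nrm1 L u + nrm1 L v.
Proof.
move=> Lu Lv; have := nrm1_dist (L2B Lu Lv) Lu; rewrite ler_distl => /andP[_].
have -> : nrm1 L (fun x => u x - v x - u x) = nrm1 L v.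
  by apply: eq_Rintegral => x _; rewrite addrAC subrr add0r normrN.
by [].
Qed.

Section TwoPaths.
Variables (f : R -> R) (W W' : R -> R -> R).
Hypotheses (hW : is_mild L q N T f W) (hW' : is_mild L q N T f W').

Let pW : L2_path W. Proof. by case: hW. Qed.
Let pW' : L2_path W'. Proof. by case: hW'. Qed.
Let WL s : L2 L (W ^~ (sl s)). Proof. by have [_ h _] := pW; exact/h/sl_in. Qed.
Let WL' s : L2 L (W' ^~ (sl s)). Proof. by have [_ h _] := pW'; exact/h/sl_in. Qed.
Let m s := nrm1 L (fun x => W x (sl s) - W' x (sl s)).

Let cm : continuous m.
Proof.
move=> s0; apply/cvgrPdist_lt => e e0 /=.
have e2 : 0 < e / 2 by rewrite divr_gt0.
have /cvgrPdist_lt/(_ _ e2) n1 := path_nrm1_cont pW s0.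
have /cvgrPdist_lt/(_ _ e2) n2 := path_nrm1_cont pW' s0.
near=> s.
have h1 : `|0 - nrm1 L (fun x => W x (sl s) - W x (sl s0))| < e / 2 by near: s; exact: n1.
have h2 : `|0 - nrm1 L (fun x => W' x (sl s) - W' x (sl s0))| < e / 2 by near: s; exact: n2.
move: h1 h2; rewrite !sub0r !normrN (ger0_norm (nrm1_ge0 _ _)) (ger0_norm (nrm1_ge0 _ _)) => h1 h2.
rewrite distrC; apply: le_lt_trans (nrm1_dist (L2B (WL s) (WL' s)) (L2B (WL s0) (WL' s0))) _.
have -> : nrm1 L (fun x => W x (sl s) - W' x (sl s) - (W x (sl s0) - W' x (sl s0))) =
    nrm1 L (fun x => (W x (sl s) - W x (sl s0)) - (W' x (sl s) - W' x (sl s0))).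
  by apply: eq_Rintegral => x _; congr (`|_|); ring.
have := nrm1_triangle (L2B (WL s) (WL s0)) (L2B (WL' s) (WL' s0)); lra.
Unshelve. all: by end_near.
Qed.

Let c1 x := extend L q x + alpha N.
Let cc1 : continuous c1. Proof. by apply: contD; [exact: extend_cont|exact: cont_cst]. Qed.
Let c0 : continuous (fun _ : R => 1 : R). Proof. exact: cont_cst. Qed.

Let J V (a b : R) tau := (avg V c1 b tau - avg V c1 a tau)
  + conv K (fun s => avg V (fun=> 1) b s - avg V (fun=> 1) a s) tau.

Let cJ V (a b : R -> R) : L2_path V -> continuous a -> continuous b ->
  continuous (fun tau => J V (a tau) (b tau) tau).
Proof.
move=> pV ca cb; have A1 := cont_avg pV cc1; have A0 := cont_avg pV c0.
have ci := @cont_id R.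
apply: contD.
  by apply: contD; [|apply: contN]; apply: (cont_comp2 (u := avg V c1)).
apply: (@cont_conv2 R R (fun=> K) (fun tau s => avg V (fun=> 1) (b tau) s - avg V (fun=> 1) (a tau) s) id) => //.
  exact: cont_snd.
by apply: contD; [|apply: contN]; apply: (cont_comp2 (u := avg V (fun=> 1))) => //;
  first [exact: continuous_snd|exact: cont_fst].
Qed.

Let avg_diff c C a b s : continuous c -> (forall x, 0 < x < L -> `|c x| <= C) ->
  `|(avg W c b s - avg W c a s) - (avg W' c b s - avg W' c a s)| <= C * m s.
Proof.
move=> cc hC; rewrite (avgB pW)// (avgB pW')// -ointB; last 2 first.
- exact: cut_locint (L2_cont_mul cc (WL s)).
- exact: cut_locint (L2_cont_mul cc (WL' s)).
have -> : (fun x => cut L (fun x => c x * W x (sl s)) x - cut L (fun x => c x * W' x (sl s)) x) =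
    cut L (fun x => c x * (W x (sl s) - W' x (sl s))).
  by apply/funext => x; rewrite -cutB; congr cut; apply/funext => y; ring.
have LW := L2B (WL s) (WL' s); have LcW := L2_cont_mul cc LW.
exact: le_trans (oint_cut_le _ _ LcW) (nrm1_mul_le LcW LW hC).
Qed.

(** Integrated over any interval in x, the two sources differ by at most (C1 + CK) B e^(lam tau). So
    for almost every x the difference of W and W' is at most half the time integral of this;
    integration over x costs a factor L, which the choice of lam absorbs. *)
Lemma mild_diff_step (C1 CK lam B : R) : 0 <= C1 -> 0 <= CK -> 1 <= lam ->
  L * (C1 + CK) <= lam -> 0 <= B ->
  (forall x, 0 < x < L -> `|c1 x| <= C1) -> (forall s, 0 <= s <= T -> `|K s| <= CK) ->
  (forall s, 0 <= s <= T -> m s <= B * expR (lam * s)) ->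
  forall s, 0 <= s <= T -> m s <= B / 2 * expR (lam * s).
Proof.
move=> C10 CK0 l1 lL B0 hC1 hCK hm t tT.
have l0 : 0 < lam by lra.
have /andP[t0 tT'] := tT.
have mE (tau : R) : 0 <= tau <= T -> oint 0 tau m <= B / lam * expR (lam * tau).
  move=> /andP[u0 uT]; apply: le_trans (ler_norm _) _.
  have := @exp_oint R m B lam tau 0 l0 B0 (cont_locint cm); rewrite subr0 (ger0_norm u0); apply.
  move=> z; rewrite min_l// max_r// => /andP[z0 zt]; rewrite subr0 (ger0_norm z0).
  rewrite ger0_norm ?nrm1_ge0//; apply: hm; rewrite z0 (le_trans zt)//.
have diffJ (a b tau : R) : 0 <= tau <= T ->
    `|J W a b tau - J W' a b tau| <= (C1 + CK) * B * expR (lam * tau).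
  move=> uT; have /andP[u0 uT'] := uT.
  set G := fun V s => avg V (fun=> 1) b s - avg V (fun=> 1) a s.
  have cG V : L2_path V -> continuous (G V).
    move=> pV; have A0 := cont_avg pV c0.
    by apply: contD; [exact: cont_sect A0|apply: contN; exact: cont_sect A0].
  have -> : J W a b tau - J W' a b tau =
      ((avg W c1 b tau - avg W c1 a tau) - (avg W' c1 b tau - avg W' c1 a tau)) +
      (conv K (G W) tau - conv K (G W') tau) by exact: (add_sub_swap _ (conv K (G W) tau) _ (conv K (G W') tau)).
  apply: le_trans (ler_normD _ _) _.
  have h1 := avg_diff a b tau cc1 hC1.
  have h2 := hm tau uT.
  have E1 : 1 <= expR (lam * tau) by apply: exp_ge1; apply: mulr_ge0 => //; exact: ltW.
  have h3 : `|conv K (G W) tau - conv K (G W') tau| <= CK * (B / lam * expR (lam * tau)).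
    have lK V : L2_path V -> locint (fun s => K (tau - s) * G V s).
      by move=> pV; apply: conv_integrand_locint => //; apply: cont_locint; exact: cG.
    rewrite !conv_oint// -ointB; [|exact: lK|exact: lK].
    have -> : (fun s => K (tau - s) * G W s - K (tau - s) * G W' s) =
      (fun s => K (tau - s) * (G W s - G W' s)) by apply/funext => s; ring.
    apply: le_trans (ler_wpM2l CK0 (mE tau uT)).
    rewrite -ointZ; last exact: cont_locint.
    rewrite !oint_ge//; apply: le_int_norm.
    - apply: conv_integrand_locint => //; apply: cont_locint.
      by apply: contD; [exact: cG|apply: contN; exact: cG].
    - by apply: locintZ; exact: cont_locint.
    - move=> s /andP[s0 st]; rewrite normrM; apply: ler_pM => //.
        by apply: hCK; lra.
      by have := @avg_diff (fun=> 1) 1 a b s c0; rewrite mul1r; apply => x _; rewrite normr1.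
  apply: le_trans (lerD h1 h3) _.
  have h4 : B / lam * expR (lam * tau) <= B * expR (lam * tau).
    rewrite ler_wpM2r ?expR_ge0// ler_pdivrMr// ler_peMr//.
  have h5 := ler_wpM2l C10 h2; have h6 := ler_wpM2l CK0 h4; lra.
have slt : sl t = t by exact: clampr_id.
have Bt : 0 <= (C1 + CK) * B / lam * expR (lam * t) / 2.
  rewrite divr_ge0// mulr_ge0 ?expR_ge0// divr_ge0 ?(ltW l0)// mulr_ge0//; lra.
have key : m t <= (C1 + CK) * B / lam * expR (lam * t) / 2 * L.
  rewrite /m slt; apply: nrm1_ae_le => //.
    by have := L2B (WL t) (WL' t); rewrite slt.
  have [_ _ _ /(_ t tT) e1] := hW; have [_ _ _ /(_ t tT) e2] := hW'.
  apply: (ae_imp2 e1 e2) => x {}e1 {}e2 xL; have /andP[x0 xL'] := xL.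
  pose a tau := `|x - t + tau|; pose b tau := x + t - tau.
  have ca : continuous a.
    by apply: cont_norm; apply: contD; [exact: cont_cst|exact: cont_id].
  have cb : continuous b.
    by apply: contD; [exact: cont_cst|apply: contN; exact: cont_id].
  have eJ V : L2_path V -> \int[mu]_(tau in `[0, t])
      (\int[mu]_(xi in `[`|x - t + tau|, x + t - tau]) mild_source L q N V xi tau) =
      oint 0 t (fun tau => J V (a tau) (b tau) tau).
    move=> pV; rewrite oint_ge//; apply: eq_Rintegral => tau; rewrite inE/= in_itv/= => /andP[u0 ut].
    rewrite (int_mild_source pV)//.
    - exact: cone_le (ltW x0) ut.
    - by rewrite u0 (le_trans ut).
  move: (e1 xL) (e2 xL); rewrite (eJ W pW) (eJ W' pW') => -> ->.
  rewrite sub_common -ointB; last 2 first.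
  - by apply: cont_locint; exact: cJ.
  - by apply: cont_locint; exact: cJ.
  have cD : continuous (fun tau => J W (a tau) (b tau) tau - J W' (a tau) (b tau) tau).
    by apply: contD; [exact: cJ|apply: contN; exact: cJ].
  have := @exp_oint R _ ((C1 + CK) * B) lam t 0 l0 _ (cont_locint cD).
  rewrite subr0 (ger0_norm t0) => H.
  rewrite normrM ger0_norm ?invr_ge0// [leRHS]mulrC ler_wpM2l ?invr_ge0//; apply: H.
    exact: (mulr_ge0 (addr_ge0 C10 CK0) B0).
  move=> z; rewrite min_l// max_r// => /andP[z0 zt]; rewrite subr0 (ger0_norm z0).
  by apply: diffJ; rewrite z0 (le_trans zt).
apply: le_trans key _.
have -> : (C1 + CK) * B / lam * expR (lam * t) / 2 * L = (L * (C1 + CK)) / lam * (B / 2 * expR (lam * t)) by ring.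
rewrite ler_piMl//; first by rewrite mulr_ge0 ?expR_ge0// divr_ge0.
by rewrite ler_pdivrMr// mul1r.
Qed.

Lemma mild_unique t : 0 <= t <= T -> eqL2 L (W ^~ t) (W' ^~ t).
Proof.
move=> tT; have slt : sl t = t by exact: clampr_id.
have LD : L2 L (fun x => W x t - W' x t) by have := L2B (WL t) (WL' t); rewrite slt.
have [C1 C10 HC1] := cont_bounded_oo L cc1.
have [CK CK0 HCK] := @cont_bounded R K 0 T cK.
have [Bm Bm0 HBm] := @cont_bounded R m 0 T cm.
pose lam := 1 + L * (C1 + CK).
have lL0 : 0 <= L * (C1 + CK) by rewrite mulr_ge0 ?addr_ge0// ltW.
have l1 : 1 <= lam by rewrite /lam; lra.
have l2 : L * (C1 + CK) <= lam by rewrite /lam; lra.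
have key n s : 0 <= s <= T -> m s <= Bm * 2^-1 ^+ n * expR (lam * s).
  elim: n s => [|n IH] s sT.
    rewrite expr0 mulr1; apply: le_trans (ler_norm _) (le_trans (HBm _ sT) _).
    rewrite ler_peMr//; apply: exp_ge1; apply: mulr_ge0; last by case/andP: sT.
    by lra.
  have := @mild_diff_step C1 CK lam (Bm * 2^-1 ^+ n) C10 CK0 l1 l2 _ HC1 HCK IH s sT.
  rewrite exprS; have -> : Bm * (2^-1 * 2^-1 ^+ n) = Bm * 2^-1 ^+ n / 2 by ring.
  by apply; rewrite mulr_ge0// exprn_ge0.
have m0 : m t = 0.
  apply: (@halving_eq0 _ _ (Bm * expR (lam * t))) => n.
  rewrite ger0_norm ?nrm1_ge0//; have := key n t tT; lra.
have : nrm1 L (fun x => W x t - W' x t) = 0 by rewrite -m0 /m slt.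
move=> n0.
have D0 : eqL2 L (fun x => W x t - W' x t) (fun=> 0).
  have iu := nrm1_integrable LD.
  have : (\int[mu]_(x in `]0%R, L[) `|(EFin \o (fun x => (W x t - W' x t)%R)) x| = 0)%E.
    rewrite -[LHS]fineK; first by congr EFin; exact: n0.
    exact: (integrable_fin_num _ iu).
  have mD : measurable_fun `]0, L[ (EFin \o (fun x => W x t - W' x t)).
    by apply/measurable_EFinP; exact: L2_measurable.
  move=> /(ae_eq_integral_abs mu (measurable_itv `]0, L[) mD) /ae_imp; apply => x h xL.
  by move: h; rewrite /= in_itv/= => /(_ xL) [].
have D1 : {ae mu, forall x, 0 < x < L -> W x t - W' x t = 0} := D0.
by apply: (ae_imp D1) => x h xL; apply/eqP; rewrite -subr_eq0; apply/eqP; exact: h.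
Qed.

End TwoPaths.
End MildUniqueness.

(** [goursat] as one integral over positions y, of the difference of the time primitive [Q] between
    the upper and the lower edge of the backward cone. The minimum selects the edge on which t - x
    is constant for y < x, and the one on which t + x is constant beyond. *)
Lemma goursat_cone (R : realType) (Q : R -> R -> R) (x r X : R) : cont2 Q ->
  (forall y s, s <= 0 -> Q y s = 0) -> 0 <= x -> x + Num.max r 0 / 2 <= X ->
  2^-1 * oint 0 X (fun y => Q y (Num.min r (r + 2 * (x - y))) - Q y (r - 2 * y)) =
  if 0 <= r then goursat Q x r else 0.
Proof.
move=> cQ Q0 x0 xX; have m0 : 0 <= Num.max r 0 by rewrite le_max lexx orbT.
have X0 : 0 <= X by lra.
have ci := @cont_id R.
have cz (z : R) : continuous (fun _ : R => z) by exact: cont_cst.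
have c1 : continuous (fun y => Q y (Num.min r (r + 2 * (x - y)))).
  apply: (cont_comp2 (u := Q)) => //; apply: cont_min => //; apply: contD => //.
  by apply: contM => //; apply: contD => //; exact: contN.
have c2 : continuous (fun y => Q y (r - 2 * y)).
  apply: (cont_comp2 (u := Q)) => //; apply: contD => //; apply: contN.
  exact: contM.
have [r0|r0] := leP 0 r; last first.
  rewrite (_ : oint _ _ _ = 0) ?mulr0//.
  rewrite -[RHS](oint0 0 X); apply: eq_oint => y; rewrite min_l// => /andP[y0 _].
  rewrite !Q0 ?subrr//; first by lra.
  by rewrite ge_min (ltW r0).
move: xX; rewrite max_l// => xX.
have l1 := cont_locint c1; have l2 := cont_locint c2.
rewrite goursatE ointB//; congr (2^-1 * _).
rewrite -(oint_cat 0 x X l1) -(oint_cat 0 (r / 2) X l2) -(oint_cat x (x + r / 2) X l1).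
have -> : oint (x + r / 2) X (fun y => Q y (Num.min r (r + 2 * (x - y)))) = 0.
  rewrite -[RHS](oint0 (x + r / 2) X); apply: eq_oint => y; rewrite min_l// => /andP[h1 _].
  by apply: Q0; rewrite ge_min; apply/orP; right; lra.
have -> : oint (r / 2) X (fun y => Q y (r - 2 * y)) = 0.
  rewrite -[RHS](oint0 (r / 2) X); apply: eq_oint => y; rewrite min_l; last by lra.
  by move=> /andP[h1 _]; apply: Q0; lra.
have -> : oint 0 x (fun y => Q y (Num.min r (r + 2 * (x - y)))) = oint 0 x (Q ^~ r).
  apply: eq_oint => y; rewrite min_l// max_r// => /andP[y0 yx]; rewrite min_l//; lra.
have -> : oint x (x + r / 2) (fun y => Q y (Num.min r (r + 2 * (x - y)))) =
    oint 0 (r / 2) (fun e => Q (x + e) (r - 2 * e)).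
  have := @oint_shift R 0 (r / 2) x _ c1; rewrite add0r [r / 2 + x]addrC => <-.
  apply: eq_oint => e; rewrite min_l; last by lra.
  move=> /andP[e0 _]; rewrite min_r; last by lra.
  by rewrite [e + x]addrC; congr (Q _ _); ring.
rewrite !addr0; exact/esym/addrA.
Qed.

Lemma cone_top (R : realType) (x t : R) : 0 <= x -> 0 <= t -> x + Num.max (t - x) 0 / 2 <= x + t.
Proof. by move=> x0 t0; rewrite lerD2l ler_pdivrMr// ge_max; apply/andP; split; lra. Qed.

(** * Waves with integrable boundary value: the source integrated over a cone *)

Section RoughWave.
Context {R : realType}.
Notation mu := (@lebesgue_measure R).
Notation rr := (measurableTypeR R * measurableTypeR R)%type.
Variables (q l0 K : R -> R) (k : R -> R -> R) (g : R -> R).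
Hypothesis cq : continuous q.
Hypothesis cK : continuous K.
Hypothesis dl0 : forall s, ider l0 s (K s).
Hypothesis hk : goursat_kernel_spec (fun y s => q y + l0 s) k.
Hypothesis ig : mu.-integrable setT (EFin \o g).
Hypothesis g0 : causal g.

Let lg : locint g. Proof. by move=> a b; exact: integrableS ig. Qed.
Let mg : measurable_fun setT g.
Proof. by apply/measurable_EFinP; exact: (measurable_int _ ig). Qed.
Let ck : cont2 k. Proof. by case: hk. Qed.

Lemma conv_delay_locint (a h : R -> R) (x t : R) : continuous a -> locint h -> causal h ->
  0 <= x -> conv a (fun s => h (s - x)) t = conv a h (t - x).
Proof.
move=> ca lh h0 x0; pose F z := if 0 <= z <= t - x then a (t - x - z) * h z else 0.
have iF : mu.-integrable setT (EFin \o F).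
  have := patch_integrable (measurable_itv `[0, (t - x)]) (@conv_integrand_locint R a h (t - x) ca lh 0 (t - x)).
  by congr (integrable _ _ _); apply/funext => z; rewrite /= patchE mem_setE in_itv.
have [_ E] := int_translate x iF.
rewrite !convE; transitivity (\int[mu]_z F z).
  rewrite -E; apply: eq_int_patch => s /=; rewrite in_itv/= /F lerD2r.
    move=> /andP[s0 st]; rewrite st andbT; case: ifPn => [_|].
      by congr (a _ * _); ring.
    by rewrite -ltNge => h1; rewrite h0 ?mulr0// ltW.
  move=> ns; case: ifP => // /andP[h1 h2]; case: ns; rewrite h2 andbT; lra.
by symmetry; apply: eq_int_patch => z /=; rewrite in_itv/= /F; [move=> ->|move=> /negP/negPf ->].
Qed.

Definition Sw x s := (q x + l0 0) * Zw k g x s + conv K (Zw k g x) s.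

Lemma causal_rough_Zw x : causal (Zw k g x).
Proof. by move=> t t0; apply: (@Zw_vanish _ _ _ _ 0). Qed.

Lemma causal_Sw x : causal (Sw x).
Proof. by move=> s s0; rewrite /Sw causal_rough_Zw// conv_le0// mulr0 addr0. Qed.

(** The continuous remainder of the source once the rough term [(q x + l0 0) * g s] is split off; it
    provides measurability and bounds. *)
Let Dw x s := (q x + l0 0) * conv (k x) g s + (conv K g s + conv K (conv (k x) g) s).

Let cZc : cont2 (fun x t => conv (k x) g t). Proof. exact: cont_Zc hk _ lg. Qed.

Let cDw : cont2 Dw.
Proof.
apply: contD.
  apply: contM => //; apply: contD; last exact: cont_cst.
  by apply: (cont_comp1 (u := q)) => //; exact: continuous_fst.
apply: contD.
  by apply: (cont_comp1 (u := conv K g)); [exact: conv_locint_cont|exact: continuous_snd].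
apply: (@cont_conv2 R (R * R)%type (fun=> K) (fun p s => conv (k p.1) g s) snd).
- exact: cont_snd.
- apply: (cont_comp2 (u := fun x t => conv (k x) g t)) => //; last exact: continuous_snd.
  apply: (cont_comp1 (u := fst)); [exact: continuous_fst|exact: continuous_fst].
- exact: continuous_snd.
Qed.

Let Sw_split x s : Sw x s = (q x + l0 0) * g s + Dw x s.
Proof.
rewrite /Sw /Dw /Zw convDr//; last by apply: cont_locint; exact: cont_sect cZc.
ring.
Qed.

Lemma locint_Sw x : locint (Sw x).
Proof.
rewrite (_ : Sw x = fun s => (q x + l0 0) * g s + Dw x s).
  by apply: locintD; [exact: locintZ|apply: cont_locint; exact: cont_sect cDw].
by apply/funext => s; exact: Sw_split.
Qed.

Lemma oint_Sw x s : oint 0 s (Sw x) = Qw q l0 k g x s.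
Proof.
have [s0|s0] := leP 0 s; first by rewrite oint_ge// (Qw_int cK dl0 hk).
rewrite /Qw conv_le0 ?ltW// -[RHS](oint0 0 s); apply: eq_oint => z.
by rewrite max_l ?(ltW s0)// => /andP[_ z0]; exact: causal_Sw.
Qed.

Section Cone.
Variables x t : R.
Hypotheses (x0 : 0 <= x) (t0 : 0 <= t).

Let cone tau y := (0 <= tau <= t) && (`|x - t + tau| <= y <= x + t - tau).
Let F tau y := if cone tau y then Sw y (tau - y) else 0.

Let cone_y tau y : cone tau y -> [/\ 0 <= tau, tau <= t, 0 <= y, y <= x + t & y <= x + t - tau /\ - (x - t + tau) <= y /\ x - t + tau <= y].
Proof.
move=> /andP[/andP[h1 h2] /andP[h3 h4]]; have h5 := le_trans (normr_ge0 _) h3.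
by move: h3; rewrite ler_norml => /andP[h6 h7]; split => //; [lra|split; [|split]; lra].
Qed.

Let mF : measurable_fun setT (fun p : rr => F p.1 p.2).
Proof.
have -> : (fun p : rr => F p.1 p.2) = (fun p : rr =>
    (if cone p.1 p.2 then q p.2 + l0 0 else 0) * g (p.1 - p.2) +
    (if cone p.1 p.2 then Dw p.2 (p.1 - p.2) else 0)).
  by apply/funext => p; rewrite /F; case: ifP => _; rewrite ?Sw_split// mul0r addr0.
have m1 := measurable_fst_snd (@cont_id R) (@cont_id R).
have cs (v : R -> R -> R) : cont2 v -> measurable_fun setT (fun p : rr => v p.1 p.2).
  exact: cont2_measurable.
have ci1 : continuous (fun p : R * R => p.1) by exact: continuous_fst.
have ci2 : continuous (fun p : R * R => p.2) by exact: continuous_snd.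
have mcone : measurable_fun setT (fun z : rr => cone z.1 z.2).
  apply: measurable_and; apply: measurable_and; apply: measurable_fun_ler;
    first [exact: measurable_cst|exact: m1.1|exact: m1.2|idtac].
  - apply: (cs (fun a _ => `|x - t + a|)); apply: cont_norm; apply: contD => //; exact: cont_cst.
  - apply: (cs (fun a _ => x + t - a)); apply: contD; [exact: cont_cst|exact: contN].
apply: measurable_funD.
  apply: measurable_funM.
    apply: (@measurable_kernel_if _ (fun _ y => q y + l0 0)) => //.
    by apply: contD; [exact: (cont_comp1 (u := q))|exact: cont_cst].
  apply: (measurableT_comp mg).
  by apply: (cs (fun a b => a - b)); apply: contD => //; exact: contN.
apply: (@measurable_kernel_if _ (fun a y => Dw y (a - y))); last exact: mcone.
apply: (cont_comp2 (u := Dw)); [exact: cDw|exact: ci2|].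
by apply: contD; [exact: ci1|exact: contN].
Qed.

(** At fixed [y] the cone cuts out an interval of retarded times. The conditions lost, such as
    [0 <= tau], concern only points where [Sw] vanishes by causality. *)
Let Fxi y : 0 <= y -> F ^~ y =
  (fun tau => if - (x - t) - 2 * y <= tau - y <= Num.min (t - x) (t - x + 2 * (x - y)) then Sw y (tau - y) else 0).
Proof.
move=> y0; apply/funext => tau; rewrite /F.
case: ifPn => [/cone_y[h1 h2 h3 h4 [h5 [h6 h7]]]|nc].
  by case: ifP => // /negP []; apply/andP; split; [lra|rewrite le_min; apply/andP; split; lra].
case: ifP => // /andP[h1]; rewrite le_min => /andP[h2 h3].
have [ty|ty] := leP tau y; first by rewrite causal_Sw// subr_le0.
case/negP: nc; apply/andP; split; first by apply/andP; split; lra.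
by rewrite ler_norml; apply/andP; split; [apply/andP; split|]; lra.
Qed.

Let int_F y : 0 <= y -> mu.-integrable setT (EFin \o F ^~ y) /\
  \int[mu]_tau F tau y = Qw q l0 k g y (Num.min (t - x) (t - x + 2 * (x - y))) - Qw q l0 k g y (t - x - 2 * y).
Proof.
move=> y0; set hi := Num.min _ _; set lo := t - x - 2 * y.
pose Phi s := if lo <= s <= hi then Sw y s else 0.
have hx0 := x0; have lohi : lo <= hi by rewrite /lo /hi le_min; apply/andP; split; lra.
have lS := @locint_Sw y.
have iP : mu.-integrable setT (EFin \o Phi).
  have := patch_integrable (measurable_itv `[lo, hi]) (lS lo hi).
  by congr (integrable _ _ _); apply/funext => z; rewrite /= patchE mem_setE in_itv.
have [i1 E] := int_translate y iP.
have FE : F ^~ y = (fun tau => Phi (tau - y)).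
  rewrite (Fxi y0); apply/funext => tau; rewrite /Phi /lo; congr (if (_ <= _) && _ then _ else _); ring.
rewrite FE E; split; first exact: i1.
rewrite -!oint_Sw -(oint_cat 0 lo hi lS) [RHS]addrC addrA addNr add0r (oint_ge _ lohi).
by symmetry; apply: eq_int_patch => z /=; rewrite in_itv/= /Phi; [move=> ->|move=> /negP/negPf ->].
Qed.

Let F_out y : ~~ (0 <= y <= x + t) -> F ^~ y = fun=> 0.
Proof.
move=> ny; apply/funext => tau; rewrite /F; case: ifP => // /cone_y[_ _ h1 h2 _].
by rewrite h1 h2 in ny.
Qed.

(** The mild formulation integrates over space inside. Fubini puts time inside, where integrating
    [Sw] gives [Qw] on the two edges of the cone, and [goursat_cone] with [Zw_goursat] concludes. As
    [Sw] is merely integrable, the majorant [h] comes from the L^1 norm of [g]. *)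
Lemma dalembert_cone : 2^-1 * \int[mu]_(tau in `[0, t])
    \int[mu]_(y in `[`|x - t + tau|, x + t - tau]) Sw y (tau - y) = conv (k x) g (t - x).
Proof.
have hx0 := x0; have ht0 := t0; have cQ : cont2 (Qw q l0 k g) := cont_Qw cq dl0 hk lg.
have [Cc Cc0 HCc] := @cont_bounded R q 0 (x + t) cq.
pose C1 := Cc + `|l0 0|.
have HC1 y : 0 <= y <= x + t -> `|q y + l0 0| <= C1.
  by move=> yt; apply: le_trans (ler_normD _ _) _; rewrite /C1 lerD2r HCc.
have C10 : 0 <= C1 by rewrite addr_ge0.
have [CD CD0 HCD] := cont2_bounded 0 (x + t) (- (x + t)) t cDw.
have iabs := integrable_abse_fin measurableT ig.
pose G1 := \int[mu]_s `|g s|.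
pose h y := if 0 <= y <= x + t then C1 * G1 + CD * t else 0.
pose I1 tau := if 0 <= tau <= t then (1 : R) else 0.
have iI1 : mu.-integrable setT (EFin \o I1).
  have := patch_integrable (measurable_itv `[0, t]) (locint_cst (1 : R) 0 t).
  by congr (integrable _ _ _); apply/funext => z; rewrite /= patchE mem_setE in_itv.
have eI1 : \int[mu]_s I1 s = t.
  transitivity (\int[mu]_(s in `[0, t]) (1 : R)); last by rewrite int_cst// mul1r subr0.
  by symmetry; apply: eq_int_patch => z /=; rewrite in_itv/= /I1; [move=> ->|move=> /negP/negPf ->].
have [] := @fubini_sections R F h mF.
- move=> y; have [/andP[y0 _]|ny] := boolP (0 <= y <= x + t); first by case: (int_F y0).
  by rewrite F_out//; exact: integrable0.
- move=> y; rewrite /h; have [yt|ny] := boolP (0 <= y <= x + t); last first.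
    by under eq_Rintegral do rewrite (congr1 (fun u : R -> R => u _) (F_out ny)) normr0; rewrite Rintegral0.
  have [iF _] := int_F (proj1 (andP yt)).
  have [ish eG1] := int_translate y iabs.
  have i2 : mu.-integrable setT (EFin \o (fun tau => C1 * `|g (tau - y)| + CD * I1 tau)).
    by apply: integrable_funD => //; apply: integrable_funZ.
  apply: le_trans (le_Rint measurableT (integrable_abse_fin measurableT iF) i2 _) _.
    move=> tau _; rewrite /F; case: ifPn => [cn|_]; last first.
      by rewrite normr0 addr_ge0// mulr_ge0// /I1; case: ifP.
    have [h1 h2 h3 h4 _] := cone_y cn.
    rewrite Sw_split; apply: le_trans (ler_normD _ _) _; rewrite normrM.
    rewrite /I1 h1 h2/= mulr1; apply: lerD; first by apply: ler_wpM2r => //; exact: HC1.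
    by apply: HCD => //; lra.
  rewrite RintegralD//; [|exact: integrable_funZ|exact: integrable_funZ].
  by rewrite -!RintegralZl_gen// eG1 eI1.
- have := patch_integrable (measurable_itv `[0, (x + t)]) (locint_cst (C1 * G1 + CD * t) 0 (x + t)).
  by congr (integrable _ _ _); apply/funext => z; rewrite /= patchE mem_setE in_itv.
move=> fub _ _ _.
have -> : \int[mu]_(tau in `[0, t]) \int[mu]_(y in `[`|x - t + tau|, x + t - tau]) Sw y (tau - y) =
    \int[mu]_tau \int[mu]_y F tau y.
  apply: eq_int_patch => tau; rewrite /= in_itv/= => ht.
    by apply: eq_int_patch => y; rewrite /= in_itv/= /F /cone ht; [move=> ->|move=> /negP/negPf ->].
  rewrite -[RHS](@Rintegral0 R setT); apply: eq_Rintegral => y _.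
  by move/negP/negPf: ht; rewrite /F /cone => ->.
rewrite fub.
pose r := t - x.
have -> : \int[mu]_y \int[mu]_tau F tau y = oint 0 (x + t)
    (fun y => Qw q l0 k g y (Num.min r (r + 2 * (x - y))) - Qw q l0 k g y (r - 2 * y)).
  rewrite (oint_ge _ (addr_ge0 hx0 ht0)); symmetry; apply: eq_int_patch => y; rewrite /= in_itv/=.
    by move=> /andP[y0 _]; have [_] := int_F y0; exact: esym.
  move=> /negP ny; rewrite -[RHS](@Rintegral0 R setT); apply: eq_Rintegral => tau _.
  exact: (congr1 (fun u : R -> R => u tau) (F_out ny)).
have Q0 y s : s <= 0 -> Qw q l0 k g y s = 0 by move=> s0; rewrite /Qw conv_le0.
have xr : x + Num.max r 0 / 2 <= x + t := cone_top hx0 ht0.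
rewrite (goursat_cone cQ Q0 hx0 xr); case: leP => r0.
  by rewrite (Zw_goursat cq dl0 hk).
exact: (esym (conv_le0 (k x) g (ltW r0))).
Qed.

End Cone.
End RoughWave.

(** * Existence of mild solutions *)

Section MildExistence.
Context {R : realType}.
Notation mu := (@lebesgue_measure R).
Notation rr := (measurableTypeR R * measurableTypeR R)%type.
Variables (L T : R) (q N f : R -> R).
Hypotheses (L0 : 0 < L) (T0 : 0 < T) (TL : T <= L).
Hypothesis hq : {within `[0, L], continuous q}.
Hypothesis hN : Ck 3 N.
Hypothesis Lf : L2 T f.
Notation qe := (extend L q).
Let cq : continuous qe. Proof. exact: extend_cont. Qed.
Let hk := wkernelP hN cq.
Let cK : continuous (memory N). Proof. exact: cont_memory. Qed.
Let dl := ider_lmem hN.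
Notation k := (wkernel N qe).
Let ck : cont2 k. Proof. by case: hk. Qed.

Definition boundary := cut T (amplitude N f).
Notation g := boundary.

Lemma amplitude_L2 : L2 T (amplitude N f).
Proof.
apply: L2_cont_mul => //; apply: (cont_comp1 (u := expR)); first exact: continuous_expR'.
by apply: contN; apply: contM; [exact: cont_cst|exact: cont_id].
Qed.

Let ig : mu.-integrable setT (EFin \o g). Proof. exact/cut_integrable/amplitude_L2. Qed.
Let lg : locint g. Proof. exact/cut_locint/amplitude_L2. Qed.

Lemma causal_boundary : causal g.
Proof. by move=> t t0; rewrite /g cutC// negb_and -leNgt t0. Qed.

Definition mild_wave x t := Zw k g x (t - x).

Let Cw x t := conv (k x) g (t - x).
Let mwE x t : mild_wave x t = g (t - x) + Cw x t. Proof. by []. Qed.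

Let cCw : cont2 Cw.
Proof.
apply: (cont_comp2 (u := fun x t => conv (k x) g t)); first exact: (cont_Zc hk lg).
  exact: continuous_fst.
by apply: contD; [exact: continuous_snd|apply: contN; exact: continuous_fst].
Qed.

Let L2_mw (t : R) : L2 L (mild_wave ^~ t).
Proof.
apply: (@eq_L2 _ L (fun x => g (t - x) + Cw x t)) => [x _|]; first by rewrite mwE.
apply: L2D; first exact: L2_reflect_cut amplitude_L2.
by apply: L2_cont; exact: (cont_comp2 (u := Cw) cCw (@cont_id R) (@cont_cst _ _ t)).
Qed.

Lemma mild_wave_path : L2_path L T mild_wave.
Proof.
split.
- apply: measurable_funTS.
  have -> : (fun p : rr => mild_wave p.1 p.2) = (fun p : rr => g (p.2 - p.1) + Cw p.1 p.2).
    by apply/funext => p; rewrite mwE.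
  apply: measurable_funD; last exact: cont2_measurable cCw.
  apply: (measurableT_comp (_ : measurable_fun setT g)).
    by apply/measurable_EFinP; exact: (measurable_int _ ig).
  apply: (@cont2_measurable R (fun a b => b - a)).
  by apply: contD; [exact: continuous_snd|apply: contN; exact: continuous_fst].
- by move=> t _; exact: L2_mw.
- move=> t0 t0T; apply/cvgrPdist_lt => e e0.
  (* The squared norm of a sum is at most twice the sum of the squared norms; e^2 / 8 for each part
     leaves e^2 / 2. *)
  have e2 : 0 < e ^+ 2 / 8 by rewrite divr_gt0// exprn_gt0.
  have [d d0 Hd] := translate_cont T0 L0 amplitude_L2 t0T e2.
  have L8 : 0 < e ^+ 2 / 8 / L by rewrite divr_gt0.
  pose c := Num.sqrt (e ^+ 2 / 8 / L).
  have c0 : 0 < c by rewrite sqrtr_gt0.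
  have cu : continuous (fun z : R * R => Cw z.2 z.1).
    by apply: (cont_comp2 (u := Cw)) => //; [exact: continuous_snd|exact: continuous_fst].
  have /nbhs_ballP[r /= r0 Hr] := @unif_near R R (fun t x => Cw x t) t0 0 L c cu c0.
  apply/nbhs_ballP; exists (Num.min d r) => /=; first by rewrite lt_min d0 r0.
  move=> t; rewrite /ball/= lt_min => /andP[td tr]; rewrite in_itv/= => tT.
  have cCt (s : R) : continuous (Cw ^~ s) by exact: (cont_comp2 (u := Cw) cCw (@cont_id R) (@cont_cst _ _ s)).
  have Lc : L2 L (fun x => Cw x t - Cw x t0) by apply: L2B; exact: L2_cont.
  have Ls : L2 L (fun x => g (t - x) - g (t0 - x)).
    by apply: L2B; exact: L2_reflect_cut amplitude_L2.
  have LW := L2B (L2_mw t) (L2_mw t0).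
  rewrite sub0r normrN ger0_norm; last by rewrite L2norm_sqrt// sqrtr_ge0.
  rewrite L2norm_sqrt// -[ltRHS](ger0_norm (ltW e0)) -sqrtr_sqr ltr_sqrt ?exprn_gt0//.
  have -> : (fun x => mild_wave x t - mild_wave x t0) =
      (fun x => (g (t - x) - g (t0 - x)) + (Cw x t - Cw x t0)).
    by apply/funext => x; rewrite !mwE add_sub_swap.
  apply: le_lt_trans (sqnD Ls Lc) _.
  have h1 : sqn L (fun x => g (t - x) - g (t0 - x)) < e ^+ 2 / 8 by apply: Hd => //; rewrite distrC.
  have h2 : sqn L (fun x => Cw x t - Cw x t0) <= e ^+ 2 / 8.
    apply: le_trans (_ : sqn L (fun=> c) <= _).
      apply: le_sqn => //; first exact: L2_cst.
      move=> x /andP[x0 xL]; rewrite (gtr0_norm c0) ltW//; apply: Hr => //.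
      by rewrite !ltW.
    rewrite sqn_cst ?(ltW L0)// sqr_sqrtr ?(ltW L8)// mulfVK//.
    by rewrite gt_eqF.
  move: h1 h2; move: (sqn L _) => A1; move: (sqn L _) => A2; move: e2; move: (e ^+ 2) => E; lra.
Qed.

Lemma mild_exists : is_mild L q N T f mild_wave.
Proof.
have [p1 p2 p3] := mild_wave_path; split=> // t /andP[t0 tT]; apply: aeW => x /andP[x0 xL].
have -> : mild_wave x t = g (t - x) + Cw x t by [].
congr (_ + _); first by rewrite /g cutP /amplitude -/(cut T f) cutP; case: ifP => // _; rewrite mulr0.
rewrite /Cw -(dalembert_cone cq cK dl hk ig causal_boundary (ltW x0) t0).
congr (_ * _); apply: eq_Rintegral => tau; rewrite inE/= in_itv/= => /andP[u0 ut].
apply: eq_Rintegral => y; rewrite inE/= in_itv/= => /andP[y1 y2].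
have y0 : 0 <= y := le_trans (normr_ge0 _) y1.
rewrite /mild_source; case: leP => yL.
  have yy : 0 <= y <= L by rewrite y0 yL.
  rewrite /Sw lmem0 (extend_id q yy); congr (_ + _).
  have := @conv_delay_locint R (memory N) (Zw k g y) y tau cK _ _ y0.
  rewrite convE => -> //; first exact: (locint_Zw hk).
  by move=> s s0; exact: (causal_rough_Zw _ causal_boundary).
(* Beyond x = L the mild source is 0 by convention, while [Sw] uses the extended potential; up to
   time T <= L the wave has not arrived there. *)
rewrite causal_Sw//; first exact: causal_boundary.
by rewrite subr_le0 (le_trans ut)// (le_trans tT)// (le_trans TL)// ltW.
Qed.

(** [mild_solution] chooses some solution; uniqueness identifies it almost everywhere with the
    explicit wave. *)
Lemma Lambda_wave : eqL2 L (Lambda L q N T f) (fun x => expR (gamma N * T) * mild_wave x T).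
Proof.
have h := @xgetPex _ (fun _ _ => 0) [set W | is_mild L q N T f W] (ex_intro _ mild_wave mild_exists).
have TT : 0 <= T <= T by rewrite (ltW T0) lexx.
apply: (ae_imp (mild_unique L0 T0 hq hN h mild_exists TT)) => x E xL.
by rewrite /Lambda /mild_solution E.
Qed.

End MildExistence.

(** * The control-to-state operator *)

Section ControlToState.
Context {R : realType}.
Notation mu := (@lebesgue_measure R).
Variables (L T : R) (q N : R -> R).
Hypotheses (L0 : 0 < L) (T0 : 0 < T) (TL : T <= L).
Hypothesis hq : {within `[0, L], continuous q}.
Hypothesis hN : Ck 3 N.
Implicit Types (f h u : R -> R).
Notation qe := (extend L q).
Notation gam := (gamma N).
Let cq : continuous qe. Proof. exact: extend_cont. Qed.
Let hk := wkernelP hN cq.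
Notation k := (wkernel N qe).
Let ck : cont2 k. Proof. by case: hk. Qed.

(* w^f(x,T) = e^(gamma x) (U f)(T - x) for x < T, where U - 1 is the Volterra operator with this kernel. *)
Definition state_kernel y s := expR (gam * (y - s)) * k (T - y) (y - s).
Notation kap := state_kernel.

Let cexp (X : topologicalType) (u : X -> R) : continuous u -> continuous (fun x => expR (gam * u x)).
Proof.
move=> cu; apply: (cont_comp1 (u := expR)); first exact: continuous_expR'.
by apply: contM => //; exact: cont_cst.
Qed.

Lemma cont_state_kernel : cont2 kap.
Proof.
have c1 : continuous (fun p : R * R => p.1 - p.2).
  by apply: contD; [exact: continuous_fst|apply: contN; exact: continuous_snd].
apply: contM; first exact: cexp.
apply: (cont_comp2 (u := k)) => //; apply: contD; first exact: cont_cst.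
by apply: contN; exact: continuous_fst.
Qed.
Let ckap := cont_state_kernel.

Lemma mild_state f x : L2 T f -> 0 < x ->
  expR (gam * T) * mild_wave L T q N f x T = expR (gam * x) * cut T (uop T kap f) (T - x).
Proof.
move=> Lf x0; have [y [yE xE]] : exists y, y = T - x /\ x = T - y by exists (T - x); split => //; ring.
have -> : mild_wave L T q N f x T =
    cut T (amplitude N f) y + conv (k x) (cut T (amplitude N f)) y by rewrite yE.
rewrite -yE.
have [y0|y0] := leP y 0.
  rewrite conv_le0// !cutC ?addr0 ?mulr0// negb_and -leNgt y0//.
have yT : 0 < y < T by rewrite y0 yE; lra.
rewrite !cutT// /uop /vop conv_oint ?(ltW y0)// [LHS]mulrDr [RHS]mulrDr; congr (_ + _).
  rewrite /amplitude mulrA -expRD; congr (expR _ * _); rewrite yE; ring.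
have lc : locint (fun s => kap y s * cut T f s).
  apply: cont_mul_locint; last exact: cut_locint.
  exact: cont_sect ckap.
have lc2 : locint (fun s => k x (y - s) * cut T (amplitude N f) s).
  apply: conv_integrand_locint; first exact: (cont_sect ck).
  exact: cut_locint (amplitude_L2 N Lf).
rewrite -!ointZ//; congr oint; apply/funext => s; rewrite /state_kernel -xE.
rewrite !cutP; case: ifP => _; last by rewrite !mulr0.
have E : expR (gam * T) * expR (- (gam * s)) = expR (gam * x) * expR (gam * (y - s)).
  by rewrite -!expRD; congr expR; rewrite yE; ring.
rewrite /amplitude; move: E.
move: (expR (gam * T)) (expR (- (gam * s))) (expR (gam * x)) (expR (gam * (y - s))) (k x (y - s)) (f s).
by move=> a b c d v w E; transitivity (a * b * v * w); [ring|rewrite E; ring].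
Qed.

Definition state f x := expR (gam * x) * cut T (uop T kap f) (T - x).

Lemma Lambda_state f : L2 T f -> eqL2 L (Lambda L q N T f) (state f).
Proof.
move=> Lf; apply: eqL2_trans (Lambda_wave L0 T0 TL hq hN Lf) _.
by apply: eqL2P => x /andP[x0 _]; exact: mild_state.
Qed.

Lemma reflect_L2 u : L2 T u -> L2 L (fun x => expR (gam * x) * cut T u (T - x)).
Proof. move=> Lu; apply: L2_cont_mul; last exact: L2_reflect_cut.
by apply: cexp; exact: cont_id. Qed.

Lemma state_L2 f : L2 T f -> L2 L (state f).
Proof. by move=> Lf; apply: reflect_L2; exact: uop_L2. Qed.

Lemma Lambda_L2 f : L2 T f -> L2 L (Lambda L q N T f).
Proof.
move=> Lf.
have [_ h _ _] := @xgetPex _ (fun _ _ => 0) [set W | is_mild L q N T f W]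
  (ex_intro _ _ (mild_exists L0 T0 TL hq hN Lf)).
have TT : 0 <= T <= T by rewrite (ltW T0) lexx.
exact: L2Z (h T TT).
Qed.

Lemma L2innerE (a : R) u h : L2inner a u h = \int[mu]_(x in `]0, a[) (u x * h x).
Proof. by []. Qed.

Definition costate h y := expR (gam * (T - y)) * cut L h (T - y).

Lemma costate_L2 h : L2 L h -> L2 T (costate h).
Proof.
move=> Lh; apply: L2_cont_mul; last exact: L2_reflect_cut.
by apply: cexp; apply: contD; [exact: cont_cst|apply: contN; exact: cont_id].
Qed.

Lemma reflect_inner u h : L2 T u -> L2 L h ->
  L2inner L (fun x => expR (gam * x) * cut T u (T - x)) h = L2inner T u (costate h).
Proof.
move=> Lu Lh; pose Phi := cut T (fun y => u y * costate h y).
have iPhi : mu.-integrable setT (EFin \o Phi).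
  by apply/integrable_cut; apply: L2_prod => //; exact: costate_L2.
have [_ E] := int_reflect T iPhi.
rewrite !L2innerE !int_cut -/Phi -E; apply: eq_Rintegral => x _.
have TTx : T - (T - x) = x by ring.
rewrite /Phi [in RHS]cutP /costate TTx !cutP; case: ifP => xL; case: ifP => yT.
- by move: (expR _) (u _) (h _) => a b c; ring.
- by rewrite mulr0 mul0r.
- by rewrite !mulr0.
- by [].
Qed.

Lemma state_adjoint f h : L2 T f -> L2 L h ->
  L2inner L (Lambda L q N T f) h = L2inner T f (uopT T kap (costate h)).
Proof.
move=> Lf Lh; rewrite (eqL2_inner (Lambda_L2 Lf) (state_L2 Lf) Lh (Lambda_state Lf)).
rewrite reflect_inner//; last exact: uop_L2.
by rewrite uop_adjoint//; exact: costate_L2.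
Qed.

(** [adjoint] is a choice, so an adjoint has to be exhibited: the transpose of the Volterra form of
    [Lambda]. *)
Lemma adjointP : is_adjoint T L (Lambda L q N T) (adjoint T L (Lambda L q N T)).
Proof.
apply: (@xgetPex _ (fun _ => cst 0) [set B | is_adjoint T L (Lambda L q N T) B]).
exists (fun h => uopT T kap (costate h)); split; last exact: state_adjoint.
by move=> h Lh; apply: uopT_L2 => //; exact: costate_L2.
Qed.

Lemma Gram_L2 f : L2 T f -> L2 T (Gram L q N T f).
Proof. by move=> Lf; have [H _] := adjointP; apply: H; exact: Lambda_L2. Qed.

Lemma Gram_inner f h : L2 T f -> L2 T h ->
  L2inner T (Gram L q N T f) h = L2inner L (Lambda L q N T f) (Lambda L q N T h).
Proof.
move=> Lf Lh; have [_ H] := adjointP.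
rewrite L2innerC; exact: (etrans (esym (H h _ Lh (Lambda_L2 Lf))) (L2innerC _ _ _)).
Qed.

Definition gram_weight y := expR (gam * (T - y)) ^+ 2.

Lemma cont_gram_weight : continuous gram_weight.
Proof.
have h : continuous (fun y => expR (gam * (T - y))).
  by apply: cexp; apply: contD; [exact: cont_cst|apply: contN; exact: cont_id].
exact: contM.
Qed.

Lemma gram_weight_gt0 y : 0 < gram_weight y.
Proof. by rewrite exprn_gt0// expR_gt0. Qed.

(** Both sides have the same inner products; the weight is the square of e^(gamma x) at x = T -
    y. *)
Lemma Gram_eq f : L2 T f -> eqL2 T (Gram L q N T f) (gram_op T kap gram_weight f).
Proof.
move=> Lf; have LU := uop_L2 ckap Lf; have LmU := L2_cont_mul cont_gram_weight LU.
apply: eqL2_of_inner; first exact: Gram_L2.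
  exact: uopT_L2.
move=> h Lh; rewrite Gram_inner//.
rewrite L2innerC (eqL2_inner (Lambda_L2 Lh) (state_L2 Lh) (Lambda_L2 Lf) (Lambda_state Lh)).
rewrite L2innerC (eqL2_inner (Lambda_L2 Lf) (state_L2 Lf) (state_L2 Lh) (Lambda_state Lf)).
rewrite reflect_inner//; last exact: state_L2.
rewrite [RHS]L2innerC /gram_op -(uop_adjoint ckap Lh LmU).
rewrite !L2innerE; apply: eq_int_on => y /andP[y0 yT].
(* Because T <= L the reflected point lies in ]0, L[, and the cut at [L] loses nothing. *)
have yL : 0 < T - y < L by have := TL; lra.
have TTy : T - (T - y) = y by ring.
rewrite /costate (cutT _ yL) /state TTy cutT ?y0// /gram_weight.
move: (uop _ _ _ _) (uop _ _ _ _) (expR _) => a b c; ring.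
Qed.

Lemma L2_reflect u : L2 T u -> L2 T (fun y => u (T - y)).
Proof.
move=> Lu; apply: (@eq_L2 _ T (fun y => cut T u (T - y))); last exact: L2_reflect_cut.
by move=> y yT; rewrite cutT//; lra.
Qed.

Lemma eqL2_reflect u h : L2 T u -> L2 T h -> eqL2 T u h ->
  eqL2 T (fun y => u (T - y)) (fun y => h (T - y)).
Proof.
move=> Lu Lh uh; have Ld := L2B Lu Lh; have Ldr := L2_reflect Ld.
have d0 : sqn T (fun y => u y - h y) = 0.
  by apply: sqn_eq0 => //; apply: (ae_imp uh) => x e xT; rewrite e// subrr.
have iP : mu.-integrable setT (EFin \o cut T (fun y => (u y - h y) ^+ 2)).
  by apply/integrable_cut; exact: L2_sq.
have [_ E] := int_reflect T iP.
have : sqn T (fun y => u (T - y) - h (T - y)) = 0.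
  have sE v : sqn T v = \int[mu]_(x in `]0, T[) (v x ^+ 2) by [].
  rewrite -d0 !sE !int_cut -E; apply: eq_Rintegral => y _; rewrite !cutP.
  have -> : (0 < T - y < T) = (0 < y < T) by apply/andP/andP => -[? ?]; split; lra.
  by [].
move=> /(sqn0_eqL2 Ldr) e; apply: (ae_imp e) => y ey yT.
by apply/eqP; rewrite -subr_eq0; apply/eqP; exact: ey.
Qed.

Lemma Gram_bounded : bounded_op T T (Gram L q N T).
Proof.
have [bG _] := gram_op_inverse T0 ckap cont_gram_weight gram_weight_gt0.
by apply: eq_bounded_op bG _ => f Lf; split; [exact: Gram_L2|exact: Gram_eq].
Qed.

Lemma Gram_inverse : exists rho, [/\ cont2 rho,
  forall f, L2 T f -> forall y, 0 < y < T ->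
    uop T rho (uop T kap f) y = f y /\ uop T kap (uop T rho f) y = f y &
  exists G, is_inverse T (Gram L q N T) G].
Proof.
have [bG [rho crho [Hr [_ bI e1 e2]]]] := gram_op_inverse T0 ckap cont_gram_weight gram_weight_gt0.
exists rho; split=> //.
exists (fun f => uop T rho (fun y => (gram_weight y)^-1 * uopT T rho f y)).
have [IL _ _] := bI; have [GL _ _] := bG.
split; [exact: Gram_bounded|exact: bI| |].
- move=> f Lf; exact: eqL2_trans (Gram_eq (IL f Lf)) (e1 f Lf).
- move=> f Lf; apply: eqL2_trans (e2 f Lf).
  exact: (bounded_op_eq bI (Gram_L2 Lf) (GL f Lf) (Gram_eq Lf)).
Qed.

(** * Steering to a given state *)

Section Steering.
Variable xi : R -> R.
Hypothesis cxi : {within `[0, L], continuous xi}.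
Notation xe := (extend L xi).
Let cxe : continuous xe. Proof. exact: extend_cont. Qed.

Definition target y := expR (- (gam * (T - y))) * xe (T - y).

Lemma cont_target : continuous target.
Proof.
have c1 : continuous (fun y : R => T - y).
  by apply: contD; [exact: cont_cst|apply: contN; exact: cont_id].
apply: contM; last exact: (cont_comp1 (u := xe)).
apply: (cont_comp1 (u := expR)); first exact: continuous_expR'.
by apply: contN; apply: contM => //; exact: cont_cst.
Qed.

Lemma target_reflect x : 0 < x < T -> expR (gam * x) * target (T - x) = xi x.
Proof.
move=> xT; rewrite /target; have -> : T - (T - x) = x by ring.
rewrite extend_id ?mulrA -?expRD ?addrN ?expR0 ?mul1r//; have := TL; lra.
Qed.

Lemma steering_uop f : steering L q N xi T f -> eqL2 T (uop T kap f) target.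
Proof.
move=> [Lf Hf]; have LU := uop_L2 ckap Lf.
have Lt : L2 T target by apply: L2_cont; exact: cont_target.
have e : eqL2 T (fun x => uop T kap f (T - x)) (fun x => target (T - x)).
  apply: (ae_imp2 Hf (Lambda_state Lf)) => x h1 h2 xT.
  have xL : 0 < x < L by have := TL; lra.
  have := h2 xL; rewrite h1// -(target_reflect xT) /state cutT; last by lra.
  by move=> /(mulfI (lt0r_neq0 (expR_gt0 _))).
have e2 := eqL2_reflect (L2_reflect LU) (L2_reflect Lt) e; apply: (ae_imp e2) => y h yT.
by have := h yT; have -> : T - (T - y) = y by ring.
Qed.

(** Steering means U f = [target] almost everywhere, so f is the inverse of U applied to [target].
    The Volterra part of that inverse vanishes at 0, whence the value e^(-gamma T) xi(T) at 0. *)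
Lemma steering_control rho : cont2 rho ->
  (forall f, L2 T f -> forall y, 0 < y < T ->
    uop T rho (uop T kap f) y = f y /\ uop T kap (uop T rho f) y = f y) ->
  [/\ steering L q N xi T (uop T rho target),
      forall f, steering L q N xi T f -> eqL2 T f (uop T rho target),
      continuous (uop T rho target) &
      xi T = expR (gam * T) * uop T rho target 0].
Proof.
move=> crho Hr; have Lt : L2 T target by apply: L2_cont; exact: cont_target.
have Lu := uop_L2 crho Lt.
split.
- split=> //; apply: (ae_imp (Lambda_state Lu)) => x h xT.
  have xL : 0 < x < L by have := TL; lra.
  rewrite h// /state cutT; last by lra.
  by rewrite (Hr _ Lt _ _).2 ?target_reflect//; lra.
- move=> f sf; have [Lf _] := sf; have e := steering_uop sf.
  have e2 := bounded_op_eq (uop_bounded T0 crho) (uop_L2 ckap Lf) Lt e.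
  by apply: (ae_imp e2) => y h yT; rewrite -h// (Hr f Lf y yT).1.
- by apply: contD; [exact: cont_target|exact: vop_cont].
- rewrite /uop /vop ointaa addr0 /target subr0 mulrA -expRD addrN expR0 mul1r extend_id//.
  by rewrite (ltW T0) TL.
Qed.

End Steering.
End ControlToState.

(** * The steering control *)

Section PairingWithXi.
Context {R : realType}.
Notation mu := (@lebesgue_measure R).
Variables (L : R) (q N xi : R -> R).
Hypothesis L0 : 0 < L.
Hypothesis hq : {within `[0, L], continuous q}.
Hypothesis hN : Ck 3 N.
Hypothesis hN0 : N 0 = 1.
Hypothesis hxi : is_xi L q xi.
Implicit Types (j : @jet R) (phi : R -> R).
Notation qe := (extend L q).
Notation xe := (extend L xi).
Let cq : continuous qe. Proof. exact: extend_cont. Qed.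
Let cN : continuous N. Proof. exact: Ck_cont hN (isT : 0 <= 3)%N. Qed.

Lemma is_xi_cont : {within `[0, L], continuous xi}.
Proof. by have [xi1 []] := hxi. Qed.
Let cxe : continuous xe. Proof. exact/extend_cont/is_xi_cont. Qed.

Lemma is_xi_extend : exists x1 : R -> R, [/\ continuous x1,
  forall x, 0 < x < L -> ider xe x (x1 x) /\ ider x1 x (- qe x * xe x),
  xe 0 = 0 & x1 0 = 1].
Proof.
have [xi1 [c0 c1 d [e0 e1]]] := hxi; exists (extend L xi1).
have L00 : (0 : R) <= 0 <= L by rewrite lexx ltW.
split; [exact: extend_cont| |by rewrite extend_id|by rewrite extend_id].
have loc u x d' : 0 < x < L -> ider u x d' -> ider (extend L u) x d'.
  move=> xL; apply: (@oo_ider _ _ _ x 0 L) => // y /andP[y0 yL].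
  by rewrite extend_id// !ltW.
move=> x xL; have [d1 d2] := d x xL; have xL' : 0 <= x <= L by case/andP: xL => *; rewrite !ltW.
by rewrite !(extend_id _ xL'); split; apply: loc.
Qed.

(** At a time s < L the wave vanishes for x > s, so it has no flux at x = L; continuity adds the
    time L. *)
Lemma jet_edge j phi t : control phi -> jet_of L q N phi j -> 0 <= t <= L -> j1 j L t = 0.
Proof.
move=> cphi [[[c0 c1 c2] _ dj] _ _ _ je] tL.
have key s : 0 <= s < L -> j1 j L s = 0.
  move=> /andP[s0 sL].
  have c1s : continuous (j1 j ^~ s) by exact: (cont_sect2 c1).
  apply: (@cont0_closed _ (j1 j ^~ s) s L) => //; last by rewrite lexx ltW.
  move=> x /andP[sx xL]; have [d1 _ _ _ _] := dj x s.
  apply: (@ider_unique _ (j0 j ^~ s) x) => //.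
  apply: (@oo_ider _ (fun=> 0) _ x s L); [by rewrite sx xL| |exact: ider_cst].
  move=> y /andP[sy yL]; rewrite je ?(ltW sL)//; last by rewrite (ltW yL) andbT; lra.
  rewrite (@wave_vanish _ _ _ _ _ 0) ?mulr0//; last by lra.
  exact: amplitude_causal (control_causal cphi).
apply: (@cont0_closed _ (j1 j L) 0 L) => //; first exact: cont_sect c1.
by move=> s /andP[s0 sL]; apply: key; rewrite (ltW s0).
Qed.

(* Pairing w_t = N * (w_xx + q w) with xi, only the boundary term w(0,t) xi'(0) remains. *)
Lemma pairing_xi j phi t : control phi -> jet_of L q N phi j -> 0 <= t <= L ->
  oint 0 L (fun x => j0 j x t * xe x) = conv (primitive N) phi t.
Proof.
move=> cphi jj /andP[t0 tL]; have [[[c0 c1 c2] [c11 _ _] dj] [_ jneg] jb jeq _] := jj.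
have cf : continuous phi by apply: smooth_cont; case: cphi.
have [x1 [cx1 dx xe0 x10]] := is_xi_extend.
have L00 : (0 : R) <= 0 <= L by rewrite lexx ltW.
pose psi x s := j11 j x s + qe x * j0 j x s.
have cpsi : cont2 psi.
  apply: contD => //; apply: contM => //.
  by apply: (cont_comp1 (u := qe)) => //; exact: continuous_fst.
have cx2 (u : R -> R -> R) : cont2 u -> cont2 (fun s x => u x s * xe x).
  move=> cu; apply: contM; first exact: cont2_swap.
  by apply: (cont_comp1 (u := xe)) => //; exact: continuous_snd.
have csec (u : R -> R -> R) s : cont2 u -> continuous (fun x => u x s * xe x).
  by move=> cu; exact: (@cont_sect R R (fun s x => u x s * xe x) s (cx2 u cu)).
have green s : 0 <= s <= L -> oint 0 L (fun x => psi x s * xe x) = phi s.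
  move=> sL; have /andP[s0 _] := sL.
  have sj (u : R -> R -> R) : cont2 u -> continuous (u ^~ s).
    by move=> cu; exact: (cont_sect2 cu).
  have := @FTC_oo R (fun x => j1 j x s * xe x - j0 j x s * x1 x) (fun x => psi x s * xe x) 0 L (ltW L0)
    (csec psi s cpsi).
  rewrite -oint_ge ?(ltW L0)// => ->.
  - have [b0 bL] := jb s s0.
    by rewrite xe0 x10 b0 bL (jet_edge cphi jj sL); ring.
  - move=> x xL; have [a1 _ a11 _ _] := dj x s; have [e1 e2] := dx x xL.
    apply: ider_val (iderB (iderM a11 e1) (iderM a1 e2)) _.
    rewrite /psi; move: (j11 j x s) (j1 j x s) (j0 j x s) (xe x) (x1 x) (qe x) => a b c d e f; ring.
  - apply: continuous_subspaceT; apply: contD; first by apply: contM => //; exact: sj.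
    by apply: contN; apply: contM => //; exact: sj.
(* The time convolution is exchanged with the pairing, so that [green] applies at each earlier
   time. *)
have swap s : 0 <= s <= L -> oint 0 L (fun x => j2 j x s * xe x) = conv N phi s.
  move=> sL; have /andP[s0 _] := sL.
  pose B x z := psi x z * xe x.
  have cB : cont2 B.
    apply: contM => //; apply: (cont_comp1 (u := xe)) => //; exact: continuous_fst.
  transitivity (oint 0 L (fun x => conv (B x) N s)).
    apply: eq_oint => x; rewrite min_l ?(ltW L0)// max_r ?(ltW L0)// => xL.
    rewrite jeq// [RHS]convC//; last exact: (cont_sect cB).
    have -> : B x = fun z => xe x * psi x z by apply/funext => z; rewrite /B mulrC.
    rewrite convZr//; last by apply: cont_locint; exact: cont_sect cpsi.
    rewrite mulrC; congr (_ * _); apply: eq_conv => // z _.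
    by rewrite /psi extend_id.
  rewrite -(conv_oint_fubini _ _ cB (cont_locint cN)) convC//; last first.
    exact: (@cont_oint R R (fun s x => B x s) (fun=> 0) (fun=> L) (cont2_swap cB) (@cont_cst _ _ 0) (@cont_cst _ _ L)).
  apply: eq_conv => // z /andP[z0 zs]; apply: green; rewrite z0 (le_trans zs)//.
  by case/andP: sL.
have dP s : ider (fun s => oint 0 L (fun x => j0 j x s * xe x)) s (oint 0 L (fun x => j2 j x s * xe x)).
  apply: (@leibniz_oint R (fun s x => j0 j x s * xe x) (fun s x => j2 j x s * xe x)).
  - exact: cx2.
  - exact: cx2.
  - move=> y x; have [_ d2 _ _ _] := dj x y.
    by apply: ider_val (iderM d2 (ider_cst (xe x) y)) _; ring.
have P0 : oint 0 L (fun x => j0 j x 0 * xe x) = 0.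
  rewrite -[RHS](oint0 0 L); apply: eq_oint => x; rewrite min_l ?(ltW L0)// max_r ?(ltW L0)// => xL.
  by rewrite jneg// mul0r.
have := @FTC_oo R (fun s => oint 0 L (fun x => j0 j x s * xe x)) (conv N phi) 0 t t0
  (cont_conv cN cf).
rewrite P0 subr0 => <-.
- have cc : continuous (fun _ : R => 1 : R) by exact: cont_cst.
  rewrite -conv1 (convA t cc cN (cont_locint cf)).
  by apply: eq_conv => // s _; rewrite conv1.
- move=> s /andP[s0 st]; have sL : 0 <= s <= L by rewrite (ltW s0) (le_trans (ltW st)).
  by rewrite -(swap s sL).
- by apply: continuous_subspaceT; exact: ider_cont dP.
Qed.

End PairingWithXi.

(** * The Gram operator on controls and on steering controls *)

Section SteeringGram.
Context {R : realType}.
Notation mu := (@lebesgue_measure R).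
Variables (L T : R) (q N : R -> R).
Hypotheses (L0 : 0 < L) (T0 : 0 < T) (TL : T <= L).
Hypothesis hq : {within `[0, L], continuous q}.
Hypothesis hN : Ck 3 N.
Hypothesis hN0 : N 0 = 1.
Implicit Types (j : @jet R) (f g phi : R -> R).

Lemma cont_int_oo (a : R) u : continuous u ->
  \int[mu]_(x in `]0, a[) u x = \int[mu]_(x in `[0, a]) u x.
Proof.
move=> cu; have mE D : measurable_fun D (EFin \o u).
  by apply/measurable_EFinP; apply: measurable_funTS; exact: continuous_measurable_fun.
by rewrite /Rintegral integral_itv_obnd_cbnd// integral_itv_bndo_bndc.
Qed.

(** Only the products have to agree: when pairing with xi, one factor is unknown exactly where the
    other vanishes. *)
Lemma eq_inner (a : R) u u' h h' : L2 a u -> L2 a u' -> L2 a h -> L2 a h' ->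
  {ae mu, forall x, 0 < x < a -> u x * h x = u' x * h' x} -> L2inner a u h = L2inner a u' h'.
Proof.
move=> Lu Lu' Lh Lh' e; rewrite !L2innerE; congr fine; apply: ae_eq_integral => //.
- by apply/measurable_EFinP; apply: measurable_funM; exact: L2_measurable.
- by apply/measurable_EFinP; apply: measurable_funM; exact: L2_measurable.
- by apply: (ae_imp e) => x {}e; rewrite /= in_itv/= => /e ->.
Qed.

(** At time T and x > 0 only boundary values before T count, so cutting the control to ]0, T[
    changes nothing. *)
Lemma Lambda_classical phi j : control phi -> jet_of L q N phi j ->
  eqL2 L (Lambda L q N T phi) (fun x => j0 j x T).
Proof.
move=> cphi [_ _ _ _ je]; have Lphi := control_L2 T cphi.
apply: (ae_imp (Lambda_wave L0 T0 TL hq hN Lphi)) => x e xL; rewrite e// je//; last first.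
  by case/andP: xL => *; rewrite !ltW.
congr (_ * _); rewrite /mild_wave.
transitivity (Zw (wkernel N (extend L q)) (amplitude N phi) x (T - x)); last by [].
apply: eq_Zw => s sT; rewrite /boundary cutP; case: ifPn => // ns.
have h := @amplitude_causal R N phi (control_causal cphi); apply/esym/h.
by rewrite leNgt; apply: contra ns => ->/=; case/andP: xL => *; lra.
Qed.

Lemma classical_L2 phi j : isC2 j -> L2 L (fun x => j0 j x T).
Proof.
move=> [[c0 _ _] _ _]; apply: L2_cont.
exact: (cont_sect2 c0).
Qed.

Lemma correlation_Gram f g : control f -> control g ->
  correlation L q N f g T T = L2inner T (Gram L q N T f) g.
Proof.
move=> cf cg; have [j jf] := jet_of_control L0 hq hN hN0 cf; have [k kg] := jet_of_control L0 hq hN hN0 cg.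
have Lf := control_L2 T cf; have Lg := control_L2 T cg.
rewrite Gram_inner// (correlation_pairing L0 jf kg) ?(ltW T0)//.
have [Cj _ _ _ _] := jf; have [Ck _ _ _ _] := kg.
rewrite (@eq_inner L _ (fun x => j0 j x T) _ (fun x => j0 k x T)); last first.
- by apply: (ae_imp2 (Lambda_classical cf jf) (Lambda_classical cg kg)) => x h1 h2 xL; rewrite h1// h2.
- exact: classical_L2.
- exact: Lambda_L2.
- exact: classical_L2.
- exact: Lambda_L2.
have [[cj _ _] _ _] := Cj; have [[ck _ _] _ _] := Ck.
have cT (u : R -> R -> R) : cont2 u -> continuous (u ^~ T).
  by move=> cu; exact: (cont_sect2 cu).
rewrite (pairingE L0) L2innerE; apply: esym; apply: cont_int_oo; apply: contM; exact: cT.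
Qed.

(** Smooth controls phi serve as test functions. The state of phi at time T vanishes beyond x = T,
    so there [Lambda f], prescribed on ]0, T[ only, may be replaced by xi; [pairing_xi] evaluates
    the result. *)
Lemma steering_Gram xi f : is_xi L q xi -> steering L q N xi T f ->
  eqL2 T (Gram L q N T f) (fun t => primitive N (T - t)).
Proof.
move=> hxi [Lf Hf]; have cN : continuous N by exact: Ck_cont hN (isT : 0 <= 3)%N.
pose M t := oint 0 t N.
have cM : continuous M by apply: cont_primitive; exact: cont_locint.
have ME t : 0 <= t -> primitive N t = M t by move=> t0; rewrite /M oint_ge.
have cMT : continuous (fun t => M (T - t)).
  by apply: (cont_comp1 (u := M)) => //; apply: contD; [exact: cont_cst|apply: contN; exact: cont_id].
have LM : L2 T (fun t => M (T - t)) by exact: L2_cont.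
have LG : L2 T (Gram L q N T f) by exact: Gram_L2.
suff H : eqL2 T (fun t => Gram L q N T f t - M (T - t)) (fun=> 0).
  apply: (ae_imp H) => t ht tT; rewrite ME; last by lra.
  by apply/eqP; rewrite -subr_eq0; apply/eqP; exact: ht.
apply: (controls_total T0) => [|phi cphi]; first exact: L2B.
have Lphi := control_L2 T cphi.
rewrite L2innerBl//; apply/eqP; rewrite subr_eq0; apply/eqP.
have [j jj] := jet_of_control L0 hq hN hN0 cphi; have [Cj _ _ _ je] := jj.
have cxe : continuous (extend L xi) by apply: extend_cont => //; exact: is_xi_cont hxi.
rewrite Gram_inner//.
transitivity (L2inner L (fun x => j0 j x T) (extend L xi)).
  rewrite L2innerC; apply: eq_inner; [exact: Lambda_L2|exact: classical_L2|exact: Lambda_L2|exact: L2_cont|].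
  apply: (ae_imp2 (Lambda_classical cphi jj) Hf) => x h1 h2 /[dup] xL /andP[x0 xL'].
  rewrite h1//; have [xT|xT] := ltP x T.
    by rewrite h2 ?x0// extend_id// !ltW.
  suff -> : j0 j x T = 0 by rewrite !mul0r.
  rewrite je ?(ltW x0) ?(ltW xL')// (@wave_vanish _ _ _ _ _ 0) ?mulr0//; last by rewrite add0r.
  exact: amplitude_causal (control_causal cphi).
have -> : L2inner L (fun x => j0 j x T) (extend L xi) = oint 0 L (fun x => j0 j x T * extend L xi x).
  have [[cj _ _] _ _] := Cj; rewrite L2innerE (oint_ge _ (ltW L0)) cont_int_oo//.
  apply: contM => //; exact: (cont_sect2 cj).
have TT : 0 <= T <= L by rewrite (ltW T0).
rewrite (pairing_xi L0 hq hN hxi cphi jj TT) convE L2innerE.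
have cphi' : continuous phi by apply: smooth_cont; case: cphi.
rewrite cont_int_oo; last exact: contM.
by apply: eq_Rintegral => s; rewrite inE/= in_itv/= => /andP[s0 sT]; rewrite ME//; lra.
Qed.

End SteeringGram.

(** * Identification of the potential *)

Section Identification.
Context {R : realType}.
Notation mu := (@lebesgue_measure R).
Variables (L T : R) (N : R -> R).
Hypotheses (L0 : 0 < L) (T0 : 0 < T) (TL : T <= L).
Hypothesis hN : Ck 3 N.
Hypothesis hN0 : N 0 = 1.
Implicit Types (q f g phi : R -> R) (A B : (R -> R) -> R -> R).

Lemma eqL2_of_controls u v : L2 T u -> L2 T v ->
  (forall phi, control phi -> L2inner T u phi = L2inner T v phi) -> eqL2 T u v.
Proof.
move=> Lu Lv H; have z : eqL2 T (fun x => u x - v x) (fun=> 0).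
  apply: (controls_total T0) => [|phi cphi]; first exact: L2B.
  by rewrite L2innerBl ?H ?subrr//; exact: control_L2.
by apply: (ae_imp z) => x h xT; apply/eqP; rewrite -subr_eq0; apply/eqP; exact: h.
Qed.

Lemma bounded_op_sub A u v : bounded_op T T A -> L2 T u -> L2 T v ->
  sqn T (fun x => A u x - A v x) = sqn T (A (fun x => u x - v x)).
Proof.
move=> [AL Alin _] Lu Lv.
have Ld : L2 T (fun x => -1 * v x + u x) by apply: L2D => //; exact: L2Z.
have -> : (fun x => u x - v x) = (fun x => -1 * v x + u x) by apply/funext => x; ring.
symmetry; apply: eqL2_sqn; [exact: AL|apply: L2B; exact: AL|].
by apply: (ae_imp (Alin (-1) v u Lv Lu)) => x h xT; rewrite h//; ring.
Qed.

(** Where [A] and [B] agree on phi, the difference of their values at f is that of their values at f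
    - phi, which the norm bounds make small. *)
Lemma bounded_op_dense A B : bounded_op T T A -> bounded_op T T B ->
  (forall phi, control phi -> eqL2 T (A phi) (B phi)) ->
  forall f, L2 T f -> eqL2 T (A f) (B f).
Proof.
move=> bA bB AB f Lf; have [AL _ _] := bA; have [BL _ _] := bB.
have [CA CA0 HA] := bounded_op_sqn bA; have [CB CB0 HB] := bounded_op_sqn bB.
have LA := AL f Lf; have LB := BL f Lf.
have d0 : sqn T (fun x => A f x - B f x) = 0.
  apply/eqP; rewrite eq_le sqn_ge0 andbT; apply/ler_addgt0Pl => e e0; rewrite addr0.
  pose c := 2 * CA + 2 * CB + 1.
  have c0 : 0 < c by rewrite /c; lra.
  have [phi cphi Hphi] := controls_dense T0 Lf (divr_gt0 e0 c0).
  have Lphi := control_L2 T cphi; have LAp := AL phi Lphi; have LBp := BL phi Lphi.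
  have -> : sqn T (fun x => A f x - B f x) =
      sqn T (fun x => (A f x - A phi x) - (B f x - B phi x)).
    apply: eqL2_sqn; [exact: L2B|apply: L2B; exact: L2B|].
    by apply: (ae_imp (AB phi cphi)) => x h xT; rewrite h//; ring.
  apply: le_trans (sqnB (L2B LA LAp) (L2B LB LBp)) _.
  rewrite (bounded_op_sub bA)// (bounded_op_sub bB)//.
  have Ld := L2B Lf Lphi; have h1 := HA _ Ld; have h2 := HB _ Ld.
  apply: le_trans (_ : c * sqn T (fun x => f x - phi x) <= _); last first.
    by rewrite -ler_pdivlMl// mulrC ltW.
  have s0 := sqn_ge0 T (fun x => f x - phi x); rewrite /c.
  move: h1 h2 s0; move: (sqn T _) => a1; move: (sqn T _) => a2; move: (sqn T _) => a3.
  move=> h1 h2 h3; lra.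
have := sqn0_eqL2 (L2B LA LB) d0 => z.
by apply: (ae_imp z) => x h xT; apply/eqP; rewrite -subr_eq0; apply/eqP; exact: h.
Qed.

Section Data.
Variable q : R -> R.
Hypothesis hq : {within `[0, L], continuous q}.

Lemma blago_correlation tau f g : control f -> control g ->
  blago_problem N tau f g (response L q N f) (response L q N g) (correlation L q N f g).
Proof.
move=> cf cg; have [j jf] := jet_of_control L0 hq hN hN0 cf; have [k kg] := jet_of_control L0 hq hN hN0 cg.
by apply: (correlation_blago L0 hq hN hN0 jf kg); apply: smooth_cont; [case: cf|case: cg].
Qed.

(** The hypothesis is applied to the correlation, which solves the problem; density of the controls
    extends the identity. *)
Lemma Gram_characterized A : bounded_op T T A ->
  (forall f g H, control f -> control g ->
    blago_problem N (2 * T) f g (response L q N f) (response L q N g) H ->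
    L2inner T (A f) g = H T T) ->
  forall f, L2 T f -> eqL2 T (A f) (Gram L q N T f).
Proof.
move=> bA HA; apply: bounded_op_dense => //; first exact: Gram_bounded.
move=> f cf; have Lf := control_L2 T cf; have [AL _ _] := bA.
apply: eqL2_of_controls; [exact: AL|exact: Gram_L2|move=> g cg].
by rewrite (HA f g _ cf cg (blago_correlation _ cf cg)) (correlation_Gram L0 T0 TL hq hN hN0 cf cg).
Qed.

End Data.

Section TwoPotentials.
Variables q q' : R -> R.
Hypothesis hq : {within `[0, L], continuous q}.
Hypothesis hq' : {within `[0, L], continuous q'}.
Hypothesis same : same_response L N (2 * T) q q'.

(** The data prescribe the responses on the open interval; the value at 0 follows by continuity. *)
Lemma same_trace f (j j' : @jet R) t : control f -> jet_of L q N f j -> jet_of L q' N f j' ->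
  0 <= t < 2 * T -> j1 j 0 t = j1 j' 0 t.
Proof.
move=> cf jf jf' /andP[t0 tT].
have [[[_ c1 _] _ _] _ _ _ _] := jf; have [[[_ c1' _] _ _] _ _ _ _] := jf'.
have hT := T0; have e s : 0 < s < 2 * T -> j1 j 0 s - j1 j' 0 s = 0.
  move=> sT; have s0 : 0 <= s by case/andP: sT => /ltW.
  by rewrite -(response_jet L0 jf s0) -(response_jet L0 jf' s0) (same cf sT) subrr.
apply/eqP; rewrite -subr_eq0; apply/eqP.
apply: (@cont0_closed _ (fun s => j1 j 0 s - j1 j' 0 s) 0 (2 * T)) => //.
- by apply: contD; [exact: cont_sect c1|apply: contN; exact: cont_sect c1'].
- by lra.
- by rewrite t0 ltW.
Qed.

(* The correlation for q' thus solves the Blagoveshchenskii problem with the data of q. *)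
Lemma blago_data_change f g H : control f -> control g ->
  blago_problem N (2 * T) f g (response L q' N f) (response L q' N g) H ->
  blago_problem N (2 * T) f g (response L q N f) (response L q N g) H.
Proof.
move=> cf cg [h1 h2 h3 h4]; split; [exact: h1|exact: h2|exact: h3|move=> s t s0 t0 stT].
have [sT2 tT2] : s < 2 * T /\ t < 2 * T by split; lra.
have E := h4 s t s0 t0 stT.
suff key : blago_F N f g (response L q' N f) (response L q' N g) s t =
    blago_F N f g (response L q N f) (response L q N g) s t by rewrite key in E; exact: E.
have cf' : continuous f by apply: smooth_cont; case: cf.
have cg' : continuous g by apply: smooth_cont; case: cg.
have [j jf] := jet_of_control L0 hq hN hN0 cf; have [k kg] := jet_of_control L0 hq hN hN0 cg.
have [j' jf'] := jet_of_control L0 hq' hN hN0 cf; have [k' kg'] := jet_of_control L0 hq' hN hN0 cg.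
have c1 (p : R -> R) h i : jet_of L p N h i -> continuous (j1 i 0).
  by move=> [[[_ c1 _] _ _] _ _ _ _]; exact: cont_sect c1.
have E1 := @blago_FE R N hN hN0 f g _ _ (j1 j' 0) (j1 k' 0) cf' cg' (c1 _ _ _ jf') (c1 _ _ _ kg')
  (fun z z0 => response_jet L0 jf' z0) (fun z z0 => response_jet L0 kg' z0) s t s0.
have E2 := @blago_FE R N hN hN0 f g _ _ (j1 j 0) (j1 k 0) cf' cg' (c1 _ _ _ jf) (c1 _ _ _ kg)
  (fun z z0 => response_jet L0 jf z0) (fun z z0 => response_jet L0 kg z0) s t s0.
apply: etrans E1 _; apply: etrans _ (esym E2).
rewrite /greens_source; apply: eq_conv => // z /andP[z0 zt].
have zT : 0 <= z < 2 * T by rewrite z0 (le_lt_trans zt).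
have sT : 0 <= s < 2 * T by rewrite (ltW s0) sT2.
by rewrite (same_trace cf jf jf' zT) (same_trace cg kg kg' sT).
Qed.

Lemma same_Gram f : L2 T f -> eqL2 T (Gram L q N T f) (Gram L q' N T f).
Proof.
have hT := T0; have T2 : 0 < 2 * T by lra.
have TT : triangle (2 * T) (T, T) by split => /=; lra.
apply: bounded_op_dense; [exact: Gram_bounded|exact: Gram_bounded|].
move=> phi cphi; have Lphi := control_L2 T cphi.
apply: eqL2_of_controls; [exact: Gram_L2|exact: Gram_L2|move=> g cg].
apply: etrans (esym (correlation_Gram L0 T0 TL hq hN hN0 cphi cg)) _.
apply: etrans _ (correlation_Gram L0 T0 TL hq' hN hN0 cphi cg).
apply: (blago_unique hN hN0 T2 (blago_correlation hq _ cphi cg) _ TT).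
by apply: blago_data_change => //; exact: blago_correlation.
Qed.

(** Both Gram operators send their steering controls to M(T - .), which depends on N alone. The
    operators coincide, and injectivity concludes. *)
Lemma same_steering xi xi' f f' : is_xi L q xi -> is_xi L q' xi' ->
  steering L q N xi T f -> steering L q' N xi' T f' -> eqL2 T f f'.
Proof.
move=> hxi hxi' sf sf'; have [Lf _] := sf; have [Lf' _] := sf'.
have e1 := steering_Gram L0 T0 TL hq hN hN0 hxi sf.
have e2 := steering_Gram L0 T0 TL hq' hN hN0 hxi' sf'.
have [_ [_ _ [G [_ bG _ GI]]]] := Gram_inverse L0 T0 TL hq hN.
have e3 : eqL2 T (Gram L q N T f) (Gram L q N T f').
  apply: eqL2_trans e1 _; apply: eqL2_trans (eqL2_sym e2) _; exact/eqL2_sym/same_Gram.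
have e4 := bounded_op_eq bG (Gram_L2 L0 T0 TL hq hN Lf) (Gram_L2 L0 T0 TL hq hN Lf') e3.
by apply: eqL2_trans (eqL2_sym (GI f Lf)) (eqL2_trans e4 (GI f' Lf')).
Qed.

(** A single point is invisible almost everywhere: equality is first obtained inside, as the
    derivative of a vanishing primitive, and then passes to 0. *)
Lemma eqL2_cont_0 u v : continuous u -> continuous v -> eqL2 T u v -> u 0 = v 0.
Proof.
move=> cu cv uv; pose d x := u x - v x.
have cd : continuous d by apply: contD => //; exact: contN.
have I0 t : 0 < t < T -> oint 0 t d = 0.
  move=> /andP[t0 tT]; rewrite (oint_ge _ (ltW t0)) -(cont_int_oo _ cd).
  transitivity (\int[mu]_(x in `]0, t[) (0 : R)).
    rewrite /Rintegral; congr fine; apply: ae_eq_integral => //.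
    - by apply/measurable_EFinP; apply: measurable_funTS; exact: continuous_measurable_fun.
    - apply: (ae_imp uv) => x h; rewrite /= in_itv/= => /andP[x0 xt].
      by rewrite /d h ?subrr// x0 (lt_trans xt).
  exact: Rintegral0.
have d0 t : 0 < t < T -> d t = 0.
  move=> tT; apply: (@ider_unique _ (fun t => oint 0 t d) t); first exact: ider_oint.
  by apply: (@oo_ider _ (fun=> 0) _ t 0 T) => [//|y /I0|]; [exact: esym|exact: ider_cst].
apply/eqP; rewrite -subr_eq0; apply/eqP.
by apply: (@cont0_closed _ d 0 T) => //; rewrite lexx ltW.
Qed.

Lemma same_xi xi xi' : is_xi L q xi -> is_xi L q' xi' -> xi' T = xi T.
Proof.
move=> hxi hxi'.
have [rho [cr Hr _]] := Gram_inverse L0 T0 TL hq hN.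
have [rho' [cr' Hr' _]] := Gram_inverse L0 T0 TL hq' hN.
have [s1 _ c1 ->] := steering_control L0 T0 TL hq hN (is_xi_cont hxi) cr Hr.
have [s2 _ c2 ->] := steering_control L0 T0 TL hq' hN (is_xi_cont hxi') cr' Hr'.
by congr (_ * _); apply/esym/eqL2_cont_0 => //; exact: same_steering hxi hxi' s1 s2.
Qed.

End TwoPotentials.
End Identification.

(** * Zeros of solutions of a linear equation of second order *)

Section LinearODE.
Context {R : realType}.
Variables (L : R) (a u u1 : R -> R).
Hypothesis L0 : 0 < L.
Hypotheses (ca : continuous a) (cu : continuous u) (cu1 : continuous u1).
Hypothesis du : forall x, 0 < x < L -> ider u x (u1 x) /\ ider u1 x (- a x * u x).
Hypotheses (u0 : u 0 = 0) (u10 : u1 0 = 1).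

(* E = u^2 + u'^2 satisfies |E'| <= C E and E(0) = 1. *)
Lemma energy_lower : exists2 m : R, 0 < m & forall x, 0 <= x <= L -> m <= u x ^+ 2 + u1 x ^+ 2.
Proof.
have [C C0 HC] := @cont_bounded R (fun x => 1 - a x) 0 L
  (contD (@cont_cst _ _ (1 : R)) (contN ca)).
exists (expR (- (C * L))); first exact: expR_gt0.
move=> x /andP[x0 xL].
pose E y := u y * u y + u1 y * u1 y.
pose dE y := 2 * (u y * u1 y * (1 - a y)).
have [|||c /andP[c0 cx] Hc] := @mvt_eq R (fun y => E y * expR (C * y))
    (fun y => E y * (C * expR (C * y)) + dE y * expR (C * y)) 0 x.
- exact: x0.
- move=> y /andP[y0 yx]; have [d1 d2] : ider u y (u1 y) /\ ider u1 y (- a y * u y).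
    by apply: du; rewrite y0 (lt_le_trans yx).
  apply: ider_val (iderM (iderD (iderM d1 d1) (iderM d2 d2)) (ider_exp_lin C y)) _.
  by rewrite /E /dE; congr (_ + _ * _); ring.
- apply: continuous_subspaceT; apply: contM.
    by apply: contD; exact: contM.
  apply: (cont_comp1 (u := expR)); first exact: continuous_expR'.
  by apply: contM; [exact: cont_cst|exact: cont_id].
- have key : 0 <= E c * (C * expR (C * c)) + dE c * expR (C * c).
    have -> : E c * (C * expR (C * c)) + dE c * expR (C * c) = (C * E c + dE c) * expR (C * c) by ring.
    apply: mulr_ge0; last exact: expR_ge0.
    have h1 : `|dE c| <= C * E c.
      rewrite /dE mulrA normrM mulrC; apply: ler_pM => //.
        by apply: HC; rewrite c0 (le_trans cx).
      rewrite ler_norml /E; apply/andP; split.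
        have := sqr_ge0 (u c + u1 c); rewrite expr2; lra.
      by have := sqr_ge0 (u c - u1 c); rewrite expr2; lra.
    by move: h1; rewrite ler_norml => /andP[h1 _]; lra.
  have h2 : 1 <= E x * expR (C * x).
    have := mulr_ge0 key (_ : 0 <= x - 0); rewrite -Hc mulr0 expR0 mulr1 /E u0 u10.
    by rewrite subr0 => /(_ x0); rewrite mulr0 mulr1 add0r subr_ge0.
  rewrite !expr2 -/(E x).
  have h3 : E x = E x * expR (C * x) * expR (- (C * x)) by rewrite -mulrA -expRD addrN expR0 mulr1.
  rewrite h3; apply: le_trans (_ : expR (- (C * x)) <= _).
    by rewrite ler_expR lerN2 ler_wpM2l.
  by rewrite ler_peMl// expR_ge0.
Qed.

(* Between two zeros u' vanishes, whereas u'^2 >= m at a zero. *)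
Lemma zeros_spaced : exists2 d : R, 0 < d &
  forall x y, 0 <= x -> x < y -> y <= L -> u x = 0 -> u y = 0 -> d <= y - x.
Proof.
have [m m0 Hm] := energy_lower.
have [B B0 HB] := @cont_bounded R (fun x => - a x * u x) 0 L (contM (contN ca) cu).
have B1 : 0 < B + 1 by rewrite ltr_wpDl.
exists (Num.sqrt m / (B + 1)); first by rewrite divr_gt0// sqrtr_gt0.
move=> x y x0 xy yL ux uy; rewrite leNgt; apply/negP => h.
have [|||c /andP[xc cy] Hc] := @mvt_eq R u u1 x y.
- exact: ltW.
- by move=> z /andP[xz zy]; have [] := @du z; first by apply/andP; split; lra.
- exact: continuous_subspaceT.
have c1 : u1 c = 0.
  move: Hc; rewrite ux uy subrr => /esym/eqP; rewrite mulf_eq0 subr_eq0 => /orP[/eqP//|].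
  by rewrite gt_eqF.
have [|||z /andP[xz zc] Hz] := @mvt_eq R u1 (fun z => - a z * u z) x c.
- exact: xc.
- by move=> z /andP[xz zy]; have [] := @du z; first by apply/andP; split; lra.
- exact: continuous_subspaceT.
have h1 : `|u1 x| <= (B + 1) * (y - x).
  rewrite -normrN -[- u1 x]add0r -{1}c1 Hz normrM.
  apply: ler_pM => //; last by rewrite ger0_norm; lra.
  by apply: le_trans (HB z _) _; [apply/andP; split; lra|lra].
have h2 : (B + 1) * (y - x) < Num.sqrt m by move: h; rewrite ltr_pdivlMr// mulrC.
have xL : 0 <= x <= L by rewrite x0/=; lra.
have := Hm x xL; rewrite ux expr0n add0r leNgt => /negP; apply.
have := sqr_sqrtr (ltW m0) => <-; rewrite -real_normK ?num_real// ltrXn2r ?normr_ge0 ?sqrtr_ge0//.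
exact: le_lt_trans h1 h2.
Qed.

(** If [T] is a zero, the spacing of zeros isolates it; otherwise continuity keeps [u] away from
    0. *)
Lemma zeros_isolated T : 0 <= T <= L -> exists2 r : R, 0 < r &
  forall x, 0 <= x <= L -> x != T -> `|x - T| < r -> u x != 0.
Proof.
move=> /andP[T0 TL]; have [uT|uT] := eqVneq (u T) 0.
  have [d d0 Hd] := zeros_spaced; exists d => // x /andP[x0 xL] xT xd; apply/eqP => ux.
  move: xT xd; rewrite neq_lt => /orP[xT|xT].
    by have := Hd x T x0 xT TL ux uT; rewrite distrC ger0_norm; lra.
  by have := Hd T x T0 xT xL uT ux; rewrite ger0_norm; lra.
have uT0 : 0 < `|u T| by rewrite normr_gt0.
have /cvgrPdist_lt /(_ _ uT0) /nbhs_ballP[r /= r0 Hr] := @cu T.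
exists r => // x _ _ xr; apply/eqP => ux.
by have := Hr x; rewrite /ball/= distrC ux subr0 ltxx => /(_ xr).
Qed.

(** The half-line is cut into slices of length [d], each containing at most one zero. *)
Lemma zeros_finite : finite_set [set x | 0 < x < L /\ u x = 0].
Proof.
have [d d0 Hd] := zeros_spaced.
pose S (n : nat) := [set x | [/\ 0 < x < L, u x = 0 & x < n%:R * d]].
have fS n : finite_set (S n).
  elim: n => [|n IH].
    apply: (@sub_finite_set _ _ set0) => //= x [/andP[x0 _] _]; rewrite mul0r; lra.
  pose S' := [set x | [/\ 0 < x < L, u x = 0 & n%:R * d <= x < n.+1%:R * d]].
  apply: (@sub_finite_set _ _ (S n `|` S')).
    move=> x [xL ux xn]; have [h|h] := ltP x (n%:R * d); first by left.
    by right; split=> //; rewrite h.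
  rewrite finite_setU; split=> //.
  have [->|/set0P[z [/andP[z0 zL] uz /andP[z1 z2]]]] := eqVneq S' set0; first exact: finite_set0.
  apply: (@sub_finite_set _ _ [set z]); last exact: finite_set1.
  move=> x [/andP[x0 xL] ux /andP[x1 x2]]; apply/eqP; rewrite -[_ == _]negbK neq_lt; apply/negP.
  rewrite -natr1 mulrDl mul1r in x2 z2.
  move=> /orP[h|h].
    have := Hd x z (ltW x0) h (ltW zL) ux uz; lra.
  have := Hd z x (ltW z0) h (ltW xL) uz ux; lra.
apply: (@sub_finite_set _ _ (S (Num.bound (L / d)))); last exact: fS.
move=> x [/andP[x0 xL] ux]; split=> //; first by rewrite x0.
apply: lt_trans xL _; rewrite -ltr_pdivrMr//; apply: archi_boundP.
by rewrite divr_ge0// ltW.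
Qed.

End LinearODE.

(** * The function xi and the quotient that recovers q *)

Section XiFunction.
Context {R : realType}.
Variables (L : R) (q : R -> R).
Hypothesis L0 : 0 < L.
Hypothesis hq : {within `[0, L], continuous q}.

Lemma is_xi_exists : exists xi, is_xi L q xi.
Proof.
have cq : continuous (extend L q) by exact: extend_cont.
(* Two integrations of xi'' = - q xi from 0 give xi(y) = y minus the integral of (y - z) q(z) xi(z)
   dz over [0, y]. *)
pose k (y z : R) := - ((y - z) * extend L q z).
have ck : cont2 k.
  apply: contN; apply: contM.
    by apply: contD; [exact: continuous_fst|apply: contN; exact: continuous_snd].
  by apply: (cont_comp1 (u := extend L q)) => //; exact: continuous_snd.
have [u cu uE] := @volterra1 R k id ck (@cont_id R).
pose p z := extend L q z * u z.
have cp : continuous p by exact: contM.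
have cid := @cont_id R.
have uE2 y : u y = y - y * oint 0 y p + oint 0 y (fun z => z * p z).
  have lp : locint p := cont_locint cp.
  have lzp : locint (fun z => z * p z) by apply: cont_locint; exact: contM.
  rewrite uE -addrA; congr (_ + _).
  rewrite -(ointZ _ _ _ lp) addrC -ointB//; last exact: locintZ.
  by congr oint; apply/funext => z; rewrite /k /p; ring.
exists u, (fun y => 1 - oint 0 y p); split.
- exact: continuous_subspaceT.
- apply: continuous_subspaceT; apply: contD; first exact: cont_cst.
  by apply: contN; apply: cont_primitive; exact: cont_locint.
- move=> x xL; have xL' : 0 <= x <= L by case/andP: xL => *; rewrite !ltW.
  have dp := @ider_oint R 0 p x cp.
  have dzp := @ider_oint R 0 (fun z => z * p z) x (contM cid cp).
  split.
    apply: (@eq_ider _ (fun y => y - y * oint 0 y p + oint 0 y (fun z => z * p z))) => [y|].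
      by rewrite uE2.
    apply: ider_val (iderD (iderB (ider_id x) (iderM (ider_id x) dp)) dzp) _.
    by move: (oint 0 x p) (p x) => A Bp; ring.
  apply: ider_val (iderB (ider_cst 1 x) dp) _.
  by rewrite /p extend_id// sub0r mulNr.
- by rewrite uE2 !ointaa; split; ring.
Qed.

Lemma xi_second_derivative xi x : is_xi L q xi -> 0 < x < L ->
  derive1n 2 xi x = - q x * xi x.
Proof.
move=> [xi1 [_ _ d _]] xL; have [_ d2] := d x xL.
apply: (@derive1_eq _ (derive1 xi)); apply: (@oo_ider _ xi1 _ x 0 L _ xL _ d2) => y yL.
by have [d1 _] := d y yL; rewrite (derive1_eq d1).
Qed.

Section Zeros.
Variable xi : R -> R.
Hypothesis hxi : is_xi L q xi.

Lemma xi_isolated T : 0 <= T <= L -> exists2 r : R, 0 < r &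
  forall x, 0 <= x <= L -> x != T -> `|x - T| < r -> xi x != 0.
Proof.
move=> TL; have [x1 [cx1 dx x0 x10]] := is_xi_extend L0 hxi.
have [r r0 Hr] := zeros_isolated (extend_cont L0 hq) (extend_cont L0 (is_xi_cont hxi)) cx1 dx x0 x10 TL.
by exists r => // x xL xT xr; rewrite -(extend_id xi xL); exact: Hr.
Qed.

Lemma xi_zeros_finite : finite_set [set x | 0 < x < L /\ xi x = 0].
Proof.
have [x1 [cx1 dx x0 x10]] := is_xi_extend L0 hxi.
apply: sub_finite_set (zeros_finite L0 (extend_cont L0 hq) (extend_cont L0 (is_xi_cont hxi)) cx1 dx x0 x10).
by move=> x [xL xi0]; split=> //; rewrite extend_id//; case/andP: xL => *; rewrite !ltW.
Qed.

Lemma xi_quotient x : 0 < x < L -> xi x != 0 -> - (derive1n 2 xi x / xi x) = q x.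
Proof.
by move=> xL nx; rewrite xi_second_derivative// mulNr mulNr opprK mulfK.
Qed.

(** Zeros of xi being isolated, the quotient equals [q] at all points near [T] other than [T]
    itself, whether or not xi vanishes at [T]. *)
Lemma xi_quotient_limit T : 0 < T < L -> - (derive1n 2 xi x / xi x) @[x --> T^'] --> q T.
Proof.
move=> /andP[T0 TL]; have TL' : 0 <= T <= L by rewrite !ltW.
have cT : extend L q x @[x --> T^'] --> q T.
  by rewrite -(extend_id q TL'); apply: cvg_trans (extend_cont L0 hq (x := T)); apply: cvg_fmap2; exact: cvg_within.
have [r r0 Hr] := xi_isolated TL'.
apply: cvg_trans cT; apply: near_eq_cvg; near=> x.
have xT : x != T by near: x; exact: nbhs_dnbhs_neq.
have [xr x0 xL] : [/\ `|x - T| < r, 0 < x & x < L].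
  near: x; apply: nbhs_dnbhs; near=> x; split.
  - near: x; apply/nbhs_ballP; exists r => // y; by rewrite /ball/= distrC.
  - near: x; exact: lt_nbhsr.
  - near: x; exact: lt_nbhsl.
have xL' : 0 <= x <= L by rewrite !ltW.
by rewrite extend_id// xi_quotient ?x0//; exact: Hr.
Unshelve. all: by end_near.
Qed.

Lemma xi_quotient_limit0 : - (derive1n 2 xi x / xi x) @[x --> 0^'+] --> q 0.
Proof.
have L00 : (0 : R) <= 0 <= L by rewrite lexx ltW.
have c0 : extend L q x @[x --> 0^'+] --> q 0.
  by rewrite -(extend_id q L00); apply: cvg_trans (extend_cont L0 hq (x := 0)); apply: cvg_fmap2; exact: cvg_within.
have [r r0 Hr] := xi_isolated L00.
apply: cvg_trans c0; apply: near_eq_cvg; near=> x.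
have x0 : 0 < x by near: x; exact: nbhs_right_gt.
have xL : x < L by near: x; exact: nbhs_right_lt.
have xr : x < r by near: x; exact: nbhs_right_lt.
have xL' : 0 <= x <= L by rewrite !ltW.
have nx : xi x != 0 by apply: Hr => //; rewrite ?gt_eqF// subr0 gtr0_norm.
by rewrite extend_id// xi_quotient ?x0.
Unshelve. all: by end_near.
Qed.

End Zeros.
End XiFunction.

(** Functions equal on an open interval have equal second derivatives there, and xi(x) can be
    divided out. *)
Lemma potential_of_xi (R : realType) (L : R) (q q' xi xi' : R -> R) x :
  is_xi L q xi -> is_xi L q' xi' -> (forall y, 0 < y < L -> xi' y = xi y) ->
  0 < x < L -> xi x != 0 -> q' x = q x.
Proof.
move=> [xi1 [_ _ d _]] [xi1' [_ _ d' _]] e xL nx.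
have e1 y : 0 < y < L -> xi1' y = xi1 y.
  move=> yL; have [a _] := d y yL; have [b _] := d' y yL.
  exact: (ider_unique (@oo_ider _ xi' xi y 0 L _ yL e b) a).
have [_ a] := d x xL; have [_ b] := d' x xL.
have := ider_unique (@oo_ider _ xi1' xi1 x 0 L _ xL e1 b) a.
by rewrite e// => /(mulIf nx)/oppr_inj.
Qed.

(** That a quantity can be computed from the response is expressed as determination: the Gram
    operator is the only bounded operator compatible with the solutions of the Blagoveshchenskii
    problem for the given responses, and potentials with the same responses share it, the steering
    controls and the values of xi. The value at 0 of an L^2 class is that of its continuous
    representative. *)
Theorem mainTheorem3 (R : realType) (L : R) (q N xi : R -> R)
    (hL : 0 < L) (hq : {within `[0, L], continuous q})
    (hN : Ck 3 N) (hN0 : N 0 = 1) (hxi : is_xi L q xi) :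
  (* (i) *)
  (forall T, 0 < T <= L ->
    exists fT : R -> R,
      [/\ steering L q N xi T fT,
          forall f, steering L q N xi T f -> eqL2 T f fT &
          exists2 G, is_inverse T (Gram L q N T) G &
            eqL2 T fT (G (fun t => primitive N (T - t)))]) /\
  (* (ii) *)
  (forall T, 0 < T <= L ->
    [/\ forall f g, control f -> control g ->
          [/\ blago_problem N (2 * T) f g (response L q N f) (response L q N g)
                (correlation L q N f g),
              forall H,
                blago_problem N (2 * T) f g
                  (response L q N f) (response L q N g) H ->
                forall s t, triangle (2 * T) (s, t) ->
                  H s t = correlation L q N f g s t &
              correlation L q N f g T T = L2inner T (Gram L q N T f) g],
        forall A, bounded_op T T A ->
          (forall f g H, control f -> control g ->
            blago_problem N (2 * T) f g
              (response L q N f) (response L q N g) H ->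
            L2inner T (A f) g = H T T) ->
          forall f, L2 T f -> eqL2 T (A f) (Gram L q N T f) &
        forall q' xi', {within `[0, L], continuous q'} -> is_xi L q' xi' ->
          same_response L N (2 * T) q q' ->
          (forall f, L2 T f -> eqL2 T (Gram L q N T f) (Gram L q' N T f)) /\
          (forall f f', steering L q N xi T f -> steering L q' N xi' T f' ->
            eqL2 T f f')]) /\
  (* (iii) *)
  [/\ (* xi(T) = w(T^-, T) = e^(gamma T) f^T(0), f^T(0) being the value at 0 of
         the continuous representative of f^T *)
      forall T f, 0 < T < L -> steering L q N xi T f ->
        ess_left_limit (Lambda L q N T f) T (xi T) /\
        exists phi : R -> R,
          [/\ {within `[0, T], continuous phi}, eqL2 T f phi &
              xi T = expR (gamma N * T) * phi 0],
      forall T q' xi', 0 < T < L ->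
        {within `[0, L], continuous q'} -> is_xi L q' xi' ->
        same_response L N (2 * T) q q' -> xi' T = xi T,
      [/\ finite_set [set T | 0 < T < L /\ xi T = 0],
          forall T, 0 < T < L -> xi T != 0 -> q T = - (derive1n 2 xi T / xi T),
          forall T, 0 < T < L -> xi T = 0 ->
            - (derive1n 2 xi x / xi x) @[x --> T^'] --> q T &
          - (derive1n 2 xi x / xi x) @[x --> 0^'+] --> q 0] &
      forall q', {within `[0, L], continuous q'} ->
        same_response L N (2 * L) q q' ->
        forall T, 0 <= T < L -> q' T = q T].
Proof.
have id0 p : is_xi L q p -> {within `[0, L], continuous p} by exact: is_xi_cont.
have same_mono p T : T <= L -> same_response L N (2 * L) q p -> same_response L N (2 * T) q p.
  move=> TL same f cf t /andP[t0 tT]; apply: same => //.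
  by rewrite t0 (lt_le_trans tT)// ler_pM2l.
split; [|split].
- move=> T /andP[T0 TL].
  have [rho [cr Hr [G iG]]] := Gram_inverse hL T0 TL hq hN.
  have [s1 s2 _ _] := steering_control hL T0 TL hq hN (id0 xi hxi) cr Hr.
  set fT := uop T rho _ in s1 s2; exists fT; split; [exact: s1|exact: s2|].
  exists G => //; have [_ bG _ GI] := iG; have [Lf _] := s1.
  have eM := steering_Gram hL T0 TL hq hN hN0 hxi s1.
  have LG := Gram_L2 hL T0 TL hq hN Lf.
  have LM : L2 T (fun t => primitive N (T - t)).
    have cN : continuous N by exact: Ck_cont hN (isT : 0 <= 3)%N.
    apply: (@eq_L2 _ T (fun t => oint 0 (T - t) N)) => [t /andP[t0 tT]|].
      by rewrite oint_ge// subr_ge0 ltW.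
    apply: L2_cont; apply: (cont_comp1 (u := fun t => oint 0 t N)).
      by apply: cont_primitive; exact: cont_locint.
    by apply: contD; [exact: cont_cst|apply: contN; exact: cont_id].
  exact: eqL2_trans (eqL2_sym (GI _ Lf)) (bounded_op_eq bG LG LM eM).
- move=> T /andP[T0 TL]; have T2 : 0 < 2 * T by rewrite mulr_gt0.
  split.
  + move=> f g cf cg; have B := blago_correlation hL hN hN0 hq (2 * T) cf cg; split.
    * exact: B.
    * by move=> H BH s t st; exact: (blago_unique hN hN0 T2 BH B st).
    * exact: (correlation_Gram hL T0 TL hq hN hN0 cf cg).
  + by move=> A bA HA f Lf; exact: (Gram_characterized hL T0 TL hN hN0 hq bA HA Lf).
  + move=> q' xi' hq' hxi' same; split.
    * by move=> f Lf; exact: (same_Gram hL T0 TL hN hN0 hq hq' same Lf).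
    * by move=> f f' sf sf'; exact: (same_steering hL T0 TL hN hN0 hq hq' same hxi hxi' sf sf').
- split.
  + move=> T f /andP[T0 TL] sf; have TL' := ltW TL.
    have [rho [cr Hr _]] := Gram_inverse hL T0 TL' hq hN.
    have [s1 s2 cphi e] := steering_control hL T0 TL' hq hN (id0 xi hxi) cr Hr.
    split; last by exists (uop T rho (target L T N xi)); split;
      [exact: continuous_subspaceT|exact: s2|exact: e].
    move=> e0 e00; have cxe := extend_cont hL (id0 xi hxi).
    have /cvgrPdist_lt /(_ _ e00) /nbhs_ballP[r /= r0 Hr'] := @cxe T.
    (* The bound by [T] keeps x positive, so that the steering identity and the extension of xi
       apply at x. *)
    exists (Num.min r T); first by rewrite lt_min r0 T0.
    have [_ Hf] := sf; apply: (ae_imp Hf) => x h /andP[].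
    rewrite ltrBlDr -ltrBlDl lt_min => /andP[x1 x2] xT.
    have x0 : 0 < x by move: x2; lra.
    rewrite h ?x0//; have := Hr' x; rewrite /ball/= !extend_id; last 2 first.
    * by rewrite !ltW// (lt_trans xT).
    * by rewrite !ltW.
    by rewrite (distrC (xi x)); apply; rewrite gtr0_norm ?subr_gt0//.
  + move=> T q' xi' /andP[T0 TL] hq' hxi' same.
    exact: (same_xi hL T0 (ltW TL) hN hN0 hq hq' same hxi hxi').
  + split.
    * exact: (xi_zeros_finite hL hq hxi).
    * by move=> T TL nx; rewrite (xi_quotient hxi).
    * by move=> T TL _; exact: (xi_quotient_limit hL hq hxi TL).
    * exact: (xi_quotient_limit0 hL hq hxi).
  + move=> q' hq' same T /andP[T0 TL].
    have [xi' hxi'] := is_xi_exists hL hq'.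
    have xiE x : 0 < x < L -> xi' x = xi x.
      move=> /andP[x0 xL].
      exact: (same_xi hL x0 (ltW xL) hN hN0 hq hq' (same_mono _ _ (ltW xL) same) hxi hxi').
    have TT : 0 <= T <= L by rewrite T0 ltW.
    have [r r0 Hr] := xi_isolated hL hq hxi TT.
    have cq := extend_cont hL hq; have cq' := extend_cont hL hq'.
    (* Between [T] and [b] xi has no zero, so the quotient determines the potential there;
       continuity brings this back to [T], which may be 0 or a zero of xi. *)
    pose b := Num.min (T + r) L.
    have Tb : T < b by rewrite lt_min TL ltrDl r0.
    apply/eqP; rewrite -subr_eq0 -(extend_id q TT) -(extend_id q' TT); apply/eqP.
    apply: (@cont0_closed _ (fun x => extend L q' x - extend L q x) T b) => //.
    * by apply: contD => //; exact: contN.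
    * move=> x /andP[Tx]; rewrite lt_min => /andP[xr xL].
      have x0 : 0 < x := le_lt_trans T0 Tx.
      have xL0 : 0 < x < L by rewrite x0.
      have xLc : 0 <= x <= L by rewrite !ltW.
      have nx : xi x != 0 by apply: Hr; [exact: xLc|rewrite gt_eqF|rewrite gtr0_norm; lra].
      rewrite !extend_id//; apply/eqP; rewrite subr_eq0; apply/eqP.
      exact: (potential_of_xi hxi hxi' xiE xL0 nx).
    * by rewrite lexx ltW.
Qed.
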